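(* Let $q_0$ be a positive real number and let $F\in\mathcal F_{A_1,A_2}^{\,q_0}$, with associated measure $f\in\mathcal M(C_{a,b}'[0,T])$. Then for all $p\in(1,2]$ and all nonzero real numbers $q_1,q_2$ with $|q_j|>q_0$, $j\in\{1,2\}$, the $L_p$ analytic generalized Fourier-Feynman transform $T_{\vec q}^{(p)}(F)$, $\vec q=(q_1,q_2)$, exists and is given by $$T_{\vec q}^{(p)}(F)(y_1,y_2)=\int_{C_{a,b}'[0,T]}\exp\Big\{\sum_{j=1}^2 i(A_j^{1/2}w,y_j)^{\sim}\Big\}\,\psi(-i\vec q;\vec A;w)\,df(w)$$ for s-a.e. $(y_1,y_2)\in C_{a,b}^2[0,T]$.
   Context: Function space. Fix $T>0$. $a:[0,T]\to\mathbb R$ is absolutely continuous with $a(0)=0$, $\int_0^T|a'(t)|^2dt<\infty$ and $\int_0^T|a'(t)|^2d|a|(t)<\infty$, where $|a|(\cdot)$ is the total variation function of $a$; $b:[0,T]\to\mathbb R$ is strictly increasing, continuously differentiable, $b(0)=0$, $b'(t)>0$ on $[0,T]$. $C_{a,b}[0,T]$ is the Banach space of continuous $x:[0,T]\to\mathbb R$ with $x(0)=0$ (sup norm), with the (completed) Gaussian probability measure $\mu$ under which $t\mapsto x(t)$ has mean $a(t)$ and covariance $\min\{b(s),b(t)\}$. $L_{a,b}^2[0,T]$ is the Hilbert space of Lebesgue measurable $v$ with $\int_0^Tv^2db<\infty$ and $\int_0^Tv^2d|a|<\infty$, with inner product $(u,v)_{a,b}=\int_0^Tuv\,d[b+|a|]$.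 For a complete orthonormal set $\{\phi_j\}$ of functions of bounded variation in $L_{a,b}^2[0,T]$, the Paley-Wiener-Zygmund integral of $v\in L_{a,b}^2[0,T]$ is $\langle v,x\rangle=\lim_{n\to\infty}\int_0^T\sum_{j=1}^n(v,\phi_j)_{a,b}\phi_j(t)\,dx(t)$ wherever the limit exists (it exists $\mu$-a.e.). $C_{a,b}'=C_{a,b}'[0,T]$ is the set of $w\in C_{a,b}[0,T]$ of the form $w(t)=\int_0^tz\,db$ with $z\in L_{a,b}^2[0,T]$; write $D_tw=z(t)=w'(t)/b'(t)$; it is a separable Hilbert space with $(w_1,w_2)_{C_{a,b}'}=\int_0^TD_tw_1D_tw_2\,db(t)$, and $a\in C_{a,b}'$. For $w\in C_{a,b}'$, $(w,x)^{\sim}:=\langle D_tw,x\rangle$. Product space. $C_{a,b}^2[0,T]=C_{a,b}[0,T]\times C_{a,b}[0,T]$ carries $\mu\times\mu$, and $E_{\vec x}[F(x_1,x_2)]=\int F\,d(\mu\times\mu)$. A set $B\subset C_{a,b}^2[0,T]$ is scale-invariant measurable if $\{(\rho_1x_1,\rho_2x_2):(x_1,x_2)\in B\}$ is measurable for all $\rho_1,\rho_2>0$; a scale-invariant measurable set is scale-invariant null if all these sets are $\mu\times\mu$-null; ''s-a.e.'' means except on a scale-invariant null set. All functionals are assumed s-a.e. defined and scale-invariant measurable (i.e. $F(\rho_1\cdot,\rho_2\cdot)$ is measurable for all $\rho_1,\rho_2>0$). Analytic integral and transform. $\mathbb C_+^2=\{\vec\lambda:\mathrm{Re}\,\lambda_j>0,\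 j=1,2\}$, $\widetilde{\mathbb C}_+^2=\{\vec\lambda:\lambda_j\neq0,\mathrm{Re}\,\lambda_j\ge0,\ j=1,2\}$; $\lambda^{\pm1/2}$ always has positive real part. If $J(\lambda_1,\lambda_2)=E_{\vec x}[F(\lambda_1^{-1/2}x_1,\lambda_2^{-1/2}x_2)]$ exists for all $\lambda_1,\lambda_2>0$ and $J^*$ is an analytic function on $\mathbb C_+^2$ with $J^*=J$ for all $\lambda_1,\lambda_2>0$, put $E_{\vec x}^{\mathrm{an}_{\vec\lambda}}[F(x_1,x_2)]=J^*(\vec\lambda)$. Let $T_{\vec\lambda}(F)(y_1,y_2)=E_{\vec x}^{\mathrm{an}_{\vec\lambda}}[F(y_1+x_1,y_2+x_2)]$. For $p\in(1,2]$ with $1/p+1/p'=1$, the $L_p$ analytic generalized Fourier-Feynman transform $T_{\vec q}^{(p)}(F)$ is the functional (defined s-a.e.), if it exists, such that for each $\rho_1,\rho_2>0$, $\lim_{\vec\lambda\to-i\vec q,\ \vec\lambda\in\mathbb C_+^2}\int_{C_{a,b}^2[0,T]}|T_{\vec\lambda}(F)(\rho_1y_1,\rho_2y_2)-T_{\vec q}^{(p)}(F)(\rho_1y_1,\rho_2y_2)|^{p'}d(\mu\times\mu)(y_1,y_2)=0$, where $-i\vec q=(-iq_1,-iq_2)$. Classes. $\mathcal M(C_{a,b}')$ is the space of complex-valued countably additive Borel measures on $C_{a,b}'$. $A_1,A_2$ are bounded nonnegative self-adjoint operators on $C_{a,b}'$. $\mathcal F_{A_1,A_2}^{\,a,b}$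 is the space of (s-a.e. equivalence classes of) functionals $F(x_1,x_2)=\int_{C_{a,b}'}\exp\{\sum_{j=1}^2i(A_j^{1/2}w,x_j)^{\sim}\}df(w)$ with $f\in\mathcal M(C_{a,b}')$ (the associated measure). For $q_0>0$ let $k(q_0;\vec A;w)=\exp\{\sum_{j=1}^2(2q_0)^{-1/2}\|A_j^{1/2}\|_o\|w\|_{C_{a,b}'}\|a\|_{C_{a,b}'}\}$, $\|\cdot\|_o$ being the operator norm; $F\in\mathcal F_{A_1,A_2}^{\,q_0}$ iff $F\in\mathcal F_{A_1,A_2}^{\,a,b}$ and $\int_{C_{a,b}'}k(q_0;\vec A;w)\,d|f|(w)<\infty$. Finally, for $\vec\lambda\in\widetilde{\mathbb C}_+^2$, $\psi(\vec\lambda;\vec A;w)=\exp\{\sum_{j=1}^2[-\frac{(A_jw,w)_{C_{a,b}'}}{2\lambda_j}+i\lambda_j^{-1/2}(A_j^{1/2}w,a)_{C_{a,b}'}]\}$. *)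

(* Defs.v *)
From HB Require Import structures.
From mathcomp Require Import all_boot all_order all_algebra.
From mathcomp Require Import complex ring.
From mathcomp Require Import all_classical all_reals all_analysis.
From mathcomp Require Import measurable_realfun.

Set Implicit Arguments.
Unset Strict Implicit.
Unset Printing Implicit Defensive.

Import Order.TTheory GRing.Theory Num.Theory.
Import numFieldNormedType.Exports.

Local Open Scope classical_set_scope.
Local Open Scope ring_scope.
Local Open Scope complex_scope.

(* A path on [0,T] is represented by the unique function on R that agrees with
   it on [0,T] and vanishes elsewhere. *)
Section path_space.
Context {R : realType} (T : R).

Definition Cab_pred : {pred R -> R^o} := [pred x : R -> R^o |
  `[< [/\ {within `[0, T], continuous x}, x 0 = 0 &
          forall t, ~ `[0%R, T]%classic t -> x t = 0] >] ].

Fact Cab_submod : submod_closed Cab_pred.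
Proof.
split.
- apply/asboolP; split => //.
  exact: (@continuous_subspaceT _ _ _ (cst (0 : R^o)) (@cst_continuous _ _ 0)).
- move=> c x y /asboolP[cx x0 xT] /asboolP[cy y0 yT]; apply/asboolP; split.
  + move=> t. apply: cvgD; last exact: cy.
    by apply: cvgZr; exact: cx.
  + by rewrite [LHS](_ : _ = c *: x 0 + y 0)// x0 y0 scaler0 add0r.
  + move=> t tT.
    by rewrite [LHS](_ : _ = c *: x t + y t)// xT// yT// scaler0 add0r.
Qed.

HB.instance Definition _ := GRing.isSubmodClosed.Build R (R -> R^o) Cab_pred
  Cab_submod.

Record Cab := MkCab { Cab_fun :> R -> R^o ; Cab_funP : Cab_fun \in Cab_pred }.

HB.instance Definition _ := [isSub for Cab_fun].
HB.instance Definition _ := [Choice of Cab by <:].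
HB.instance Definition _ := [SubChoice_isSubLmodule of Cab by <:].
HB.instance Definition _ := isPointed.Build Cab 0.

Definition supnorm (x : Cab) : R := sup [set `|x t| | t in `[0%R, T]%classic].

Definition Cab_open : set (set Cab) := [set U | forall x, U x ->
  exists2 e : R, 0 < e & forall y, supnorm (y - x) < e -> U y].

HB.instance Definition _ := @isMeasurable.Build (sigma_display Cab_open) Cab
  <<s Cab_open >> (@sigma_algebra0 _ setT Cab_open)
  (@sigma_algebraC _ Cab_open) (@sigma_algebra_bigcup _ setT Cab_open).

End path_space.

Section stieltjes.
Context {R : realType} (T : R).

Definition clamp (g : R -> R) : R -> R := fun t => g (Num.max 0 (Num.min t T)).

Definition clamp_cumulative (g : R -> R) :=
  nondecreasing (clamp g) /\ right_continuous (clamp g).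

Definition clamped (g : R -> R) (h : clamp_cumulative g) : R -> R := clamp g.

HB.instance Definition _ g h :=
  isCumulative.Build R _ R (@clamped g h) (proj1 h) (proj2 h).

(* The measure dg on [0,T] of a nondecreasing right-continuous g on [0,T]
   (g is extended by constants outside [0,T]); the zero measure is a default
   value, used only when g is not such a function. *)
Definition stieltjes (g : R -> R) :
    {measure set (measurableTypeR R) -> \bar R} :=
  match pselect (clamp_cumulative g) with
  | left h => lebesgue_stieltjes_measure (clamped h)
  | right _ => mzero
  end.

Fact stieltjes_finite g : (stieltjes g `[0%R, T]%classic < +oo)%E.
Proof.
rewrite /stieltjes; case: pselect => [h|_]; last by rewrite /mzero ltry.
have sub : `[0%R, T]%classic `<=` (`](-1)%R, T]%classic : set (ocitv_type R)).
  move=> t; rewrite /= !in_itv/= => /andP[t0 ->]; rewrite andbT.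
  by rewrite (lt_le_trans _ t0)// oppr_lt0.
apply: (@le_lt_trans _ _
    (lebesgue_stieltjes_measure (clamped h) `](-1)%R, T]%classic)).
  by apply: le_measure; rewrite ?inE//; exact: measurable_itv.
rewrite /lebesgue_stieltjes_measure/= /measure_extension/= measurable_mu_extE//.
  by rewrite /= wlength_itv/=; case: ifP => _; rewrite ltry.
exact: is_ocitv.
Qed.

(* |g|(t), the total variation of g on [0,t]. *)
Definition tv_fun (g : R -> R) : R -> R := fun t => fine (total_variation 0 t g).

End stieltjes.

Section L2ab.
Context {R : realType} (T : R) (a b : R -> R).

Local Notation db := (stieltjes T b).
Local Notation dva := (stieltjes T (tv_fun a)).

Definition sq_integrable (m : {measure set (measurableTypeR R) -> \bar R})
    (v : R -> R) :=
  (\int[m]_(t in `[0%R, T]) (v t ^+ 2)%:E < +oo)%E.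

(* Borel representatives: every Lebesgue measurable function is equal to a Borel
   one outside a Lebesgue-null, hence db- and d|a|-null, set. *)
Definition L2ab (v : R -> R) :=
  [/\ measurable_fun `[0%R, T]%classic v,
      sq_integrable db v & sq_integrable dva v].

Definition ipab (u v : R -> R) : R :=
  \int[stieltjes T (b \+ tv_fun a)]_(t in `[0%R, T]) (u t * v t).

(* Completeness in L^2_{a,b}: only (the class of) 0 is orthogonal to all phi j. *)
Definition complete_orthonormal (phi : nat -> R -> R) :=
  [/\ forall j, L2ab (phi j) /\ bounded_variation 0 T (phi j),
      forall i j, ipab (phi i) (phi j) = (i == j)%:R &
      forall v, L2ab v -> (forall j, ipab v (phi j) = 0) -> ipab v v = 0].

Lemma L2ab0 : L2ab (cst 0).
Proof.
split; first exact: measurable_cst.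
- by rewrite /sq_integrable/= integral0_eq ?ltry// => t _; rewrite expr0n.
- by rewrite /sq_integrable/= integral0_eq ?ltry// => t _; rewrite expr0n.
Qed.

Lemma sq_integrable_lin m (c : R) u v :
    measurable_fun `[0%R, T]%classic u ->
    measurable_fun `[0%R, T]%classic v ->
    sq_integrable m u -> sq_integrable m v ->
  sq_integrable m (fun t => c * u t + v t).
Proof.
move=> mu mv su sv; rewrite /sq_integrable.
have mI : measurable `[0%R, T]%classic.
  exact: measurable_itv.
have msq (w : R -> R) k :
    measurable_fun `[0%R, T]%classic w ->
    measurable_fun `[0%R, T]%classic
      (fun t => (k * w t ^+ 2)%:E).
  move=> mw; apply/measurable_EFinP; apply: measurable_funM => //.
  exact: measurable_funX.
have k0 : 0 <= 2 * c ^+ 2 by rewrite mulr_ge0// sqr_ge0.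
apply: (@le_lt_trans _ _ (\int[m]_(t in `[0%R, T])
   ((2 * c ^+ 2 * u t ^+ 2)%:E + (2 * v t ^+ 2)%:E))%E).
  apply: ge0_le_integral => //.
  - by move=> t _; rewrite lee_fin sqr_ge0.
  - apply/measurable_EFinP; apply: measurable_funX.
    by apply: measurable_funD => //; exact: measurable_funM.
  - by apply: emeasurable_funD; exact: msq.
  - move=> t _; rewrite -EFinD lee_fin -subr_ge0.
    rewrite (_ : _ - _ = (c * u t - v t) ^+ 2) ?sqr_ge0//.
    by ring.
rewrite ge0_integralD//; [|by move=> t _; rewrite lee_fin mulr_ge0// ?sqr_ge0
  |exact: msq|by move=> t _; rewrite lee_fin mulr_ge0// ?sqr_ge0|exact: msq].
under eq_integral do rewrite EFinM.
under [X in (_ + X)%E]eq_integral do rewrite EFinM.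
rewrite !ge0_integralZl_EFin//; [|by move=> t _; rewrite lee_fin sqr_ge0|
  by apply/measurable_EFinP; exact: measurable_funX|
  by move=> t _; rewrite lee_fin sqr_ge0|
  by apply/measurable_EFinP; exact: measurable_funX].
by apply: lte_add_pinfty; apply: lte_mul_pinfty => //; rewrite ?lee_fin.
Qed.

Lemma L2ab_lin c u v : L2ab u -> L2ab v -> L2ab (fun t => c * u t + v t).
Proof.
move=> [mu bu au] [mv bv av]; split.
- by apply: measurable_funD => //; exact: measurable_funM.
- exact: sq_integrable_lin.
- exact: sq_integrable_lin.
Qed.

Lemma L2ab_integrable t z : t <= T -> L2ab z ->
  db.-integrable `[0%R, t]%classic (EFin \o z).
Proof.
move=> tT [mz bz _].
have mI s : measurable (`[0%R, s]%classic : set R).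
  exact: measurable_itv.
apply: (@integrableS _ (measurableTypeR R) R db `[0%R, T]%classic) => //.
  by apply: subset_itvl; rewrite bnd_simp.
apply/integrableP; split; first exact/measurable_EFinP.
apply: (@le_lt_trans _ _ (\int[db]_(t in `[0%R, T]) (1%:E + (z t ^+ 2)%:E))%E).
  apply: ge0_le_integral => //.
  - by apply: measurableT_comp => //; exact/measurable_EFinP.
  - apply: emeasurable_funD => //.
    by apply/measurable_EFinP; exact: measurable_funX.
  - move=> s _; rewrite -EFinD lee_fin -real_normK ?num_real//.
    rewrite -subr_ge0; set x := `|z s|.
    have x0 : 0 <= x by exact: normr_ge0.
    have -> : 1 + x ^+ 2 - x = (1 - x) ^+ 2 + x by ring.
    by rewrite addr_ge0// sqr_ge0.
rewrite ge0_integralD//; [|by move=> s _; rewrite lee_fin sqr_ge0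
  |by apply/measurable_EFinP; exact: measurable_funX].
apply: lte_add_pinfty => //.
by rewrite integral_cst// mul1e; exact: stieltjes_finite.
Qed.

End L2ab.

Section Cp.
Context {R : realType} (T : R) (a b : R -> R).

(* z is a density D_t w of w, that is, w(t) = \int_0^t z db. *)
Definition has_density (w z : R -> R) :=
  L2ab T a b z /\ forall t, `[0%R, T]%classic t ->
    w t = \int[stieltjes T b]_(s in `[0%R, t]) z s.

Definition Cp_pred : {pred R -> R^o} := [pred w : R -> R^o |
  (w \in Cab_pred T) && `[< exists z, has_density w z >] ].

Fact Cp_submod : submod_closed Cp_pred.
Proof.
split.
- apply/andP; split; first by case: (Cab_submod T).
  apply/asboolP; exists (cst 0); split; first exact: L2ab0.
  by move=> t _; rewrite Rintegral_cst ?mul0r.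
- move=> c u v /andP[uC /asboolP[y [Ly yE]]] /andP[vC /asboolP[z [Lz zE]]].
  apply/andP; split; first by case: (Cab_submod T) => _; exact.
  apply/asboolP; exists (fun t => c * y t + z t); split; first exact: L2ab_lin.
  move=> t /[dup] tI; rewrite /= in_itv/= => /andP[_ tT].
  have iy := L2ab_integrable tT Ly; have iz := L2ab_integrable tT Lz.
  rewrite [LHS](_ : _ = c * u t + v t)// (yE _ tI) (zE _ tI).
  rewrite RintegralD//; [by rewrite RintegralZl|].
  have mI : measurable (`[0%R, t]%classic : set (measurableTypeR R)).
    exact: measurable_itv.
  exact: (@integrableZl _ (measurableTypeR R) R (stieltjes T b) _ mI c _ iy).
Qed.

HB.instance Definition _ := GRing.isSubmodClosed.Build R (R -> R^o) Cp_pred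
  Cp_submod.

Record Cp := MkCp { Cp_fun :> R -> R^o ; Cp_funP : Cp_fun \in Cp_pred }.

HB.instance Definition _ := [isSub for Cp_fun].
HB.instance Definition _ := [Choice of Cp by <:].
HB.instance Definition _ := [SubChoice_isSubLmodule of Cp by <:].
HB.instance Definition _ := isPointed.Build Cp 0.

(* D_t w, which is unique up to a db-null set when it exists. It is defined on all
   functions so that it applies to the mean function a, an element of C'_{a,b}. *)
Definition Dt (w : R -> R) : R -> R := xget (cst 0) [set z | has_density w z].

Definition ipCp (u v : R -> R) : R :=
  \int[stieltjes T b]_(t in `[0%R, T]) (Dt u t * Dt v t).

Definition normCp (w : R -> R) : R := Num.sqrt (ipCp w w).

Definition Cp_open : set (set Cp) := [set U | forall w, U w ->
  exists2 e : R, 0 < e & forall v : Cp, normCp (v - w : Cp) < e -> U v].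

HB.instance Definition _ := @isMeasurable.Build (sigma_display Cp_open) Cp
  <<s Cp_open >> (@sigma_algebra0 _ setT Cp_open)
  (@sigma_algebraC _ Cp_open) (@sigma_algebra_bigcup _ setT Cp_open).

Definition bounded_op (A : Cp -> Cp) :=
  exists M : R, forall w : Cp, normCp (A w) <= M * normCp w.

Definition nonneg_selfadjoint (A : Cp -> Cp) :=
  [/\ bounded_op A,
      forall u v : Cp, ipCp (A u) v = ipCp u (A v) &
      forall w : Cp, 0 <= ipCp (A w) w].

Definition is_sqrt_op (A S : Cp -> Cp) :=
  nonneg_selfadjoint S /\ forall w, S (S w) = A w.

Definition opnorm (A : Cp -> Cp) : R :=
  sup [set normCp (A w) | w in [set w : Cp | normCp w <= 1]].

End Cp.

Section assumptions.
Context {R : realType} (T : R).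

Definition absolutely_continuous (g : R -> R) :=
  forall e : R, 0 < e -> exists2 d : R, 0 < d &
    forall (n : nat) (s t : nat -> R),
      (forall i, (i < n)%N -> 0 <= s i <= t i /\ t i <= T) ->
      (forall i j, (i < n)%N -> (j < n)%N -> i != j ->
         t i <= s j \/ t j <= s i) ->
      \sum_(i < n) (t i - s i) < d ->
      \sum_(i < n) `|g (t i) - g (s i)| < e.

Definition mean_function (a : R -> R) :=
  [/\ absolutely_continuous a, a 0 = 0,
      (\int[lebesgue_measure]_(t in `[0%R, T]) (`|derive1 a t| ^+ 2)%:E
         < +oo)%E &
      (\int[stieltjes T (tv_fun a)]_(t in `[0%R, T]) (`|derive1 a t| ^+ 2)%:E
         < +oo)%E].

(* The derivative of b on [0,T] is one-sided at 0 and T. *)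
Definition variance_function (b : R -> R) :=
  [/\ forall s t, 0 <= s -> s < t -> t <= T -> b s < b t,
      b 0 = 0 &
      exists b' : R -> R,
        [/\ {within `[0, T], continuous b'},
            forall t, `[0%R, T]%classic t ->
              (b s - b t) / (s - t) @[s --> within `[0%R, T]%classic t^'] --> b' t &
            forall t, `[0%R, T]%classic t -> 0 < b' t]].

End assumptions.

Section gaussian.
Context {R : realType} (T : R).

Definition gaussian_law (Q : set R -> \bar R) :=
  exists m s : R,
    (s != 0 /\ forall B : set R, measurable B -> Q B = normal_prob m s B) \/
    (forall B : set R, measurable B -> Q B = dirac m B).

Definition gaussian_measure (a b : R -> R) (mu : probability (Cab T) R) :=
  [/\ forall (n : nat) (t c : 'I_n -> R), (forall i, `[0%R, T]%classic (t i)) ->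
        gaussian_law (fun B =>
          mu [set x : Cab T | B (\sum_(i < n) c i * x (t i))]),
      forall t, `[0%R, T]%classic t ->
        'E_mu[fun x : Cab T => x t]%E = (a t)%:E &
      forall s t, `[0%R, T]%classic s -> `[0%R, T]%classic t ->
        covariance mu (fun x : Cab T => x s) (fun x : Cab T => x t) =
        (Num.min (b s) (b t))%:E].

End gaussian.

Section pwz.
Context {R : realType} (T : R) (a b : R -> R) (phi : nat -> R -> R).

(* Riemann-Stieltjes integral of v with respect to x on [0,T]: limit of tagged
   sums as the mesh tends to 0. *)
Definition is_RS_integral (v x : R -> R) (I : R) :=
  forall e : R, 0 < e -> exists2 d : R, 0 < d &
    forall (n : nat) (t c : nat -> R), t 0%N = 0 -> t n = T ->
      (forall i, (i < n)%N ->
         [/\ t i <= c i, c i <= t i.+1 & t i.+1 - t i < d]) ->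
      `|\sum_(i < n) v (c i) * (x (t i.+1) - x (t i)) - I| < e.

Definition RS_integral (v x : R -> R) : R := xget 0 [set I | is_RS_integral v x I].

(* <v,x>; where the limit does not exist, limn is an arbitrary real number. *)
Definition pwz (v x : R -> R) : R :=
  limn (fun n => RS_integral
    (fun t => \sum_(j < n) ipab T a b v (phi j) * phi j t) x).

(* (w,x)~ *)
Definition pwzC (w : Cp T a b) (x : Cab T) : R := pwz (Dt T a b w) x.

End pwz.

Section complex_integration.
Context {R : realType}.

Definition cexp (z : R[i]) : R[i] :=
  (expR (complex.Re z))%:C * (cos (complex.Im z) +i* sin (complex.Im z)).

Definition cmod (z : R[i]) : R := complex.Re `|z|.

Context d (X : measurableType d).

Definition cintegral (m : {measure set X -> \bar R}) (F : X -> R[i]) : R[i] :=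
  (\int[m]_x complex.Re (F x)) +i* (\int[m]_x complex.Im (F x)).

(* Measurability with respect to the completion of m. For such functions the
   integral of the library, a supremum over simple functions, is the integral
   with respect to the completed measure. *)
Definition completed_measurable_fun (m : {measure set X -> \bar R})
    (F : X -> R[i]) :=
  forall B : set R, measurable B ->
    completed_algebra_gen m [set x | B (complex.Re (F x))] /\
    completed_algebra_gen m [set x | B (complex.Im (F x))].

Definition cintegrable (m : {measure set X -> \bar R}) (F : X -> R[i]) :=
  completed_measurable_fun m F /\ (\int[m]_x (cmod (F x))%:E < +oo)%E.

(* A complex measure, given by its real and imaginary parts. *)
Record complex_measure := ComplexMeasure {
  cm_re : {charge set X -> \bar R} ;
  cm_im : {charge set X -> \bar R} }.

Definition cm_val (f : complex_measure) (A : set X) : R[i] :=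
  fine (cm_re f A) +i* fine (cm_im f A).

Definition is_total_variation (f : complex_measure)
    (nu : {measure set X -> \bar R}) :=
  forall A, measurable A -> nu A = ereal_sup
    [set s | exists2 E : nat -> set X,
      [/\ forall n, measurable (E n), trivIset setT E & \bigcup_n E n = A] &
      s = (\sum_(0 <= n <oo) (cmod (cm_val f (E n)))%:E)%E].

Definition charge_integral (nu : {charge set X -> \bar R}) (F : X -> R[i]) :
    R[i] :=
  let P := cid (Hahn_decomposition nu) in
  let N := cid (projT2 P) in
  cintegral (jordan_pos (projT2 N)) F - cintegral (jordan_neg (projT2 N)) F.

Definition cm_integral (f : complex_measure) (F : X -> R[i]) : R[i] :=
  charge_integral (cm_re f) F + 'i * charge_integral (cm_im f) F.

End complex_integration.

Section scale_invariance.
Context {R : realType} (T : R) (mu : probability (Cab T) R).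

(* mu is a Borel measure and completed_algebra_gen (mu \x mu) is the completion of
   the product sigma-algebra; it is the same as the completion of the product of
   the completed measures. *)
Definition scale2 (r1 r2 : R) (x : Cab T * Cab T) : Cab T * Cab T :=
  (r1 *: x.1, r2 *: x.2).

Definition si_measurable (B : set (Cab T * Cab T)) :=
  forall r1 r2 : R, 0 < r1 -> 0 < r2 ->
    completed_algebra_gen (mu \x mu)%E (scale2 r1 r2 @` B).

Definition si_null (B : set (Cab T * Cab T)) :=
  si_measurable B /\ forall r1 r2 : R, 0 < r1 -> 0 < r2 ->
    (mu \x mu)%E.-negligible (scale2 r1 r2 @` B).

Definition sae (P : Cab T * Cab T -> Prop) :=
  exists2 N, si_null N & forall x, ~ N x -> P x.

Definition si_measurable_fun (F : Cab T * Cab T -> R[i]) :=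
  forall r1 r2 : R, 0 < r1 -> 0 < r2 ->
    completed_measurable_fun (mu \x mu)%E (F \o scale2 r1 r2).

End scale_invariance.

Section transform.
Context {R : realType} (T : R) (mu : probability (Cab T) R).

Definition Cplus2 : set (R[i]^o * R[i]^o) :=
  [set l | 0 < complex.Re l.1 /\ 0 < complex.Re l.2].

(* J is analytic on C_+^2 and extends (l1, l2) |-> E[F(l1^{-1/2} x1, l2^{-1/2} x2)],
   so that J l is the analytic integral of F at l. *)
Definition is_analytic_integral (F : Cab T * Cab T -> R[i])
    (J : R[i]^o * R[i]^o -> R[i]^o) :=
  [/\ forall l1 l2 : R, 0 < l1 -> 0 < l2 ->
        cintegrable (mu \x mu)%E
          (F \o scale2 (Num.sqrt l1)^-1 (Num.sqrt l2)^-1),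
      forall l, Cplus2 l -> differentiable J l &
      forall l1 l2 : R, 0 < l1 -> 0 < l2 ->
        J (l1%:C, l2%:C) = cintegral (mu \x mu)%E
          (F \o scale2 (Num.sqrt l1)^-1 (Num.sqrt l2)^-1)].

(* Here Tl l y stands for T_l(F)(y) and p' is the exponent conjugate to p. *)
Definition is_GFFT_of_functional (p q1 q2 : R) (F TF : Cab T * Cab T -> R[i]) :=
  let p' := (1 - p^-1)^-1 in
  [/\ si_measurable_fun mu F, si_measurable_fun mu TF &
  exists Tl : R[i]^o * R[i]^o -> Cab T * Cab T -> R[i]^o,
    [/\ sae mu (fun y =>
          is_analytic_integral (fun x => F (y + x)) (fun l => Tl l y)),
        forall l, Cplus2 l -> si_measurable_fun mu (Tl l) &
        forall r1 r2 : R, 0 < r1 -> 0 < r2 ->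
          (\int[(mu \x mu)%E]_y
             (cmod (Tl l (scale2 r1 r2 y) - TF (scale2 r1 r2 y)) `^ p')%:E)%E
          @[l --> within Cplus2
                    (nbhs ((0 -i* q1, 0 -i* q2) : R[i]^o * R[i]^o))] --> 0%E]].

(* Functionals that agree s-a.e. are identified, so the transform of F is that of
   a representative F0 of its class. The definition cannot be applied to an
   arbitrary representative: changing a functional on a scale-invariant null set
   can change x |-> F(y + l^{-1/2} x) on a set of positive measure for some
   l = l(y) > 0, for every y, although for each fixed l it does not for s-a.e. y.
   Any two representatives that have transforms have s-a.e. equal ones, since for
   s-a.e. y their analytic integrals agree at all positive rational l. *)
Definition is_GFFT (p q1 q2 : R) (F TF : Cab T * Cab T -> R[i]) :=
  exists2 F0, sae mu (fun x => F x = F0 x) &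
              is_GFFT_of_functional p q1 q2 F0 TF.

End transform.

Section classes.
Context {R : realType} (T : R) (a b : R -> R) (phi : nat -> R -> R).
Context (mu : probability (Cab T) R).
Local Notation Cp := (Cp T a b).

Definition char_kernel (S1 S2 : Cp -> Cp) (w : Cp) (x : Cab T * Cab T) : R[i] :=
  cexp ('i * (pwzC phi (S1 w) x.1)%:C + 'i * (pwzC phi (S2 w) x.2)%:C).

Definition in_F (S1 S2 : Cp -> Cp) (f : complex_measure Cp)
    (F : Cab T * Cab T -> R[i]) :=
  sae mu (fun x => F x = cm_integral f (fun w => char_kernel S1 S2 w x)).

Definition k_weight (q0 : R) (S1 S2 : Cp -> Cp) (w : Cp) : R :=
  expR ((Num.sqrt (2 * q0))^-1 * opnorm S1 * normCp T a b w * normCp T a b a +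
        (Num.sqrt (2 * q0))^-1 * opnorm S2 * normCp T a b w * normCp T a b a).

Definition in_Fq0 (q0 : R) (S1 S2 : Cp -> Cp) (f : complex_measure Cp)
    (F : Cab T * Cab T -> R[i]) :=
  in_F S1 S2 f F /\
  exists2 nu : {measure set Cp -> \bar R}, is_total_variation f nu &
    (\int[nu]_w (k_weight q0 S1 S2 w)%:E < +oo)%E.

(* sqrtc is the principal square root: it has positive real part for
   l <> 0 with Re l >= 0. *)
Definition psi_exponent (A S : Cp -> Cp) (l : R[i]) (w : Cp) : R[i] :=
  - ((ipCp T a b (A w) w)%:C / (2 * l))
  + 'i * (sqrtc l)^-1 * (ipCp T a b (S w) a)%:C.

Definition psi (A1 A2 S1 S2 : Cp -> Cp) (l1 l2 : R[i]) (w : Cp) : R[i] :=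
  cexp (psi_exponent A1 S1 l1 w + psi_exponent A2 S2 l2 w).

End classes.

(* Main.v *)
Require Import Defs.
From HB Require Import structures.
From mathcomp Require Import all_boot all_order all_algebra.
From mathcomp Require Import complex ring lra.
From mathcomp Require Import all_classical all_reals all_analysis.
From mathcomp Require Import measurable_realfun.

(** Split the real and imaginary parts of [f] into positive and negative parts; this
writes [f] as a combination of four finite positive measures [m] below its total
variation, with coefficients of modulus one. It thus suffices to understand, for
one such [m], the integrals
  I_g(y) = \int exp(i (S1 w, y1)~ + i (S2 w, y2)~) g(w) dm(w),
the functional itself being the case g = 1 and its transform the case
g = psi(- i q; w).

The path measure. A function v of bounded variation is a difference of monotone
functions, so that its Riemann-Stieltjes integral against a continuous path
exists ([RS_exists]). It is the limit of Riemann sums, which are Gaussian; hence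
it is Gaussian with mean \int v z db, where z is the density of the mean function
with respect to db, and variance \int v^2 db ([RS_chf]). The partial sums defining
<v,x> have increments whose centered fourth moments are at most three times the
squared variances, and these variances are controlled by the increments of a
convergent series, by Bessel's inequality: a maximal
inequality ([maximal_inequality]) then gives almost sure convergence of the whole
sequence ([pwz_cvg]), and the limit is Gaussian ([pwz_chf]). The norm of C'_{a,b}
is that of L^2(db), whereas the coefficients (D_t w, phi_j)_{a,b} involve d|a| as
well; they are nevertheless continuous in w because d|a| is dominated by |z| db with
z square integrable ([mean_density]). Hence <D_t w, x> is jointly measurable in the
direction w and the path x ([measurable_pwzC]).

The analytic integral. By Tonelli, for almost every path pair y the defining
limits at y exist for m-almost every w. The exceptional set of those y for which
this fails is Borel and stable under scaling of each coordinate, hence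
scale-invariant null ([exceptional_null], [exceptional_scale]). For y outside it
the phase is additive under almost every translation, and Fubini's theorem with
the characteristic function of a normal variable turns the average of
I_1(y + l^{-1/2} x) over x into I_{psi(l)}(y) for l1, l2 > 0
([char_integral_average]). The right-hand side makes sense on the product of the
two open right half-planes. It is differentiable there, because the real part of
the exponent of psi is bounded by C0 - al * (|S1 w|^2 + |S2 w|^2) with al > 0, which
dominates every power of |S1 w| and |S2 w| produced by a Taylor expansion
([differentiable_char_integral]).

The limit. On the imaginary axis this decay is lost and the linear term of the
exponent grows. In the closed right half-plane the argument of the square root is
at most pi/4, so that |Im l^{-1/2}| <= (2 |l|)^{-1/2}, and for |l1|, |l2| >= q0 the
modulus of psi(l; w) is at most the weight k(q0; w) ([psi_le_weight]), which is
integrable by assumption. Since characters have modulus one, I_{psi(l)}(y) differs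
from I_{psi(- i q)}(y) by at most a multiple of \int |psi(l) - psi(- i q)| dm,
whatever y is, and this tends to 0 by dominated convergence ([psi_dist_small]). The
convergence is therefore uniform in y, hence holds in every L^{p'} of a
probability, for all scalings at once. *)

Set Implicit Arguments.
Unset Strict Implicit.
Unset Printing Implicit Defensive.
Import Order.TTheory GRing.Theory Num.Theory.
Import numFieldNormedType.Exports.
Local Open Scope classical_set_scope.
Local Open Scope ring_scope.
Local Open Scope complex_scope.

(** * Densities and Lebesgue-Stieltjes measures *)

Section density.
Local Open Scope ereal_scope.
Context d (X : measurableType d) (R : realType).
Import HBNNSimple.

(** Both sides agree on simple functions by the formula for [nu], and are continuous
    along the same increasing approximation of [f]. *)
Lemma ge0_integral_density (m nu : {measure set X -> \bar R}) (w : X -> R)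
    (D : set X) (f : X -> \bar R) :
  measurable D -> (forall x, D x -> (0 <= w x)%R) -> measurable_fun D w ->
  (forall A, measurable A -> A `<=` D -> nu A = \int[m]_(x in A) (w x)%:E) ->
  measurable_fun D f -> (forall x, D x -> 0 <= f x) ->
  \int[nu]_(x in D) f x = \int[m]_(x in D) (f x * (w x)%:E).
Proof.
move=> mD w0 mw nuE mf f0; pose h := nnsfun_approx mD mf.
have fE x : D x -> (EFin \o h ^~ x) n @[n --> \oo] --> f x.
  by move=> Dx; exact: cvg_nnsfun_approx.
have hmono x : {homo (EFin \o h ^~ x) : a b / (a <= b)%N >-> a <= b}.
  by move=> a b ab; rewrite lee_fin; exact/lefP/nd_nnsfun_approx.
have mh n : measurable_fun D (EFin \o h n).
  exact/measurable_EFinP/measurable_funTS.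
have mwE : measurable_fun D (EFin \o w) by exact/measurable_EFinP.
have L1 : \int[nu]_(x in D) (EFin \o h n) x @[n --> \oo] -->
    \int[nu]_(x in D) f x.
  have -> : \int[nu]_(x in D) f x =
      \int[nu]_(x in D) limn (fun n => (EFin \o h n) x).
    by apply: eq_integral => x /[!inE] Dx; apply/esym/cvg_lim => //; exact: fE.
  apply: cvg_monotone_convergence => //.
  - by move=> n x Dx; rewrite lee_fin.
  - by move=> x Dx; exact: hmono.
have L2 : \int[m]_(x in D) ((EFin \o h n) x * (w x)%:E) @[n --> \oo] -->
    \int[m]_(x in D) (f x * (w x)%:E).
  have -> : \int[m]_(x in D) (f x * (w x)%:E) =
      \int[m]_(x in D) limn (fun n => (EFin \o h n) x * (w x)%:E).
    apply: eq_integral => x /[!inE] Dx; apply/esym/cvg_lim => //.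
    by apply: cvgeZr => //; exact: fE.
  apply: cvg_monotone_convergence => //.
  - by move=> n; exact: emeasurable_funM.
  - by move=> n x Dx; rewrite mule_ge0// ?lee_fin// w0.
  - move=> x Dx a b ab; apply: lee_wpmul2r; first by rewrite lee_fin w0.
    exact: hmono.
suff E n : \int[nu]_(x in D) (EFin \o h n) x =
    \int[m]_(x in D) ((EFin \o h n) x * (w x)%:E).
  move/funext in E; rewrite E in L1.
  exact: (cvg_unique _ L1 L2).
transitivity (\int[nu]_(x in D)
   (\sum_(y \in range (h n)) (y * \1_(h n @^-1` [set y]) x)%:E)).
  by apply: eq_integral => t tE; rewrite /= fimfunE -fsumEFin.
transitivity (\int[m]_(x in D) (\sum_(y \in range (h n))
    (y * \1_(h n @^-1` [set y]) x)%:E * (w x)%:E)); last first.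
  apply: eq_integral => x xE; rewrite -ge0_mule_fsuml; last first.
    by move=> y; exact: nnfun_muleindic_ge0.
  by rewrite fsumEFin // -(fimfunE _ x).
have mind r : measurable_fun D (fun x => (r * \1_(h n @^-1` [set r]) x)%:E).
  by apply/measurable_EFinP; apply: measurable_funM.
rewrite ge0_integral_fsum//; last by move=> r x Dx; exact: nnfun_muleindic_ge0.
rewrite ge0_integral_fsum//; last 2 first.
- by move=> r; exact: emeasurable_funM.
- by move=> r x Dx; rewrite mule_ge0// ?nnfun_muleindic_ge0// lee_fin w0.
apply: eq_fsbigr => r /[!inE] -[z _ zr]; have r0 : (0 <= r)%R by rewrite -zr.
have mA : measurable (h n @^-1` [set r]) by [].
under [RHS]eq_integral do rewrite EFinM -muleA.
rewrite [RHS]ge0_integralZl//; last 2 first.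
- by apply: emeasurable_funM => //; exact/measurable_EFinP/measurable_indic.
- by move=> x Dx; rewrite mule_ge0// ?lee_fin// w0.
under eq_integral do rewrite EFinM.
rewrite ge0_integralZl//; last first.
- exact/measurable_EFinP/measurable_indic.
congr (_ * _); rewrite integral_indic// nuE//; last first.
- exact: measurableI.
rewrite [in LHS]setIC integral_mkcondr; apply: eq_integral => x _.
by rewrite epatch_indic muleC.
Qed.

Definition density_measure (m : {measure set X -> \bar R}) (w : X -> \bar R)
  (mw : measurable_fun setT w) (w0 : forall x, 0 <= w x) :=
  fun A => \int[m]_(x in A) w x.

Section density_measure_instance.
Variables (m : {measure set X -> \bar R}) (w : X -> \bar R).
Hypotheses (mw : measurable_fun setT w) (w0 : forall x, 0 <= w x).
Local Notation nu := (density_measure m mw w0).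
Let nu0 : nu set0 = 0. Proof. exact: integral_set0. Qed.
Let nu_ge0 A : 0 <= nu A. Proof. by apply: integral_ge0. Qed.
Let nu_sigma : semi_sigma_additive nu.
Proof. exact: semi_sigma_additive_nng_induced. Qed.
HB.instance Definition _ := isMeasure.Build _ _ _ nu nu0 nu_ge0 nu_sigma.
End density_measure_instance.
End density.

Section stieltjes_measure.
Local Open Scope ereal_scope.
Context (R : realType).

(** Half-open intervals generate the Borel sets, are stable under intersection, and
    exhaust the line with finite measure. *)
Lemma measure_unique_oc (m1 m2 : {measure set (measurableTypeR R) -> \bar R}) :
  (forall s t : R, (s <= t)%R -> m1 `]s, t]%classic = m2 `]s, t]%classic) ->
  (forall s t : R, (s <= t)%R -> m1 `]s, t]%classic < +oo) ->
  forall A, measurable A -> m1 A = m2 A.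
Proof.
move=> m12 m1oo; pose g k : set (measurableTypeR R) :=
  `](- (k%:R))%R, k%:R]%classic.
apply: (@measure_unique _ _ (measurableTypeR R) R.-ocitv.-measurable g erefl) => //.
- by move=> A B; exact: measurableI.
- by move=> k; exact: is_ocitv.
- apply/seteqP; split => // x _; exists (Num.trunc `|x|%R).+1 => //.
  rewrite /g /= in_itv/=; have := truncnS_gt `|x|%R.
  by rewrite ltr_norml => /andP[-> /ltW ->].
- move=> A /ocitvP[->|[[s t] /= st ->]]; first by rewrite !measure0.
  by rewrite m12// ltW.
- by move=> k; apply: m1oo; rewrite (@le_trans _ _ 0%R)// oppr_le0.
Qed.

Variable T : R.
Implicit Types g : R -> R.

Lemma clampE g t : (0 <= t <= T)%R -> clamp T g t = g t.
Proof. by move=> /andP[t0 tT]; rewrite /clamp (min_l tT) (max_r t0). Qed.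

Lemma clamp_le0 g t : (0 <= T)%R -> (t <= 0)%R -> clamp T g t = g 0%R.
Proof. by move=> T0 t0; rewrite /clamp min_l ?(le_trans t0)// max_l. Qed.

Lemma clamp_geT g t : (0 <= T)%R -> (T <= t)%R -> clamp T g t = g T.
Proof. by move=> T0 tT; rewrite /clamp min_r// max_r. Qed.

Lemma stieltjes_oc g s t : clamp_cumulative T g -> (s <= t)%R ->
  stieltjes T g `]s, t]%classic = (clamp T g t - clamp T g s)%:E.
Proof.
move=> gc st; rewrite /stieltjes; case: pselect => // h.
rewrite [LHS](_ : _ = lebesgue_stieltjes_measure (clamped h)
  (`]s, t]%classic : set (ocitv_type R)))//.
rewrite /lebesgue_stieltjes_measure/= /measure_extension/= measurable_mu_extE//=.
  by rewrite wlength_itv_bnd.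
exact: is_ocitv.
Qed.

Lemma stieltjes_ocE g s t : clamp_cumulative T g ->
  (0 <= s)%R -> (s <= t)%R -> (t <= T)%R ->
  stieltjes T g `]s, t]%classic = (g t - g s)%:E.
Proof.
move=> gc s0 st tT; rewrite stieltjes_oc// !clampE//.
  by rewrite s0 (le_trans st).
by rewrite tT (le_trans s0).
Qed.

Lemma stieltjes_oc_fin g s t : clamp_cumulative T g -> (s <= t)%R ->
  stieltjes T g `]s, t]%classic < +oo.
Proof. by move=> gc st; rewrite stieltjes_oc// ltry. Qed.

Lemma stieltjes_set0 g : (0 <= T)%R -> stieltjes T g [set 0%R] = 0.
Proof.
move=> T0; have [gc|gc] := pselect (clamp_cumulative T g); last first.
  by rewrite /stieltjes; case: pselect.
apply/eqP; rewrite -measure_le0; apply: (@le_trans _ _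
    (stieltjes T g (`](-1)%R, 0%R]%classic : set (measurableTypeR R)))).
  apply: le_measure; [by rewrite inE; exact: measurable_set1|
    by rewrite inE; exact: measurable_itv|].
  by move=> _ ->; rewrite /= in_itv/= lexx ltrN10.
by rewrite stieltjes_oc// ?lerN10// !clamp_le0 ?lerN10// subrr.
Qed.

Lemma clamp_cumulativeD f g : clamp_cumulative T f -> clamp_cumulative T g ->
  clamp_cumulative T (f \+ g)%R.
Proof.
move=> [f1 f2] [g1 g2]; split.
  by move=> x y xy; apply: lerD; [exact: f1|exact: g1].
by move=> x; apply: cvgD; [exact: f2|exact: g2].
Qed.

Lemma stieltjesD f g A : clamp_cumulative T f -> clamp_cumulative T g ->
  measurable A ->
  stieltjes T (f \+ g)%R A = stieltjes T f A + stieltjes T g A.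
Proof.
move=> fc gc mA; have fgc := clamp_cumulativeD fc gc.
rewrite -measure_addE.
apply: measure_unique_oc => //.
- move=> s t st; rewrite -[RHS]/(measure_add _ _ _) measure_addE.
  by rewrite !stieltjes_oc// -EFinD /clamp/= opprD addrACA.
- by move=> s t st; exact: stieltjes_oc_fin.
Qed.

(** The measure [stieltjes T g] lives on all of the line, so the density is cut off to
    the interval before measures are compared on half-open intervals. *)
Lemma stieltjes_density (m : {measure set (measurableTypeR R) -> \bar R})
    g (w : R -> R) : (0 <= T)%R -> clamp_cumulative T g ->
  measurable_fun `]0%R, T]%classic w ->
  (forall t, (0 < t <= T)%R -> (0 <= w t)%R) ->
  (forall s t, (0 <= s)%R -> (s <= t)%R -> (t <= T)%R ->
    (\int[m]_(x in `]s, t]) (w x)%:E = (g t - g s)%:E)) ->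
  forall A, measurable A -> A `<=` `]0%R, T]%classic ->
    stieltjes T g A = \int[m]_(x in A) (w x)%:E.
Proof.
move=> T0 gc mw w0 H A mA AT.
have mI : measurable (`]0%R, T]%classic : set (measurableTypeR R)).
  exact: measurable_itv.
pose v : R -> \bar R := (EFin \o w) \_ `]0%R, T].
have mv : measurable_fun (setT : set (measurableTypeR R)) v.
  by apply/(measurable_restrictT _ _).1 => //; exact/measurable_EFinP.
have v0 x : 0 <= v x.
  rewrite /v /patch; case: ifPn => //; rewrite inE/= in_itv/= => /w0.
  by rewrite lee_fin.
rewrite (@measure_unique_oc _ (density_measure m mv v0))//.
- rewrite /density_measure; apply: eq_integral => x /[!inE] /AT xI.
  by rewrite /v /patch mem_set.
- move=> s t st; rewrite stieltjes_oc//= /density_measure.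
  rewrite /v -integral_mkcondr.
  have [sT|Ts] := leP s T; last first.
    rewrite !clamp_geT// ?(ltW Ts)// ?(le_trans _ st)// ?(ltW Ts)// subrr.
    rewrite (_ : _ `&` _ = set0) ?integral_set0//.
    rewrite -subset0 => x [] /=; rewrite !in_itv/= => /andP[sx _] /andP[_ xT].
    by move: (lt_le_trans sx xT); rewrite ltNge (ltW Ts).
  have [t0|t0] := leP t 0%R.
    rewrite !clamp_le0// ?(le_trans st)// subrr.
    rewrite (_ : _ `&` _ = set0) ?integral_set0//.
    rewrite -subset0 => x [] /=; rewrite !in_itv/= => /andP[_ xt] /andP[x0 _].
    by move: (lt_le_trans x0 xt); rewrite ltNge t0.
  rewrite (_ : _ `&` _ =
      `]Num.max 0%R (Num.min s T), Num.max 0%R (Num.min t T)]%classic); last first.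
    rewrite (min_l sT) (@max_r _ _ 0%R (Num.min t T)); last first.
      by rewrite le_min (ltW t0).
    apply/seteqP; split => x /=; rewrite !in_itv/= gt_max le_min.
      by move=> [/andP[-> ->] /andP[-> ->]].
    by move=> /andP[/andP[-> ->] /andP[-> ->]].
  rewrite H//.
  + by rewrite le_max lexx.
  + by rewrite ge_max le_max lexx/= le_max; apply/orP; right;
      rewrite le_min ge_min st/= ge_min lexx orbT.
  + by rewrite ge_max T0 ge_min lexx orbT.
- by move=> s t st; exact: stieltjes_oc_fin.
Qed.

End stieltjes_measure.

(** * Absolutely continuous functions and their total variation *)

Section partition_cells.
Context (R : realType).
Implicit Types (g : R -> R) (L K : seq (R * R)).

Fixpoint cells (a : R) (s : seq R) : seq (R * R) :=
  if s is x :: s' then (a, x) :: cells x s' else [::].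

Definition nonoverlapping (I J : R * R) := (I.2 <= J.1) || (J.2 <= I.1).

(** Absolute continuity is quantified over sequences of intervals; sequences of pairs
    are easier to concatenate and refine. *)
Definition subintervals (T : R) L :=
  all (fun I => [&& 0 <= I.1, I.1 <= I.2 & I.2 <= T]) L &&
  pairwise nonoverlapping L.

Definition total_length L := \sum_(I <- L) (I.2 - I.1).

Lemma cells_bounds a s : path <%R a s ->
  all (fun I => [&& a <= I.1, I.1 <= I.2 & I.2 <= last a s]) (cells a s).
Proof.
elim: s a => //= x s IH a /andP[ax xs]; rewrite lexx (ltW ax)/=.
have xl : x <= last x s.
  elim: s x {IH ax} xs => //= y s IH x /andP[xy ys].
  by rewrite (le_trans (ltW xy))// IH.
rewrite xl/=; apply: sub_all (IH _ xs) => I /and3P[h1 -> ->].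
by rewrite (le_trans (ltW ax)).
Qed.

Lemma cells_nonoverlapping a s : path <%R a s ->
  pairwise nonoverlapping (cells a s).
Proof.
elim: s a => //= x s IH a /andP[ax xs]; rewrite IH// andbT.
by apply: sub_all (cells_bounds xs) => I /and3P[h1 _ _]; rewrite /nonoverlapping h1.
Qed.

Lemma cells_length a s : total_length (cells a s) = last a s - a.
Proof.
rewrite /total_length; elim: s a => [|x s IH] a /=.
  by rewrite big_nil subrr.
by rewrite big_cons IH/=; ring.
Qed.

Lemma cells_variation a b g s :
  \sum_(I <- cells a s) `|g I.2 - g I.1| = variation a b g s.
Proof.
elim: s a => [|x s IH] a; first by rewrite /variation big_nil big_geq.
rewrite /= big_cons IH /variation/= big_nat_recl//=.
Qed.
End partition_cells.

Section absolutely_continuous_functions.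
Context (R : realType) (T : R).
Implicit Types (g : R -> R) (L K : seq (R * R)).

Lemma absolutely_continuous_seq g : absolutely_continuous T g ->
  forall e : R, 0 < e -> exists2 d : R, 0 < d & forall L, subintervals T L ->
    total_length L < d -> \sum_(I <- L) `|g I.2 - g I.1| < e.
Proof.
move=> acg e e0; have [d d0 H] := acg e e0; exists d => // L /andP[/allP Lok Lp] Ld.
have := H (size L) (fun i => (nth (0, 0) L i).1) (fun i => (nth (0, 0) L i).2).
rewrite !(big_nth (0, 0)) !big_mkord; apply.
- by move=> i iL; have /and3P[-> -> ->] := Lok _ (mem_nth (0, 0) iL).
- move=> i j iL jL; rewrite neq_ltn => /orP[] ij.
    by have /(pairwiseP (0, 0))/(_ _ _ iL jL ij)/orP[|] := Lp; [left|right].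
  by have /(pairwiseP (0, 0))/(_ _ _ jL iL ij)/orP[|] := Lp; [right|left].
- by move: Ld; rewrite /total_length (big_nth (0, 0)) big_mkord.
Qed.

(** Replacing an interval by a finer and finer partition turns increments into
    variations, one interval at a time. *)
Lemma absolutely_continuous_variation g (d e : R) :
  (forall L, subintervals T L -> total_length L < d ->
     \sum_(I <- L) `|g I.2 - g I.1| < e) ->
  forall K L, subintervals T (K ++ L) -> total_length (K ++ L) < d ->
  (\sum_(I <- K) total_variation I.1 I.2 g +
   (\sum_(I <- L) `|g I.2 - g I.1|)%:E <= e%:E)%E.
Proof.
move=> H; elim=> [|I K IH] L KL dKL.
  by rewrite big_nil add0e lee_fin ltW// H.
move: KL; rewrite /subintervals /= -andbA => /and4P[Iok ok IL pKL].
move: ok IL pKL; rewrite !all_cat pairwise_cat => /andP[okK okL] /andP[IK IL] /and3P[KL pK pL].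
have sub_all (s : seq (R * R)) J :
    all (fun I' => [&& I.1 <= I'.1, I'.1 <= I'.2 & I'.2 <= I.2]) s ->
    0 <= I.1 -> I.2 <= T -> nonoverlapping I J ->
  all [pred I' | nonoverlapping I' J] s /\ all (nonoverlapping J) s /\
  all (fun I => [&& 0 <= I.1, I.1 <= I.2 & I.2 <= T]) s.
  move=> /allP sI I0 IT IJ; split; [|split]; apply/allP => I' /sI /and3P[h1 h2 h3].
  - rewrite /nonoverlapping /=; case/orP: IJ => h; first by rewrite (le_trans h3).
    by rewrite (le_trans h h1) orbT.
  - rewrite /nonoverlapping /=; case/orP: IJ => h; first by rewrite (le_trans h3)// orbT.
    by rewrite (le_trans h h1).
  - by rewrite (le_trans I0 h1) h2 (le_trans h3 IT).
move/and3P : Iok => [I0 I12 IT].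
have step s : path <%R I.1 s -> last I.1 s = I.2 ->
    (\sum_(J <- K) total_variation J.1 J.2 g +
     (variation I.1 I.2 g s + \sum_(J <- L) `|g J.2 - g J.1|)%:E <= e%:E)%E.
  move=> Is sI; rewrite -cells_variation -big_cat/=; apply: IH.
    have cI := cells_bounds Is; rewrite sI in cI.
    have II : nonoverlapping I (I.2, I.2) by rewrite /nonoverlapping /= lexx.
    have [_ [_ okc]] := sub_all _ _ cI I0 IT II.
    apply/andP; split; first by rewrite !all_cat okK okc okL.
    rewrite pairwise_cat pK pairwise_cat pL cells_nonoverlapping// !andbT/=.
    apply/andP; split; last first.
      apply/allrelP => x y xs yL.
      have [/allP h _] := sub_all _ y cI I0 IT (allP IL _ yL).
      exact: h.
    rewrite allrel_catr KL andbT; apply/allrelP => x y xK ys.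
    have [_ [/allP h _]] := sub_all _ x cI I0 IT (allP IK _ xK).
    exact: h.
  move: dKL; rewrite /total_length !(big_cat, big_cons)/=.
  have := cells_length I.1 s; rewrite /total_length sI => ->.
  by rewrite -addrA addrCA.
have fin : (\sum_(J <- K) total_variation J.1 J.2 g +
    (\sum_(J <- L) `|g J.2 - g J.1|)%:E)%E \is a fin_num.
  rewrite ge0_fin_numE; last first.
    rewrite adde_ge0// ?lee_fin ?sumr_ge0//.
    rewrite big_seq; apply: sume_ge0 => J /(allP okK) /and3P[_ h _].
    exact: total_variation_ge0.
  rewrite (@le_lt_trans _ _ e%:E) ?ltry//; apply: IH.
    by rewrite /subintervals all_cat okK okL pairwise_cat KL pK pL.
  apply: le_lt_trans dKL; rewrite /total_length !(big_cat, big_cons)/=.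
  by rewrite lerD2r lerDr subr_ge0.
rewrite big_cons -addeA -leeBrDr//.
apply: ub_ereal_sup => _ [_ [s [Is /eqP sI] <-] <-].
by rewrite leeBrDr// addeCA -EFinD; exact: step.
Qed.

(** The bound passes from increments to variations: refining each interval by a
    partition does not change the total length. *)
Lemma absolutely_continuous_TV g : absolutely_continuous T g ->
  forall e : R, 0 < e -> exists2 d : R, 0 < d & forall K, subintervals T K ->
    total_length K < d ->
    (\sum_(I <- K) total_variation I.1 I.2 g <= e%:E)%E.
Proof.
move=> /absolutely_continuous_seq acg e e0; have [d d0 H] := acg e e0.
exists d => // K Kok Kd.
have := @absolutely_continuous_variation g d e H K [::].
by rewrite cats0 big_nil adde0; exact.
Qed.

Lemma absolutely_continuous_cts g : absolutely_continuous T g ->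
  {within `[0, T], continuous g}.
Proof.
move=> /absolutely_continuous_seq acg.
have P (e : R) : 0 < e -> exists2 d : R, 0 < d & forall s t, 0 <= s -> s <= t ->
    t <= T -> t - s < d -> `|g t - g s| < e.
  move=> e0; have [d d0 H] := acg e e0; exists d => // s t s0 st tT tsd.
  have := H [:: (s, t)]; rewrite /total_length !big_seq1; apply => //.
  by rewrite /subintervals/= s0 st tT.
apply/subspace_continuousP => x /=; rewrite in_itv/= => /andP[x0 xT].
apply/cvgrPdist_lt => e e0; have [d d0 H] := P e e0.
rewrite near_withinE; near=> y => /=; rewrite in_itv/= => /andP[y0 yT].
have xyd : `|x - y| < d by near: y; apply/nbhs_ballP; exists d.
have [xy|yx] := leP x y.
  by rewrite distrC H// (le_lt_trans _ xyd)// distrC ler_norm.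
by rewrite H ?(ltW yx)// (le_lt_trans _ xyd)// ler_norm.
Unshelve. all: by end_near. Qed.

(** Cut the interval into finitely many pieces shorter than the modulus for [e = 1];
    each has variation at most 1. *)
Lemma absolutely_continuous_BV g t : absolutely_continuous T g ->
  0 <= t <= T -> total_variation 0 t g \is a fin_num.
Proof.
move=> acg /andP[t0 tT]; have [d d0 H] := absolutely_continuous_TV acg ltr01.
have small s u : 0 <= s -> s <= u -> u <= T -> u - s < d ->
    (total_variation s u g <= 1%:E)%E.
  move=> s0 su uT usd; have := H [:: (s, u)]; rewrite /total_length !big_seq1.
  by apply => //; rewrite /subintervals/= s0 su uT.
have [n nP] : exists n : nat, t / n.+1%:R < d.
  exists (Num.trunc (t / d)); rewrite ltr_pdivrMr ?ltr0n// mulrC -ltr_pdivrMr//.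
  exact: truncnS_gt.
pose u i : R := i%:R * (t / n.+1%:R).
have u_ge0 i : 0 <= u i by rewrite mulr_ge0// divr_ge0.
have uS i : u i.+1 - u i = t / n.+1%:R by rewrite /u -natr1; ring.
have u_mono i : u i <= u i.+1 by rewrite -subr_ge0 uS divr_ge0.
have un : u n.+1 = t by rewrite /u mulrC divfK.
have u_le i : (i <= n.+1)%N -> u i <= T.
  move=> im; apply: le_trans tT; rewrite -[leRHS]un ler_wpM2r ?ler_nat//.
  by rewrite divr_ge0.
suff : forall i, (i <= n.+1)%N -> (total_variation 0 (u i) g <= i%:R%:E)%E.
  move=> /(_ n.+1 (leqnn _)); rewrite un => h.
  by rewrite ge0_fin_numE ?total_variation_ge0// (le_lt_trans h)// ltry.
elim=> [_|i IH im]; first by rewrite /u mul0r total_variationxx.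
rewrite (total_variationD g (u_ge0 i) (u_mono i)) -natr1 EFinD leeD ?IH//.
  exact: ltnW.
by apply: small => //; [exact: u_le|rewrite uS].
Qed.

Lemma tv_funB g s t : absolutely_continuous T g -> 0 <= s -> s <= t -> t <= T ->
  (tv_fun g t - tv_fun g s)%:E = total_variation s t g.
Proof.
move=> acg s0 st tT; have ft : total_variation 0 t g \is a fin_num.
  by apply: absolutely_continuous_BV => //; rewrite (le_trans s0).
have fs : total_variation 0 s g \is a fin_num.
  by apply: absolutely_continuous_BV => //; rewrite s0 (le_trans st).
rewrite EFinB /tv_fun !fineK// (total_variationD g s0 st) addeAC subee ?add0e//.
Qed.

Lemma tv_fun_ge g s t : absolutely_continuous T g ->
  0 <= s -> s <= t -> t <= T -> `|g t - g s| <= tv_fun g t - tv_fun g s.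
Proof.
by move=> ag s0 st tT; rewrite -lee_fin (tv_funB ag)// total_variation_ge.
Qed.

Lemma tv_fun_ac g : absolutely_continuous T g -> absolutely_continuous T (tv_fun g).
Proof.
move=> acg e e0.
have [d d0 H] := absolutely_continuous_TV acg (divr_gt0 e0 (ltr0n _ 2)).
exists d => // n s t st dis ltd.
apply: (@le_lt_trans _ _ (e / 2)); last by rewrite ltr_pdivrMr// mulr_natr mulr2n ltrDl.
have := H (mkseq (fun i => (s i, t i)) n).
rewrite /total_length !big_map (_ : iota 0 n = index_iota 0 n); last first.
  by rewrite /index_iota subn0.
rewrite !big_mkord/= -lee_fin -sumEFin => h.
apply: le_trans (h _ _).
- apply: lee_sum => i _; have [/andP[s0 sti] tT] := st i (ltn_ord i).
  rewrite -(tv_funB acg)// lee_fin ger0_norm// -lee_fin (tv_funB acg)//.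
  exact: total_variation_ge0.
- apply/andP; split.
    apply/(all_nthP (0, 0)) => i; rewrite size_mkseq => ni; rewrite nth_mkseq//=.
    by have [/andP[-> ->] ->] := st i ni.
  apply/(pairwiseP (0, 0)) => i j; rewrite !inE size_mkseq => ni nj ij.
  rewrite !nth_mkseq//= /nonoverlapping/=.
  by have [|->|->] := dis i j ni nj; rewrite ?orbT// neq_ltn ij.
- exact: ltd.
Qed.

Lemma absolutely_continuousB f g : absolutely_continuous T f ->
  absolutely_continuous T g -> absolutely_continuous T (f \- g).
Proof.
move=> af ag e e0; have e2 : 0 < e / 2 by rewrite divr_gt0.
have [d1 d10 H1] := af _ e2; have [d2 d20 H2] := ag _ e2.
exists (Num.min d1 d2); first by rewrite lt_min d10.
move=> n s t st dis; rewrite lt_min => /andP[l1 l2].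
apply: (@le_lt_trans _ _ (\sum_(i < n) (`|f (t i) - f (s i)| +
    `|g (t i) - g (s i)|))).
  apply: ler_sum => i _; apply: le_trans (ler_normB _ _).
  by rewrite le_eqVlt; apply/orP; left; apply/eqP; congr `|_|; rewrite /=; ring.
by rewrite big_split/= (splitr e) ltrD ?H1 ?H2.
Qed.

End absolutely_continuous_functions.

(** * Absolutely continuous functions as integrals *)

Lemma measureU_le d (X : measurableType d) (R : realType)
    (m : {measure set X -> \bar R}) A B :
  measurable A -> measurable B -> (m (A `|` B) <= m A + m B)%E.
Proof. exact: measureU2. Qed.

Lemma le_measureR (R : realType)
    (m : {measure set (measurableTypeR R) -> \bar R}) (A B : set R) :
  measurable A -> measurable B -> A `<=` B -> (m A <= m B)%E.
Proof. by move=> mA mB AB; apply: le_measure; rewrite ?inE. Qed.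

Section absolutely_continuous_measure.
Context (R : realType) (T : R).
Hypothesis T0 : 0 < T.
Implicit Types g : R -> R.

Lemma clamp_cumulative_cts g : {within `[0, T], continuous g} ->
  (forall s t, 0 <= s -> s <= t -> t <= T -> g s <= g t) -> clamp_cumulative T g.
Proof.
move=> cg ng; split.
  move=> s t st; rewrite /clamp; apply: ng.
  - by rewrite le_max lexx.
  - by rewrite ge_max le_max lexx/= le_max; apply/orP; right;
      rewrite le_min ge_min st/= ge_min lexx orbT.
  - by rewrite ge_max (ltW T0) ge_min lexx orbT.
move=> x; apply: cvg_at_right_filter.
pose c : R -> R := fun t => Num.max 0 (Num.min t T).
have cc : continuous c.
  move=> y; apply: (@continuous_max _ _ (cst 0) (fun t => Num.min t T)).
    exact: cvg_cst.
  by apply: (@continuous_min _ _ id (cst T)); [exact: cvg_id|exact: cvg_cst].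
have cI y : `[0, T]%classic (c y).
  by rewrite /= in_itv/= le_max lexx/= ge_max (ltW T0) ge_min lexx orbT.
have /subspace_continuousP/(_ _ (cI x)) H := cg.
have cw : c y @[y --> x] --> within `[0, T]%classic (nbhs (c x)).
  move=> P HP; apply: (@filterS _ (nbhs x) _ _ _ _ (cc x _ HP)) => y /= Py.
  by apply: Py; exact: cI.
exact: (cvg_comp _ _ cw H).
Qed.

Lemma stieltjes_outside g : clamp_cumulative T g ->
  stieltjes T g (~` `]0%R, T]%classic) = 0%E.
Proof.
move=> gc; apply/eqP; rewrite -measure_le0.
pose B n : set R :=
  `](- (n%:R))%R, 0%R]%classic `|` `]T, T + n%:R]%classic.
have mB n : measurable (B n).
  by apply: measurableU; exact: measurable_itv.
have B0 n : stieltjes T g (B n) = 0%E.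
  apply/eqP; rewrite -measure_le0; apply: (le_trans (measureU_le _ _ _)).
  - exact: measurable_itv.
  - exact: measurable_itv.
  rewrite !stieltjes_oc ?oppr_le0 ?ler0n ?lerDl//.
  have h1 : - (n%:R) <= 0 :> R by rewrite oppr_le0.
  have h2 : T <= T + n%:R by rewrite lerDl.
  rewrite (clamp_le0 g (ltW T0) h1) (clamp_le0 g (ltW T0) (lexx 0)).
  by rewrite (clamp_geT g (ltW T0) (lexx T)) (clamp_geT g (ltW T0) h2) !subrr adde0.
have mI : measurable (~` `]0%R, T]%classic : set (measurableTypeR R)).
  by apply: measurableC; exact: measurable_itv.
apply: le_trans (_ : (\sum_(n <oo) stieltjes T g (B n) <= 0)%E); last first.
  by rewrite eseries0.
apply: measure_sigma_subadditive => // x /=; rewrite in_itv/= => /negP.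
rewrite negb_and -leNgt -ltNge => xI.
exists (Num.trunc `|x|).+1 => //; rewrite /B /=; have := truncnS_gt `|x|.
rewrite ltr_norml => /andP[h1 h2]; case/orP: xI => [x0|Tx]; [left|right].
  by rewrite in_itv/= h1.
by rewrite in_itv/= Tx (le_trans (ltW h2))// lerDr (ltW T0).
Qed.

Lemma stieltjes_fin g : clamp_cumulative T g -> fin_num_fun (stieltjes T g).
Proof.
move=> gc A mA; rewrite ge0_fin_numE//.
have mI : measurable (`]0%R, T]%classic : set (measurableTypeR R)).
  exact: measurable_itv.
have sT : (stieltjes T g setT < +oo)%E.
  rewrite (_ : setT = `]0%R, T]%classic `|` ~` `]0%R, T]%classic :> set R); last first.
    by rewrite setUv.
  apply: le_lt_trans (measureU_le _ _ _) _ => //; first exact: measurableC.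
  by rewrite stieltjes_outside// adde0; apply: stieltjes_oc_fin => //; exact: ltW.
by apply: le_lt_trans sT; apply: le_measure; rewrite ?inE//.
Qed.

(** A component of an open subset of ]0, T[ is recovered, up to its endpoints, from
    its infimum and supremum. *)
Lemma interval_endpoints (J : set R) : is_interval J -> open J ->
    J `<=` `]0%R, T[ -> J !=set0 ->
  [/\ 0 <= inf J, inf J < sup J, sup J <= T, J `<=` `]inf J, sup J] &
      `]inf J, sup J[ `<=` J].
Proof.
move=> iJ oJ JT J0.
have hI : has_inf J.
  by split => //; exists 0 => x /JT; rewrite /= in_itv/= => /andP[/ltW].
have hS : has_sup J.
  by split => //; exists T => x /JT; rewrite /= in_itv/= => /andP[_ /ltW].
have JE := interval_bounded_interior iJ hI.2 hS.2.
rewrite (interior_id _).1// in JE.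
have JE' : J = `]inf J, sup J[%classic by rewrite -JE.
split.
- by apply: lb_le_inf => // x /JT; rewrite /= in_itv/= => /andP[/ltW].
- have [x] := J0; rewrite {1}JE' /= in_itv/= => /andP[h1 h2].
  exact: lt_trans h2.
- by apply: sup_le_ub => // x /JT; rewrite /= in_itv/= => /andP[_ /ltW].
- rewrite {1}JE'; exact: subset_itv_oo_oc.
- by rewrite -JE'.
Qed.
(** A null set lies in an open set of small length. Its components are disjoint
    intervals, so absolute continuity makes the sum of the increments of [g] over
    finitely many of them small, uniformly in their number. *)
Lemma stieltjes_ac_null g (A : set (measurableTypeR R)) :
  absolutely_continuous T g -> clamp_cumulative T g ->
  measurable A -> A `<=` `]0%R, T[ -> lebesgue_measure A = 0%E ->
  stieltjes T g A = 0%E.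
Proof.
move=> acg gc mA AT A0.
have gmono s t : 0 <= s -> s <= t -> t <= T -> g s <= g t.
  move=> s0 st tT; have := gc.1 s t st; rewrite !clampE//.
    by rewrite (le_trans s0 st).
  by rewrite s0 (le_trans st).
apply/eqP; rewrite -measure_le0; apply/lee_addgt0Pr => e e0; rewrite add0e.
have [d d0 H] := absolutely_continuous_seq acg e0.
have A1 : (lebesgue_measure A < +oo)%E by rewrite A0 ltry.
have [U [oU AU UA]] := lebesgue_regularity_outer mA A1 d0.
pose J i := open_disjoint_itv oU i `&` `]0%R, T[%classic.
have oJ i : open (J i).
  by apply: openI; [exact: open_disjoint_itv_open|exact: interval_open].
have iJ i : is_interval (J i).
  move=> x y [Ix Tx] [Iy Ty] z xzy; split.
    exact: (open_disjoint_itv_is_interval Ix Iy).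
  move: Tx Ty; rewrite /= !in_itv/= => /andP[x0 _] /andP[_ yT].
  by case/andP: xzy => xz zy; rewrite (lt_le_trans x0 xz) (le_lt_trans zy yT).
have JT i : J i `<=` `]0%R, T[ by exact: subIsetr.
have mJ i : measurable (J i) by exact: open_measurable.
have tJ : trivIset setT J.
  apply/trivIsetP => i j _ _ ij.
  have /trivIsetP/(_ i j Logic.I Logic.I ij) := @open_disjoint_itv_trivIset _ _ oU.
  by rewrite /J => IJ; rewrite setIACA IJ set0I.
have AJ : A `<=` \bigcup_i J i.
  move=> x Ax; have := AU _ Ax; rewrite {1}(open_disjoint_itv_bigcup oU).
  by move=> [i _ Ji]; exists i => //; split => //; exact: AT.
(* Empty components are given the degenerate interval (0, 0). *)
pose st i : R * R := if pselect (J i !=set0) is left _ then (inf (J i), sup (J i))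
  else (0, 0).
have stP i : [/\ 0 <= (st i).1, (st i).1 <= (st i).2, (st i).2 <= T,
    J i `<=` `](st i).1, (st i).2] & `](st i).1, (st i).2[ `<=` J i] /\
    ((st i).1 < (st i).2 \/ (st i).2 = 0).
  rewrite /st; case: pselect => [J0|/set0P/negP/negPn/eqP ->] /=.
    have [? h ? ? ?] := interval_endpoints (iJ i) (oJ i) (@JT i) J0.
    by split; [split => //; exact: ltW|left].
  split; last by right.
  split => //; first exact: ltW.
  by move=> x; rewrite /= in_itv/= => /andP[x0 /(lt_trans x0)]; rewrite ltxx.
have okst n : subintervals T (mkseq st n).
  apply/andP; split.
    apply/(all_nthP (0, 0)) => i; rewrite size_mkseq => ni; rewrite nth_mkseq//.
    by have [[-> -> ->]] := stP i.
  apply/(pairwiseP (0, 0)) => i j; rewrite !inE size_mkseq => ni nj ij.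
  rewrite !nth_mkseq//= /nonoverlapping; apply/orP.
  have [[si0 _ siT _ Ji] si2] := stP i; have [[sj0 _ sjT _ Jj] sj2] := stP j.
  have [|h1] := leP (st i).2 (st j).1; first by left.
  have [|h2] := leP (st j).2 (st i).1; first by right.
  case: si2 => [si2|si2]; last by move: h1; rewrite si2 ltNge sj0.
  case: sj2 => [sj2|sj2]; last by move: h2; rewrite sj2 ltNge si0.
  (* Overlapping intervals would share the midpoint of their intersection. *)
  pose p := Num.max (st i).1 (st j).1; pose q := Num.min (st i).2 (st j).2.
  have pq : p < q by rewrite gt_max !lt_min si2 h1 h2 sj2.
  have [pm mq] := midf_lt pq.
  have mi : J i ((p + q) / 2).
    apply: Ji; rewrite /= in_itv/=; move: pm mq; rewrite gt_max lt_min.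
    by move=> /andP[-> _] /andP[-> _].
  have mj : J j ((p + q) / 2).
    apply: Jj; rewrite /= in_itv/=; move: pm mq; rewrite gt_max lt_min.
    by move=> /andP[_ ->] /andP[_ ->].
  have /trivIsetP/(_ i j Logic.I Logic.I) := tJ; rewrite neq_ltn ij => /(_ isT) IJ.
  by have : (J i `&` J j) ((p + q) / 2) by []; rewrite IJ.
have lenst n : total_length (mkseq st n) < d.
  rewrite -lte_fin.
  apply: (@le_lt_trans _ _ (lebesgue_measure (\bigcup_i J i))).
    have -> : lebesgue_measure (\bigcup_i J i) =
        (\sum_(i <oo) lebesgue_measure (J i))%E.
      rewrite measure_bigcup//; last by move=> i _; exact: mJ.
      by apply: eq_eseriesl => i; rewrite in_setT.
    rewrite /total_length /mkseq big_map -sumEFin.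
    rewrite (_ : iota 0 n = index_iota 0 n); last by rewrite /index_iota subn0.
    apply: le_trans (nneseries_lim_ge n _); last by [].
    apply: lee_sum => i _; have [[_ h1 _ _ h2] _] := stP i.
    have -> : ((st i).2 - (st i).1)%:E =
        lebesgue_measure (`](st i).1, (st i).2[%classic : set R).
      by rewrite lebesgue_measure_itv/= lte_fin; case: ltgtP h1 => // ->; rewrite subrr.
    by apply: le_measureR => //; exact: measurable_itv.
  apply: (@le_lt_trans _ _ (lebesgue_measure (U `\` A `|` A))).
    apply: le_measureR.
    - exact: bigcup_measurable.
    - by apply: measurableU => //; apply: measurableD => //; exact: open_measurable.
    - move=> x [i _ [Jx _]]; have Ux : U x.
        by rewrite (open_disjoint_itv_bigcup oU); exists i.
      by have [Ax|nAx] := pselect (A x); [right|left].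
  apply: le_lt_trans (measureU_le _ _ _) _ => //.
    by apply: measurableD => //; exact: open_measurable.
  by rewrite [X in (_ + X)%E]A0 adde0.
apply: (@le_trans _ _ (\sum_(i <oo) stieltjes T g (J i))%E).
  exact: measure_sigma_subadditive.
apply: lime_le; first by apply: is_cvg_nneseries.
apply: nearW => n; apply: (@le_trans _ _ (\sum_(0 <= i < n)
    (`|g (st i).2 - g (st i).1|)%:E)%E).
  apply: lee_sum => i _; have [[h0 h1 h2 h3 _] _] := stP i.
  apply: (@le_trans _ _ (stieltjes T g `](st i).1, (st i).2]%classic)).
    by apply: le_measureR => //; exact: measurable_itv.
  by rewrite stieltjes_ocE// lee_fin ler_norm.
have := H _ (okst n) (lenst n); rewrite big_map sumEFin lee_fin => /ltW.
by rewrite (_ : iota 0 n = index_iota 0 n) // /index_iota subn0.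
Qed.

End absolutely_continuous_measure.

(** An alias that records finiteness, so that the Radon-Nikodym theorem applies. *)
Definition fin_stieltjes (R : realType) (T : R) (T0 : 0 < T) (g : R -> R)
    (gc : clamp_cumulative T g) : set (measurableTypeR R) -> \bar R :=
  stieltjes T g.

Section fin_stieltjes_instance.
Context (R : realType) (T : R) (T0 : 0 < T) (g : R -> R).
Hypothesis gc : clamp_cumulative T g.
HB.instance Definition _ := Measure.on (fin_stieltjes T0 gc).
HB.instance Definition _ :=
  Measure_isFinite.Build _ _ _ (fin_stieltjes T0 gc) (stieltjes_fin T0 gc).
End fin_stieltjes_instance.

Section fundamental_theorem.
Context (R : realType) (T : R).
Hypothesis T0 : 0 < T.
Implicit Types g : R -> R.
Local Notation leb := (@lebesgue_measure R).

Lemma stieltjes_ac_dominates g (gc : clamp_cumulative T g) :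
  absolutely_continuous T g ->
  charge_of_finite_measure (fin_stieltjes T0 gc) `<< leb.
Proof.
move=> acg; apply/null_content_dominatesP => A mA A0.
rewrite /charge_of_finite_measure /fin_stieltjes.
have mI : measurable (`]0%R, T[%classic : set (measurableTypeR R)).
  exact: measurable_itv.
have mI' : measurable (`]0%R, T]%classic : set (measurableTypeR R)).
  exact: measurable_itv.
apply/eqP; rewrite -measure_le0.
pose B : set R := (A `&` `]0, T[) `|` (~` `]0, T]%classic `|` [set T]).
apply: (@le_trans _ _ (stieltjes T g B)).
  apply: le_measure; rewrite ?inE//.
    by apply: measurableU; [exact: measurableI|apply: measurableU;
      [exact: measurableC|exact: measurable_set1]].
  move=> x Ax; have [xT|xT] := pselect (`]0, T[%classic x); first by left.
  right; have [->|xnT] := eqVneq x T; first by right.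
  left; apply: contra_not xT; rewrite /= !in_itv/= => /andP[-> xT]/=.
  by rewrite lt_neqAle xnT.
apply: le_trans (measureU_le _ _ _) _.
- exact: measurableI.
- by apply: measurableU; [exact: measurableC|exact: measurable_set1].
rewrite stieltjes_ac_null//; last 2 first.
- exact: measurableI.
- apply/eqP; rewrite -measure_le0 -A0; apply: le_measure; rewrite ?inE//.
  exact: measurableI.
rewrite add0e; apply: le_trans (measureU_le _ _ _) _.
- exact: measurableC.
- exact: measurable_set1.
rewrite stieltjes_outside// add0e.
apply/lee_addgt0Pr => e e0; rewrite add0e.
have [d d0 H] := absolutely_continuous_seq acg e0.
pose s := Num.max 0 (T - d / 2).
have sT : s < T by rewrite gt_max T0 gtrBl divr_gt0.
have s0 : 0 <= s by rewrite le_max lexx.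
apply: (@le_trans _ _ (stieltjes T g `]s, T]%classic)).
  apply: le_measureR; [exact: measurable_set1|exact: measurable_itv|].
  by move=> _ ->; rewrite /= in_itv/= sT lexx.
rewrite stieltjes_ocE// ?(ltW sT)// lee_fin.
have := H [:: (s, T)]; rewrite /total_length !big_seq1/= => h.
apply: le_trans (ler_norm _) _; apply/ltW/h.
  by rewrite /subintervals/= s0 (ltW sT) lexx.
rewrite ltrBlDl -ltrBlDr (lt_le_trans _ (_ : T - d / 2 <= _))//; last first.
  by rewrite le_max lexx orbT.
by rewrite ltrD2l ltrN2 ltr_pdivrMr// mulr_natr mulr2n ltrDl.
Qed.

Lemma monotone_ac_density g : absolutely_continuous T g ->
  (forall s t, 0 <= s -> s <= t -> t <= T -> g s <= g t) ->
  exists h : R -> R, [/\ leb.-integrable setT (EFin \o h) &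
    forall A, measurable A -> (stieltjes T g A = \int[leb]_(x in A) (h x)%:E)%E].
Proof.
move=> acg gm.
have gc := clamp_cumulative_cts T0 (absolutely_continuous_cts acg) gm.
have dom := stieltjes_ac_dominates gc acg.
pose r := Radon_Nikodym (charge_of_finite_measure (fin_stieltjes T0 gc)) leb.
have rf x : r x \is a fin_num by exact: Radon_Nikodym_fin_num.
have rE : EFin \o (fine \o r) = r by apply/funext => x /=; rewrite fineK.
exists (fine \o r); split.
  by rewrite rE; exact: Radon_Nikodym_integrable.
move=> A mA; rewrite -[LHS]/(charge_of_finite_measure (fin_stieltjes T0 gc) A).
rewrite (Radon_Nikodym_integral dom mA).
by apply: eq_integral => x _; rewrite /= fineK.
Qed.

(** Write [g] as the difference of its variation and of its variation minus itself:
    both are monotone and absolutely continuous, hence integrals of their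
    Radon-Nikodym densities. Lebesgue's differentiation theorem identifies the
    difference of the densities with the derivative of [g]. *)
Lemma absolutely_continuous_FTC g : absolutely_continuous T g ->
  exists h : R -> R, [/\ leb.-integrable setT (EFin \o h),
    forall s t, 0 <= s -> s <= t -> t <= T ->
      \int[leb]_(x in `]s, t]) h x = g t - g s &
    {ae leb, forall t : R, 0 < t < T -> derive1 g t = h t}].
Proof.
move=> acg.
have acp := tv_fun_ac acg; have acn := absolutely_continuousB acp acg.
have pm s t : 0 <= s -> s <= t -> t <= T -> tv_fun g s <= tv_fun g t.
  move=> s0 st tT; rewrite -subr_ge0; apply: le_trans (tv_fun_ge acg s0 st tT).
  exact: normr_ge0.
have nm s t : 0 <= s -> s <= t -> t <= T ->
    (tv_fun g \- g) s <= (tv_fun g \- g) t.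
  move=> s0 st tT; have := le_trans (ler_norm _) (tv_fun_ge acg s0 st tT).
  by rewrite /=; lra.
have pc := clamp_cumulative_cts T0 (absolutely_continuous_cts acp) pm.
have nc := clamp_cumulative_cts T0 (absolutely_continuous_cts acn) nm.
have [hp [ip Hp]] := monotone_ac_density acp pm.
have [hn [in_ Hn]] := monotone_ac_density acn nm.
have mI s t : measurable (`]s, t]%classic : set (measurableTypeR R)).
  exact: measurable_itv.
have ih : leb.-integrable setT (EFin \o (hp \- hn)).
  rewrite (_ : _ \o _ = (EFin \o hp) \- (EFin \o hn))%E//.
  exact: integrableB.
have H s t : 0 <= s -> s <= t -> t <= T ->
    \int[leb]_(x in `]s, t]) (hp \- hn) x = g t - g s.
  move=> s0 st tT; rewrite RintegralB//; last 2 first.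
  - exact: integrableS ip.
  - exact: integrableS in_.
  rewrite /Rintegral -Hp// -Hn// !stieltjes_ocE//=; ring.
exists (hp \- hn); split => //.
set h := hp \- hn in ih H *.
have ihy (y : R) : leb.-integrable `]0, y] (EFin \o h).
  exact: integrableS ih.
have locf : locally_integrable [set: R] h.
  split => //.
  - by apply/measurable_EFinP; exact: measurable_int ih.
  - exact: openT.
  move=> K _ /compact_measurable mK.
  by have /integrableP[_] :=
    @integrableS _ (measurableTypeR R) R leb setT K _ measurableT mK (@subsetT _ K) ih.
have := FTC1 (a := BRight 0) ihy locf.
apply: filterS; first exact: (ae_filter_ringOfSetsType leb).
move=> x Hx /andP[x0 xT].
have [dF Fx] := Hx x0.
rewrite -Fx !derive1E.
have Fg : \near x, g x = ((fun y => \int[leb]_(t in `]0, y]) h t) + cst (g 0)) x.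
  near=> y.
  rewrite /= fctE H ?subrK//; apply/ltW; near: y; [exact: lt_nbhsr|exact: lt_nbhsl].
move: dF Fg; set F0 := (fun y => _); move: F0 => F0 dF Fg.
rewrite (near_eq_derive _ Fg) (deriveD dF (derivable_cst _ _ _)) derive_cst.
by rewrite addr0.
Unshelve. all: by end_near. Qed.
End fundamental_theorem.

(** * The mean and the variance function *)

Section integral_complements.
Local Open Scope ereal_scope.
Context d (X : measurableType d) (R : realType).
Import HBNNSimple.

(** The integral of a nonnegative function is a supremum over simple functions
    below it, whether or not the function is measurable. *)
Lemma ge0_le_integral_nonmeasurable (m : {measure set X -> \bar R}) (D E : set X)
    (f g : X -> \bar R) : D `<=` E ->
  (forall x, D x -> 0 <= f x) -> (forall x, E x -> 0 <= g x) ->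
  (forall x, D x -> f x <= g x) ->
  \int[m]_(x in D) f x <= \int[m]_(x in E) g x.
Proof.
move=> DE f0 g0 fg; rewrite integral_mkcond [leRHS]integral_mkcond.
have f0' x : 0 <= (f \_ D) x.
  by rewrite /patch; case: ifPn => // /[!inE] /f0.
have g0' x : 0 <= (g \_ E) x.
  by rewrite /patch; case: ifPn => // /[!inE] /g0.
rewrite !ge0_integralTE//; apply: le_ereal_sup => _ [h hf <-]; exists h => // x.
apply: le_trans (hf x) _; rewrite /patch; case: ifPn => [/[!inE] xD|xD].
  by rewrite mem_set ?fg//; exact: DE.
by case: ifPn => // /[!inE] /g0.
Qed.

Lemma integral_density (m nu : {measure set X -> \bar R}) (w : X -> R)
    (D : set X) (f : X -> R) :
  measurable D -> (forall x, D x -> (0 <= w x)%R) -> measurable_fun D w ->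
  (forall A, measurable A -> A `<=` D -> nu A = \int[m]_(x in A) (w x)%:E) ->
  measurable_fun D f ->
  \int[nu]_(x in D) (f x)%:E = \int[m]_(x in D) (f x * w x)%:E.
Proof.
move=> mD w0 mw nuE mf; rewrite integralE [RHS]integralE.
have mfE : measurable_fun D (EFin \o f) by exact/measurable_EFinP.
congr (_ - _).
  rewrite (ge0_integral_density (m := m) (w := w))//; last exact: measurable_funepos.
  apply: eq_integral => x /[!inE] Dx; rewrite !funeposE -!EFin_max -EFinM.
  by rewrite maxr_pMl ?w0// mul0r.
rewrite (ge0_integral_density (m := m) (w := w))//; last exact: measurable_funeneg.
apply: eq_integral => x /[!inE] Dx; rewrite !funenegE -!EFinN -!EFin_max -EFinM.
by rewrite maxr_pMl ?w0// mul0r mulNr.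
Qed.

End integral_complements.

Section mean_and_variance.
Context (R : realType) (T : R) (a b : R -> R).
Hypotheses (T0 : 0 < T) (ma : mean_function T a) (vb : variance_function T b).
Local Notation leb := (@lebesgue_measure R).
Local Notation db := (stieltjes T b).
Local Notation va := (tv_fun a).
Local Notation dva := (stieltjes T (tv_fun a)).

Lemma mean_ac : absolutely_continuous T a. Proof. by case: ma. Qed.

Lemma va_mono s t : 0 <= s -> s <= t -> t <= T -> va s <= va t.
Proof.
move=> s0 st tT; rewrite -subr_ge0; apply: le_trans (tv_fun_ge mean_ac s0 st tT).
exact: normr_ge0.
Qed.

Lemma va_cumulative : clamp_cumulative T va.
Proof.
apply: clamp_cumulative_cts => //; last exact: va_mono.
exact/absolutely_continuous_cts/tv_fun_ac/mean_ac.
Qed.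

Lemma b_mono s t : 0 <= s -> s <= t -> t <= T -> b s <= b t.
Proof.
have [h _ _] := vb; move=> s0; rewrite le_eqVlt => /predU1P[->//|st] tT.
by rewrite ltW// h.
Qed.

Lemma b_cts : {within `[0, T], continuous b}.
Proof.
have [_ _ [b' [_ bd _]]] := vb.
apply/subspace_continuousP => x xI; apply/cvgrPdist_lt => e e0.
have H1 : \forall s \near x, s != x -> `[0, T]%classic s ->
    `|b' x - (b s - b x) / (s - x)| < 1.
  have /cvgrPdist_lt/(_ 1 ltr01) := bd x xI.
  by rewrite near_withinE /dnbhs near_withinE; apply: filterS => y.
have k0 : 0 < `|b' x| + 1 by rewrite ltr_wpDl.
rewrite near_withinE; near=> s => sI.
have [->|sx] := eqVneq s x; first by rewrite subrr normr0.
have h1 : `|b' x - (b s - b x) / (s - x)| < 1.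
  by move: sx sI; near: s.
have h2 : `|x - s| < e / (`|b' x| + 1).
  by near: s; apply/nbhs_ballP; exists (e / (`|b' x| + 1)) => //=; rewrite divr_gt0.
have -> : from_subspace `[0, T] b x - from_subspace `[0, T] b s =
    ((b s - b x) / (s - x)) * (x - s).
  by rewrite -(opprB s x) mulrN divfK ?subr_eq0// opprB.
rewrite normrM; have h3 : `|(b s - b x) / (s - x)| < `|b' x| + 1.
  rewrite -ltrBlDl (le_lt_trans _ h1)// distrC.
  exact: le_trans (lerB_dist _ _).
rewrite (@le_lt_trans _ _ ((`|b' x| + 1) * `|x - s|))// ?ler_wpM2r// 1?ltW//.
by rewrite mulrC -ltr_pdivlMr.
Unshelve. all: by end_near. Qed.

Lemma b_cumulative : clamp_cumulative T b.
Proof. by apply: clamp_cumulative_cts => //; [exact: b_cts|exact: b_mono]. Qed.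

(** The closed interval differs from the half-open one by the origin, which neither
    measure charges. *)
Lemma stieltjes_density_cc (m : {measure set (measurableTypeR R) -> \bar R})
    g (w : R -> R) : m [set 0] = 0%E -> clamp_cumulative T g ->
  measurable_fun `[0, T] w ->
  (forall t, 0 <= t <= T -> 0 <= w t) ->
  (forall s t, 0 <= s -> s <= t -> t <= T ->
    (\int[m]_(x in `]s, t]) (w x)%:E = (g t - g s)%:E)%E) ->
  forall A : set R, measurable A -> A `<=` `[0, T] ->
    (stieltjes T g A = \int[m]_(x in A) (w x)%:E)%E.
Proof.
move=> m0 gc mw w0 H A mA AT.
have mI : measurable (`]0, T]%classic : set R) by exact: measurable_itv.
have mA1 : measurable (A `&` `]0, T]%classic) by exact: measurableI.
have mA2 : measurable (A `&` [set 0]) by apply: measurableI.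
have AE : A = (A `&` `]0, T]%classic) `|` (A `&` [set 0]).
  apply/seteqP; split => x; last by move=> [] [].
  move=> Ax; have [x0|x0] := eqVneq x 0; [right|left]; split => //.

  have := AT _ Ax; rewrite /= !in_itv/= => /andP[h ->].
  by rewrite andbT lt_neqAle eq_sym x0.
have dis : [disjoint A `&` `]0, T]%classic & A `&` [set 0]].
  apply/disj_setPS => x [[_ /=]]; rewrite in_itv/= => /andP[+ _] [_ /= x0].
  by rewrite x0 ltxx.
have mwA : measurable_fun A w by apply: measurable_funS mw => //; exact: measurable_itv.
rewrite [in RHS]AE (@ge0_integral_setU _ (measurableTypeR R))//; last 2 first.
- by rewrite -AE; exact/measurable_EFinP.
- by rewrite -AE => x /AT; rewrite /= in_itv/= lee_fin => /w0.
rewrite [X in (_ + X)%E]null_set_integral ?adde0//; last 2 first.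
- apply/measurable_EFinP; apply: measurable_funS mwA => //; exact: subIsetl.
- by apply/eqP; rewrite -measure_le0 -m0; apply: le_measureR.
rewrite -(@stieltjes_density _ T m g w) ?(ltW T0)//; last 2 first.
- apply: measurable_funS mw; [exact: measurable_itv|exact: subset_itv_oc_cc].
- by move=> t /andP[t0 tT]; rewrite w0// (ltW t0).
rewrite [in LHS]AE; apply/eqP; rewrite eq_le; apply/andP; split.
  apply: le_trans (measureU_le _ _ _) _ => //.
  rewrite [X in (_ + X <= _)%E](_ : _ = 0%E) ?adde0//.
  apply/eqP; rewrite -measure_le0 -(stieltjes_set0 g (ltW T0)).
  apply: le_measureR => //; exact: subIsetr.
by apply: le_measureR => //; exact: measurableU.
Qed.

(** The density is the derivative of [b]: it is continuous and positive on a compact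
    interval, hence bounded away from 0. *)
Lemma b_density : exists2 w : R -> R, measurable_fun `[0, T]%classic w &
  (exists2 c : R, 0 < c & forall t, 0 <= t <= T -> c <= w t) /\
  (forall A : set R, measurable A -> A `<=` `[0, T]%classic ->
   (db A = \int[leb]_(x in A) (w x)%:E)%E).
Proof.
have [_ _ [b' [cb' bd b'0]]] := vb.
have mb' : measurable_fun `[0, T]%classic b' by apply: subspace_continuous_measurable_fun.
have [c cI cmin] := EVT_min (ltW T0) cb'.
exists b' => //; split.
  exists (b' c); first exact: b'0.
  by move=> t tI; apply: cmin; rewrite in_itv.
apply: stieltjes_density_cc => //.
- exact: lebesgue_measure_set1.
- exact: b_cumulative.
- by move=> t tI; rewrite ltW// b'0//= in_itv.
move=> s t s0; rewrite le_eqVlt => /predU1P[-> tT|st tT].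
  rewrite subrr (_ : `]t, t]%classic = set0) ?integral_set0//.
  by rewrite set_itv_ge// bnd_simp ltxx.
have sub : (`[s, t] : set R) `<=` `[0, T]%classic.
  by apply: subset_itv; rewrite bnd_simp.
rewrite integral_itv_obnd_cbnd; last first.
  apply/measurable_EFinP; apply: measurable_funS mb' => //.
  by apply: subset_itv; rewrite bnd_simp.
have bdd (x : R) : x \in `]s, t[ ->
    (h^-1 *: (b (h *: 1 + x) - b x)) @[h --> 0^'] --> b' x.
  rewrite in_itv/= => /andP[sx xt].
  have xI : `[0, T]%classic x.
    by rewrite /= in_itv/= (le_trans s0 (ltW sx)) (le_trans (ltW xt) tT).
  apply/cvgrPdist_lt => e e0.
  have /cvgrPdist_lt/(_ e e0) := bd x xI.
  rewrite near_withinE /dnbhs near_withinE => /nbhs_ballP[d /= d0 Hd].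
  pose d' := Num.min d (Num.min (x - s) (t - x)).
  have d'0 : 0 < d' by rewrite !lt_min d0 !subr_gt0 sx xt.
  apply/nbhs_ballP; exists d' => //= h; rewrite /ball/= sub0r normrN.
  rewrite !lt_min => /andP[hd /andP[hs ht]] h0.
  have := Hd (h + x); rewrite /ball/= opprD addrCA subrr addr0 normrN => /(_ hd).
  rewrite addrK -[h *: 1]/(h * 1) mulr1 mulrC; apply.
    by rewrite -subr_eq0 addrK.
  have := ler_norm h; have := ler_norm (- h); rewrite normrN in_itv/=; lra.
have bder x : x \in `]s, t[ -> derivable b x 1 /\ derive1 b x = b' x.
  move=> /bdd H; split; first by apply/cvg_ex; exists (b' x).
  by rewrite derive1E; apply/cvg_lim.
rewrite (@continuous_FTC2 _ b' b)// ?EFinB//.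
- exact: continuous_subspaceW cb'.
- have /(continuous_within_itvP _ st)[_ b1 b2] := continuous_subspaceW sub b_cts.
  by split => // x /bder[].
- by move=> x /bder[].
Qed.

Lemma measurable_inv_pos (D : set R) (f : R -> R) :
  measurable D -> measurable_fun D f -> (forall t, D t -> 0 < f t) ->
  measurable_fun D (fun t => (f t)^-1).
Proof.
move=> mD mf f0.
apply: (@measurable_comp _ _ _ _ _ _ (`]0, +oo[%classic : set R) (fun x : R => x^-1)) => //.
- by move=> _ [t Dt <-]; rewrite /= in_itv/= andbT f0.
- apply: open_continuous_measurable_fun; first exact: interval_open.
  by move=> x; rewrite inE/= in_itv/= andbT => x0; apply: inv_continuous; rewrite gt_eqF.
Qed.

Lemma integral_stieltjesD (f : R -> \bar R) : measurable_fun `[0, T]%classic f ->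
  (forall t : R, (0 <= t <= T)%R -> 0 <= f t)%E ->
  (\int[stieltjes T (b \+ va)%R]_(t in `[0%R, T]) f t =
   \int[db]_(t in `[0%R, T]) f t + \int[dva]_(t in `[0%R, T]) f t)%E.
Proof.
move=> mf f0; have mI : measurable (`[0, T]%classic : set (measurableTypeR R)).
  exact: measurable_itv.
rewrite (eq_measure_integral (measure_add db dva)).
  by apply: ge0_integral_measure_add => // t; rewrite /= in_itv/= => /f0.
move=> A mA _; rewrite -[RHS]/(measure_add db dva A) measure_addE; apply: stieltjesD => //.
- exact: b_cumulative.
- exact: va_cumulative.
Qed.
Lemma variation_le_primitive (g H : R -> R) p s :
  (forall s t, 0 <= s -> s <= t -> t <= T -> `|g t - g s| <= H t - H s) ->
  path <%R p s -> 0 <= p -> last p s <= T ->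
  \sum_(I <- cells p s) `|g I.2 - g I.1| <= H (last p s) - H p.
Proof.
move=> gH; elim: s p => [|x s IH] p /=; first by rewrite big_nil subrr.
move=> /andP[px xs] p0 sT; rewrite big_cons /=.
have /andP[xl lT] : x <= last x s <= T.
  rewrite sT andbT; elim: s x xs {IH px sT} => //= y s IH x /andP[xy ys].
  by rewrite (le_trans (ltW xy))// IH.
have := IH x xs (le_trans p0 (ltW px)) sT.
have := gH p x p0 (ltW px) (le_trans xl lT); lra.
Qed.

(** With [h] the density of [a] for Lebesgue measure and [w = b'], the function
    [z = h / w] is the density of [a] with respect to db. It is square integrable for db
    and d|a| because [h = a'] outside a set that is null for both and [w] is bounded
    below. Increments of |a| are at most those of the primitive of |h|, whence the
    domination of d|a| by |z| db, which allows to control integrals with respect to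
    d|a| by norms in L^2(db). *)
Lemma mean_density : exists z : R -> R, [/\ L2ab T a b z,
  forall t, `[0%R, T]%classic t -> a t = \int[db]_(s in `[0%R, t]) z s &
  forall f : R -> \bar R, measurable_fun `[0, T]%classic f ->
    (forall t : R, (0 <= t <= T)%R -> 0 <= f t)%E ->
    (\int[dva]_(t in `[0%R, T]) f t <= \int[db]_(t in `[0%R, T]) (f t * (`|z t|)%:E))%E].
Proof.
have [h [ih Hh hae]] := absolutely_continuous_FTC T0 mean_ac.
have [w mw [[c c0 wc] dbE]] := b_density.
have a0 : a 0 = 0 by case: ma.
have mI t : measurable (`[0, t]%classic : set (measurableTypeR R)).
  exact: measurable_itv.
have mh : measurable_fun (setT : set (measurableTypeR R)) h.
  by apply/measurable_EFinP; exact: measurable_int ih.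
have mhI D : measurable_fun (D : set (measurableTypeR R)) h.
  exact: measurable_funTS.
have w0 t : 0 <= t <= T -> 0 < w t by move=> /wc; exact: lt_le_trans.
have mwV : measurable_fun `[0, T]%classic (fun t => (w t)^-1).
  by apply: measurable_inv_pos => // t; rewrite /= in_itv/= => /w0.
pose z t := h t / w t.
have mz : measurable_fun `[0, T]%classic z.
  by apply: measurable_funM => //; exact: mhI.
have zw t : 0 <= t <= T -> z t * w t = h t.
  by move=> /w0 wt; rewrite /z divfK// gt_eqF.
have dbD (D : set R) : D `<=` `[0, T] -> measurable D -> forall f : R -> \bar R,
    measurable_fun D f -> (forall t, D t -> 0 <= f t)%E ->
    (\int[db]_(t in D) f t = \int[leb]_(t in D) (f t * (w t)%:E))%E.
  move=> DI mD f mf f0; apply: ge0_integral_density => //.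
  - by move=> t /DI; rewrite /= in_itv/= => /w0/ltW.
  - by apply: measurable_funS mw => //; exact: mI.
  - by move=> A mA AD; apply: dbE => //; exact: subset_trans DI.
pose Hn t := \int[leb]_(x in `[0, t]) `|h x|.
have ihn : leb.-integrable setT (EFin \o (fun x => `|h x|)).
  exact: integrable_norm ih.
have HnB s t : 0 <= s -> s <= t -> t <= T ->
    \int[leb]_(x in `]s, t]) `|h x| = Hn t - Hn s.
  move=> s0 st tT; rewrite /Hn (@Rintegral_itvB _ (fun x => `|h x|) (BLeft 0) (BRight t) s)//.
  exact: integrableS ihn.
have gH s t : 0 <= s -> s <= t -> t <= T -> `|a t - a s| <= Hn t - Hn s.
  move=> s0 st tT; rewrite -Hh// -HnB//; apply: le_normr_Rintegral => //.
  by apply: integrableS ih => //; exact: measurable_itv.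
have vH s t : 0 <= s -> s <= t -> t <= T -> va t - va s <= Hn t - Hn s.
  move=> s0 st tT; rewrite -lee_fin (tv_funB mean_ac)//.
  apply: ub_ereal_sup => _ [_ [l [sl /eqP ls] <-] <-].
  rewrite lee_fin -cells_variation -ls; apply: variation_le_primitive => //.
  by rewrite ls.
(* [V] is nondecreasing, and its measure is the gap between |h| dt and d|a|. *)
pose V := Hn \- va.
have cHn : {within `[0, T], continuous Hn}.
  apply: (parameterized_integral_continuous (ltW T0)).
  exact: integrableS ihn.
have cV : clamp_cumulative T V.
  apply: clamp_cumulative_cts => //.
    move=> t; apply: cvgB; first exact: cHn.
    exact: (absolutely_continuous_cts (tv_fun_ac mean_ac)).
  by move=> s t s0 st tT; rewrite /V/= lerBlDr; have := vH _ _ s0 st tT; lra.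
have VvE (A : set R) : measurable A -> A `<=` `[0, T] ->
    (stieltjes T (V \+ va)%R A = \int[leb]_(x in A) (`|h x|)%:E)%E.
  apply: stieltjes_density_cc.
  - exact: lebesgue_measure_set1.
  - exact: clamp_cumulativeD cV va_cumulative.
  - by apply: measurableT_comp => //; exact: mhI.
  - by [].
  move=> s t s0 st tT; rewrite /V /= !subrK -HnB// /Rintegral fineK//.
  apply: integrable_fin_num; first exact: measurable_itv.
  by apply: integrableS ihn => //; exact: measurable_itv.
have D3 (f : R -> \bar R) : measurable_fun `[0, T]%classic f ->
    (forall t : R, (0 <= t <= T)%R -> 0 <= f t)%E ->
    (\int[dva]_(t in `[0%R, T]) f t <= \int[db]_(t in `[0%R, T]) (f t * (`|z t|)%:E))%E.
  move=> mf f0; have f0' t : `[0, T]%classic t -> (0 <= f t)%E.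
    by rewrite /= in_itv/= => /f0.
  apply: (@le_trans _ _ (\int[stieltjes T (V \+ va)%R]_(t in `[0%R, T]) f t)%E).
    rewrite [leRHS](eq_measure_integral (measure_add (stieltjes T V) dva)); last first.
      move=> A mA _; rewrite -[RHS]/(measure_add (stieltjes T V) dva A).
      rewrite measure_addE; apply: stieltjesD => //.
      exact: va_cumulative.
    by rewrite ge0_integral_measure_add// leeDr// integral_ge0.
  rewrite (ge0_integral_density (m := leb) (w := fun x => `|h x|))//; last first.
    by apply: measurableT_comp => //; exact: mhI.
  rewrite dbD//; last 2 first.
  - by apply: emeasurable_funM => //; apply/measurable_EFinP; exact: measurableT_comp.
  - by move=> t tI; rewrite mule_ge0// ?f0' ?lee_fin.
  rewrite le_eqVlt; apply/orP; left; apply/eqP.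
  apply: eq_integral => t; rewrite inE/= in_itv/= => tI.
  by rewrite -muleA -EFinM -(zw _ tI) normrM (gtr0_norm (w0 _ tI)).
exists z; split => //; last first.
  move=> t; rewrite /= in_itv/= => /andP[t0 tT].
  have sub : `[0, t]%classic `<=` (`[0, T]%classic : set R).
    by apply: subset_itvl; rewrite bnd_simp.
  have := Hh 0 t (lexx 0) t0 tT; rewrite a0 subr0 => <-.
  rewrite /Rintegral; congr fine.
  rewrite [RHS](integral_density (m := leb) (w := w))//; last 4 first.
  - by move=> s /sub; rewrite /= in_itv/= => /w0/ltW.
  - by apply: measurable_funS mw => //; exact: mI.
  - by move=> A mA AD; apply: dbE => //; exact: subset_trans sub.
  - by apply: measurable_funS mz => //; exact: mI.
  rewrite integral_itv_obnd_cbnd; last by apply/measurable_EFinP; exact: mhI.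
  by apply: eq_integral => s /[!inE] /sub; rewrite /= in_itv/= => /zw ->.
have [N [mN N0 Nsub]] := hae.
(* Outside [E] the derivative of [a] is [h]; at the endpoints it need not exist. *)
pose E : set R := `[0, T]%classic `\` (`]0, T[%classic `\` N).
have mI' : measurable (`]0, T[%classic : set (measurableTypeR R)).
  exact: measurable_itv.
have mD' : measurable (`]0, T[%classic `\` N : set (measurableTypeR R)).
  exact: measurableD.
have mE : measurable (E : set (measurableTypeR R)) by exact: measurableD.
have lE : leb E = 0%E.
  apply/eqP; rewrite -measure_le0.
  apply: (@le_trans _ _ (leb ([set 0] `|` [set T] `|` N))).
    apply: le_measureR => //.
      by apply: measurableU => //; exact: measurableU.
    move=> t [] /=; rewrite !in_itv/= => /andP[t0 tT] nD.
    have [Nt|nN] := pselect (N t); first by right.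
    left; have [->|tn0] := eqVneq t 0; first by left.
    right; apply/eqP/negPn/negP => tnT; apply: nD; split => //.
    by rewrite !lt_neqAle eq_sym tn0 t0 tnT.
  apply: (le_trans (measureU_le _ _ _)) => //; first exact: measurableU.
  rewrite [X in (_ + X)%E]N0 adde0; apply: (le_trans (measureU_le _ _ _)) => //.
  rewrite [X in (X + _)%E]lebesgue_measure_set1 add0e.
  by rewrite [leLHS]lebesgue_measure_set1.
have sqh (m : {measure set (measurableTypeR R) -> \bar R}) : m E = 0%E ->
    (\int[m]_(t in `[0%R, T]) (`|derive1 a t| ^+ 2)%:E < +oo)%E ->
    (\int[m]_(t in `[0%R, T]) (h t ^+ 2)%:E < +oo)%E.
  move=> mE0; apply: le_lt_trans.
  have IE : `[0, T]%classic = (`]0, T[%classic `\` N) `|` E :> set R.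
    rewrite /E setDUK// => t [] /=; rewrite !in_itv/= => /andP[/ltW -> /ltW ->].
    by [].
  have mh2 (D : set (measurableTypeR R)) : measurable_fun D (fun t => (h t ^+ 2)%:E).
    by apply/measurable_EFinP; apply: measurable_funX; exact: mhI.
  rewrite [X in (\int[m]_(t in X) (h t ^+ 2)%:E <= _)%E]IE.
  rewrite (@ge0_integral_setU _ (measurableTypeR R))//; last 2 first.
  - by move=> t _; rewrite lee_fin sqr_ge0.
  - by apply/disj_setPS => t [? []].
  rewrite [X in (_ + X <= _)%E]null_set_integral ?adde0//.
  apply: ge0_le_integral_nonmeasurable.
  - by rewrite IE; exact: subsetUl.
  - by move=> t _; rewrite lee_fin sqr_ge0.
  - by move=> t _; rewrite lee_fin sqr_ge0.
  move=> t [/=]; rewrite in_itv/= => tI nNt; rewrite lee_fin.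
  have [->|hn] := eqVneq (derive1 a t) (h t); first by rewrite real_normK ?num_real.
  by exfalso; apply: nNt; apply: Nsub => /= H; move/eqP: hn; apply; apply: H.
have [_ _ la da] := ma.
have vE : dva E = 0%E.
  have dom := stieltjes_ac_dominates T0 va_cumulative (tv_fun_ac mean_ac).
  by move/null_content_dominatesP : dom; apply.
have h1 := sqh _ lE la; have h2 := sqh _ vE da.
have mz2 k : measurable_fun `[0, T]%classic (fun t => (k * z t ^+ 2)%:E).
  apply/measurable_EFinP; apply: measurable_funM => //.
  exact: measurable_funX.
have mz2' : measurable_fun `[0, T]%classic (fun t => (z t ^+ 2)%:E).
  by apply/measurable_EFinP; exact: measurable_funX.
have mh2 k : measurable_fun `[0, T]%classic (fun t => (k * h t ^+ 2)%:E).
  apply/measurable_EFinP; apply: measurable_funM => //.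
  by apply: measurable_funX; exact: mhI.
have mh2' : measurable_fun `[0, T]%classic (fun t => (h t ^+ 2)%:E).
  by apply/measurable_EFinP; apply: measurable_funX; exact: mhI.
split; [exact: mz| |]; rewrite /sq_integrable.
- rewrite dbD//; last by move=> t _; rewrite lee_fin sqr_ge0.
  apply: (@le_lt_trans _ _ (\int[leb]_(t in `[0%R, T]) (c^-1 * h t ^+ 2)%:E)%E).
    apply: ge0_le_integral_nonmeasurable => //.
    + move=> t; rewrite /= in_itv/= => tI.
      by rewrite mule_ge0// lee_fin ?sqr_ge0// ltW// w0.
    + by move=> t _; rewrite lee_fin mulr_ge0 ?sqr_ge0// invr_ge0 ltW.
    move=> t; rewrite /= in_itv/= => tI; rewrite -EFinM lee_fin.
    rewrite expr2 -mulrA zw// /z mulrAC -expr2 mulrC ler_wpM2r ?sqr_ge0//.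
    by rewrite lef_pV2 ?posrE ?wc ?w0.
  under eq_integral do rewrite EFinM.
  rewrite ge0_integralZl_EFin//; [|by move=> t _; rewrite lee_fin sqr_ge0|
    by rewrite invr_ge0 ltW].
  by apply: lte_mul_pinfty => //; rewrite ?lee_fin ?invr_ge0 ltW.
- apply: (@le_lt_trans _ _ (\int[dva]_(t in `[0%R, T]) ((c^-1)^+2 * h t ^+ 2)%:E)%E).
    apply: ge0_le_integral_nonmeasurable => //.
    + by move=> t _; rewrite lee_fin sqr_ge0.
    + by move=> t _; rewrite lee_fin mulr_ge0 ?sqr_ge0.
    move=> t; rewrite /= in_itv/= => tI; rewrite lee_fin /z exprMn mulrC.
    rewrite ler_wpM2r ?sqr_ge0// lerXn2r ?nnegrE ?invr_ge0 ?(ltW c0) ?(ltW (w0 _ tI))//.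
    by rewrite lef_pV2 ?posrE ?wc ?w0.
  under eq_integral do rewrite EFinM.
  rewrite ge0_integralZl_EFin//; [|by move=> t _; rewrite lee_fin sqr_ge0|
    by rewrite sqr_ge0].
  by apply: lte_mul_pinfty => //; rewrite lee_fin sqr_ge0.
Qed.
End mean_and_variance.

(** * Square integrable functions and orthonormal expansions *)

Section L2_theory.
Context d (X : measurableType d) (R : realType).
Variables (m : {measure set X -> \bar R}) (D : set X).
Hypothesis mD : measurable D.
Implicit Types f g h u v : X -> R.

Definition L2 f := measurable_fun D f /\ (\int[m]_(x in D) (f x ^+ 2)%:E < +oo)%E.

Definition ip f g := \int[m]_(x in D) (f x * g x).

Lemma L2_measurable_sq f : measurable_fun D f ->
  measurable_fun D (fun x => (f x ^+ 2)%:E).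
Proof. by move=> mf; apply/measurable_EFinP; exact: measurable_funX. Qed.

Lemma L2_mul f g : L2 f -> L2 g -> m.-integrable D (fun x => (f x * g x)%:E).
Proof.
move=> [mf f2] [mg g2]; apply/integrableP; split.
  by apply/measurable_EFinP; exact: measurable_funM.
apply: (@le_lt_trans _ _ (\int[m]_(x in D) ((f x ^+ 2)%:E + (g x ^+ 2)%:E))%E).
  apply: ge0_le_integral => //.
  - by apply: measurableT_comp => //; apply/measurable_EFinP; exact: measurable_funM.
  - by apply: emeasurable_funD; exact: L2_measurable_sq.
  move=> x Dx; rewrite -EFinD lee_fin normrM -(real_normK (num_real (f x))).
  rewrite -(real_normK (num_real (g x))) -subr_ge0.
  set p := `|f x|; set q := `|g x|.
  have p0 : 0 <= p := normr_ge0 _; have q0 : 0 <= q := normr_ge0 _.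
  have : 0 <= (p - q) ^+ 2 := sqr_ge0 _; have := mulr_ge0 p0 q0; nra.
rewrite ge0_integralD//; [exact: lte_add_pinfty|by move=> x _; rewrite lee_fin sqr_ge0|
  exact: L2_measurable_sq|by move=> x _; rewrite lee_fin sqr_ge0|exact: L2_measurable_sq].
Qed.

Lemma ip_ge0 f : 0 <= ip f f.
Proof. by apply: Rintegral_ge0 => x _; rewrite -expr2 sqr_ge0. Qed.

Lemma ipE f : L2 f -> (\int[m]_(x in D) (f x ^+ 2)%:E = (ip f f)%:E)%E.
Proof.
move=> [mf f2]; rewrite /ip /Rintegral fineK//.
by rewrite ge0_fin_numE// integral_ge0// => x _; rewrite lee_fin sqr_ge0.
Qed.

Lemma ipC f g : ip f g = ip g f.
Proof. by apply: eq_Rintegral => x _; rewrite mulrC. Qed.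

Lemma L2_lin (c : R) f g : L2 f -> L2 g -> L2 (fun x => c * f x + g x).
Proof.
move=> Lf Lg; have [mf f2] := Lf; have [mg g2] := Lg.
have mfg : measurable_fun D (fun x => c * f x + g x).
  by apply: measurable_funD => //; exact: measurable_funM.
split => //; apply: (@le_lt_trans _ _ (\int[m]_(x in D)
    ((2 * c ^+ 2)%:E * (f x ^+ 2)%:E + 2%:E * (g x ^+ 2)%:E))%E).
  apply: ge0_le_integral => //.
  - by move=> x _; rewrite lee_fin sqr_ge0.
  - exact: L2_measurable_sq.
  - by apply: emeasurable_funD; apply: measurable_funeM; exact: L2_measurable_sq.
  move=> x Dx; rewrite -!EFinM -EFinD lee_fin.
  have : 0 <= (c * f x - g x) ^+ 2 := sqr_ge0 _; nra.
have c0 : 0 <= 2 * c ^+ 2 by rewrite mulr_ge0 ?sqr_ge0.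
rewrite ge0_integralD//; last 4 first.
- by move=> x _; rewrite mule_ge0// lee_fin ?sqr_ge0.
- by apply: measurable_funeM; exact: L2_measurable_sq.
- by move=> x _; rewrite mule_ge0// lee_fin ?sqr_ge0.
- by apply: measurable_funeM; exact: L2_measurable_sq.
rewrite !ge0_integralZl_EFin//; [|by move=> x _; rewrite lee_fin sqr_ge0|
  exact: L2_measurable_sq|by move=> x _; rewrite lee_fin sqr_ge0|exact: L2_measurable_sq].
by apply: lte_add_pinfty; apply: lte_mul_pinfty => //; rewrite lee_fin.
Qed.

Lemma L2_0 : L2 (cst 0).
Proof.
by split => //; rewrite integral0_eq ?ltry// => x _; rewrite /= expr0n.
Qed.

Lemma L2B f g : L2 f -> L2 g -> L2 (fun x => f x - g x).
Proof.
move=> Lf Lg; have := L2_lin (-1) Lg Lf.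
by under eq_fun do rewrite mulN1r addrC.
Qed.

Lemma L2_sum n (c : nat -> R) (phi : nat -> X -> R) : (forall j, L2 (phi j)) ->
  L2 (fun x => \sum_(j < n) c j * phi j x).
Proof.
move=> Lphi; elim: n => [|n IH].
  by under eq_fun do rewrite big_ord0; exact: L2_0.
under eq_fun do rewrite big_ord_recr/= addrC.
exact: L2_lin.
Qed.

Lemma ip_lin (c : R) f g h : L2 f -> L2 g -> L2 h ->
  ip (fun x => c * f x + g x) h = c * ip f h + ip g h.
Proof.
move=> Lf Lg Lh; rewrite /ip.
have i1 := L2_mul Lf Lh; have i2 := L2_mul Lg Lh.
under eq_Rintegral do rewrite mulrDl -mulrA.
rewrite RintegralD//; first by rewrite RintegralZl.
by have := integrableZl mD c i1.
Qed.

Lemma ipB f g h : L2 f -> L2 g -> L2 h ->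
  ip (fun x => f x - g x) h = ip f h - ip g h.
Proof.
move=> Lf Lg Lh; have := ip_lin (-1) Lg Lf Lh.
under eq_fun do rewrite mulN1r addrC.
by move=> ->; rewrite mulN1r addrC.
Qed.

Lemma ip_sum n (c : nat -> R) (phi : nat -> X -> R) h : (forall j, L2 (phi j)) ->
  L2 h -> ip (fun x => \sum_(j < n) c j * phi j x) h = \sum_(j < n) c j * ip (phi j) h.
Proof.
move=> Lphi Lh; elim: n => [|n IH].
  rewrite big_ord0 /ip; under eq_Rintegral do rewrite big_ord0 mul0r.
  by rewrite Rintegral_cst// mul0r.
under eq_fun do rewrite big_ord_recr/= addrC.
by rewrite ip_lin//; [rewrite IH big_ord_recr/= addrC|exact: L2_sum].
Qed.

Lemma Cauchy_Schwarz f g : L2 f -> L2 g -> ip f g ^+ 2 <= ip f f * ip g g.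
Proof.
move=> Lf Lg.
have H t : 0 <= t ^+ 2 * ip f f + 2 * t * ip f g + ip g g.
  have Lt := L2_lin t Lf Lg.
  have := ip_ge0 (fun x => t * f x + g x).
  rewrite ip_lin// (ipC f) (ipC g) !ip_lin// (ipC g f); lra.
have [f0|f0] := eqVneq (ip f f) 0.
  rewrite f0 mul0r; have [->|fg] := eqVneq (ip f g) 0; first by rewrite expr0n.
  have := H (- (ip g g + 1) / (2 * ip f g)).
  rewrite f0 mulr0 add0r.
  have -> : 2 * (- (ip g g + 1) / (2 * ip f g)) * ip f g = - (ip g g + 1).
    by field.
  lra.
have fp : 0 < ip f f by rewrite lt_neqAle eq_sym f0 ip_ge0.
have := H (- ip f g / ip f f).
have -> : (- ip f g / ip f f) ^+ 2 * ip f f + 2 * (- ip f g / ip f f) * ip f g +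
    ip g g = ip g g - ip f g ^+ 2 / ip f f by field.
by rewrite subr_ge0 ler_pdivrMr// mulrC.
Qed.

Lemma Cauchy_Schwarz_sqrt f g : L2 f -> L2 g ->
  `|ip f g| <= Num.sqrt (ip f f) * Num.sqrt (ip g g).
Proof.
move=> Lf Lg; rewrite -sqrtrM ?ip_ge0// -(sqrtr_sqr (ip f g)).
by rewrite ler_wsqrtr// Cauchy_Schwarz.
Qed.

Lemma ip_lin2 (t : R) f g : L2 f -> L2 g ->
  ip (fun x => t * f x + g x) (fun x => t * f x + g x) =
  t ^+ 2 * ip f f + 2 * t * ip f g + ip g g.
Proof.
move=> Lf Lg; have Lt := L2_lin t Lf Lg.
by rewrite ip_lin// (ipC f) (ipC g) !ip_lin// (ipC g f); ring.
Qed.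

Lemma ip_sub_le f g : L2 f -> L2 g ->
  ip (fun x => f x - g x) (fun x => f x - g x) <= 2 * ip f f + 2 * ip g g.
Proof.
move=> Lf Lg; have := ip_ge0 (fun x => 1 * g x + f x); rewrite ip_lin2//.
have := ip_lin2 (-1) Lg Lf; under eq_fun do rewrite mulN1r addrC; move=> ->; lra.
Qed.

Lemma fatou_le (g_ : nat -> X -> \bar R) (g : X -> \bar R) (C : \bar R) :
  (forall k, measurable_fun D (g_ k)) -> (forall k x, D x -> 0 <= g_ k x)%E ->
  measurable_fun D g -> (forall x, D x -> 0 <= g x)%E ->
  {ae m, forall x, D x -> g_ k x @[k --> \oo] --> g x} ->
  (\forall k \near \oo, \int[m]_(x in D) g_ k x <= C)%E ->
  (\int[m]_(x in D) g x <= C)%E.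
Proof.
move=> mg_ g_0 mg g0 [Z [mZ Z0 HZ]] gC.
have mDZ : measurable (D `\` Z) by exact: measurableD.
rewrite (ge0_negligible_integral _ _ _ _ Z0)//.
apply: (@le_trans _ _ (\int[m]_(x in D `\` Z) limn_einf (g_ ^~ x))%E).
  rewrite le_eqVlt; apply/orP; left; apply/eqP; apply: eq_integral => x /[!inE] -[Dx nZ].
  have c : g_ k x @[k --> \oo] --> g x.
    by apply: contrapT => h; apply: nZ; apply: HZ => /= /(_ Dx).
  by rewrite is_cvg_limn_einfE; [apply/esym/cvg_lim|apply/cvg_ex; exists (g x)].
apply: (le_trans (fatou _ _ _ _)) => //.
- by move=> k; apply: measurable_funS (mg_ k) => //; exact: subDsetl.
- by move=> k x [Dx _]; exact: g_0.
rewrite limn_einf_lim; apply: lime_le; first exact: is_cvg_einfs.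
near=> k; apply: (@le_trans _ _ (\int[m]_(x in D `\` Z) g_ k x)%E).
  by apply: ereal_inf_lbound; exists k => /=.
apply: (@le_trans _ _ (\int[m]_(x in D) g_ k x)%E); last by near: k.
apply: ge0_subset_integral => //; exact: g_0.
Unshelve. all: by end_near. Qed.

(** Riesz and Fischer: the squares of the increments of a fast subsequence,
    weighted by powers of [4], have an integrable sum, so that this subsequence
    converges geometrically fast almost everywhere. *)
Lemma L2_complete (f : nat -> X -> R) : (forall n, L2 (f n)) ->
  (forall e : R, 0 < e -> exists N, forall n k, (N <= n)%N -> (N <= k)%N ->
     ip (fun x => f n x - f k x) (fun x => f n x - f k x) <= e) ->
  exists2 u, L2 u & forall e : R, 0 < e -> exists N, forall n, (N <= n)%N ->
     ip (fun x => f n x - u x) (fun x => f n x - u x) <= e.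
Proof.
move=> Lf cauchy.
have LfB n k : L2 (fun x => f n x - f k x) by exact: L2B.
have /choice[N NP] : forall k : nat, exists N, forall n i, (N <= n)%N -> (N <= i)%N ->
    ip (fun x => f n x - f i x) (fun x => f n x - f i x) <= (8^-1) ^+ k.+1.
  by move=> k; apply: cauchy; rewrite exprn_gt0.
pose nk k := (\sum_(i < k.+1) N i + k)%N.
have nkN k : (N k <= nk k)%N.
  by rewrite /nk big_ord_recr/= -addnA addnCA leq_addr.
have nkS k : (N k <= nk k.+1)%N.
  by rewrite /nk big_ord_recr/= big_ord_recr/= -!addnA addnCA leq_addr.
have nk_ge k : (k <= nk k)%N by rewrite leq_addl.
pose D_ k x := f (nk k.+1) x - f (nk k) x.
pose g x := (\sum_(k <oo) (4 ^+ k * D_ k x ^+ 2)%:E)%E.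
have mDk k : measurable_fun D (fun x => (4 ^+ k * D_ k x ^+ 2)%:E).
  apply/measurable_EFinP; apply: measurable_funM => //; apply: measurable_funX.
  by have [] := LfB (nk k.+1) (nk k).
have Dk0 k x : (0 <= (4 ^+ k * D_ k x ^+ 2)%:E)%E.
  by rewrite lee_fin mulr_ge0 ?sqr_ge0 ?exprn_ge0.
have intg : m.-integrable D g.
  apply/integrableP; split; first exact: ge0_emeasurable_sum.
  under eq_integral do rewrite gee0_abs ?nneseries_ge0//.
  rewrite integral_nneseries//.
  apply: (@le_lt_trans _ _ (\sum_(k <oo) (1 / (2 ^ (k + 1))%:R)%:E)%E).
    apply: lee_nneseries => [k _ _|k _]; first exact: integral_ge0.
    under eq_integral do rewrite EFinM.
    rewrite ge0_integralZl_EFin ?exprn_ge0//; last 2 first.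
    + by move=> x _; rewrite lee_fin sqr_ge0.
    + by apply: L2_measurable_sq; have [] := LfB (nk k.+1) (nk k).
    rewrite (ipE (LfB _ _)) -EFinM lee_fin.
    rewrite (@le_trans _ _ (4 ^+ k * 8^-1 ^+ k.+1))//.
      by rewrite ler_wpM2l ?exprn_ge0// NP.
    rewrite addn1 natrX div1r -exprVn.
    have -> : 2^-1 ^+ k.+1 = 4 ^+ k.+1 * 8^-1 ^+ k.+1 :> R.
      by rewrite -exprMn; congr (_ ^+ _); lra.
    rewrite ler_wpM2r ?exprn_ge0// ler_weXn2l// ler1n.
    by [].
  have /cvg_lim -> // := @cvg_geometric_eseries_half R 1 0.
  by rewrite ltry.
have [Z [mZ Z0 HZ]] := integrable_ae mD intg.
have cvgx x : D x -> ~ Z x -> cvgn (fun k => f (nk k) x).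
  move=> Dx nZ; have gfin : g x \is a fin_num.
    by apply: contrapT => h; apply: nZ; apply: HZ => /= /(_ Dx).
  pose G := fine (g x).
  have G0 : 0 <= G by rewrite fine_ge0// nneseries_ge0.
  have DG k : `|D_ k x| <= Num.sqrt G * 2^-1 ^+ k.
    rewrite -ler_pdivrMr ?exprn_gt0//.
    rewrite -[leLHS]ger0_norm ?divr_ge0// -[leLHS]sqrtr_sqr ler_wsqrtr//.
    rewrite exprMn real_normK ?num_real// -exprVn invrK -exprM mulnC exprM mulrC.
    have -> : 2 ^+ 2 = 4 :> R by rewrite expr2; lra.
    rewrite -lee_fin /G fineK//.
    apply: le_trans (nneseries_lim_ge k.+1 _); last by [].
    by rewrite big_nat_recr//= leeDr// sume_ge0.
  have -> : (fun k => f (nk k) x) = series (fun k => D_ k x) + cst (f (nk 0) x).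
    apply/funext => k; rewrite fctE /series/=.
    by rewrite telescope_sumr// subrK.
  apply: is_cvgD; last exact: is_cvg_cst.
  apply: normed_cvg.
  apply: (@series_le_cvg _ _ (fun k => Num.sqrt G * 2^-1 ^+ k)) => //.
  - by move=> k; exact: normr_ge0.
  - by apply: is_cvg_geometric_series; rewrite ger0_norm// invf_lt1// ltr1n.
pose h k x := f (nk k) x * \1_(~` Z) x.
pose u x := limn (h ^~ x).
have hE k x : ~ Z x -> h k x = f (nk k) x.
  by move=> nZ; rewrite /h indicE mem_set// mulr1.
have hu x : D x -> h k x @[k --> \oo] --> u x.
  move=> Dx; apply/cvg_ex; have [Zx|nZ] := pselect (Z x).
    exists 0; rewrite (_ : h ^~ x = cst 0); first exact: cvg_cst.
    by apply/funext => k; rewrite /h indicE memNset ?mulr0//=; exact.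
  have /cvg_ex[l fl] := cvgx x Dx nZ; exists l.
  by rewrite (_ : h ^~ x = (fun k => f (nk k) x))//; apply/funext => k; exact: hE.
have mu_ : measurable_fun D u.
  apply: (measurable_fun_cvg (h := h)) => // k.
  apply: measurable_funM; first by have [] := Lf (nk k).
  exact/measurable_indic/measurableC.
have ux x : D x -> ~ Z x -> f (nk k) x @[k --> \oo] --> u x.
  move=> Dx nZ; have := hu x Dx.
  by rewrite (_ : h ^~ x = (fun k => f (nk k) x))//; apply/funext => k; exact: hE.
have key e : 0 < e -> exists N, forall n, (N <= n)%N ->
    (\int[m]_(x in D) ((f n x - u x) ^+ 2)%:E <= e%:E)%E.
  move=> e0; have [M HM] := cauchy e e0; exists M => n Mn.
  apply: (@fatou_le (fun k x => ((f n x - f (nk k) x) ^+ 2)%:E)).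
  - by move=> k; apply: L2_measurable_sq; have [] := LfB n (nk k).
  - by move=> k x _; rewrite lee_fin sqr_ge0.
  - by apply: L2_measurable_sq; apply: measurable_funB => //; have [] := Lf n.
  - by move=> x _; rewrite lee_fin sqr_ge0.
  - exists Z; split => // x /= /not_implyP[Dx H]; apply: contrapT => nZ; apply: H.
    apply: cvg_EFin; first exact: nearW.
    have c : f n x - f (nk k) x @[k --> \oo] --> f n x - u x.
      by apply: cvgB; [exact: cvg_cst|exact: ux].
    by have := cvgM c c; rewrite -expr2; apply.
  near=> k; rewrite (ipE (LfB _ _)) lee_fin HM//.
  by rewrite (leq_trans _ (nk_ge k))//; near: k; exists M.
exists u.
  have [M HM] := key 1 ltr01.
  have Lu : L2 (fun x => f M x - u x).
    split; last by rewrite (le_lt_trans (HM M _))// ltry.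
    by apply: measurable_funB => //; have [] := Lf M.
  have := L2B (Lf M) Lu.
  by under eq_fun do rewrite opprB addrC subrK.
move=> e /key[M HM]; exists M => n /HM.
rewrite -lee_fin /ip /Rintegral => nle; rewrite fineK//.
rewrite ge0_fin_numE; last by apply: integral_ge0 => x _; rewrite lee_fin -expr2 sqr_ge0.
exact: le_lt_trans nle (ltry _).
Unshelve. all: by end_near. Qed.

Section orthonormal_expansion.
Variable phi : nat -> X -> R.
Hypothesis Lphi : forall j, L2 (phi j).
Hypothesis phiO : forall i j, ip (phi i) (phi j) = (i == j)%:R.
Variable v : X -> R.
Hypothesis Lv : L2 v.

Let c j := ip v (phi j).
Let s n x := \sum_(j < n) c j * phi j x.

Lemma ip_expansion n j : ip (s n) (phi j) = if (j < n)%N then c j else 0.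
Proof.
rewrite ip_sum//; case: ifPn => [jn|]; last first.
  rewrite -leqNgt => nj; rewrite big1// => i _.
  by rewrite phiO ltn_eqF ?mulr0// (leq_trans _ nj).
rewrite (bigD1 (Ordinal jn))//= phiO eqxx mulr1 big1 ?addr0// => i ij.
by rewrite phiO; case: eqP => [e|]; rewrite ?mulr0//; case/eqP: ij; exact/val_inj.
Qed.

Lemma ip_expansionB n k : (k <= n)%N ->
  ip (fun x => s n x - s k x) (fun x => s n x - s k x) = \sum_(k <= j < n) c j ^+ 2.
Proof.
move=> kn; have Ls i : L2 (s i) by exact: L2_sum.
rewrite ipB//; last exact: L2B.
have ipsB i : ip (s i) (fun x => s n x - s k x) =
    \sum_(j < i) c j * (c j - if (j < k)%N then c j else 0) \/ (n < i)%N.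
  have [|ni] := ltnP n i; [by right|left].
  rewrite {1}/s ip_sum//; last exact: L2B.
  apply: eq_bigr => j _; congr (_ * _).
  rewrite ipC ipB// !ip_expansion ifT//.
  exact: leq_trans ni.
have [->|] := ipsB n; last by rewrite ltnn.
have [->|] := ipsB k; last by rewrite ltnNge kn.
rewrite [X in _ - X]big1 ?subr0; last by move=> j _; rewrite ltn_ord subrr mulr0.
rewrite -(big_mkord xpredT (fun j => c j * (c j - if (j < k)%N then c j else 0))).
rewrite (big_cat_nat (leq0n k) kn)//= big_nat_cond big1 ?add0r; last first.
  by move=> j /andP[/andP[_ ->] _]; rewrite subrr mulr0.
by apply: eq_big_nat => j /andP[kj _]; rewrite ltnNge kj/= subr0 expr2.
Qed.

(** The inner product of [v - s n] with itself is nonnegative. *)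
Lemma Bessel n : \sum_(0 <= j < n) c j ^+ 2 <= ip v v.
Proof.
have Ls i : L2 (s i) by exact: L2_sum.
have := ip_ge0 (fun x => v x - s n x).
rewrite ipB//; last exact: L2B.
rewrite (ipC v (fun x => v x - s n x)) ipB// (ipC (s n) (fun x => v x - s n x)) ipB// (ipC (s n) v).
have e1 : ip v (s n) = \sum_(0 <= j < n) c j ^+ 2.
  rewrite ipC ip_sum// big_mkord; apply: eq_bigr => j _.
  by rewrite ipC expr2.
have e2 : ip (s n) (s n) = \sum_(0 <= j < n) c j ^+ 2.
  rewrite {1}/s ip_sum// big_mkord; apply: eq_bigr => j _.
  by rewrite ipC ip_expansion ltn_ord expr2.
by rewrite e1 e2; lra.
Qed.

Lemma expansion_cauchy (e : R) : 0 < e -> exists N, forall n k, (N <= k)%N ->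
  (k <= n)%N -> \sum_(k <= j < n) c j ^+ 2 <= e.
Proof.
move=> e0.
have nd : nondecreasing_seq (fun n => \sum_(0 <= j < n) c j ^+ 2).
  apply/nondecreasing_seqP => n; rewrite big_nat_recr//= lerDl sqr_ge0//.
have cv : cvgn (fun n => \sum_(0 <= j < n) c j ^+ 2).
  apply: nondecreasing_is_cvgn => //; exists (ip v v) => _ [n _ <-].
  exact: Bessel.
have /cvgrPdist_le/(_ e e0)[N _ HN] := cv; exists N => n k Nk kn.
have := HN k Nk => /=.
set l := limn _ => h.
have ln : \sum_(0 <= j < n) c j ^+ 2 <= l.
  exact: nondecreasing_cvgn_le.
have := ler_norm (l - \sum_(0 <= j < k) c j ^+ 2).
rewrite [X in X <= l](big_cat_nat (leq0n k) kn)//= in ln; lra.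
Qed.

(** The expansion converges by completeness of the space; its limit has the same
    coefficients as [v], and the orthonormal system is complete. *)
Lemma expansion_cvg :
  (forall w, L2 w -> (forall j, ip w (phi j) = 0) -> ip w w = 0) ->
  forall e : R, 0 < e -> exists N, forall n, (N <= n)%N ->
     ip (fun x => v x - s n x) (fun x => v x - s n x) <= e.
Proof.
move=> complete e e0.
have Ls i : L2 (s i) by exact: L2_sum.
have sym f g : ip (fun x => f x - g x) (fun x => f x - g x) =
    ip (fun x => g x - f x) (fun x => g x - f x).
  by apply: eq_Rintegral => x _; ring.
have [|u Lu Hu] := L2_complete Ls.
  move=> d1 d10; have [N HN] := expansion_cauchy d10; exists N => n k Nn Nk.
  have [kn|/ltnW nk] := leqP k n; first by rewrite ip_expansionB// HN.
  by rewrite sym ip_expansionB// HN.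
have Lw : L2 (fun x => v x - u x) by exact: L2B.
have w0 : ip (fun x => v x - u x) (fun x => v x - u x) = 0.
  apply: complete => // j; apply/eqP; rewrite -sqrf_eq0 eq_le sqr_ge0 andbT.
  apply/ler_addgt0Pl => d1 d10; rewrite addr0.
  have [N HN] := Hu d1 d10; pose n := (N + j.+1)%N.
  have Nn : (N <= n)%N by rewrite leq_addr.
  have jn : (j < n)%N by rewrite leq_addl.
  have -> : ip (fun x => v x - u x) (phi j) = ip (fun x => s n x - u x) (phi j).
    by rewrite !ipB// ip_expansion jn.
  apply: le_trans (Cauchy_Schwarz _ (Lphi j)) _; first exact: L2B.
  by rewrite phiO eqxx mulr1 HN.
have e4 : 0 < e / 4 by rewrite divr_gt0.
have [N HN] := Hu _ e4; exists N => n Nn.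
have LB : L2 (fun x => s n x - u x) by exact: L2B.
have := Cauchy_Schwarz Lw LB; rewrite w0 mul0r => h.
have {}h : ip (fun x => v x - u x) (fun x => s n x - u x) = 0.
  by apply/eqP; rewrite -sqrf_eq0 eq_le h sqr_ge0.
have -> : (fun x => v x - s n x) = (fun x => (v x - u x) - (s n x - u x)).
  by apply/funext => x; ring.
rewrite ipB//; last exact: L2B.
rewrite ipC ipB// w0 (ipC (fun x => s n x - u x)) h.
rewrite (ipC (fun x => s n x - u x)) ipB// h.
have := HN n Nn; lra.
Qed.
End orthonormal_expansion.

End L2_theory.

(** * Riemann-Stieltjes integrals against continuous paths *)

Section riemann_stieltjes.
Context (R : realType) (T : R).
Hypothesis T0 : 0 < T.
Implicit Types v x g : R -> R.

Definition tagged_partition (d : R) (n : nat) (t c : nat -> R) :=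
  [/\ t 0%N = 0, t n = T & forall i, (i < n)%N ->
         [/\ t i <= c i, c i <= t i.+1 & t i.+1 - t i < d]].

Definition tagged_sum v x n (t c : nat -> R) :=
  \sum_(i < n) v (c i) * (x (t i.+1) - x (t i)).

Lemma partition_mono d n t c : tagged_partition d n t c ->
  forall i j, (i <= j)%N -> (j <= n)%N -> t i <= t j.
Proof.
move=> [_ _ H] i; elim=> [|j IH]; first by rewrite leqn0 => /eqP ->.
rewrite leq_eqVlt => /predU1P[->//|]; rewrite ltnS => ij jn.
rewrite (le_trans (IH ij (ltnW jn)))//.
by have [h1 h2 _] := H j jn; rewrite (le_trans h1).
Qed.

Lemma partition_bounds d n t c : tagged_partition d n t c ->
  (forall i, (i <= n)%N -> 0 <= t i <= T) /\
  (forall i, (i < n)%N -> 0 <= c i <= T).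
Proof.
move=> tp; have [t0 tn H] := tp; have mono := partition_mono tp.
have tI i : (i <= n)%N -> 0 <= t i <= T.
  by move=> ni; rewrite -{1}t0 -tn !mono.
split => // i ni; have [h1 h2 _] := H i ni.
have /andP[ti _] := tI i (ltnW ni); have /andP[_ ti1] := tI i.+1 ni.
by rewrite (le_trans ti h1) (le_trans h2 ti1).
Qed.

Lemma is_RSP v x I : is_RS_integral T v x I <->
  forall e : R, 0 < e -> exists2 d : R, 0 < d &
    forall n t c, tagged_partition d n t c -> `|tagged_sum v x n t c - I| < e.
Proof.
split=> H e e0; have [d d0 Hd] := H e e0; exists d => //.
  by move=> n t c [t00 tn tc]; exact: Hd.
by move=> n t c t00 tn tc; apply: Hd.
Qed.

Lemma is_RS_ext v v' x I : (forall t, 0 <= t <= T -> v t = v' t) ->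
  is_RS_integral T v x I -> is_RS_integral T v' x I.
Proof.
move=> vv' /is_RSP H; apply/is_RSP => e e0; have [d d0 Hd] := H e e0.
exists d => // n t c tp; rewrite (_ : tagged_sum v' x n t c = tagged_sum v x n t c).
  exact: Hd.
by apply: eq_bigr => i _; rewrite vv'//; have [_ ->] := partition_bounds tp.
Qed.

Lemma is_RS_linl (k : R) u v x I J : is_RS_integral T u x I ->
  is_RS_integral T v x J -> is_RS_integral T (fun t => k * u t + v t) x (k * I + J).
Proof.
move=> /is_RSP Hu /is_RSP Hv; apply/is_RSP => e e0.
have k0 : 0 < `|k| + 1 by rewrite ltr_wpDl.
have [d1 d10 H1] := Hu (e / 2 / (`|k| + 1)) (divr_gt0 (divr_gt0 e0 (ltr0n _ 2)) k0).
have [d2 d20 H2] := Hv (e / 2) (divr_gt0 e0 (ltr0n _ 2)).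
exists (Num.min d1 d2); first by rewrite lt_min d10.
move=> n t c [t00 tn tc].
have tp1 : tagged_partition d1 n t c.
  by split => // i /tc[h1 h2]; rewrite lt_min => /andP[].
have tp2 : tagged_partition d2 n t c.
  by split => // i /tc[h1 h2]; rewrite lt_min => /andP[].
have -> : tagged_sum (fun t => k * u t + v t) x n t c - (k * I + J) =
   k * (tagged_sum u x n t c - I) + (tagged_sum v x n t c - J).
  rewrite /tagged_sum mulrBr mulr_sumr addrACA -opprD -big_split/=.
  by congr (_ - _); apply: eq_bigr => i _; ring.
apply: (le_lt_trans (ler_normD _ _)); rewrite (splitr e) ltr_leD//; last first.
  exact/ltW/H2.
rewrite normrM (@le_lt_trans _ _ ((`|k| + 1) * `|tagged_sum u x n t c - I|))//.
  by rewrite ler_wpM2r// lerDl.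
by rewrite mulrC -ltr_pdivlMr// H1.
Qed.

Lemma is_RS_linr (k : R) v x y I J : is_RS_integral T v x I ->
  is_RS_integral T v y J -> is_RS_integral T v (fun t => k * x t + y t) (k * I + J).
Proof.
move=> /is_RSP Hu /is_RSP Hv; apply/is_RSP => e e0.
have k0 : 0 < `|k| + 1 by rewrite ltr_wpDl.
have [d1 d10 H1] := Hu (e / 2 / (`|k| + 1)) (divr_gt0 (divr_gt0 e0 (ltr0n _ 2)) k0).
have [d2 d20 H2] := Hv (e / 2) (divr_gt0 e0 (ltr0n _ 2)).
exists (Num.min d1 d2); first by rewrite lt_min d10.
move=> n t c [t00 tn tc].
have tp1 : tagged_partition d1 n t c.
  by split => // i /tc[h1 h2]; rewrite lt_min => /andP[].
have tp2 : tagged_partition d2 n t c.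
  by split => // i /tc[h1 h2]; rewrite lt_min => /andP[].
have -> : tagged_sum v (fun t => k * x t + y t) n t c - (k * I + J) =
   k * (tagged_sum v x n t c - I) + (tagged_sum v y n t c - J).
  rewrite /tagged_sum mulrBr mulr_sumr addrACA -opprD -big_split/=.
  by congr (_ - _); apply: eq_bigr => i _; ring.
apply: (le_lt_trans (ler_normD _ _)); rewrite (splitr e) ltr_leD//; last first.
  exact/ltW/H2.
rewrite normrM (@le_lt_trans _ _ ((`|k| + 1) * `|tagged_sum v x n t c - I|))//.
  by rewrite ler_wpM2r// lerDl.
by rewrite mulrC -ltr_pdivlMr// H1.
Qed.

(** The [i]-th point of the uniform partition of [0, T] into [N.+1] intervals, which
    are tagged at their right endpoints in [usum]. *)
Definition upt (N i : nat) : R := i%:R * (T / N.+1%:R).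

Definition usum (N : nat) v x := tagged_sum v x N.+1 (upt N) (upt N \o succn).

Lemma uptS N i : upt N i.+1 - upt N i = T / N.+1%:R.
Proof. by rewrite /upt -natr1; ring. Qed.

Lemma upt_ltS N i : upt N i < upt N i.+1.
Proof. by rewrite -subr_gt0 uptS divr_gt0. Qed.

Lemma upt0 N : upt N 0 = 0. Proof. by rewrite /upt mul0r. Qed.

Lemma uptT N : upt N N.+1 = T. Proof. by rewrite /upt mulrC divfK. Qed.

Lemma upt_mono N i j : (i <= j)%N -> upt N i <= upt N j.
Proof. by move=> ij; rewrite ler_wpM2r ?ler_nat// divr_ge0 ?ltW. Qed.

Lemma upt_itv N i : (i <= N.+1)%N -> 0 <= upt N i <= T.
Proof. by move=> iN; rewrite -{1}(upt0 N) -(uptT N) !upt_mono. Qed.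

Lemma upartition (d : R) : 0 < d -> \forall N \near \oo,
  tagged_partition d N.+1 (upt N) (upt N \o succn).
Proof.
move=> d0; exists (Num.trunc (T / d)) => // N /= hN; split.
- exact: upt0.
- exact: uptT.
move=> i _; split => //=; first exact/ltW/upt_ltS.
rewrite uptS ltr_pdivrMr// mulrC -ltr_pdivrMr//.
by rewrite (lt_le_trans (truncnS_gt _))// ler_nat.
Qed.

Lemma usum_cvg v x I : is_RS_integral T v x I -> usum N v x @[N --> \oo] --> I.
Proof.
move=> /is_RSP H; apply/cvgrPdist_lt => e e0; have [d d0 Hd] := H e e0.
have := upartition d0; apply: filterS => N /Hd.
by rewrite distrC.
Qed.

Lemma is_RS_unique v x I : is_RS_integral T v x I -> RS_integral T v x = I.
Proof.
move=> H; apply: (cvg_unique _ _ (usum_cvg H)) => //.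
by apply: usum_cvg; rewrite /RS_integral; case: xgetP => [J -> //|/(_ I)].
Qed.

(** ** Existence of the integral of a monotone function against a path *)

Definition monotone_on g := forall s t, 0 <= s -> s <= t -> t <= T -> g s <= g t.

(** A generalized inverse of the nondecreasing function [g]: the last time at which it
    is at most [u]. The alternative [t = 0] keeps the set nonempty. *)
Definition level (g : R -> R) (u : R) := sup [set t | 0 <= t <= T /\ (t = 0 \/ g t <= u)].

Lemma level_has_sup g u : has_sup [set t | 0 <= t <= T /\ (t = 0 \/ g t <= u)].
Proof.
split; first by exists 0; split; [rewrite lexx ltW|left].
by exists T => t [/andP[]].
Qed.

Lemma level_itv g u : 0 <= level g u <= T.
Proof.
apply/andP; split.
  apply: ub_le_sup; first by have [] := level_has_sup g u.
  by split; [rewrite lexx ltW|left].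
apply: sup_le_ub; first by have [] := level_has_sup g u.
by move=> t [/andP[]].
Qed.

Lemma level_ge g u c : 0 <= c <= T -> g c <= u -> c <= level g u.
Proof.
move=> cI cu; apply: ub_le_sup; first by have [] := level_has_sup g u.
by split => //; right.
Qed.

Lemma level_le g u c : monotone_on g -> 0 <= c <= T -> u < g c -> level g u <= c.
Proof.
move=> gm /andP[c0 cT] uc; apply: sup_le_ub; first by have [] := level_has_sup g u.
move=> t [/andP[t0 tT] [->//|gu]]; rewrite leNgt; apply/negP => ct.
by have := le_lt_trans (le_trans (gm c t c0 (ltW ct) tT) gu) uc; rewrite ltxx.
Qed.

Lemma level_mono g : {homo level g : u v / u <= v}.
Proof.
move=> u v uv; apply: sup_le_ub; first by have [] := level_has_sup g u.
move=> t [tI tu]; apply: ub_le_sup; first by have [] := level_has_sup g v.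
by split => //; case: tu => [|gu]; [left|right; exact: le_trans uv].
Qed.
(** The tags [c i] with [u < g (c i)] form a final segment, so that the sum telescopes to
    the increment of [x] from a partition point next to [level g u]. *)
Lemma cut_sum g x (d w : R) n t c (u : R) : monotone_on g ->
  tagged_partition d n t c ->
  (forall r s, 0 <= r <= T -> 0 <= s <= T -> `|r - s| < d -> `|x r - x s| <= w) ->
  `| \sum_(i < n) (x (t i.+1) - x (t i)) * ((u < g (c i))%R)%:R
     - (x T - x (level g u)) | <= w.
Proof.
move=> gm tp xw; have [t00 tn tc] := tp; have [tI cI] := partition_bounds tp.
have mono := partition_mono tp.
have cm i j : (i < n)%N -> (j < n)%N -> (i <= j)%N -> c i <= c j.
  move=> ni nj; rewrite leq_eqVlt => /predU1P[->//|ij].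
  have [_ h1 _] := tc i ni; have [h2 _ _] := tc j nj.
  by rewrite (le_trans h1)// (le_trans (mono _ _ ij (ltnW nj))).
have exk : exists k, (k == n) || ((k < n)%N && (u < g (c k))).
  by exists n; rewrite eqxx.
case: (ex_minnP exk) => k kP kmin.
have kn : (k <= n)%N by case/orP: kP => [/eqP ->//|/andP[/ltnW]].
have Plt i : (i < k)%N -> g (c i) <= u.
  move=> ik; rewrite leNgt; apply/negP => h.
  by have := kmin i; rewrite h (leq_trans ik kn) orbT leqNgt ik => /(_ isT).
have Pge i : (k <= i)%N -> (i < n)%N -> u < g (c i).
  move=> ki ni; case/orP: kP => [/eqP kE|/andP[kn' h]].
    by move: ni; rewrite -kE ltnNge ki.
  have /andP[ck0 _] := cI k kn'; have /andP[_ ciT] := cI i ni.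
  by rewrite (lt_le_trans h)// gm// cm.
have -> : \sum_(i < n) (x (t i.+1) - x (t i)) * ((u < g (c i))%R)%:R = x T - x (t k).
  rewrite -(big_mkord xpredT
    (fun i => (x (t i.+1) - x (t i)) * ((u < g (c i))%R)%:R)).
  rewrite (big_cat_nat (leq0n k) kn)//= big_nat_cond big1 ?add0r; last first.
    by move=> i /andP[/andP[_ ik] _]; rewrite ltNge (Plt i ik) mulr0.
  rewrite -tn -(telescope_sumr (x \o t) kn)/=.
  by apply: eq_big_nat => i /andP[ki ni]; rewrite (Pge i ki ni) mulr1.
have -> : x T - x (t k) - (x T - x (level g u)) = x (level g u) - x (t k) by ring.
apply: xw; [exact: level_itv|exact: tI|].
have /andP[l0 lT] := level_itv g u.
rewrite ltr_norml; apply/andP; split.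
  case: k {exk} kP kn Plt Pge kmin => [|j] kP kn Plt Pge kmin.
    rewrite t00 subr0 (lt_le_trans _ l0)// oppr_lt0.
    have [n0|n0] := posnP n; first by move: T0; rewrite -tn n0 t00 ltxx.
    have [h1 h2 h3] := tc 0%N n0; apply: le_lt_trans h3.
    by rewrite subr_ge0 (le_trans h1).
  have [h1 h2 h3] := tc j kn.
  have := level_ge (cI j kn) (Plt j (leqnn _)); lra.
case/orP: kP => [/eqP kE|/andP[kn' h]].
  rewrite kE tn (@le_lt_trans _ _ 0) ?subr_le0//.
  have [n0|n0] := posnP n; first by move: T0; rewrite -tn n0 t00 ltxx.
  have [h1 h2 h3] := tc 0%N n0; apply: le_lt_trans h3.
  by rewrite subr_ge0 (le_trans h1).
have [h1 h2 h3] := tc k kn'.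
have := level_le gm (cI k kn') h; lra.
Qed.

(** Heine's theorem by compactness: a sequence of pairs violating the estimate has a
    convergent subsequence. *)
Lemma continuous_within_unif x : {within `[0, T], continuous x} ->
  forall e : R, 0 < e -> exists2 d : R, 0 < d & forall r s, 0 <= r <= T ->
    0 <= s <= T -> `|r - s| < d -> `|x r - x s| <= e.
Proof.
move=> cx e e0; apply: contrapT => H.
have {}H (n : nat) : exists rs : R * R, [/\ 0 <= rs.1 <= T, 0 <= rs.2 <= T,
    `|rs.1 - rs.2| < n.+1%:R^-1 & e < `|x rs.1 - x rs.2|].
  apply: contrapT => h; apply: H; exists n.+1%:R^-1; first by rewrite invr_gt0.
  move=> r s rI sI rs; rewrite leNgt; apply/negP => h'; apply: h.
  by exists (r, s).
have [rs rsP] := choice H.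
have bd : bounded_fun (fun n => (rs n).1).
  exists T; split; first exact: num_real.
  move=> M TM n _ /=; have [/andP[r0 rT] _ _ _] := rsP n.
  by rewrite ger0_norm// (le_trans rT)// ltW.
have [f finc /cvg_ex[l rl]] := bolzano_weierstrass bd.
have fn n : (n <= f n)%N.
  elim: n => // n IH; apply: (leq_ltn_trans IH).
  by have := finc n.+1 n; rewrite !leEnat ltnn => /negbT; rewrite -ltnNge.
have lI : `[0, T]%classic l.
  rewrite /= in_itv/=; apply/andP; split.
    by apply: (cvgr_to_ge rl); apply: nearW => n; have [/andP[]] := rsP (f n).
  by apply: (cvgr_to_le rl); apply: nearW => n; have [/andP[]] := rsP (f n).
have sl : (rs (f n)).2 @[n --> \oo] --> l.
  have d0 : (rs (f n)).1 - (rs (f n)).2 @[n --> \oo] --> 0.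
    apply/cvgrPdist_lt => d d0.
    have /cvgrPdist_lt/(_ d d0)[N _ HN] := @cvg_harmonic R.
    exists N => // n Nn; rewrite sub0r normrN.
    have [_ _ h _] := rsP (f n); apply: (lt_trans h).
    apply: le_lt_trans (HN n Nn); rewrite /= sub0r normrN ger0_norm ?invr_ge0//.
    by rewrite lef_pV2 ?posrE// ler_nat ltnS.
  rewrite (_ : (fun n => _) = ((fun n => (rs (f n)).1) \-
    (fun n => (rs (f n)).1 - (rs (f n)).2))); last by apply/funext => n /=; ring.
  by rewrite -[l]subr0; exact: cvgB.
have /subspace_continuousP/(_ l lI) cl := cx.
have cvx (u : nat -> R) : (forall n, 0 <= u n <= T) -> u n @[n --> \oo] --> l ->
    x (u n) @[n --> \oo] --> x l.
  move=> uI ul; apply: cvg_comp cl => A.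
  rewrite /within => /= HA; apply: (@filterS _ \oo _ _ _ _ (ul _ HA)) => n /=.
  by apply; rewrite /= in_itv/= uI.
have h1 := cvx (fun n => (rs (f n)).1) _ rl.
have h2 := cvx (fun n => (rs (f n)).2) _ sl.
have {}h1 := h1 (fun n => let: And4 h _ _ _ := rsP (f n) in h).
have {}h2 := h2 (fun n => let: And4 _ h _ _ := rsP (f n) in h).
have h3 : x (rs (f n)).1 - x (rs (f n)).2 @[n --> \oo] --> (0 : R).
  by rewrite -(subrr (x l)); exact: cvgB.
move/cvgrPdist_lt : h3 => /(_ e e0)[N _ /(_ N (leqnn _))].
rewrite /= sub0r normrN => h; have [_ _ _ h'] := rsP (f N).
by have := lt_trans h h'; rewrite ltxx.
Qed.

(** Layer cake: [g c - g 0] is the integral over the levels [u] of the indicator of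
    [u < g c]. A tagged sum is therefore an integral over [u] of sums of increments of [x]
    over final segments, each of which is uniformly close to
    [x T - x (level g u)] by [cut_sum]. *)
Lemma RS_exists_monotone g x : monotone_on g -> {within `[0, T], continuous x} ->
  exists I, is_RS_integral T g x I.
Proof.
move=> gm cx.
have g0T : g 0 <= g T by apply: gm => //; exact: ltW.
pose D : set R := `[g 0, g T]%classic.
have mD : measurable D by exact: measurable_itv.
have lD : lebesgue_measure D = (g T - g 0)%:E.
  by rewrite lebesgue_measure_itv/= lte_fin; case: ltgtP g0T => // ->; rewrite subrr.
have lDoo : (lebesgue_measure D < +oo)%E by rewrite lD ltry.
pose xl u := x (level g u).
have mxl : measurable_fun D xl.
  apply: (@measurable_comp _ _ _ _ _ _ (`[0, T]%classic : set R) x) => //.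
  - by move=> _ [u _ <-]; rewrite /= in_itv/=; exact: level_itv.
  - by apply: subspace_continuous_measurable_fun => //; exact: measurable_itv.
  - exact: nondecreasing_measurable (@level_mono g).
have [M xM] : exists M, forall t, 0 <= t <= T -> `|x t| <= M.
  have [p pI xp] := EVT_max (ltW T0) cx; have [q qI xq] := EVT_min (ltW T0) cx.
  exists (`|x p| + `|x q|) => t tI.
  have h1 := xp t; have h2 := xq t; rewrite in_itv/= in h1 h2.
  have := h1 tI; have := h2 tI; have := ler_norm (x p); have := ler_norm (- x q).
  rewrite normrN; have := normr_ge0 (x p); have := normr_ge0 (x q).
  by rewrite ler_norml; lra.
have iD (h : R -> R) B : measurable_fun D h -> (forall u, D u -> `|h u| <= B) ->
    lebesgue_measure.-integrable D (EFin \o h).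
  move=> mh hB; apply: measurable_bounded_integrable => //.
  exists B; split; first exact: num_real.
  by move=> C BC u Du /=; rewrite (le_trans (hB u Du))// ltW.
have ixl : lebesgue_measure.-integrable D (EFin \o (fun u => x T - xl u)).
  apply: (iD _ (M + M)) => //; first exact: measurable_funB.
  move=> u _; apply: le_trans (ler_normB _ _) _; rewrite lerD// xM ?level_itv//.
  by rewrite lexx ltW.
(* Formally this is g T * x T - g 0 * x 0 minus the integral of x against dg, as in
   integration by parts. *)
exists (g 0 * (x T - x 0) + \int[lebesgue_measure]_(u in D) (x T - xl u)).
apply/is_RSP => e e0.
have w0 : 0 < e / (g T - g 0 + 1) by rewrite divr_gt0// ltr_wpDl// subr_ge0.
have [d d0 xd] := continuous_within_unif cx w0.
exists d => // n t c tp; have [t00 tn tc] := tp.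
have [_ cI] := partition_bounds tp.
pose K u := \sum_(i < n) (x (t i.+1) - x (t i)) * ((u < g (c i))%R)%:R.
have m1 i : measurable_fun D (fun u => ((u < g (c i))%R)%:R : R).
  rewrite (_ : (fun u => _) = \1_(`]-oo, g (c i)[%classic)).
    by apply: measurable_indic; exact: measurable_itv.
  by apply/funext => u; rewrite indicE mem_setE/= in_itv/=.
have i1 i : lebesgue_measure.-integrable D
    (EFin \o (fun u => ((u < g (c i))%R)%:R : R)).
  apply: (iD _ 1) => // u _.
  by case: (_ < _); rewrite ?normr0 ?normr1.
have mi i : measurable_fun D (fun u => (x (t i.+1) - x (t i)) * ((u < g (c i))%R)%:R).
  exact: measurable_funM.
have ii i : lebesgue_measure.-integrable D
    (EFin \o (fun u => (x (t i.+1) - x (t i)) * ((u < g (c i))%R)%:R)).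
  apply: (iD _ `|x (t i.+1) - x (t i)|) => // u _.
  by rewrite normrM ler_piMr//; case: (_ < _); rewrite ?normr0 ?normr1.
have intK : \int[lebesgue_measure]_(u in D) K u =
    \sum_(i < n) (x (t i.+1) - x (t i)) * (g (c i) - g 0).
  rewrite /Rintegral.
  have -> : (\int[lebesgue_measure]_(u in D) (K u)%:E = \sum_(i < n)
      \int[lebesgue_measure]_(u in D) ((x (t i.+1) - x (t i)) * ((u < g (c i))%R)%:R)%:E)%E.
    rewrite -(@integral_sum _ (measurableTypeR R) R lebesgue_measure D mD _
      (fun (i : 'I_n) u => ((x (t i.+1) - x (t i)) * ((u < g (c i))%R)%:R)%:E))//.
      by apply: eq_integral => u _; rewrite sumEFin.
    by move=> i; exact: ii.
  rewrite -[RHS]/(fine (\sum_(i < n) (x (t i.+1) - x (t i)) * (g (c i) - g 0))%:E).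
  rewrite -sumEFin; congr fine; apply: eq_bigr => i _.
  under eq_integral do rewrite EFinM.
  rewrite integralZl//; last exact: i1.
  rewrite EFinM; congr (_ * _)%E.
  rewrite (_ : (fun u => _) = EFin \o \1_(`]-oo, g (c i)[%classic)); last first.
    by apply/funext => u; rewrite /= indicE mem_setE/= in_itv/=.
  rewrite (@integral_indic _ (measurableTypeR R) R lebesgue_measure D mD)//.
  rewrite (_ : _ `&` _ = `[g 0, g (c i)[%classic).
    have /andP[c0 cT] := cI i (ltn_ord i).
    rewrite [LHS]lebesgue_measure_itv/= lte_fin.
    by case: ltgtP (gm 0 (c i) (lexx _) c0 cT) => // ->; rewrite subrr.
  have /andP[c0 cT] := cI i (ltn_ord i).
  apply/seteqP; split => u; rewrite /D /= !in_itv/=.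
    by move=> [-> /andP[-> _]].
  move=> /andP[-> h]; split => //; rewrite (le_trans (ltW h))// gm//.
have iK : lebesgue_measure.-integrable D (EFin \o K).
  apply: (iD _ (\sum_(i < n) `|x (t i.+1) - x (t i)|)).
    exact: measurable_sum.
  move=> u _; apply: le_trans (ler_norm_sum _ _ _) _; apply: ler_sum => i _.
  by rewrite normrM ler_piMr//; case: (_ < _); rewrite ?normr0 ?normr1.
have iKB : lebesgue_measure.-integrable D (EFin \o (fun u => K u - (x T - xl u))).
  exact: (@integrableB _ (measurableTypeR R) R lebesgue_measure D mD _ _ iK ixl).
have -> : tagged_sum g x n t c - (g 0 * (x T - x 0) +
    \int[lebesgue_measure]_(u in D) (x T - xl u)) =
    \int[lebesgue_measure]_(u in D) (K u - (x T - xl u)).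
  rewrite (@RintegralB _ (measurableTypeR R) R lebesgue_measure D _ _ mD iK ixl).
  rewrite [X in _ = X - _]intK /tagged_sum.
  have -> : x T - x 0 = \sum_(i < n) (x (t i.+1) - x (t i)).
    rewrite -(big_mkord xpredT (fun i => x (t i.+1) - x (t i))).
    by rewrite (telescope_sumr (x \o t))//= t00 tn.
  rewrite opprD addrA mulr_sumr -sumrB; congr (_ - _).
  by apply: eq_bigr => i _; ring.
apply: le_lt_trans
  (@le_normr_Rintegral _ (measurableTypeR R) R lebesgue_measure D _ mD iKB) _.
apply: (@le_lt_trans _ _ (\int[lebesgue_measure]_(u in D) (e / (g T - g 0 + 1)))).
  apply: (@le_Rintegral _ (measurableTypeR R) R lebesgue_measure D _ _ mD) => //.
  - exact: integrable_norm iKB.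
  - by apply: (iD _ `|e / (g T - g 0 + 1)|).
  - by move=> u _; exact: (cut_sum u gm tp xd).
rewrite Rintegral_cst// (_ : fine _ = g T - g 0); last by rewrite [X in fine X]lD.
rewrite mulrAC ltr_pdivrMr ?ltr_wpDl ?subr_ge0//.
by rewrite ltr_pM2l// ltrDl.
Qed.

(** ** Differences of monotone functions *)

(** Functions of bounded variation, in the form that makes linearity and the
    existence of integrals immediate. *)
Definition mono_diff v := exists p n, [/\ monotone_on p, monotone_on n &
  forall t, 0 <= t <= T -> v t = p t - n t].

Lemma BV_mono_diff v : bounded_variation 0 T v -> mono_diff v.
Proof.
move=> bv; exists (fine \o pos_tv 0 v), (fine \o neg_tv 0 v); split.
- move=> s t s0 st tT.
  have bvN : bounded_variation 0 T (\- v) by exact/bounded_variationN.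
  have := @fine_neg_tv_nondecreasing R 0 T _ bvN s t; rewrite !in_itv/=; apply=> //.
    by rewrite s0 (le_trans st).
  by rewrite (le_trans s0 st).
- move=> s t s0 st tT.
  have := @fine_neg_tv_nondecreasing R 0 T _ bv s t; rewrite !in_itv/=; apply=> //.
    by rewrite s0 (le_trans st).
  by rewrite (le_trans s0 st).
by move=> t tI; rewrite (bounded_variation_pos_neg_tvE bv) ?in_itv.
Qed.

Lemma monotone_onD (k l : R) f g : 0 <= k -> 0 <= l -> monotone_on f -> monotone_on g ->
  monotone_on (fun t => k * f t + l * g t).
Proof. by move=> k0 l0 mf mg s t s0 st tT; rewrite lerD// ler_wpM2l// ?mf ?mg. Qed.

Lemma mono_diff_lin (k : R) u v : mono_diff u -> mono_diff v ->
  mono_diff (fun t => k * u t + v t).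
Proof.
move=> [p1 [n1 [mp1 mn1 e1]]] [p2 [n2 [mp2 mn2 e2]]].
have [k0|k0] := leP 0 k.
  exists (fun t => k * p1 t + 1 * p2 t), (fun t => k * n1 t + 1 * n2 t); split.
  - exact: monotone_onD.
  - exact: monotone_onD.
  - by move=> t tI; rewrite e1// e2//; ring.
exists (fun t => (- k) * n1 t + 1 * p2 t), (fun t => (- k) * p1 t + 1 * n2 t); split.
- by apply: monotone_onD => //; rewrite oppr_ge0 ltW.
- by apply: monotone_onD => //; rewrite oppr_ge0 ltW.
- by move=> t tI; rewrite e1// e2//; ring.
Qed.

Lemma mono_diff0 : mono_diff (cst 0).
Proof. by exists (cst 0), (cst 0); split => // t _; rewrite /= subr0. Qed.

Lemma mono_diff_sum n (c : nat -> R) (phi : nat -> R -> R) :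
  (forall j, mono_diff (phi j)) -> mono_diff (fun t => \sum_(j < n) c j * phi j t).
Proof.
move=> Hphi; elim: n => [|n IH].
  by under eq_fun do rewrite big_ord0; exact: mono_diff0.
by under eq_fun do rewrite big_ord_recr/= addrC; exact: mono_diff_lin.
Qed.

Lemma RS_exists v x : mono_diff v -> {within `[0, T], continuous x} ->
  is_RS_integral T v x (RS_integral T v x).
Proof.
move=> [p [n [mp mn e]]] cx.
have [I pI] := RS_exists_monotone mp cx; have [J nJ] := RS_exists_monotone mn cx.
have := is_RS_linl (-1) nJ pI => h.
have H : is_RS_integral T v x (-1 * J + I).
  by apply: is_RS_ext h => t tI; rewrite e// mulN1r addrC.
by rewrite (is_RS_unique H).
Qed.

Lemma RS_sum n (c : nat -> R) (phi : nat -> R -> R) x :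
  (forall j, mono_diff (phi j)) -> {within `[0, T], continuous x} ->
  RS_integral T (fun t => \sum_(j < n) c j * phi j t) x =
  \sum_(j < n) c j * RS_integral T (phi j) x.
Proof.
move=> Hphi cx; elim: n => [|n IH].
  apply: is_RS_unique; rewrite big_ord0; apply/is_RSP => e e0; exists 1 => // n t c' _.
  by rewrite /tagged_sum big1 ?subrr ?normr0// => i _; rewrite big_ord0 mul0r.
rewrite big_ord_recr/= -IH addrC; apply: is_RS_unique.
under eq_fun do rewrite big_ord_recr/= addrC.
exact: (is_RS_linl (c n) (RS_exists (Hphi n) cx) (RS_exists (mono_diff_sum n c Hphi) cx)).
Qed.

Lemma RS_linr (k : R) v x y : mono_diff v -> {within `[0, T], continuous x} ->
  {within `[0, T], continuous y} ->
  RS_integral T v (fun t => k * x t + y t) = k * RS_integral T v x + RS_integral T v y.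
Proof.
by move=> vm cx cy; apply: is_RS_unique; apply: is_RS_linr; exact: RS_exists.
Qed.

Lemma monotone_on_bound g t : monotone_on g -> 0 <= t <= T ->
  `|g t| <= `|g 0| + `|g T|.
Proof.
move=> gm /andP[t0 tT]; have := gm 0 t (lexx _) t0 tT; have := gm t T t0 tT (lexx _).
have := ler_norm (g T); have := ler_norm (- g 0); rewrite normrN.
by have := normr_ge0 (g 0); have := normr_ge0 (g T); rewrite ler_norml; lra.
Qed.

Lemma mono_diff_bounded v : mono_diff v ->
  exists2 M, 0 <= M & forall t, 0 <= t <= T -> `|v t| <= M.
Proof.
move=> [p [n [mp mn e]]]; exists (`|p 0| + `|p T| + (`|n 0| + `|n T|)).
  by rewrite !addr_ge0.
move=> t tI; rewrite e//; apply: le_trans (ler_normB _ _) _.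
by rewrite lerD// monotone_on_bound.
Qed.

Lemma monotone_on_measurable g : monotone_on g -> measurable_fun `[0, T]%classic g.
Proof.
move=> gm; apply: (eq_measurable_fun (clamp T g)).
  by move=> t; rewrite inE/= in_itv/= => tI; rewrite clampE.
apply: nondecreasing_measurable; first exact: measurable_itv.
move=> s t st; rewrite /clamp; apply: gm.
- by rewrite le_max lexx.
- by rewrite ge_max le_max lexx/= le_max; apply/orP; right;
    rewrite le_min ge_min st/= ge_min lexx orbT.
- by rewrite ge_max (ltW T0) ge_min lexx orbT.
Qed.

Lemma mono_diff_measurable v : mono_diff v -> measurable_fun `[0, T]%classic v.
Proof.
move=> [p [n [mp mn e]]]; apply: (eq_measurable_fun (p \- n)).
  by move=> t; rewrite inE/= in_itv/= => tI; rewrite e.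
by apply: measurable_funB; exact: monotone_on_measurable.
Qed.

(** ** Step functions *)

Variable b : R -> R.
Hypotheses (bc : clamp_cumulative T b) (cb : {within `[0, T], continuous b}).
Local Notation db := (stieltjes T b).
Local Notation I := (`[0%R, T]%classic : set (measurableTypeR R)).
Local Notation L2b := (L2 db I).
Local Notation ipb := (ip db I).

Definition cell N i : set R := `]upt N i, upt N i.+1]%classic.

(** The step function whose inner products in L^2(db) are the moments of the Riemann
    sum [usum]. *)
Definition ustep N v t := \sum_(i < N.+1) v (upt N i.+1) * \1_(cell N i) t.

Lemma cell_sub N i : (i <= N)%N -> cell N i `<=` `[0, T]%classic.
Proof.
move=> iN t; rewrite /cell /= !in_itv/= => /andP[h1 h2].
have /andP[h3 _] := upt_itv (leqW iN); have /andP[_ h4] := @upt_itv N i.+1 iN.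
by rewrite (le_trans h3 (ltW h1)) (le_trans h2).
Qed.

Lemma measurable_cell N i : measurable (cell N i : set (measurableTypeR R)).
Proof. exact: measurable_itv. Qed.

Lemma measurable_I : measurable I. Proof. exact: measurable_itv. Qed.

Lemma dbI : (db I < +oo)%E. Proof. exact: stieltjes_finite. Qed.

Lemma bounded_L2 v (M : R) : measurable_fun I v -> (forall t, 0 <= t <= T -> `|v t| <= M) ->
  L2b v.
Proof.
move=> mv vM; split => //; have mI := measurable_I.
apply: (@le_lt_trans _ _ (\int[db]_(t in I) (cst ((M ^+ 2)%:E) t))%E).
  apply: ge0_le_integral => //.
  - by move=> t _; rewrite lee_fin sqr_ge0.
  - by apply/measurable_EFinP; exact: measurable_funX.
  - move=> t; rewrite /= in_itv/= => tI; rewrite lee_fin.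
    rewrite -(real_normK (num_real (v t))) lerXn2r ?nnegrE//; last exact: vM.
    exact: le_trans (vM t tI).
rewrite integral_cst//; apply: lte_mul_pinfty => //; first by rewrite lee_fin sqr_ge0.
exact: dbI.
Qed.

Lemma mono_diff_L2 v : mono_diff v -> L2b v.
Proof.
by move=> vm; have [M _ vM] := mono_diff_bounded vm;
  apply: bounded_L2 vM; exact: mono_diff_measurable.
Qed.

Lemma indic_cell_L2 N i : L2b \1_(cell N i).
Proof.
apply: (@bounded_L2 _ 1); first by apply: measurable_indic; exact: measurable_cell.
by move=> t _; rewrite indicE; case: (_ \in _); rewrite ?normr0 ?normr1.
Qed.

Lemma ustep_L2 N v : L2b (ustep N v).
Proof.
exact: (@L2_sum _ _ _ db I measurable_I N.+1 (fun i => v (upt N i.+1)) _ (indic_cell_L2 N)).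
Qed.

Lemma ip_cell N i h : (i <= N)%N -> ipb \1_(cell N i) h = \int[db]_(t in cell N i) h t.
Proof.
move=> iN; rewrite /ip /Rintegral; congr fine.
rewrite integral_mkcond [RHS]integral_mkcond; apply: eq_integral => t _.
rewrite /patch indicE; have [tc|tc] := boolP (t \in cell N i).
  by rewrite mem_set ?mul1r//; apply: (cell_sub iN); exact/set_mem.
by rewrite mul0r; case: ifPn.
Qed.

Lemma ip_ustep N v h : L2b h ->
  ipb (ustep N v) h = \sum_(i < N.+1) v (upt N i.+1) * \int[db]_(t in cell N i) h t.
Proof.
move=> Lh; rewrite /ustep.
rewrite (@ip_sum _ _ _ db I measurable_I N.+1 (fun i => v (upt N i.+1))
  (fun i => \1_(cell N i)))//; last exact: indic_cell_L2.
by apply: eq_bigr => i _; rewrite ip_cell// -ltnS.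
Qed.

Lemma db_cell N i : (i <= N)%N -> db (cell N i) = (b (upt N i.+1) - b (upt N i))%:E.
Proof.
move=> iN; have /andP[h1 _] := upt_itv (leqW iN).
have /andP[_ h2] := @upt_itv N i.+1 iN.
by rewrite /cell stieltjes_ocE//; exact/ltW/upt_ltS.
Qed.

Lemma ustepE N v i t : (i <= N)%N -> cell N i t -> ustep N v t = v (upt N i.+1).
Proof.
move=> iN ti; rewrite /ustep (bigD1 (Ordinal (iN : (i < N.+1)%N)))//= indicE mem_set//.
rewrite mulr1 big1 ?addr0// => j ji; rewrite indicE memNset ?mulr0//.
move: ti; rewrite /cell /= !in_itv/= => /andP[h1 h2] /andP[h3 h4].
have : (j != i :> nat)%N by apply: contra ji => /eqP e; exact/eqP/val_inj.
rewrite neq_ltn => /orP[] ij.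
  by have := lt_le_trans h1 (le_trans h4 (upt_mono N ij)); rewrite ltxx.
by have := lt_le_trans h3 (le_trans h2 (upt_mono N ij)); rewrite ltxx.
Qed.

Lemma ip_ustep_ustep N v :
  ipb (ustep N v) (ustep N v) =
  \sum_(i < N.+1) v (upt N i.+1) ^+ 2 * (b (upt N i.+1) - b (upt N i)).
Proof.
rewrite ip_ustep; last exact: ustep_L2.
apply: eq_bigr => i _; rewrite expr2 -mulrA; congr (_ * _).
have iN : (i <= N)%N by rewrite -ltnS.
transitivity (\int[db]_(t in cell N i) (cst (v (upt N i.+1)) t)).
  by apply: eq_Rintegral => t /[!inE]; exact: ustepE.
rewrite Rintegral_cst ?db_cell//; exact: measurable_cell.
Qed.

Lemma cells_integral N (f : R -> \bar R) : measurable_fun I f ->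
  (forall t, I t -> 0 <= f t)%E ->
  (\int[db]_(t in I) f t = \sum_(i < N.+1) \int[db]_(t in cell N i) f t)%E.
Proof.
move=> mf f0.
have H k : (k <= N.+1)%N -> (\int[db]_(t in `]0%R, upt N k]) f t =
    \sum_(i < k) \int[db]_(t in cell N i) f t)%E.
  elim: k => [_|k IH kN].
    by rewrite big_ord0 upt0 set_itv_ge ?integral_set0// bnd_simp ltxx.
  rewrite big_ord_recr/= -IH 1?ltnW//.
  have /andP[k0 _] := upt_itv (ltnW kN); have /andP[_ kT] := upt_itv kN.
  have E : `]0%R, upt N k.+1]%classic = `]0%R, upt N k]%classic `|` cell N k :> set R.
    rewrite /cell; apply/seteqP; split => t /=; rewrite !in_itv/=.
      by move=> /andP[-> ->]/=; rewrite andbT; have [|] := leP t (upt N k); [left|right].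
    move=> [/andP[-> h]|/andP[h ->]].
      by rewrite (le_trans h)//; exact/ltW/upt_ltS.
    by rewrite (le_lt_trans k0 h).
  have sub : `]0%R, upt N k.+1]%classic `<=` (I : set R).
    by apply: subset_itv; rewrite bnd_simp.
  rewrite E (@ge0_integral_setU _ (measurableTypeR R))//.
  - exact: measurable_itv.
  - by rewrite -E; apply: measurable_funS mf => //; exact: measurable_I.
  - by move=> t; rewrite -E => /sub; exact: f0.
  - apply/disj_setPS => t [/=]; rewrite /cell /= !in_itv/= => /andP[_ h1] /andP[h2 _].
    by have := le_lt_trans h1 h2; rewrite ltxx.
rewrite -H// uptT.
have E : I = `]0%R, T]%classic `|` [set 0%R] :> set R.
  apply/seteqP; split => t /=; rewrite !in_itv/=.
    move=> /andP[t0 ->]; rewrite andbT.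
    by have [->|tn0] := eqVneq t 0; [right|left; rewrite lt_neqAle eq_sym tn0].
  by move=> [/andP[/ltW -> ->]//|->]; rewrite lexx ltW.
rewrite [in LHS]E (@ge0_integral_setU _ (measurableTypeR R))//.
- rewrite [X in (_ + X)%E]null_set_integral ?adde0//.
    apply: measurable_funS mf => //.
    by rewrite [X in _ `<=` X]E; exact: subsetUr.
  exact/stieltjes_set0/ltW.
- by rewrite -E.
- by rewrite -E.
- by apply/disj_setPS => t [/=]; rewrite in_itv/= => /andP[h _] /= e; move: h; rewrite e ltxx.
Qed.

(** On each cell the difference is at most the increment of [g], whose sum is bounded,
    while the mass of the cell is small by uniform continuity of [b]. *)
Lemma ustep_approx_monotone g : monotone_on g -> forall e : R, 0 < e ->
  \forall N \near \oo,
    ipb (fun t => ustep N g t - g t) (fun t => ustep N g t - g t) <= e.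
Proof.
move=> gm e e0; set G := g T - g 0.
have G0 : 0 <= G by rewrite subr_ge0 gm// ltW.
have w0 : 0 < e / (G ^+ 2 + 1) by rewrite divr_gt0// ltr_wpDl// sqr_ge0.
have [d d0 bd] := continuous_within_unif cb w0.
have := upartition d0; apply: filterS => N [_ _ tc].
have Lg : L2b g.
  by apply: mono_diff_L2; exists g, (cst 0); split => // t _; rewrite /= subr0.
have LB : L2b (fun t => ustep N g t - g t) by apply: (L2B measurable_I) => //; exact: ustep_L2.
rewrite -lee_fin -ipE// (@cells_integral N); last 2 first.
- by have [mB _] := LB; apply/measurable_EFinP; exact: measurable_funX.
- by move=> t _; rewrite lee_fin sqr_ge0.
pose Dg i := g (upt N i.+1) - g (upt N i).
have Dg0 i : (i <= N)%N -> 0 <= Dg i.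
  move=> iN; rewrite subr_ge0; have /andP[h1 _] := upt_itv (leqW iN).
  by have /andP[_ h2] := @upt_itv N i.+1 iN; apply: gm => //; exact/ltW/upt_ltS.
have sumDg : \sum_(i < N.+1) Dg i = G.
  rewrite -(big_mkord xpredT Dg) /Dg (telescope_sumr (g \o upt N))//=.
  by rewrite upt0 uptT.
apply: (@le_trans _ _ (\sum_(i < N.+1) (Dg i * (G * (e / (G ^+ 2 + 1))))%:E)%E).
  apply: lee_sum => i _; have iN : (i <= N)%N by rewrite -ltnS.
  have /andP[h1 _] := upt_itv (leqW iN); have /andP[_ h2] := @upt_itv N i.+1 iN.
  apply: (@le_trans _ _ (\int[db]_(t in cell N i) cst ((Dg i ^+ 2)%:E) t)%E).
    apply: ge0_le_integral; first exact: measurable_cell.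
    - by move=> t _; rewrite lee_fin sqr_ge0.
    - have [mB _] := LB; apply/measurable_EFinP; apply: measurable_funX.
      by apply: measurable_funS mB; [exact: measurable_I|exact: cell_sub].
    - exact: measurable_cst.
    - move=> t tc'; rewrite lee_fin (ustepE g iN tc').
      move: tc'; rewrite /cell /= in_itv/= => /andP[h3 h4].
      rewrite ler_sqr ?nnegrE ?Dg0//; last first.
        by rewrite subr_ge0 gm//; exact: (le_trans h1 (ltW h3)).
      by rewrite lerD2l lerN2 gm//; [exact: ltW|exact: le_trans h2].
  rewrite integral_cst; last exact: measurable_cell.
  rewrite db_cell// -EFinM lee_fin expr2 -mulrA ler_wpM2l ?Dg0//.
  apply: ler_pM; [exact: Dg0| | |].
  - rewrite subr_ge0; have := bc.1 _ _ (ltW (upt_ltS N i)).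
    by rewrite !clampE ?upt_itv// ltnW// ltnS.
  - rewrite -sumDg (bigD1 i)//= lerDl sumr_ge0// => j _; apply: Dg0.
    by rewrite -ltnS.
  - apply: le_trans (ler_norm _) _; apply: bd; rewrite ?upt_itv//; first exact: leqW.
    have [_ _ h] := tc i (ltn_ord i).
    by rewrite ger0_norm// subr_ge0; exact/ltW/upt_ltS.
rewrite sumEFin lee_fin -mulr_suml sumDg.
rewrite [leLHS](_ : _ = G ^+ 2 * e / (G ^+ 2 + 1)); last by ring.
rewrite ler_pdivrMr; last first.
  by rewrite ltr_wpDl// sqr_ge0.
by rewrite mulrC ler_wpM2l ?(ltW e0)// lerDl.
Qed.

Lemma ustep_approx v : mono_diff v -> forall e : R, 0 < e ->
  \forall N \near \oo,
    ipb (fun t => ustep N v t - v t) (fun t => ustep N v t - v t) <= e.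
Proof.
move=> vm e e0; have [p [n [mp mn vE]]] := vm.
have mI := measurable_I.
have e4 : 0 < e / 4 by rewrite divr_gt0.
have hp := ustep_approx_monotone mp e4; have hn := ustep_approx_monotone mn e4.
near=> N.
have Lp : L2b (fun t => ustep N p t - p t).
  apply: (L2B mI); [exact: ustep_L2|apply: mono_diff_L2].
  by exists p, (cst 0); split => // t _; rewrite /= subr0.
have Ln : L2b (fun t => ustep N n t - n t).
  apply: (L2B mI); [exact: ustep_L2|apply: mono_diff_L2].
  by exists n, (cst 0); split => // t _; rewrite /= subr0.
have -> : ipb (fun t => ustep N v t - v t) (fun t => ustep N v t - v t) =
   ipb (fun t => (ustep N p t - p t) - (ustep N n t - n t))
       (fun t => (ustep N p t - p t) - (ustep N n t - n t)).
  apply: eq_Rintegral => t; rewrite inE/= in_itv/= => tI.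
  suff -> : ustep N v t = ustep N p t - ustep N n t by rewrite vE//; ring.
  rewrite /ustep -sumrB; apply: eq_bigr => i _.
  by rewrite vE ?upt_itv//; ring.
have H1 : ipb (fun t => ustep N p t - p t) (fun t => ustep N p t - p t) <= e / 4.
  by near: N.
have H2 : ipb (fun t => ustep N n t - n t) (fun t => ustep N n t - n t) <= e / 4.
  by near: N.
by have := ip_sub_le mI Lp Ln; lra.
Unshelve. all: by end_near. Qed.

End riemann_stieltjes.

(** * Normal variables and their characteristic functions *)

Section normal_moments.
Context (R : realType) (m s : R).
Hypothesis s0 : s != 0.
Local Notation leb := (@lebesgue_measure R).
Local Notation P := (normal_prob m s).
Local Notation pdf := (normal_pdf m s).
Implicit Types g G : R -> R.

Let s2 : 0 < s ^+ 2. Proof. by rewrite lt0r sqrf_eq0 s0 sqr_ge0. Qed.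

Lemma normal_probE g : measurable_fun setT g ->
  (\int[P]_x (g x)%:E = \int[leb]_x (g x * pdf x)%:E)%E.
Proof.
move=> mg; apply: (@integral_density _ (measurableTypeR R) R leb P pdf setT g) => //.
- by move=> x _; exact: normal_pdf_ge0.
- exact: measurable_normal_pdf.
Qed.

Lemma normal_pdfE0 s' x : s' != 0 -> normal_pdf m s' x = normal_peak s' * normal_fun m s' x.
Proof. by move=> s'0; rewrite normal_pdfE. Qed.

(** Twice the standard deviation absorbs a quadratic factor, so that integrability
    reduces to that of another normal density. *)
Lemma normal_pdf_wide x :
  (1 + (x - m) ^+ 2) * pdf x <=
  (1 + 8 * s ^+ 2) * normal_peak s / normal_peak (2 * s) * normal_pdf m (2 * s) x.
Proof.
have s20 : 2 * s != 0 by rewrite mulf_neq0.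
rewrite !normal_pdfE0// [leRHS]mulrA mulfVK; last first.
  by rewrite gt_eqF// normal_peak_gt0.
rewrite mulrCA [leRHS]mulrAC [leRHS]mulrC ler_pM2l ?normal_peak_gt0//.
rewrite /normal_fun; set z := (x - m) ^+ 2.
have z0 : 0 <= z by exact: sqr_ge0.
have -> : - z / ((2 * s) ^+ 2 *+ 2) = - z / (s ^+ 2 *+ 2) + 3 * z / (8 * s ^+ 2).
  by field.
rewrite expRD mulrCA [leLHS]mulrC ler_pM2l ?expR_gt0//.
apply: (@le_trans _ _ ((1 + 8 * s ^+ 2) * (1 + 3 * z / (8 * s ^+ 2)))); last first.
  by rewrite ler_pM2l ?expR_ge1Dx// addr_gt0// mulr_gt0.
rewrite (_ : (1 + _) * _ = 1 + 8 * s ^+ 2 + 3 * z / (8 * s ^+ 2) + 3 * z); last by field.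
have h : 0 <= 3 * z / (8 * s ^+ 2) by rewrite divr_ge0// mulr_ge0// ltW.
move: s2; lra.
Qed.

Lemma normal_integrable_pdf g K : measurable_fun setT g ->
  (forall x, `|g x| <= K * (1 + (x - m) ^+ 2)) ->
  leb.-integrable setT (fun x => (g x * pdf x)%:E).
Proof.
move=> mg gK; set c := K * ((1 + 8 * s ^+ 2) * normal_peak s / normal_peak (2 * s)).
apply: (@le_integrable _ (measurableTypeR R) R leb setT measurableT _
  (fun x => (c * normal_pdf m (2 * s) x)%:E)).
- apply/measurable_EFinP; apply: measurable_funM => //; exact: measurable_normal_pdf.
- move=> x _; rewrite lee_fin (normrM (g x)) (normrM c) !(ger0_norm (normal_pdf_ge0 _ _ _)).
  have K0 : 0 <= K.
    have := le_trans (normr_ge0 _) (gK x); rewrite pmulr_lge0//.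
    by rewrite ltr_pwDl// sqr_ge0.
  apply: le_trans (ler_wpM2r (normal_pdf_ge0 _ _ _) (gK x)) _.
  rewrite -mulrA; apply: (le_trans (y := `|K| * ((1 + (x - m) ^+ 2) * pdf x))).
    by rewrite ger0_norm.
  rewrite /c normrM -mulrA ler_wpM2l//; apply: le_trans (normal_pdf_wide x) _.
  by rewrite ler_wpM2r ?normal_pdf_ge0// ler_norm.
- under eq_fun do rewrite EFinM.
  apply: (@integrableZl _ (measurableTypeR R) R leb setT measurableT c).
  exact: integrable_normal_pdf.
Qed.

Lemma normal_integrable g K : measurable_fun setT g ->
  (forall x, `|g x| <= K * (1 + (x - m) ^+ 2)) -> P.-integrable setT (EFin \o g).
Proof.
move=> mg gK; apply/integrableP; split; first exact/measurable_EFinP.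
have := normal_integrable_pdf (g := fun x => `|g x|) (K := K).
case/(_ _ _)/integrableP.
- exact: measurableT_comp.
- by move=> x; rewrite normr_id.
move=> _ h; rewrite (@normal_probE (fun x => `|g x|)); last exact: measurableT_comp.
apply: le_lt_trans h; apply: ge0_le_integral => //.
- by move=> x _; rewrite lee_fin mulr_ge0// normal_pdf_ge0.
- apply/measurable_EFinP; apply: measurable_funM; last exact: measurable_normal_pdf.
  exact: measurableT_comp.
- apply: measurableT_comp => //.
  apply/measurable_EFinP; apply: measurable_funM; last exact: measurable_normal_pdf.
  exact: measurableT_comp.
- by move=> x _; rewrite lee_fin ler_norm.
Qed.

Lemma is_derive_normal_pdf (x : R) : is_derive x (1 : R) (pdf : R -> R) (- ((x - m) / s ^+ 2) * pdf x).
Proof.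
have -> : pdf = fun y => normal_peak s * expR (- (y - m) ^+ 2 / (s ^+ 2 *+ 2)).
  by apply/funext => y; rewrite normal_pdfE0.
apply: is_derive_eq.
by rewrite /GRing.scale/=; field.
Qed.

Lemma normal_tail x : (2 + (x - m) ^+ 2) * pdf x <=
  (2 + 4 * s ^+ 2) * normal_peak s / (1 + (x - m) ^+ 2 / (4 * s ^+ 2)).
Proof.
rewrite normal_pdfE0// /normal_fun; set z := (x - m) ^+ 2.
have z0 : 0 <= z by exact: sqr_ge0.
set y := z / (4 * s ^+ 2).
have y0 : 0 <= y by rewrite divr_ge0// mulr_ge0// ltW.
have -> : - z / (s ^+ 2 *+ 2) = - (y + y) by rewrite /y; field.
rewrite mulrCA [leRHS](_ : _ = normal_peak s * ((2 + 4 * s ^+ 2) / (1 + y))); last by ring.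
rewrite expRN expRD ler_pM2l ?normal_peak_gt0//.
have e1 := expR_ge1Dx y.
have y1 : 0 < 1 + y by rewrite ltr_pwDl.
rewrite ler_pdivlMr// mulrAC ler_pdivrMr ?mulr_gt0 ?expR_gt0//.
have -> : 2 + z = 2 + 4 * s ^+ 2 * y by rewrite /y; field.
apply: (@le_trans _ _ ((2 + 4 * s ^+ 2) * ((1 + y) * (1 + y)))).
  rewrite [leRHS]mulrA ler_wpM2r ?(ltW y1)//.
  rewrite mulrDr mulr1 mulrDl; move: s2 y0; nra.
rewrite ler_pM2l; last by rewrite addr_gt0// mulr_gt0.
by rewrite ler_pM// ltW.
Qed.

(** This disposes of the boundary terms in integrations by parts. *)
Lemma normal_tail_cvg0 (F : R -> R) K (w : nat -> R) :
  (forall x, `|F x| <= K * ((2 + (x - m) ^+ 2) * pdf x)) ->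
  (fun n => `|w n - m|) @ \oo --> +oo%R -> F (w n) @[n --> \oo] --> (0 : R).
Proof.
move=> FK wm.
have K0 : 0 <= K.
  have := le_trans (normr_ge0 _) (FK m); rewrite pmulr_lge0//.
  rewrite mulr_gt0// ?ltr_pwDl ?sqr_ge0// normal_pdfE0// mulr_gt0 ?normal_peak_gt0//.
  exact: expR_gt0.
set c := K * ((2 + 4 * s ^+ 2) * normal_peak s).
have c0 : 0 <= c.
  by rewrite mulr_ge0// mulr_ge0 ?normal_peak_ge0// addr_ge0// mulr_ge0// ltW.
apply/cvgrPdist_lt => e e0.
have s40 : 0 < 4 * s ^+ 2 by rewrite mulr_gt0.
have /cvgryPge /(_ (4 * s ^+ 2 * (c / e) + 1)) h := wm.
apply: filterS h => n h; rewrite sub0r normrN.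
apply: le_lt_trans (FK _) _; apply: le_lt_trans (ler_wpM2l K0 (normal_tail _)) _.
rewrite mulrA -/c ltr_pdivrMr; last first.
  by rewrite ltr_pwDl// divr_ge0 ?sqr_ge0// ltW.
rewrite mulrC -ltr_pdivrMr//.
have h1 : 1 <= `|w n - m|.
  by apply: le_trans h; rewrite lerDr mulr_ge0 ?divr_ge0// ltW.
have h2 : `|w n - m| <= (w n - m) ^+ 2 by rewrite -real_normK ?num_real// expr2 ler_peMl.
rewrite -ltrBlDl ltr_pdivlMr//.
have e1 : (c / e - 1) * (4 * s ^+ 2) <= 4 * s ^+ 2 * (c / e).
  by rewrite mulrC ler_wpM2l ?(ltW s40)// gerBl.
apply: le_lt_trans e1 _; apply: lt_le_trans h2; apply: lt_le_trans h.
by rewrite ltrDl.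
Qed.

(** Integration by parts: [- (x - m) pdf] is the derivative of [s ^+ 2 * pdf], and the
    boundary terms vanish at infinity. *)
Lemma Gaussian_Stein G g K : (forall x : R, is_derive x (1 : R) G (g x)) -> continuous g ->
  (forall x, `|g x| <= K) -> (forall x, `|G x| <= K * (1 + `|x - m|)) ->
  \int[P]_x (G x * (x - m)) = s ^+ 2 * \int[P]_x g x.
Proof.
move=> dG cg gK GK.
have K0 : 0 <= K := le_trans (normr_ge0 _) (gK 0).
have cG : continuous G.
  move=> x; apply: differentiable_continuous; apply/derivable1_diffP.
  by have [] := dG x.
have mG : measurable_fun setT G by exact: continuous_measurable_fun.
have mg : measurable_fun setT g by exact: continuous_measurable_fun.
have mGx : measurable_fun setT (fun x => G x * (x - m)).
  by apply: measurable_funM => //; apply: measurable_funB.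
have abs1 (x : R) : `|x - m| <= 1 + (x - m) ^+ 2.
  rewrite -real_normK ?num_real//; set y := `|_|.
  have : 0 <= (y - 1) ^+ 2 by exact: sqr_ge0.
  have : 0 <= y by exact: normr_ge0.
  by rewrite sqrrB1 mulr2n; lra.
have iG : P.-integrable setT (EFin \o (fun x => G x * (x - m))).
  apply: (@normal_integrable _ (2 * K)) => // x; rewrite normrM.
  apply: le_trans (ler_wpM2r (normr_ge0 _) (GK x)) _; rewrite -mulrA.
  rewrite (mulrC 2) -mulrA ler_wpM2l// mulrDl mul1r mulr2n mulrDl mul1r.
  by rewrite lerD// -expr2 real_normK ?num_real// lerDr.
have ig : P.-integrable setT (EFin \o g).
  by apply: (@normal_integrable _ K) => // x; rewrite (le_trans (gK x))// ler_peMr// lerDl sqr_ge0.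
pose F x := s ^+ 2 * (G x * pdf x).
pose f x := s ^+ 2 * (g x * pdf x) - G x * (x - m) * pdf x.
have dF (x : R) : is_derive x (1 : R) F (f x).
  have dp := is_derive_normal_pdf x; have dGx := dG x.
  rewrite /F; apply: is_derive_eq; rewrite /f /GRing.scale/=; field.
  exact: s0.
have cp : continuous pdf by exact: continuous_normal_pdf.
have cf : continuous f.
  move=> x; apply: cvgB; apply: cvgM.
  - exact: cvg_cst.
  - by apply: cvgM; [exact: cg|exact: cp].
  - apply: cvgM; [exact: cG|apply: cvgB; [exact: cvg_id|exact: cvg_cst]].
  - exact: cp.
have mf : measurable_fun setT f by exact: continuous_measurable_fun.
have igp : leb.-integrable setT (fun x => (g x * pdf x)%:E).
  apply: (@normal_integrable_pdf _ K) => // x.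
  by rewrite (le_trans (gK x))// ler_peMr// lerDl sqr_ge0.
have isgp : leb.-integrable setT (fun x => (s ^+ 2 * (g x * pdf x))%:E).
  exact: (@integrableZl _ (measurableTypeR R) R leb setT measurableT (s ^+ 2)
      (fun x => (g x * pdf x)%:E)).
have iGp : leb.-integrable setT (fun x => (G x * (x - m) * pdf x)%:E).
  apply: (@normal_integrable_pdf _ (2 * K)) => // x; rewrite normrM.
  apply: le_trans (ler_wpM2r (normr_ge0 _) (GK x)) _; rewrite -mulrA.
  rewrite (mulrC 2) -mulrA ler_wpM2l// mulrDl mul1r mulr2n mulrDl mul1r.
  by rewrite lerD// -expr2 real_normK ?num_real// lerDr.
have if_ : leb.-integrable setT (EFin \o f).
  exact: (@integrableB _ (measurableTypeR R) R leb setT measurableT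
    (fun x => (s ^+ 2 * (g x * pdf x))%:E) (fun x => (G x * (x - m) * pdf x)%:E)).
suff If0 : (\int[leb]_x (f x)%:E = 0)%E.
  have e1 : (\int[P]_x (G x * (x - m)) = \int[leb]_x (G x * (x - m) * pdf x))%R.
    by rewrite /Rintegral normal_probE.
  have e2 : (\int[P]_x g x = \int[leb]_x (g x * pdf x))%R.
    by rewrite /Rintegral normal_probE.
  have e3 : (\int[leb]_x f x = 0)%R by rewrite /Rintegral If0.
  have := @RintegralB _ (measurableTypeR R) R leb setT _ _ measurableT isgp iGp.
  have := @RintegralZl _ (measurableTypeR R) R leb setT _ (s ^+ 2) measurableT igp.
  rewrite [X in X = _ -> _](_ : _ = \int[leb]_x (s ^+ 2 * (g x * pdf x)))%R// => ->.
  rewrite [X in X = _ -> _](_ : _ = \int[leb]_x (f x))%R// e3 => /esym/eqP.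
  by rewrite subr_eq0 e1 e2 => /eqP.
have ftc n : (\int[leb]_x ((f \_ `[(- n.+1%:R), n.+1%:R]) x)%:E =
    (F n.+1%:R)%:E - (F (- n.+1%:R))%:E)%E.
  have -> : (\int[leb]_x ((f \_ `[(- n.+1%:R), n.+1%:R]) x)%:E =
    \int[leb]_(x in `[(- n.+1%:R)%R, n.+1%:R]) (f x)%:E)%E.
    rewrite [RHS]integral_mkcond; apply: eq_integral => x _.
    by rewrite !patchE; case: ifP.
  apply: continuous_FTC2.
  - by rewrite gtrN.
  - exact: continuous_subspaceT.
  - have cF : continuous F.
      move=> x; apply: differentiable_continuous; apply/derivable1_diffP.
      by have [] := dF x.
    split.
    + by move=> x _; have [] := dF x.
    + by apply: cvg_at_right_filter; exact: cF.
    + by apply: cvg_at_left_filter; exact: cF.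
  - by move=> x _; rewrite derive1E; have [_ ->] := dF x.
have FK x : `|F x| <= s ^+ 2 * K * ((2 + (x - m) ^+ 2) * pdf x).
  rewrite /F normrM (ger0_norm (ltW s2)) -mulrA ler_pM2l// normrM.
  rewrite (ger0_norm (normal_pdf_ge0 _ _ _)) mulrA ler_wpM2r ?normal_pdf_ge0//.
  apply: le_trans (GK x) _; rewrite ler_wpM2l//.
  by have := abs1 x; lra.
have nat_cvg : (fun n => n.+1%:R : R) @ \oo --> +oo%R.
  by rewrite (cvg_shiftS (fun n => n%:R : R)); exact: cvgr_idn.
have c1 : (\int[leb]_x ((f \_ `[(- n.+1%:R), n.+1%:R]) x)%:E)%E @[n --> \oo] --> 0%E.
  under eq_fun do rewrite ftc.
  rewrite (_ : 0%E = (0 - 0)%:E); last by rewrite subr0.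
  under eq_fun do rewrite -EFinB.
  apply: cvg_EFin; first exact: nearW.
  apply: cvgB; apply: (normal_tail_cvg0 FK).
  - apply/cvgryPge => A; have /cvgryPge /(_ (A + `|m|)) := nat_cvg.
    apply: filterS => n h; apply: le_trans (lerB_dist _ _).
    by rewrite ger0_norm// lerBrDr.
  - apply/cvgryPge => A; have /cvgryPge /(_ (A + `|m|)) := nat_cvg.
    apply: filterS => n h; apply: le_trans (lerB_dist _ _).
    by rewrite normrN ger0_norm// lerBrDr.
have c2 : (\int[leb]_x ((f \_ `[(- n.+1%:R), n.+1%:R]) x)%:E)%E @[n --> \oo] -->
   (\int[leb]_x (f x)%:E)%E.
  apply: (@dominated_cvg _ (measurableTypeR R) R leb setT measurableT
    (fun n x => ((f \_ `[(- n.+1%:R), n.+1%:R]) x)%:E) (EFin \o f) (fun x => `|f x|%:E)).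
  - move=> n; apply/measurable_EFinP.
    by apply/measurable_restrict => //; apply: measurable_funTS.
  - move=> x _; apply: cvg_near_cst.
    exists (Num.truncn `|x|).+1 => // n /= xn.
    rewrite patchE mem_set//= in_itv/= -ler_norml.
    apply: ltW; apply: lt_le_trans (truncnS_gt _) _.
    by rewrite ler_nat; exact: leq_trans xn (leqnSn _).
  - by [].
  - exact: integrable_norm if_.
  - move=> n x _; rewrite /= lee_fin patchE; case: ifP => // _.
    by rewrite normr0.
by apply: cvg_unique c2 c1.
Qed.

(** Both cosine and sine solve [h'' = - h]. Differentiating under the integral and
    integrating by parts gives [H' = - s^2 u H] for [H u] the left-hand side. *)
Lemma normal_char_gen (h h1 : R -> R) (u : R) :
  (forall x : R, is_derive x (1 : R) h (h1 x)) ->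
  (forall x : R, is_derive x (1 : R) h1 (- h x)) ->
  (forall x, `|h x| <= 1) -> (forall x, `|h1 x| <= 1) ->
  \int[P]_x h (u * (x - m)) = h 0 * expR (- (u ^+ 2 * s ^+ 2 / 2)).
Proof.
move=> dh dh1 hb h1b.
have chd (k k' : R -> R) : (forall x : R, is_derive x (1 : R) k (k' x)) -> continuous k.
  move=> dk x; apply: differentiable_continuous; apply/derivable1_diffP.
  by have [] := dk x.
have ch := chd _ _ dh; have ch1 := chd _ _ dh1.
have cl (w : R) : continuous (fun x : R => w * (x - m)).
  by move=> x; apply: cvgM; [exact: cvg_cst|apply: cvgB; [exact: cvg_id|exact: cvg_cst]].
have chl w : continuous (fun x : R => h (w * (x - m))).
  by move=> x; apply: continuous_comp; [exact: cl|exact: ch].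
have ch1l w : continuous (fun x : R => h1 (w * (x - m))).
  by move=> x; apply: continuous_comp; [exact: cl|exact: ch1].
have abs1 (x : R) : `|x - m| <= 1 + (x - m) ^+ 2.
  rewrite -real_normK ?num_real//; set y := `|_|.
  have : 0 <= (y - 1) ^+ 2 by exact: sqr_ge0.
  have : 0 <= y by exact: normr_ge0.
  by rewrite sqrrB1 mulr2n; lra.
pose H w := \int[P]_x h (w * (x - m)).
have ih w : P.-integrable setT (EFin \o (fun x => h (w * (x - m)))).
  apply: (@normal_integrable 	_ 1); first exact: continuous_measurable_fun.
  by move=> x; rewrite mul1r (le_trans (hb _))// lerDl sqr_ge0.
have dhw (w x : R) : is_derive w (1 : R) (fun w => h (w * (x - m))) ((x - m) * h1 (w * (x - m))).
  have := dh (w * (x - m)) => dhx.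
  apply: is_derive_eq; rewrite /GRing.scale/=. by ring.
have dH (w : R) : is_derive w (1 : R) H (- (s ^+ 2 * w) * H w).
  have wI : `](w - 1), (w + 1)[%classic w by rewrite /= in_itv/= gtrBl ltrDl ltr01.
  have p1 v x : partial1of2 (fun w x => h (w * (x - m))) v x = (x - m) * h1 (v * (x - m)).
    by rewrite /partial1of2 derive1E; have [_ ->] := dhw v x.
  have dom : P.-integrable setT (EFin \o (fun x => 1 + (x - m) ^+ 2)).
    apply: (@normal_integrable _ 1) => [|x].
      by apply: measurable_funD => //; apply: measurable_funX; exact: measurable_funB.
    by rewrite mul1r ger0_norm// addr_ge0// sqr_ge0.
  have G0 (x : R) : 0 <= 1 + (x - m) ^+ 2 by rewrite addr_ge0// sqr_ge0.
  have pG v x : `]w - 1, w + 1[%classic v -> (setT : set R) x ->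
      `|partial1of2 (fun w x => h (w * (x - m))) v x| <= 1 + (x - m) ^+ 2.
    move=> _ _; rewrite p1 normrM; apply: le_trans (abs1 x).
    by rewrite ler_piMr.
  have dv v x : `]w - 1, w + 1[%classic v -> (setT : set R) x ->
     derivable ((fun w x => h (w * (x - m)))^~ x) v 1.
    by move=> _ _; have [] := dhw v x.
  have D1 := derivable_under_integral measurableT wI (fun v _ => ih v) dv G0 dom pG.
  have D2 := cvg_differentiation_under_integral measurableT wI (fun v _ => ih v) dv G0 dom pG.
  apply: DeriveDef => //.
  rewrite /H -derive1E /derive1; rewrite (cvg_lim _ D2)//.
  under eq_Rintegral do rewrite p1 mulrC.
  rewrite [LHS](@Gaussian_Stein (fun x => h1 (w * (x - m)))
    (fun x => - w * h (w * (x - m))) (1 + `|w|)).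
  - rewrite (@RintegralZl _ (measurableTypeR R) R P setT _ (- w) measurableT (ih w)).
    by rewrite mulrA mulrN.
  - move=> x; have dhx := dh1 (w * (x - m)).
    apply: is_derive_eq; rewrite /GRing.scale/=; ring.
  - by move=> x; apply: cvgM; [exact: cvg_cst|exact: chl].
  - move=> x; rewrite normrM normrN (@le_trans _ _ `|w|)// ?ler_piMr//.
    by rewrite lerDr.
  - move=> x; rewrite (le_trans (h1b _))//.
    rewrite (le_trans (y := 1 * 1)) ?mulr1// -[leLHS]mulr1.
    by rewrite ler_pM ?lerDl.
pose Q w := H w * expR (w ^+ 2 * s ^+ 2 / 2).
have dQ (w : R) : is_derive w (1 : R) Q 0.
  have dHw := dH w.
  by apply: is_derive_eq; rewrite /GRing.scale/=; field.
have := is_derive_0_is_cst u 0 dQ.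
rewrite /Q expr0n/= !mul0r expR0 mulr1 => QE.
have -> : h 0 = H 0.
  rewrite /H; under eq_Rintegral do rewrite mul0r.
  by rewrite Rintegral_cst// [X in fine X]probability_setT/= mulr1.
by rewrite -QE -[RHS]mulrA -expRD subrr expR0 mulr1.
Qed.

Lemma normal_cos (u : R) :
  \int[P]_x cos (u * (x - m)) = expR (- (u ^+ 2 * s ^+ 2 / 2)).
Proof.
rewrite (@normal_char_gen cos (fun x => - sin x) u) ?cos0 ?mul1r//.
- by move=> x; rewrite ler_norml cos_geN1 cos_le1.
- by move=> x; rewrite normrN ler_norml sin_geN1 sin_le1.
Qed.

Lemma normal_sin (u : R) : \int[P]_x sin (u * (x - m)) = 0.
Proof.
rewrite (@normal_char_gen sin cos u) ?sin0 ?mul0r//.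
- by move=> x; rewrite ler_norml sin_geN1 sin_le1.
- by move=> x; rewrite ler_norml cos_geN1 cos_le1.
Qed.

Lemma normal_mean : \int[P]_x (x - m) = 0.
Proof.
transitivity (\int[P]_x (1 * (x - m))).
  by apply: eq_Rintegral => x _; rewrite mul1r.
rewrite [LHS](@Gaussian_Stein (fun=> 1) (fun=> 0) 1).
- by rewrite Rintegral_cst// mul0r mulr0.
- by move=> x; exact: cvg_cst.
- by move=> x; rewrite normr0.
- by move=> x; rewrite mul1r normr1 lerDl.
Qed.

Lemma normal_var : \int[P]_x ((x - m) ^+ 2) = s ^+ 2.
Proof.
under eq_Rintegral do rewrite expr2.
rewrite [LHS](@Gaussian_Stein (fun x => x - m) (fun=> 1) 1).
- by rewrite Rintegral_cst// mul1r [X in fine X]probability_setT/= mulr1.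
- by move=> x; apply: is_derive_eq; rewrite subr0.
- by move=> x; exact: cvg_cst.
- by move=> x; rewrite normr1.
- by move=> x; rewrite mul1r lerDr.
Qed.

End normal_moments.

Section normal_variables.
Context d (X : measurableType d) (R : realType) (P : probability X R).
Implicit Types Y : X -> R.

(** The characteristic function of a normal law with mean [m] and variance [V], where
    [V = 0] is allowed; this form passes to limits without any discussion of
    degenerate laws. *)
Definition normal_chf Y (m V : R) := [/\ measurable_fun setT Y, 0 <= V,
  forall u, \int[P]_x cos (u * (Y x - m)) = expR (- (u ^+ 2 * V / 2)) &
  forall u, \int[P]_x sin (u * (Y x - m)) = 0].

Lemma bounded_integrable Y (K : R) : measurable_fun setT Y -> (forall x, `|Y x| <= K) ->
  P.-integrable setT (EFin \o Y).
Proof.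
move=> mY YK; apply: (@le_integrable _ _ _ P setT measurableT _ (EFin \o cst K)) => //.
- exact/measurable_EFinP.
- by move=> x _; rewrite lee_fin (le_trans (YK x))// ler_norm.
- exact: finite_measure_integrable_cst.
Qed.

Lemma measurable_trig Y (u m : R) : measurable_fun setT Y ->
  measurable_fun setT (fun x => cos (u * (Y x - m))) /\
  measurable_fun setT (fun x => sin (u * (Y x - m))).
Proof.
move=> mY; have h : measurable_fun setT (fun x => u * (Y x - m)).
  by apply: measurable_funM => //; exact: measurable_funB.
split; apply: (measurableT_comp _ h); apply: continuous_measurable_fun.
  exact: continuous_cos.
exact: continuous_sin.
Qed.

Lemma integrable_cos Y (u m : R) : measurable_fun setT Y ->
  P.-integrable setT (EFin \o (fun x => cos (u * (Y x - m)))).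
Proof.
move=> mY; apply: (@bounded_integrable _ 1); first by case: (measurable_trig u m mY).
by move=> x; rewrite ler_norml cos_geN1 cos_le1.
Qed.

Lemma integrable_sin Y (u m : R) : measurable_fun setT Y ->
  P.-integrable setT (EFin \o (fun x => sin (u * (Y x - m)))).
Proof.
move=> mY; apply: (@bounded_integrable _ 1); first by case: (measurable_trig u m mY).
by move=> x; rewrite ler_norml sin_geN1 sin_le1.
Qed.

(** The fourth difference of the characteristic function at 0 with step [u], divided by
    [u ^ 4], is the expectation of [((2 - 2 cos (u (Y - m))) / u ^ 2) ^ 2], which tends to
    [(Y - m) ^ 4] as [u] tends to 0. Fatou's lemma turns a bound for it into a bound
    for the moment. *)
Lemma normal_moment4 Y m V : normal_chf Y m V ->
  (\int[P]_x ((Y x - m) ^+ 4)%:E <= (3 * V ^+ 2)%:E)%E.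
Proof.
move=> [mY V0 cE _].
have mYm : measurable_fun setT (fun x => Y x - m) by exact: measurable_funB.
pose u (k : nat) : R := k.+1%:R^-1.
have u0 k : 0 < u k by rewrite invr_gt0.
pose g k x := ((2 - 2 * cos (u k * (Y x - m))) / u k ^+ 2) ^+ 2.
have mc k : measurable_fun setT (fun x => cos (u k * (Y x - m))).
  by case: (measurable_trig (u k) m mY).
have mg k : measurable_fun setT (g k).
  apply: measurable_funX; apply: measurable_funM => //; apply: measurable_funB => //.
  exact: measurable_funM.
apply: (@fatou_le _ X R P setT measurableT (fun k x => (g k x)%:E)).
- by move=> k; exact/measurable_EFinP.
- by move=> k x _; rewrite lee_fin sqr_ge0.
- by apply/measurable_EFinP; exact: measurable_funX.
- by move=> x _; rewrite lee_fin (exprM _ 2 2) sqr_ge0.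
- apply: aeW => x _; apply: cvg_EFin; first exact: nearW.
  rewrite (exprM _ 2 2) /g; set y := Y x - m.
  under eq_fun => k.
    rewrite (_ : (2 - 2 * cos (u k * y)) / u k ^+ 2 = (2 * ((u k)^-1 * sin (u k * (y / 2)))) ^+ 2).
      over.
    have -> : u k * y = u k * (y / 2) *+ 2 by field.
    rewrite cos_mulr2n cos2sin2; field; exact: lt0r_neq0.
  apply: (@cvg_comp _ _ _ _ (fun z : R => z ^+ 2)); last exact: exprn_continuous.
  apply: (@cvg_comp _ _ _ _ (fun z : R => z ^+ 2)); last exact: exprn_continuous.
  have ds : is_derive (0 : R) (1 : R) (fun t => sin (t * (y / 2))) (y / 2).
    by apply: is_derive_eq; rewrite mul0r cos0 /GRing.scale/= mul1r mulr1 mulr0 add0r.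
  have [ds1 ds2] := ds.
  have : h^-1 *: (sin (h * (y / 2)) - sin (0 * (y / 2))) @[h --> (0 : R)^'] --> y / 2.
    have : h^-1 *: (sin ((h + 0) * (y / 2)) - sin (0 * (y / 2))) @[h --> (0 : R)^'] --> y / 2.
      rewrite -[X in _ --> X]ds2 /derive; apply: cvg_trans ds1; apply: near_eq_cvg.
      by apply: nearW => h; rewrite /= [h *: _]mulr1.
    by under eq_fun do rewrite addr0.
  move=> /cvgr_dnbhsP /(_ u) h.
  rewrite (_ : nbhs y = nbhs (2 * (y / 2))); last by congr nbhs; field.
  apply: cvgM; first exact: cvg_cst.
  have : (u n)^-1 *: (sin (u n * (y / 2)) - sin (0 * (y / 2))) @[n --> \oo] --> y / 2.
    apply: h; split; first by move=> n; rewrite gt_eqF.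
    exact: cvg_harmonic.
  by under eq_fun do rewrite mul0r sin0 subr0.
- apply: nearW => k.
  have gE x : g k x = (u k ^+ 4)^-1 * (6 - 8 * cos (u k * (Y x - m)) + 2 * cos ((2 * u k) * (Y x - m))).
    rewrite /g (_ : 2 * u k * (Y x - m) = u k * (Y x - m) + u k * (Y x - m)); last by ring.
    rewrite cosD; have := cos2Dsin2 (u k * (Y x - m)); set c := cos _; set s := sin _ => e.
    have -> : s * s = 1 - c * c by rewrite -!expr2 -e; ring.
    field. exact: lt0r_neq0.
  have ic := @integrable_cos Y (u k) m mY.
  have ic2 := @integrable_cos Y (2 * u k) m mY.
  have i2 : P.-integrable setT (EFin \o (fun x => 2 * cos ((2 * u k) * (Y x - m)))).
    by have := @integrableZl _ X R P setT measurableT 2 _ ic2.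
  have i3 : P.-integrable setT (EFin \o (fun x => 8 * cos (u k * (Y x - m)))).
    by have := @integrableZl _ X R P setT measurableT 8 _ ic.
  have i6 : P.-integrable setT (EFin \o (fun=> 6)).
    exact: finite_measure_integrable_cst.
  have i1 : P.-integrable setT (EFin \o (fun x => 6 - 8 * cos (u k * (Y x - m)))).
    exact: (@integrableB _ X R P setT measurableT _ _ i6 i3).
  have i12 : P.-integrable setT (EFin \o (fun x => 6 - 8 * cos (u k * (Y x - m)) +
      2 * cos ((2 * u k) * (Y x - m)))).
    exact: (@integrableD _ X R P setT measurableT _ _ i1 i2).
  have ig : P.-integrable setT (EFin \o g k).
    have := @integrableZl _ X R P setT measurableT (u k ^+ 4)^-1 _ i12.
    by apply: eq_integrable => // x _; rewrite /= gE.
  have -> : (\int[P]_x (g k x)%:E = (\int[P]_x g k x)%R%:E)%E.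
    by rewrite /Rintegral fineK//; exact: (integrable_fin_num measurableT ig).
  rewrite lee_fin; under eq_Rintegral do rewrite gE.
  rewrite RintegralZl//.
  rewrite RintegralD// RintegralB//.
  rewrite !RintegralZl// Rintegral_cst// [X in fine X]probability_setT !cE/= mulr1.
  set q := expR (- (u k ^+ 2 * V / 2)).
  have -> : expR (- ((2 * u k) ^+ 2 * V / 2)) = q ^+ 4.
    by rewrite /q -expRM_natl; congr expR; ring.
  have u40 : 0 < u k ^+ 4 by rewrite exprn_gt0.
  rewrite mulrC ler_pdivrMr//.
  have q0 : 0 <= q <= 1.
    by rewrite expR_ge0 -expR0 ler_expR oppr_le0 divr_ge0// mulr_ge0// sqr_ge0.
  have qV : (1 - q) <= u k ^+ 2 * V / 2.
    by have := expR_ge1Dx (- (u k ^+ 2 * V / 2)); rewrite -/q; lra.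
  have q2 : (1 - q) ^+ 2 <= (u k ^+ 2 * V / 2) ^+ 2.
    have q1 : 0 <= 1 - q by rewrite subr_ge0; case/andP: q0.
    by rewrite ler_sqr// nnegrE (le_trans q1).
  apply: (@le_trans _ _ (12 * (1 - q) ^+ 2)).
    have -> : 6 - 8 * q + 2 * q ^+ 4 = (2 * q ^+ 2 + 4 * q + 6) * (1 - q) ^+ 2 by ring.
    rewrite ler_wpM2r ?sqr_ge0//.
    have : q ^+ 2 <= 1 by rewrite expr_le1//; case/andP: q0.
    by case/andP: q0 => _; lra.
  have -> : 3 * V ^+ 2 * u k ^+ 4 = 12 * (u k ^+ 2 * V / 2) ^+ 2 by field.
  by rewrite ler_pM2l.
Qed.

(** Characteristic functions converge by dominated convergence. *)
Lemma normal_chf_limit (Y_ : nat -> X -> R) (m_ V_ : nat -> R) Y m V :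
  (forall n, normal_chf (Y_ n) (m_ n) (V_ n)) -> measurable_fun setT Y ->
  {ae P, forall x, Y_ n x @[n --> \oo] --> Y x} ->
  m_ n @[n --> \oo] --> m -> V_ n @[n --> \oo] --> V -> normal_chf Y m V.
Proof.
move=> chf mY YY mm VV.
have V0 : 0 <= V.
  rewrite -(cvg_lim _ VV)//; apply: limr_ge; first by apply/cvg_ex; exists V.
  by apply: nearW => n; case: (chf n).
have main (h : R -> R) (u : R) : continuous h -> (forall x, `|h x| <= 1) ->
    \int[P]_x h (u * (Y_ n x - m_ n)) @[n --> \oo] --> \int[P]_x h (u * (Y x - m)).
  move=> ch hb.
  have mh : measurable_fun setT h by exact: continuous_measurable_fun.
  have mm' (Z : X -> R) k : measurable_fun setT Z -> measurable_fun setT (fun x => h (u * (Z x - k))).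
    move=> mZ; apply: (measurableT_comp mh); apply: measurable_funM => //.
    exact: measurable_funB.
  have mYn n : measurable_fun setT (Y_ n) by case: (chf n).
  apply: fine_cvg; rewrite fineK; last first.
    apply: (integrable_fin_num measurableT).
    by apply: (@bounded_integrable (fun x => h (u * (Y x - m))) 1) => //; exact: mm'.
  have := @dominated_convergence _ X R P setT measurableT
    (fun n x => (h (u * (Y_ n x - m_ n)))%:E) (fun x => (h (u * (Y x - m)))%:E) (cst 1%:E).
  case.
  - by move=> n; apply/measurable_EFinP; exact: mm'.
  - by apply/measurable_EFinP; exact: mm'.
  - apply: filterS YY => x Yx _; apply: cvg_EFin; first exact: nearW.
    apply: (@cvg_comp _ _ _ (fun n => u * (Y_ n x - m_ n)) h); last exact: ch.
    by apply: cvgM; [exact: cvg_cst|exact: cvgB].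
  - exact: finite_measure_integrable_cst.
  - by apply: aeW => x n _; rewrite lee_fin.
  - by [].
split => // u.
- have h1 := main cos u (@continuous_cos R) (@cos_max R).
  apply: (cvg_unique _ h1) => //=.
  under eq_fun => n do (have [_ _ -> _] := chf n).
  apply: continuous_cvg; first exact: continuous_expR.
  by apply: cvgN; apply: cvgM; [apply: cvgM; [exact: cvg_cst|]|exact: cvg_cst].
- have h1 := main sin u (@continuous_sin R) (@sin_max R).
  apply: (cvg_unique _ h1) => //=.
  under eq_fun => n do (have [_ _ _ ->] := chf n).
  exact: cvg_cst.
Qed.

(** The law determines all expectations of functions of [Y]: they are computed under
    [normal_prob], or at the single atom if the law is a Dirac mass. *)
Lemma gaussian_law_chf Y : measurable_fun setT Y ->
  gaussian_law (fun B => P (Y @^-1` B)) ->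
  exists m V, [/\ normal_chf Y m V, L2 P setT Y, \int[P]_x Y x = m &
    ip P setT (fun x => Y x - m) (fun x => Y x - m) = V].
Proof.
move=> mY [m [s [[s0 QE]|QE]]]; exists m.
- exists (s ^+ 2).
  have mYf (g : R -> R) : measurable_fun setT g -> measurable_fun setT (g \o Y).
    by move=> mg; exact: measurableT_comp mg mY.
  have pf (g : R -> \bar R) : measurable_fun setT g -> (forall x, 0 <= g x)%E ->
      (\int[P]_x g (Y x) = \int[normal_prob m s]_x g x)%E.
    move=> mg g0.
    rewrite -(@ge0_integral_pushforward _ _ X (measurableTypeR R) R Y mY P setT g)//.
    apply: eq_measure_integral => A mA _.
    exact: QE.
  have pfR (g : R -> R) K : measurable_fun setT g ->
      (forall x, `|g x| <= K * (1 + (x - m) ^+ 2)) ->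
      \int[P]_x g (Y x) = \int[normal_prob m s]_x g x.
    move=> mg gK; rewrite /Rintegral integralE [in RHS]integralE; congr fine.
    have mg' : measurable_fun setT (EFin \o g) by exact/measurable_EFinP.
    congr (_ - _)%E.
      have h x : (0 <= (EFin \o g)^\+ x)%E by exact: funepos_ge0.
      have e := pf _ (measurable_funepos mg') h.
      transitivity (\int[P]_x ((EFin \o g)^\+ (Y x)))%E; last first.
        exact: e.
      by apply: eq_integral => x _; rewrite !funeposE.
    have h x : (0 <= (EFin \o g)^\- x)%E by exact: funeneg_ge0.
    have e := pf _ (measurable_funeneg mg') h.
    transitivity (\int[P]_x ((EFin \o g)^\- (Y x)))%E; last first.
      exact: e.
    by apply: eq_integral => x _; rewrite !funenegE.
  have cmg (h : R -> R) u : continuous h -> measurable_fun setT (fun x : R => h (u * (x - m))).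
    move=> ch; apply: (measurableT_comp (continuous_measurable_fun ch)).
    by apply: measurable_funM => //; exact: measurable_funB.
  have one (x : R) : 1 <= 1 * (1 + (x - m) ^+ 2) by rewrite mul1r lerDl sqr_ge0.
  have abs1 (x : R) : `|x - m| <= 1 * (1 + (x - m) ^+ 2).
    rewrite -real_normK ?num_real//; set y := `|_|.
    have : 0 <= (y - 1) ^+ 2 by exact: sqr_ge0.
    have : 0 <= y by exact: normr_ge0.
    by rewrite sqrrB1 mulr2n; lra.
  have var := pfR (fun x => (x - m) ^+ 2) 1.
  have L2Y : L2 P setT (fun x => Y x - m).
    split; first exact: measurable_funB.
    rewrite (pf (fun x => ((x - m) ^+ 2)%:E)).
    + have h : (normal_prob m s).-integrable setT (EFin \o (fun x => (x - m) ^+ 2)).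
        apply: (@normal_integrable _ _ _ s0 _ 1).
          by apply: measurable_funX; exact: measurable_funB.
        by move=> x; rewrite mul1r ger0_norm ?sqr_ge0// lerDr.
      move/integrableP : h => [_]; apply: le_lt_trans; apply: ge0_le_integral => //=.
      * by move=> x _; rewrite lee_fin sqr_ge0.
      * by apply/measurable_EFinP; apply: measurable_funX; exact: measurable_funB.
      * apply/measurable_EFinP; apply: measurableT_comp => //.
        by apply: measurable_funX; exact: measurable_funB.
      * by move=> x _; rewrite lee_fin ler_norm.
    + by apply/measurable_EFinP; apply: measurable_funX; exact: measurable_funB.
    + by move=> x; rewrite lee_fin sqr_ge0.
  have L2c : L2 P setT (cst 1).
    split => //; rewrite (_ : (fun x => _) = cst 1%E); last first.
      by apply/funext => x; rewrite /= expr1n.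
    by rewrite integral_cst// [X in (_ * X)%E]probability_setT mule1 ltry.
  have L2Y' : L2 P setT Y.
    have := L2_lin measurableT m L2c L2Y.
    by under eq_fun do rewrite /= mulr1 subrKC.
  split => //.
  + split => //; first exact: sqr_ge0.
    * move=> u; rewrite -(normal_cos m s0).
      apply: (pfR (fun x => cos (u * (x - m))) 1); first exact: cmg (@continuous_cos R).
      by move=> x; exact: le_trans (cos_max _) (one x).
    * move=> u; rewrite -(normal_sin m s0 u).
      apply: (pfR (fun x => sin (u * (x - m))) 1); first exact: cmg (@continuous_sin R).
      by move=> x; exact: le_trans (sin_max _) (one x).
  + have i0 : \int[P]_x (Y x - m) = 0.
      by rewrite (pfR (fun x => x - m) 1)//; [exact: normal_mean|exact: measurable_funB].
    have := ip_lin measurableT m L2c L2Y L2c; rewrite /ip /=.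
    under [X in X = _ -> _]eq_Rintegral do rewrite !mulr1 subrKC.
    move=> ->; under [X in _ + X]eq_Rintegral do rewrite mulr1.
    rewrite i0 addr0 Rintegral_cst// [X in _ * (_ * fine X)]probability_setT/=.
    by rewrite !mulr1.
  + rewrite /ip; under eq_Rintegral do rewrite -expr2.
    rewrite (pfR (fun x => (x - m) ^+ 2) 1) ?normal_var//.
      by apply: measurable_funX; exact: measurable_funB.
    by move=> x; rewrite mul1r ger0_norm ?sqr_ge0// lerDr.
- exists 0.
  have Ym : {ae P, forall x, Y x = m}.
    exists (Y @^-1` [set~ m]); split.
    + rewrite -[X in measurable X]setTI; apply: mY => //.
      by apply: measurableC.
    + have := QE [set~ m] (measurableC (measurable_set1 m)).
      by rewrite diracE memNset//= => ->.
    + by move=> x /= /eqP h; apply/eqP.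
  have eqm (g : R -> R) : measurable_fun setT g ->
      (\int[P]_x (g (Y x))%:E = (g m)%:E)%E.
    move=> mg; transitivity (\int[P]_x (cst (g m)%:E) x)%E.
      apply: ae_eq_integral => //.
      + by apply/measurable_EFinP; exact: measurableT_comp mg mY.
      + by apply: filterS Ym => x Yx _; rewrite /= Yx.
    by rewrite integral_cst// [X in (_ * X)%E]probability_setT mule1.
  have cmg (h : R -> R) u : continuous h -> measurable_fun setT (fun x : R => h (u * (x - m))).
    move=> ch; apply: (measurableT_comp (continuous_measurable_fun ch)).
    by apply: measurable_funM => //; exact: measurable_funB.
  split.
  + split => // u.
    * rewrite /Rintegral (eqm (fun x => cos (u * (x - m)))) ?subrr ?mulr0 ?cos0/=.
        by rewrite mul0r oppr0 expR0.
      exact: cmg (@continuous_cos R).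
    * rewrite /Rintegral (eqm (fun x => sin (u * (x - m)))) ?subrr ?mulr0 ?sin0//.
      exact: cmg (@continuous_sin R).
  + split => //; rewrite (eqm (fun x => x ^+ 2)) ?ltry//.
  + by rewrite /Rintegral (eqm id).
  + rewrite /ip /Rintegral (eqm (fun x => (x - m) * (x - m))) ?subrr ?mulr0//.
    by apply: measurable_funM; exact: measurable_funB.
Qed.

End normal_variables.

(** * A maximal inequality *)

Section maximal_inequality.
Context d (X : measurableType d) (R : realType) (P : {measure set X -> \bar R}).
Variables (S : nat -> X -> R) (tau : nat -> R) (C : R).
Hypothesis mS : forall n, measurable_fun setT (S n).
Hypothesis tauN : {homo tau : n m / (n <= m)%N >-> n <= m}.
Hypothesis C0 : 0 <= C.
Hypothesis SC : forall n m, (n <= m)%N ->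
  (\int[P]_x ((S m x - S n x) ^+ 4)%:E <= (C * (tau m - tau n) ^+ 2)%:E)%E.

Definition increment_max n m x : R := \big[Num.max/0]_(n <= k < m.+1) (S k x - S n x) ^+ 4.

Lemma increment_max_ge0 n m x : 0 <= increment_max n m x.
Proof. by rewrite /increment_max; elim/big_rec: _ => // i y _ y0; rewrite le_max y0 orbT. Qed.

Lemma increment_le_max n m k x : (n <= k <= m)%N ->
  (S k x - S n x) ^+ 4 <= increment_max n m x.
Proof.
move=> nkm; apply: (@le_bigmax_seq _ _ _ _ 0 k xpredT) => //.
by rewrite mem_index_iota ltnS.
Qed.

Lemma increment_max_le n m x (B : R) : 0 <= B ->
  (forall k, (n <= k <= m)%N -> (S k x - S n x) ^+ 4 <= B) -> increment_max n m x <= B.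
Proof.
move=> B0 H; rewrite /increment_max big_seq; elim/big_ind: _ => //.
  by move=> y z yB zB; rewrite ge_max yB.
by move=> k; rewrite mem_index_iota ltnS; exact: H.
Qed.

Lemma measurable_increment_max n m : measurable_fun setT (increment_max n m).
Proof.
rewrite /increment_max; elim: (index_iota _ _) => [|k s IH].
  by under eq_fun do rewrite big_nil; exact: measurable_cst.
under eq_fun do rewrite big_cons.
by apply: measurable_maxr => //; apply: measurable_funX; exact: measurable_funB.
Qed.

Lemma square_split (a c : R) : (a + c) ^+ 2 <= 5 / 4 * a ^+ 2 + 5 * c ^+ 2.
Proof.
have : 0 <= (a - 4 * c) ^+ 2 by exact: sqr_ge0.
rewrite (_ : (a - 4 * c) ^+ 2 = 4 * (5 / 4 * a ^+ 2 + 5 * c ^+ 2 - (a + c) ^+ 2)); last by field.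
by rewrite pmulr_rge0// subr_ge0.
Qed.

(* The factor that [square_split], applied twice, puts in front of the second term;
   as a power it is not computed. *)
Let kappa : R := 5 ^+ 3.
Let kappa0 : 0 <= kappa. Proof. by rewrite exprn_ge0. Qed.

Lemma fourth_power_split (a c : R) : (a + c) ^+ 4 <= 2 * a ^+ 4 + kappa * c ^+ 4.
Proof.
rewrite !(exprM _ 2 2).
have h := square_split a c.
apply: (@le_trans _ _ ((5 / 4 * a ^+ 2 + 5 * c ^+ 2) ^+ 2)).
  by rewrite ler_sqr ?nnegrE ?sqr_ge0// (le_trans _ h)// sqr_ge0.
apply: le_trans (square_split _ _) _; rewrite /kappa.
apply: lerD; last first.
  by rewrite (_ : 5 ^+ 3 * _ = 5 * (5 * c ^+ 2) ^+ 2)//; ring.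
rewrite exprMn mulrA ler_wpM2r ?sqr_ge0// -subr_ge0.
by rewrite (_ : _ - _ = 3 / 64)//; field.
Qed.

(** The last index at which at most half of the mass has been spent. *)
Lemma half_mass n m : (n < m)%N -> exists h, [/\ (n <= h < m)%N,
  tau h - tau n <= (tau m - tau n) / 2 & tau m - tau h.+1 <= (tau m - tau n) / 2].
Proof.
move=> nm; pose Q k := ((n <= k < m)%N && (tau k - tau n <= (tau m - tau n) / 2)).
have exQ : exists k, Q k.
  exists n; rewrite /Q leqnn nm subrr divr_ge0// subr_ge0; apply: tauN; exact: ltnW.
have ubQ k : Q k -> (k <= m)%N by move=> /andP[/andP[_ /ltnW]].
case: (ex_maxnP exQ ubQ) => h /andP[hnm hQ] hmax; exists h; split => //.
have /andP[nh hm] := hnm.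
have [e|hm'] := eqVneq h.+1 m.
  rewrite e subrr divr_ge0// subr_ge0; apply: tauN; exact: ltnW.
have hm1 : (h.+1 < m)%N by rewrite ltn_neqAle hm'.
have : ~~ Q h.+1 by apply/negP => /hmax; rewrite ltnn.
rewrite /Q hm1 (leqW nh)/= -ltNge; lra.
Qed.

(** Splitting the index range into two parts of at most half the mass and one
    single step makes the constant reproduce itself: 1/4 + 2/4 < 1. *)
Lemma maximal_inequality n m : (n <= m)%N ->
  (\int[P]_x (increment_max n m x)%:E <= (4 * kappa * C * (tau m - tau n) ^+ 2)%:E)%E.
Proof.
have [k] := ubnP (m - n)%N; elim: k n m => // k IH n m mnk nm.
have [e|] := eqVneq n m.
  rewrite e integral0_eq ?subrr ?expr0n/= ?mulr0// => x _.
  apply/eqP; rewrite eqe eq_le increment_max_ge0 andbT.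
  apply: increment_max_le => // j; rewrite -eqn_leq => /eqP <-.
  by rewrite subrr expr0n.
move=> nem; have {nem} nltm : (n < m)%N by rewrite ltn_neqAle nem.
have [h [/andP[nh hm] h1 h2]] := half_mass nltm.
set U := tau m - tau n.
have mI := measurable_increment_max.
have mD i j : measurable_fun setT (fun x => ((S i x - S j x) ^+ 4)%:E).
  by apply/measurable_EFinP; apply: measurable_funX; exact: measurable_funB.
have pw x : increment_max n m x <= increment_max n h x + 2 * increment_max h.+1 m x +
    kappa * (S h.+1 x - S n x) ^+ 4.
  have q0 : 0 <= (S h.+1 x - S n x) ^+ 4 by rewrite (exprM _ 2 2) sqr_ge0.
  have kq0 := mulr_ge0 kappa0 q0; have i0 := increment_max_ge0 n h x; have j0 := increment_max_ge0 h.+1 m x.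
  apply: increment_max_le => [|j /andP[nj jm]]; first by lra.
  have [jh|hj] := leqP j h.
    by have := @increment_le_max n h j x; rewrite nj jh => /(_ isT); lra.
  have := @increment_le_max h.+1 m j x; rewrite hj jm => /(_ isT) H.
  have := fourth_power_split (S j x - S h.+1 x) (S h.+1 x - S n x).
  by rewrite addrA subrK; lra.
apply: (@le_trans _ _ (\int[P]_x ((increment_max n h x)%:E +
    2%:E * (increment_max h.+1 m x)%:E + kappa%:E * ((S h.+1 x - S n x) ^+ 4)%:E))%E).
  apply: ge0_le_integral => //.
  - by move=> x _; rewrite lee_fin increment_max_ge0.
  - by apply/measurable_EFinP.
  - apply: emeasurable_funD; [apply: emeasurable_funD|].
    + by apply/measurable_EFinP.
    + by apply: measurable_funeM; apply/measurable_EFinP.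
    + exact: measurable_funeM.
  - by move=> x _; rewrite -!EFinM -!EFinD lee_fin.
rewrite ge0_integralD//; first last.
- exact: measurable_funeM.
- by move=> x _; rewrite mule_ge0// lee_fin (exprM _ 2 2) sqr_ge0.
- apply: emeasurable_funD; [by apply/measurable_EFinP|apply: measurable_funeM].
  by apply/measurable_EFinP.
- by move=> x _; rewrite adde_ge0 ?mule_ge0// lee_fin increment_max_ge0.
rewrite ge0_integralD//; first last.
- by apply: measurable_funeM; apply/measurable_EFinP.
- by move=> x _; rewrite mule_ge0// lee_fin increment_max_ge0.
- by apply/measurable_EFinP.
- by move=> x _; rewrite lee_fin increment_max_ge0.
rewrite !ge0_integralZl//; first last.
- by move=> x _; rewrite lee_fin increment_max_ge0.
- by apply/measurable_EFinP.
- by move=> x _; rewrite lee_fin (exprM _ 2 2) sqr_ge0.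
have I1 := IH n h; have I2 := IH h.+1 m; have I3 := @SC n h.+1 (leqW nh).
have {}I1 := I1 (leq_trans (ltn_sub2r nltm hm) (ltnSE mnk)) nh.
have {}I2 : (\int[P]_x (increment_max h.+1 m x)%:E <= (4 * kappa * C * (tau m - tau h.+1) ^+ 2)%:E)%E.
  apply: I2 => //; rewrite ltnS in mnk; apply: leq_trans mnk.
  by rewrite ltn_sub2l.
have sq (p : R) : 0 <= p -> p <= U / 2 -> p ^+ 2 <= U ^+ 2 / 4.
  move=> p0 pU; have -> : U ^+ 2 / 4 = (U / 2) ^+ 2 by field.
  by rewrite ler_sqr// nnegrE (le_trans p0).
have s1 : (tau h - tau n) ^+ 2 <= U ^+ 2 / 4 by rewrite sq// subr_ge0 tauN.
have s2 : (tau m - tau h.+1) ^+ 2 <= U ^+ 2 / 4 by rewrite sq// subr_ge0 tauN.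
have s3 : (tau h.+1 - tau n) ^+ 2 <= U ^+ 2.
  rewrite ler_sqr ?nnegrE ?subr_ge0 ?tauN ?lerB ?(leqW nh)//.
  exact: tauN.
apply: (@le_trans _ _ ((4 * kappa * C * (U ^+ 2 / 4))%:E + 2%:E * (4 * kappa * C * (U ^+ 2 / 4))%:E +
   kappa%:E * (C * U ^+ 2)%:E)%E).
  have C5 : 0 <= 4 * kappa * C by rewrite !mulr_ge0.
  apply: leeD; [apply: leeD|].
  - by apply: le_trans I1 _; rewrite lee_fin ler_wpM2l.
  - apply: lee_wpmul2l; first by rewrite lee_fin.
    by apply: le_trans I2 _; rewrite lee_fin ler_wpM2l.
  - apply: lee_wpmul2l; first by rewrite lee_fin.
    by apply: le_trans I3 _; rewrite lee_fin ler_wpM2l.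
rewrite -!EFinM -!EFinD lee_fin le_eqVlt; apply/orP; left; apply/eqP; by field.
Qed.

Hypothesis tau_cvg : cvgn tau.

(** The expectation of the supremum of the fourth powers of the increments after [N]
    tends to 0 with [N]. These suprema need not decrease in [N], so their infimum over [N] is
    used: it has expectation 0, and where it vanishes the sequence is Cauchy. *)
Lemma increments_cvg : {ae P, forall x, cvgn (fun n => S n x)}.
Proof.
pose Z N x := ereal_sup (range (fun m => (increment_max N m x)%:E)).
have Zlim N x : (increment_max N m x)%:E @[m --> \oo] --> Z N x.
  apply: ereal_nondecreasing_cvgn; apply/nondecreasing_seqP => m; rewrite lee_fin.
  apply: increment_max_le; first exact: increment_max_ge0.
  by move=> k /andP[Nk km]; apply: increment_le_max; rewrite Nk leqW.
have mZ N : measurable_fun setT (Z N).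
  apply: (emeasurable_fun_cvg (fun m x => (increment_max N m x)%:E)) => [m|x _].
    by apply/measurable_EFinP; exact: measurable_increment_max.
  exact: Zlim.
have Z0 N x : (0 <= Z N x)%E.
  apply: (@le_trans _ _ (increment_max N 0 x)%:E); first by rewrite lee_fin increment_max_ge0.
  by apply: ereal_sup_ubound; exists 0%N.
have ZC N : (\int[P]_x Z N x <= (4 * kappa * C * (limn tau - tau N) ^+ 2)%:E)%E.
  apply: (@fatou_le _ X R P setT measurableT (fun m x => (increment_max N m x)%:E)) => //.
  - by move=> m; apply/measurable_EFinP; exact: measurable_increment_max.
  - by move=> m x _; rewrite lee_fin increment_max_ge0.
  - by apply: aeW => x _; exact: Zlim.
  - exists N => // m /= Nm; apply: le_trans (maximal_inequality Nm) _.
    rewrite lee_fin ler_wpM2l//; first by rewrite !mulr_ge0.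
    have tl : tau m <= limn tau by apply: nondecreasing_cvgn_le.
    by rewrite ler_sqr ?nnegrE ?subr_ge0 ?tauN ?lerB// (le_trans _ tl)// tauN.
pose G x := einfs (fun N => Z N x) 0%N.
have mG : measurable_fun setT G by apply: measurable_fun_einfs.
have GZ N x : (G x <= Z N x)%E by apply: ereal_inf_lbound; exists N.
have G0 x : (0 <= G x)%E by apply: le_ereal_inf_tmp => _ [N _ <-].
have intG : (\int[P]_x G x = 0)%E.
  apply/eqP; rewrite eq_le integral_ge0// andbT.
  have lim0 : (4 * kappa * C * (limn tau - tau N) ^+ 2)%:E @[N --> \oo] --> 0%E.
    apply: cvg_EFin; first exact: nearW.
    rewrite [X in _ --> X](_ : 0 = 4 * kappa * C * (limn tau - limn tau) ^+ 2); last first.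
      by rewrite subrr expr0n mulr0.
    apply: cvgM; first exact: cvg_cst.
    apply: (@cvg_comp _ _ _ (fun N => limn tau - tau N) (fun z : R => z ^+ 2)).
      by apply: cvgB; [exact: cvg_cst|exact: tau_cvg].
    exact: exprn_continuous.
  rewrite -(cvg_lim _ lim0)//; apply: lime_ge; first by apply/cvg_ex; exists 0%E.
  apply: nearW => N; apply: le_trans (ZC N).
  by apply: ge0_le_integral.
have [Q [mQ Q0 HQ]] : {ae P, forall x, setT x -> G x = 0%E}.
  apply/ae_eq_integral_abs => //.
  by rewrite -intG; apply: eq_integral => x _; rewrite gee0_abs.
exists Q; split => // x /= ncv; apply: HQ => /= /(_ I) Gx; apply: ncv.
apply/cauchy_cvgP/cauchy_exP => e e0.
have e40 : 0 < e ^+ 4 by rewrite exprn_gt0.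
have [N ZN] : exists N, (Z N x < (e ^+ 4)%:E)%E.
  apply: contrapT => /forallNP H.
  have : ((e ^+ 4)%:E <= G x)%E.
    by apply: le_ereal_inf_tmp => _ [N _ <-]; rewrite leNgt; apply/negP/H.
  by rewrite Gx lee_fin leNgt e40.
exists (S N x); exists N => // k /= Nk; rewrite /ball /= distrC.
have h : (S k x - S N x) ^+ 4 < e ^+ 4.
  rewrite -lte_fin; apply: le_lt_trans ZN; apply: (@le_trans _ _ (increment_max N k x)%:E).
    by rewrite lee_fin; apply: increment_le_max; rewrite Nk leqnn.
  by apply: ereal_sup_ubound; exists k.
rewrite -(@ltr_pXn2r _ 4%N) ?nnegrE ?normr_ge0 ?(ltW e0)// -normrX.
by rewrite ger0_norm// (exprM _ 2 2) sqr_ge0.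
Qed.

End maximal_inequality.

(** * Integrals of functions of bounded variation under the path measure *)

Lemma measurable_rays d (X : measurableType d) (R : realType) (f : X -> R) :
  (forall c, measurable [set x | c < f x]) -> measurable_fun setT f.
Proof.
move=> H; apply: (measurability _ (RGenOInfty.measurableE R)).
move=> _ [_ [c ->] <-]; rewrite setTI; have := H c; congr measurable.
by apply/seteqP; split => x /=; rewrite in_itv/= andbT.
Qed.

Section path_measurability.
Context (R : realType) (T : R).
Hypothesis T0 : 0 < T.
Implicit Types x y : Cab T.

Lemma Cab_cts x : {within `[0, T], continuous x}.
Proof. by have /asboolP[] := Cab_funP x. Qed.

Lemma Cab_outside x t : ~ (0 <= t <= T) -> x t = 0.
Proof. by have /asboolP[_ _ H] := Cab_funP x; move=> h; apply: H; rewrite /= in_itv. Qed.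

Lemma supnorm_ge x t : `|x t| <= supnorm x.
Proof.
suff H s : 0 <= s <= T -> `|x s| <= supnorm x.
  have [t01|nt] := boolP (0 <= t <= T); first exact: H.
  rewrite Cab_outside ?normr0; last exact/negP.
  by apply: le_trans (normr_ge0 (x 0)) (H 0 _); rewrite lexx ltW.
move=> s01; apply: ub_le_sup; last by exists s => //=; rewrite in_itv.
have [M HM] : exists M, forall t, 0 <= t <= T -> `|x t| <= M.
  have cx : {within `[0, T], continuous (fun t => `|x t|)}.
      by move=> u; apply: cvg_norm; exact: Cab_cts.
  have [c _ cM] := EVT_max (ltW T0) cx.
  by exists `|x c| => u u0; apply: cM; rewrite in_itv.
by exists M => _ [u u0 <-]; apply: HM; rewrite /= in_itv in u0.
Qed.

(** Preimages of open rays are open for the norm. *)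
Lemma Cab_cts_measurable (f : Cab T -> R) :
  (forall x e, 0 < e -> exists2 d, 0 < d & forall y, supnorm (y - x) < d -> `|f y - f x| < e) ->
  measurable_fun setT f.
Proof.
move=> H; apply: measurable_rays => c; apply: sub_sigma_algebra => x /= cx.
have e0 : 0 < f x - c by rewrite subr_gt0.
have [e e1 He] := H x _ e0; exists e => // y /He.
by rewrite ltr_norml => /andP[+ _]; lra.
Qed.

Lemma measurable_eval t : measurable_fun setT (fun x : Cab T => x t).
Proof.
apply: Cab_cts_measurable => x e e0; exists e => // y; apply: le_lt_trans.
exact: supnorm_ge (y - x) t.
Qed.

Lemma measurable_usum N (v : R -> R) : measurable_fun setT (fun x : Cab T => usum T N v x).
Proof.
apply: measurable_sum => i; apply: measurable_funM => //.
by apply: measurable_funB; exact: measurable_eval.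
Qed.

Lemma measurable_RS (v : R -> R) : mono_diff T v ->
  measurable_fun setT (fun x : Cab T => RS_integral T v x).
Proof.
move=> vm; apply: (measurable_fun_cvg (fun N => measurable_usum N v)) => x _.
by apply: usum_cvg => //; apply: RS_exists => //; exact: Cab_cts.
Qed.

End path_measurability.

Section L2_limits.
Context d (X : measurableType d) (R : realType).
Variables (m : {measure set X -> \bar R}) (D : set X).
Hypothesis mD : measurable D.
Variables (f_ : nat -> X -> R) (f : X -> R).
Hypothesis Lf_ : forall n, L2 m D (f_ n).
Hypothesis Lf : L2 m D f.
Hypothesis fC : forall e : R, 0 < e ->
  \forall n \near \oo, ip m D (fun x => f_ n x - f x) (fun x => f_ n x - f x) <= e.

Lemma ip_cvg g : L2 m D g -> ip m D (f_ n) g @[n --> \oo] --> ip m D f g.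
Proof.
move=> Lg; apply/cvgrPdist_le => e e0.
have G1 : 0 < ip m D g g + 1 by rewrite ltr_pwDr// ip_ge0.
have e1 : 0 < e ^+ 2 / (ip m D g g + 1) by rewrite divr_gt0// exprn_gt0.
apply: filterS (fC e1) => n h.
have LB := L2B mD (Lf_ n) Lf.
rewrite -normrN opprB -(ipB mD (Lf_ n) Lf Lg).
have := Cauchy_Schwarz mD LB Lg.
move=> h2; rewrite -(@ler_pXn2r _ 2%N) ?nnegrE ?(ltW e0)// real_normK ?num_real//.
apply: le_trans h2 _.
apply: (@le_trans _ _ (e ^+ 2 / (ip m D g g + 1) * (ip m D g g + 1))).
  by apply: ler_pM; rewrite ?ip_ge0// lerDl.
by rewrite divfK// gt_eqF.
Qed.

Lemma ip_cvg_sq : ip m D (f_ n) (f_ n) @[n --> \oo] --> ip m D f f.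
Proof.
have h : ip m D (fun x => f_ n x - f x) (fun x => f_ n x - f x) @[n --> \oo] --> (0 : R).
  apply/cvgrPdist_le => e e0; apply: filterS (fC e0) => n h.
  by rewrite sub0r normrN ger0_norm// ip_ge0.
have e n : ip m D (f_ n) (f_ n) = ip m D (fun x => f_ n x - f x) (fun x => f_ n x - f x) +
    2 * ip m D (f_ n) f - ip m D f f.
  have Ln := L2B mD (Lf_ n) Lf.
  rewrite ipB// ipC [X in _ - X + _ - _]ipC !ipB//.
  rewrite [ip m D f (f_ n)]ipC; ring.
rewrite (funext e).
have : (ip m D (fun x => f_ n x - f x) (fun x => f_ n x - f x) +
    2 * ip m D (f_ n) f - ip m D f f) @[n --> \oo] --> 0 + 2 * ip m D f f - ip m D f f.
  apply: cvgB; last exact: cvg_cst.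
  apply: cvgD => //; apply: cvgM; [exact: cvg_cst|exact: ip_cvg].
by rewrite (_ : 0 + _ - _ = ip m D f f)//; ring.
Qed.

End L2_limits.

Section path_measure.
Context (R : realType) (T : R) (a b : R -> R) (mu : probability (Cab T) R).
Hypotheses (T0 : 0 < T) (ma : mean_function T a) (vb : variance_function T b).
Hypothesis gmu : gaussian_measure a b mu.
Local Notation db := (stieltjes T b).
Local Notation I := (`[0%R, T]%classic : set (measurableTypeR R)).
Local Notation L2b := (L2 db I).
Local Notation ipb := (ip db I).

Let mI : measurable I. Proof. exact: measurable_itv. Qed.
Let bc : clamp_cumulative T b := b_cumulative T0 vb.
Let cb : {within `[0, T], continuous b} := b_cts vb.

Lemma eval_moments t : 0 <= t <= T ->
  L2 mu setT (fun x : Cab T => x t) /\ \int[mu]_x (x t) = a t.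
Proof.
move=> t01; have tI : `[0%R, T]%classic t by rewrite /= in_itv.
have [gl gm _] := gmu.
have := gl 1%N (fun=> t) (fun=> 1) (fun=> tI).
have -> : (fun B : set R => mu [set x : Cab T | B (\sum_(i < 1) 1 * x t)]) =
  (fun B => mu ((fun x : Cab T => x t) @^-1` B)).
  apply/funext => B; congr (mu _); apply/seteqP; split => x /=;
  by rewrite big_ord_recl big_ord0 addr0 mul1r.
move=> /(gaussian_law_chf (measurable_eval T0 t)) [m [V [_ LY mE _]]]; split => //.
by have := gm t tI; rewrite expectation.unlock /Rintegral => ->.
Qed.

Lemma eval_covariance s t : 0 <= s <= T -> 0 <= t <= T ->
  ip mu setT (fun x : Cab T => x s - a s) (fun x : Cab T => x t - a t) =
  Num.min (b s) (b t).
Proof.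
move=> s01 t01; have [_ gm gc] := gmu.
have sI : `[0%R, T]%classic s by rewrite /= in_itv.
have tI : `[0%R, T]%classic t by rewrite /= in_itv.
have := gc s t sI tI; rewrite covariance.unlock expectation.unlock.
have := gm s sI; have := gm t tI; rewrite expectation.unlock => -> -> /=.
by rewrite /ip /Rintegral => e; rewrite [X in fine X]e.
Qed.

(** Expanded by bilinearity, the covariances [Num.min (b s) (b t)] cancel or telescope. *)
Lemma increment_covariance s s' t t' : 0 <= s -> s <= s' -> s' <= T ->
  0 <= t -> t <= t' -> t' <= T -> s' <= t \/ s = t /\ s' = t' ->
  ip mu setT (fun x : Cab T => (x s' - a s') - (x s - a s))
             (fun x : Cab T => (x t' - a t') - (x t - a t)) =
  if s' <= t then 0 else b s' - b s.
Proof.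
move=> s0 ss' s'T t0 tt' t'T cs.
have L u : 0 <= u <= T -> L2 mu setT (fun x : Cab T => x u - a u).
  move=> u01; have [Lx _] := eval_moments u01; apply: (L2B measurableT Lx).
  split => //; rewrite integral_cst// [X in (_ * X)%E]probability_setT mule1 ltry//.
have us : 0 <= s <= T by rewrite s0 (le_trans ss').
have us' : 0 <= s' <= T by rewrite s'T (le_trans s0).
have ut : 0 <= t <= T by rewrite t0 (le_trans tt').
have ut' : 0 <= t' <= T by rewrite t'T (le_trans t0).
have Ls := L _ us; have Ls' := L _ us'; have Lt := L _ ut; have Lt' := L _ ut'.
have LB := L2B measurableT Lt' Lt.
rewrite (ipB measurableT Ls' Ls LB) ipC (ipB measurableT Lt' Lt Ls').
rewrite [X in _ - X]ipC (ipB measurableT Lt' Lt Ls) !eval_covariance//.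
have bm u v : 0 <= u -> u <= v -> v <= T -> b u <= b v by exact: b_mono.
have b1 : b s <= b s' by exact: bm.
have b2 : b t <= b t' by exact: bm.
case: cs => [s't|[<- <-]].
  rewrite s't; have b3 : b s' <= b t by apply: bm => //; [case/andP: us'|case/andP: ut].
  rewrite (min_r (le_trans b3 b2)) (min_r b3) (min_r (le_trans b1 (le_trans b3 b2))).
  by rewrite (min_r (le_trans b1 b3)) !subrr.
rewrite !minxx (min_l b1) (min_r b1) subrr subr0.
have [s's|//] := leP s' s.
have -> : s' = s by apply/eqP; rewrite eq_le s's ss'.
by rewrite subrr.
Qed.

Lemma has_density_L2 w z : has_density T a b w z -> L2b z.
Proof. by move=> [[mz bz _] _]. Qed.

Lemma has_density_cell w z s t : has_density T a b w z -> 0 <= s -> s <= t -> t <= T ->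
  \int[db]_(u in (`]s, t]%classic : set R)) z u = w t - w s.
Proof.
move=> [Lz wE] s0 st tT.
rewrite (wE t) ?(wE s); last 2 first.
  by rewrite /= in_itv/= s0 (le_trans st).
  by rewrite /= in_itv/= tT (le_trans s0).
have mcc u : measurable (`[0, u]%classic : set (measurableTypeR R)) by exact: measurable_itv.
have moc : measurable (`]s, t]%classic : set (measurableTypeR R)) by exact: measurable_itv.
have e : (`[0, t]%classic : set (measurableTypeR R)) = `[0, s]%classic `|` `]s, t]%classic.
  by rewrite -itv_bndbnd_setU// bnd_simp.
have iz := L2ab_integrable tT Lz; rewrite e in iz *.
rewrite (@Rintegral_setU _ (measurableTypeR R) R db _ _ _ (mcc s) moc)//.
  by rewrite addrC addKr.
rewrite disj_set2E; apply/eqP; apply/seteqP; split => // u [].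
by rewrite /= !in_itv/= => /andP[_ us] /andP[]; rewrite ltNge us.
Qed.

(** A uniform sum is a linear combination of values of the path, hence Gaussian. Its
    mean and variance follow from [increment_covariance] and are inner products of
    the step function [ustep N v]. *)
Lemma usum_chf N v z : has_density T a b a z ->
  normal_chf mu (fun x => usum T N v x) (ipb (ustep T N v) z)
    (ipb (ustep T N v) (ustep T N v)).
Proof.
move=> az; have Lz := has_density_L2 az; have mu_ := measurable_usum T0 N v.
(* Coefficients and times: first the right endpoints, then the left endpoints with
   opposite signs. *)
pose y (i : nat) := if (i < N.+1)%N then (v (upt T N i.+1), upt T N i.+1)
  else (- v (upt T N (i - N.+1).+1), upt T N (i - N.+1)).
have yT (i : 'I_(N.+1 + N.+1)) : `[0%R, T]%classic (y i).2.
  rewrite /= in_itv /y; case: ltnP => h /=; apply: upt_itv => //.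
  by rewrite leq_subLR ltnW.
have [gl _ _] := gmu.
have := gl _ (fun i => (y i).2) (fun i => (y i).1) yT.
have -> : (fun B : set R => mu [set x : Cab T | B (\sum_(i < N.+1 + N.+1) (y i).1 * x (y i).2)]) =
    (fun B => mu ((fun x : Cab T => usum T N v x) @^-1` B)).
  apply/funext => B; congr (mu _); congr (preimage _ B); apply/funext => x.
  rewrite big_split_ord/= /usum /tagged_sum -big_split/=; apply: eq_bigr => i _.
  by rewrite /y ltn_ord (ltnNge (_ + _)) leq_addr/= addKn; ring.
move=> /(gaussian_law_chf mu_) [m [V [chf LY mE VE]]].
have Lx t : L2 mu setT (fun x : Cab T => x t).
  have [t01|t01] := boolP (0 <= t <= T); first by have [] := eval_moments t01.
  under eq_fun do rewrite (Cab_outside _ (negP t01)).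
  exact: (@L2_0 _ _ _ mu setT).
have L1 k : L2 mu setT (fun=> k : R).
  by split => //; rewrite integral_cst// [X in (_ * X)%E]probability_setT mule1 ltry.
pose D i (x : Cab T) := x (upt T N i.+1) - x (upt T N i).
pose da i := a (upt T N i.+1) - a (upt T N i).
have LD i : L2 mu setT (D i) by apply: L2B.
have uT i : (i <= N.+1)%N -> 0 <= upt T N i <= T by exact: upt_itv.
have ip1 g : ip mu setT g (fun=> 1) = \int[mu]_x g x.
  by rewrite /ip; apply: eq_Rintegral => x _; rewrite mulr1.
have YE : (fun x : Cab T => usum T N v x) = fun x : Cab T => \sum_(i < N.+1) v (upt T N i.+1) * D i x.
  by [].
have mE' : m = \sum_(i < N.+1) v (upt T N i.+1) * da i.
  rewrite -mE -ip1 YE (ip_sum measurableT _ (fun i => v (upt T N i.+1)) LD (L1 1)).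
  apply: eq_bigr => i _; congr (_ * _).
  rewrite (ipB measurableT (Lx _) (Lx _) (L1 1)) !ip1.
  have [_ ->] := eval_moments (uT i.+1 (ltn_ord i)).
  by have [_ ->] := eval_moments (uT i (ltnW (ltn_ord i))).
have mV : m = ipb (ustep T N v) z.
  rewrite mE' ip_ustep//; apply: eq_bigr => i _; congr (_ * _).
  rewrite /cell (has_density_cell az)//; last 2 first.
  - exact/ltW/upt_ltS.
  - by case/andP: (uT i.+1 (ltn_ord i)).
  by case/andP: (uT i (ltnW (ltn_ord i))).
suff -> : ipb (ustep T N v) (ustep T N v) = V by rewrite -mV.
pose E i x := D i x - da i.
have LE i : L2 mu setT (E i) by apply: L2B.
have YmE : (fun x : Cab T => usum T N v x - m) = fun x : Cab T => \sum_(i < N.+1) v (upt T N i.+1) * E i x.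
  apply/funext => x; rewrite mE' -sumrB; apply: eq_bigr => i _.
  by rewrite -mulrBr.
have EE i : E i = fun x : Cab T => (x (upt T N i.+1) - a (upt T N i.+1)) - (x (upt T N i) - a (upt T N i)).
  by apply/funext => x; rewrite /E /D /da; ring.
have u0 i : (i < N.+1)%N -> 0 <= upt T N i by move=> /ltnW/uT/andP[].
have u1 i : (i < N.+1)%N -> upt T N i.+1 <= T by move=> /uT/andP[].
have uS i : upt T N i <= upt T N i.+1 by exact/ltW/upt_ltS.
have cov i j : (i < N.+1)%N -> (j < N.+1)%N -> ip mu setT (E i) (E j) =
   if i == j then b (upt T N i.+1) - b (upt T N i) else 0.
  wlog ij : i j / (i <= j)%N => [H|iN jN].
    have [|/ltnW ij iN jN] := leqP i j; first exact: H.
    by rewrite ipC H// eq_sym; case: eqP => // ->.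
  rewrite !EE increment_covariance ?u0 ?u1//; last first.
    have [->|ij'] := eqVneq i j; first by right.
    by left; apply: upt_mono => //; rewrite ltn_neqAle ij' ij.
  have [->|ij'] := eqVneq i j; first by rewrite leNgt upt_ltS.
  by rewrite upt_mono// ltn_neqAle ij' ij.
pose vu i := v (upt T N i.+1).
have LY' : L2 mu setT (fun x => \sum_(i < N.+1) vu i * E i x) by exact: L2_sum.
rewrite ip_ustep_ustep// -VE YmE (ip_sum measurableT N.+1 vu LE LY').
apply: eq_bigr => i _; rewrite ipC (ip_sum measurableT N.+1 vu LE (LE i)).
rewrite (bigD1 i)//= cov// eqxx big1.
  by rewrite addr0 mulrA -expr2.
move=> j ji; rewrite cov// (_ : (j == i :> nat) = false) ?mulr0//.
by apply/negbTE; apply: contra ji => /eqP e; apply/eqP/val_inj.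
Qed.

(** The integral is the limit of the uniform sums, and the step functions converge to
    [v] in L^2(db). *)
Lemma RS_chf v z : mono_diff T v -> has_density T a b a z ->
  normal_chf mu (fun x : Cab T => RS_integral T v x) (ipb v z) (ipb v v).
Proof.
move=> vm az; have Lz := has_density_L2 az.
have Lv : L2b v by exact: mono_diff_L2.
have Lu N : L2b (ustep T N v) by exact: ustep_L2.
have ap := ustep_approx T0 bc cb vm.
apply: (@normal_chf_limit _ _ R mu (fun N x => usum T N v x) (fun N => ipb (ustep T N v) z)
  (fun N => ipb (ustep T N v) (ustep T N v))).
- by move=> N; exact: usum_chf.
- exact: measurable_RS.
- by apply: aeW => x; apply: usum_cvg => //; apply: RS_exists => //; exact: Cab_cts.
- exact: ip_cvg.
- exact: ip_cvg_sq.
Qed.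

End path_measure.

(** * The Paley-Wiener-Zygmund integral *)

Section pointwise_limits.
Context d (X : measurableType d) (R : realType) (f_ : nat -> X -> R).
Hypothesis mf : forall n, measurable_fun setT (f_ n).

(** The Cauchy criterion is a countable combination of measurable conditions. *)
Lemma measurable_cvgn : measurable [set x | cvgn (fun n => f_ n x)].
Proof.
have -> : [set x | cvgn (fun n => f_ n x)] =
    \bigcap_k \bigcup_N \bigcap_n [set x | `|f_ (N + n)%N x - f_ N x| < k.+1%:R^-1].
  apply/seteqP; split => x /=.
    move=> /cauchy_cvgP/cauchyP H k _.
    have k0 : 0 < k.+1%:R^-1 / 2 :> R by rewrite divr_gt0.
    have [y [N _ HN]] := H _ k0; exists N => // n _ /=.
    have h1 := HN _ (leqnn N); have h2 := HN _ (leq_addr n N).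
    rewrite /ball/= in h1 h2.
    have -> : f_ (N + n)%N x - f_ N x = (y - f_ N x) - (y - f_ (N + n)%N x) by ring.
    by apply: le_lt_trans (ler_normB _ _) _; rewrite [ltRHS]splitr ltrD.
  move=> H; apply/cauchy_cvgP/cauchy_exP => e e0.
  have [k ke] : exists k, k.+1%:R^-1 < e.
    exists (Num.truncn e^-1); rewrite invf_plt ?posrE//; exact: truncnS_gt.
  have [N _ HN] := H k Logic.I; exists (f_ N x); exists N => // n /= Nn.
  by rewrite /ball/= distrC; apply: lt_trans ke; have := HN (n - N)%N Logic.I; rewrite /= subnKC.
apply: bigcapT_measurable => k; apply: bigcupT_measurable => N.
apply: bigcapT_measurable => n.
have mg : measurable_fun setT (fun x => `|f_ (N + n)%N x - f_ N x|).
  by apply: measurableT_comp => //; exact: measurable_funB.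
have := mg measurableT _ (measurable_itv `]-oo, (k.+1%:R^-1)[); rewrite setTI.
by congr measurable; apply/seteqP; split => x /=; rewrite in_itv.
Qed.

(** Where the sequence diverges, [limn] is the default element. *)
Lemma measurable_limn : measurable_fun setT (fun x => limn (fun n => f_ n x)).
Proof.
pose Cv := [set x | cvgn (fun n => f_ n x)].
have mC : measurable Cv := measurable_cvgn.
pose g_ n x := f_ n x * \1_Cv x.
pose g x := if x \in Cv then limn (fun n => f_ n x) else 0.
have gg x : g_ n x @[n --> \oo] --> g x.
  rewrite /g_ /g; case: ifPn => xC.
    by rewrite indicE xC mulr1n; under eq_fun do rewrite mulr1; move/set_mem: xC.
  rewrite indicE (negbTE xC); under eq_fun do rewrite mulr0; exact: cvg_cst.
have mg : measurable_fun setT g.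
  apply: (measurable_fun_cvg (h := g_)) => [n|x _]; last exact: gg.
  exact: measurable_funM.
have -> : (fun x => limn (fun n => f_ n x)) = fun x => g x + (point : R) * \1_(~` Cv) x.
  apply/funext => x; rewrite /g indicE; case: ifPn => xC.
    by rewrite memNset ?mulr0 ?addr0//; apply; exact: set_mem.
  rewrite dvgP; last by move/negP: xC; apply: contra_not => h; apply/mem_set.
  by rewrite mem_set ?mulr1 ?add0r//= => h; move/negP: xC; apply; exact/mem_set.
apply: measurable_funD => //; apply: measurable_funM => //.
by apply: measurable_indic; exact: measurableC.
Qed.

End pointwise_limits.

Section pwz_integral.
Context (R : realType) (T : R) (a b : R -> R) (mu : probability (Cab T) R).
Context (phi : nat -> R -> R).
Hypotheses (T0 : 0 < T) (ma : mean_function T a) (vb : variance_function T b).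
Hypothesis gmu : gaussian_measure a b mu.
Hypothesis cphi : complete_orthonormal T a b phi.
Local Notation db := (stieltjes T b).
Local Notation dva := (stieltjes T (tv_fun a)).
Local Notation dab := (stieltjes T (b \+ tv_fun a)).
Local Notation I := (`[0%R, T]%classic : set (measurableTypeR R)).
Local Notation ipb := (ip db I).
Implicit Types v : R -> R.

Let mI : measurable I. Proof. exact: measurable_itv. Qed.

Lemma sq_integral_dab v : measurable_fun I v ->
  (\int[dab]_(t in I) (v t ^+ 2)%:E =
   \int[db]_(t in I) (v t ^+ 2)%:E + \int[dva]_(t in I) (v t ^+ 2)%:E)%E.
Proof.
move=> mv; apply: (integral_stieltjesD T0 ma vb).
  exact: L2_measurable_sq.
by move=> t _; rewrite lee_fin sqr_ge0.
Qed.

Let sq_ge0 (m : {measure set (measurableTypeR R) -> \bar R}) v :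
  (0 <= \int[m]_(t in I) (v t ^+ 2)%:E)%E.
Proof. by apply: integral_ge0 => t _; rewrite lee_fin sqr_ge0. Qed.

(** The measure [d(b + |a|)] is the sum of db and d|a|. *)
Lemma L2abE v : L2ab T a b v <-> L2 dab I v.
Proof.
split=> [[mv vb' va']|[mv vab]].
  split; first exact: mv.
  rewrite sq_integral_dab; last exact: mv.
  by apply: lte_add_pinfty; [exact: vb'|exact: va'].
move: vab; rewrite sq_integral_dab; last exact: mv.
move=> h; split; first exact: mv.
- by apply: le_lt_trans h; rewrite leeDl; [by []|exact: sq_ge0].
- by apply: le_lt_trans h; rewrite leeDr; [by []|exact: sq_ge0].
Qed.

Lemma L2ab_L2b v : L2ab T a b v -> L2 db I v.
Proof. by move=> [mv bv _]; split; [exact: mv|exact: bv]. Qed.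

Lemma ip_db_le v : L2ab T a b v -> ipb v v <= ip dab I v v.
Proof.
move=> Lv; have Lb := L2ab_L2b Lv; have /L2abE Lab := Lv.
rewrite -lee_fin -[leLHS](ipE Lb) -[leRHS](ipE Lab) sq_integral_dab; last by case: Lb.
rewrite leeDl; [by []|exact: sq_ge0].
Qed.

Lemma phi_L2ab j : L2ab T a b (phi j). Proof. by case: cphi => /(_ j)[]. Qed.

Lemma phi_mono_diff j : mono_diff T (phi j).
Proof. by apply: BV_mono_diff => //; case: cphi => /(_ j)[]. Qed.

Definition phi_sum v n t := \sum_(j < n) ipab T a b v (phi j) * phi j t.

Lemma phi_sum_mono_diff v n : mono_diff T (phi_sum v n).
Proof. exact: (mono_diff_sum n (fun j => ipab T a b v (phi j)) phi_mono_diff). Qed.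

Lemma phi_sum_L2ab v n : L2ab T a b (phi_sum v n).
Proof.
apply/L2abE; apply: (L2_sum mI n (fun j => ipab T a b v (phi j))) => j.
by apply/L2abE; exact: phi_L2ab.
Qed.

Lemma phi_sum_cvg v : L2ab T a b v -> forall e : R, 0 < e ->
  \forall n \near \oo, ipb (fun t => phi_sum v n t - v t) (fun t => phi_sum v n t - v t) <= e.
Proof.
move=> Lv e e0; have /L2abE Lv' := Lv.
have Lphi j : L2 dab I (phi j) by apply/L2abE; exact: phi_L2ab.
have [_ O compl] := cphi.
have compl' w : L2 dab I w -> (forall j, ip dab I w (phi j) = 0) -> ip dab I w w = 0.
  by move=> /L2abE Lw; exact: compl.
have [N HN] := expansion_cvg mI Lphi O Lv' compl' e0.
exists N; first by [].
move=> n Nn; apply: le_trans (HN n Nn).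
have Ls : L2 dab I (phi_sum v n) by apply/L2abE; exact: phi_sum_L2ab.
have LB : L2ab T a b (fun t => v t - phi_sum v n t) by apply/L2abE; exact: L2B.
apply: le_trans (ip_db_le LB).
by rewrite le_eqVlt; apply/orP; left; apply/eqP; apply: eq_Rintegral => t _; ring.
Qed.

(** The norm of L^2(db) is at most that of L^2_{a,b}, where the increment of the
    expansion is a partial sum of squared coefficients. *)
Lemma phi_sum_ip v n m : L2ab T a b v -> (n <= m)%N ->
  ipb (fun t => phi_sum v m t - phi_sum v n t) (fun t => phi_sum v m t - phi_sum v n t) <=
  \sum_(0 <= j < m) ipab T a b v (phi j) ^+ 2 - \sum_(0 <= j < n) ipab T a b v (phi j) ^+ 2.
Proof.
move=> Lv nm; have /L2abE Lv' := Lv.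
have Lphi j : L2 dab I (phi j) by apply/L2abE; exact: phi_L2ab.
have [_ O _] := cphi.
have LB : L2ab T a b (fun t => phi_sum v m t - phi_sum v n t).
  by apply/L2abE; apply: L2B => //; apply/L2abE; exact: phi_sum_L2ab.
apply: le_trans (ip_db_le LB) _.
rewrite [leLHS](ip_expansionB mI Lphi O v nm) [X in _ <= X - _](big_cat_nat _ nm)//=.
by rewrite addrAC subrr add0r.
Qed.

(** The centered partial sums have Gaussian increments, whose variance is at most the
    increment of [tau]; the means converge because the expansion converges in L^2(db). *)
Lemma pwz_cvg v z : has_density T a b a z -> L2ab T a b v ->
  {ae mu, forall x : Cab T, cvgn (fun n => RS_integral T (phi_sum v n) x)}.
Proof.
move=> az Lv; have Lz := has_density_L2 az.
have chf n := RS_chf T0 vb gmu (phi_sum_mono_diff v n) az.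
pose S n (x : Cab T) := RS_integral T (phi_sum v n) x - ipb (phi_sum v n) z.
have RSB n m (x : Cab T) : RS_integral T (phi_sum v m) x - RS_integral T (phi_sum v n) x =
    RS_integral T (fun t => phi_sum v m t - phi_sum v n t) x.
  have h k := RS_exists T0 (phi_sum_mono_diff v k) (@Cab_cts R T x).
  have := is_RS_unique T0 (is_RS_linl (-1) (h n) (h m)).
  under [X in RS_integral T X]eq_fun do rewrite mulN1r addrC.
  by move=> ->; rewrite mulN1r addrC.
have LB n : L2 db I (phi_sum v n) by apply: L2ab_L2b; exact: phi_sum_L2ab.
have mono n m : mono_diff T (fun t => phi_sum v m t - phi_sum v n t).
  have := mono_diff_lin (-1) (phi_sum_mono_diff v n) (phi_sum_mono_diff v m).
  by under eq_fun do rewrite mulN1r addrC.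
pose tau n := \sum_(0 <= j < n) ipab T a b v (phi j) ^+ 2.
have tauN : {homo tau : n m / (n <= m)%N >-> n <= m}.
  move=> n m nm; rewrite /tau (big_cat_nat _ nm)//= lerDl sumr_ge0// => j _.
  exact: sqr_ge0.
have mS n : measurable_fun setT (S n).
  by apply: measurable_funB => //; case: (chf n).
have SC n m : (n <= m)%N ->
    (\int[mu]_x ((S m x - S n x) ^+ 4)%:E <= (3 * (tau m - tau n) ^+ 2)%:E)%E.
  move=> nm; have := normal_moment4 (RS_chf T0 vb gmu (mono n m) az).
  under eq_integral => x _.
    rewrite (_ : _ - _ = S m x - S n x); first over.
    by rewrite -RSB (ipB mI (LB m) (LB n) Lz) /S; ring.
  move=> h; apply: le_trans h _; rewrite lee_fin ler_pM2l// ler_sqr ?nnegrE ?ip_ge0//.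
    exact: phi_sum_ip.
  by rewrite subr_ge0 tauN.
have tau_cvg : cvgn tau.
  apply: nondecreasing_is_cvgn => //; exists (ip dab I v v) => _ [n _ <-].
  have /L2abE Lv' := Lv; have [_ O _] := cphi.
  have Lphi j : L2 dab I (phi j) by apply/L2abE; exact: phi_L2ab.
  exact: (Bessel mI Lphi O Lv' n).
have := increments_cvg mS tauN (ler0n _ 3) SC tau_cvg.
apply: filterS => x Sx.
have ic : cvgn (fun n => ipb (phi_sum v n) z).
  apply/cvg_ex; exists (ipb v z).
  exact: (ip_cvg mI LB (L2ab_L2b Lv) (phi_sum_cvg Lv) Lz).
have -> : (fun n => RS_integral T (phi_sum v n) x) = (fun n => S n x + ipb (phi_sum v n) z).
  by apply/funext => n; rewrite subrK.
exact: is_cvgD.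
Qed.

(** A limit of the Gaussian partial sums, whose means and variances converge. *)
Lemma pwz_chf v z : has_density T a b a z -> L2ab T a b v ->
  normal_chf mu (fun x : Cab T => pwz T a b phi v x) (ipb v z) (ipb v v).
Proof.
move=> az Lv; have Lz := has_density_L2 az.
apply: (@normal_chf_limit _ _ R mu (fun n x => RS_integral T (phi_sum v n) x)
  (fun n => ipb (phi_sum v n) z) (fun n => ipb (phi_sum v n) (phi_sum v n))).
- by move=> n; exact: (RS_chf T0 vb gmu (phi_sum_mono_diff v n) az).
- apply: (measurable_limn (f_ := fun n (x : Cab T) => RS_integral T (phi_sum v n) x)) => n.
  exact: (measurable_RS T0 (phi_sum_mono_diff v n)).
- exact: (pwz_cvg az Lv).
- exact: (ip_cvg mI (fun n => L2ab_L2b (phi_sum_L2ab v n)) (L2ab_L2b Lv) (phi_sum_cvg Lv) Lz).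
- exact: (ip_cvg_sq mI (fun n => L2ab_L2b (phi_sum_L2ab v n)) (L2ab_L2b Lv) (phi_sum_cvg Lv)).
Qed.

Lemma pwz_linear v (k : R) (x y : Cab T) :
  cvgn (fun n => RS_integral T (phi_sum v n) x) ->
  cvgn (fun n => RS_integral T (phi_sum v n) y) ->
  cvgn (fun n => RS_integral T (phi_sum v n) (k *: x + y)) /\
  pwz T a b phi v (k *: x + y) = k * pwz T a b phi v x + pwz T a b phi v y.
Proof.
move=> cx cy.
have e : (fun n => RS_integral T (phi_sum v n) (k *: x + y)) =
   (fun n => k * RS_integral T (phi_sum v n) x + RS_integral T (phi_sum v n) y).
  apply/funext => n.
  by rewrite -(RS_linr T0 k (phi_sum_mono_diff v n) (@Cab_cts R T x) (@Cab_cts R T y)).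
have c : (fun n => RS_integral T (phi_sum v n) (k *: x + y)) @ \oo -->
    k * pwz T a b phi v x + pwz T a b phi v y.
  by rewrite e; apply: cvgD => //; apply: cvgM => //; exact: cvg_cst.
split; first by apply/cvg_ex; eexists; exact: c.
exact: (cvg_lim _ c).
Qed.

End pwz_integral.

(** * The Hilbert space of directions *)

Lemma ip_triangle d (X : measurableType d) (R : realType) (m : {measure set X -> \bar R})
    (D : set X) (f g : X -> R) : measurable D -> L2 m D f -> L2 m D g ->
  Num.sqrt (ip m D f f) <=
  Num.sqrt (ip m D g g) + Num.sqrt (ip m D (fun x => f x - g x) (fun x => f x - g x)).
Proof.
move=> mD Lf Lg; have LB := L2B mD Lf Lg.
rewrite -ler_sqr ?nnegrE ?addr_ge0 ?sqrtr_ge0// sqrrD !sqr_sqrtr ?ip_ge0//.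
have := ip_lin2 mD 1 Lg LB; under eq_fun do rewrite mul1r addrC subrK.
move=> ->; have := Cauchy_Schwarz_sqrt mD Lg LB; rewrite ler_norml => /andP[_].
rewrite mulr2n; lra.
Qed.

Section density_uniqueness.
Context (R : realType) (T : R) (a b : R -> R).
Hypothesis T0 : 0 < T.
Local Notation db := (stieltjes T b).
Local Notation I := (`[0%R, T]%classic : set (measurableTypeR R)).
Local Notation ipb := (ip db I).
Implicit Types z : R -> R.

Let mI : measurable I. Proof. exact: measurable_itv. Qed.

Lemma density0_itv z (s t : R) : has_density T a b (cst 0) z -> s <= t ->
  \int[db]_(u in (`]s, t]%classic `&` I)) z u = 0.
Proof.
move=> zd st; have [t0|t0] := ltP t 0.
  rewrite (_ : _ `&` _ = set0) ?Rintegral_set0//; apply/seteqP; split => // u [].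
  rewrite /= !in_itv/= => /andP[_ ut] /andP[u0 _].
  by have := le_lt_trans (le_trans u0 ut) t0; rewrite ltxx.
pose t' := Num.min t T; have t'T : t' <= T by rewrite ge_min lexx orbT.
have t'0 : 0 <= t' by rewrite le_min t0 ltW.
have [s0|s0] := ltP s 0.
  rewrite (_ : _ `&` _ = `[0, t']%classic); last first.
    apply/seteqP; split => u /=; rewrite !in_itv/=.
      by move=> [/andP[_ ut] /andP[u0 uT]]; rewrite u0 le_min ut.
    by rewrite le_min => /and3P[u0 ut uT]; rewrite ut u0 uT (lt_le_trans s0).
  by have [_ /(_ t')] := zd; rewrite /= in_itv/= t'0 t'T => /(_ isT) <-.
have [st'|t's] := leP s t'; last first.
  rewrite (_ : _ `&` _ = set0) ?Rintegral_set0//; apply/seteqP; split => // u [].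
  rewrite /= !in_itv/= => /andP[su ut] /andP[_ uT].
  have : u <= t' by rewrite le_min ut.
  by rewrite leNgt (lt_trans t's).
rewrite (_ : _ `&` _ = `]s, t']%classic); last first.
  apply/seteqP; split => u /=; rewrite !in_itv/=.
    by move=> [/andP[su ut] /andP[u0 uT]]; rewrite su le_min ut.
  rewrite le_min => /and3P[su ut uT]; rewrite ut su uT; split => //.
  by rewrite (le_trans s0 (ltW su)).
by have := has_density_cell zd s0 st' t'T; rewrite subrr.
Qed.

(** The positive and negative parts of [z] define measures that agree on intervals, hence on
    Borel sets, so that [z] vanishes almost everywhere. *)
Lemma density0 z : has_density T a b (cst 0) z -> ipb z z = 0.
Proof.
move=> zd; have [[mz zb _] _] := zd.
have iz : db.-integrable I (EFin \o z) := L2ab_integrable (lexx T) (proj1 zd).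
pose zp t := Num.max (z t) 0; pose zn t := Num.max (- z t) 0.
have mp : measurable_fun I zp by exact: measurable_maxr.
have mn : measurable_fun I zn by apply: measurable_maxr => //; exact: measurableT_comp.
have zE t : z t = zp t - zn t.
  by rewrite /zp /zn; case: leP => h1; case: leP => h2; lra.
have ip_ : db.-integrable I (EFin \o zp).
  apply: le_integrable iz => //; first exact/measurable_EFinP.
  move=> t _; rewrite lee_fin ger0_norm ?le_max ?lexx ?orbT//.
  by rewrite ge_max ler_norm normr_ge0.
have in_ : db.-integrable I (EFin \o zn).
  apply: le_integrable iz => //; first exact/measurable_EFinP.
  move=> t _; rewrite lee_fin ger0_norm ?le_max ?lexx ?orbT//.
  by rewrite ge_max -normrN ler_norm normr_ge0.
pose hp := ((EFin \o zp) \_ I); pose hn := ((EFin \o zn) \_ I).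
have mhp : measurable_fun setT hp.
  by apply/(measurable_restrictT _ mI); exact/measurable_EFinP.
have mhn : measurable_fun setT hn.
  by apply/(measurable_restrictT _ mI); exact/measurable_EFinP.
have hp0 t : (0 <= hp t)%E.
  by rewrite /hp patchE; case: ifP => // _; rewrite lee_fin /zp le_max lexx orbT.
have hn0 t : (0 <= hn t)%E.
  by rewrite /hn patchE; case: ifP => // _; rewrite lee_fin /zn le_max lexx orbT.
pose np := density_measure db mhp hp0; pose nn := density_measure db mhn hn0.
have npE A : np A = (\int[db]_(t in A `&` I) (zp t)%:E)%E.
  by rewrite /np /density_measure /hp integral_mkcondr.
have nnE A : nn A = (\int[db]_(t in A `&` I) (zn t)%:E)%E.
  by rewrite /nn /density_measure /hn integral_mkcondr.
have key A : measurable A -> np A = nn A.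
  apply: measure_unique_oc => s t st.
    have mJ : measurable (`]s, t]%classic `&` I : set (measurableTypeR R)).
      by apply: measurableI => //; exact: measurable_itv.
    have JI : `]s, t]%classic `&` I `<=` I by move=> u [].
    have ipJ := integrableS mI mJ JI ip_; have inJ := integrableS mI mJ JI in_.
    have := density0_itv zd st.
    under eq_Rintegral do rewrite zE.
    rewrite (@RintegralB _ (measurableTypeR R) R db _ _ _ mJ ipJ inJ) => /eqP.
    rewrite subr_eq0 => /eqP e; rewrite -[LHS]/(np _) -[RHS]/(nn _) npE nnE.
    have fp := integrable_fin_num mJ ipJ; have fn := integrable_fin_num mJ inJ.
    by rewrite -[LHS](fineK fp) -[RHS](fineK fn); congr (_%:E).
  rewrite -[X in (X < _)%E]/(np _) npE.
  have mJ : measurable (`]s, t]%classic `&` I : set (measurableTypeR R)).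
    by apply: measurableI => //; exact: measurable_itv.
  have JI : `]s, t]%classic `&` I `<=` I by move=> u [].
  have /integrableP[_] := integrableS mI mJ JI ip_.
  apply: le_lt_trans; rewrite le_eqVlt; apply/orP; left; apply/eqP.
  by apply: eq_integral => u _; rewrite gee0_abs// lee_fin /zp le_max lexx orbT.
have := @integral_ae_eq _ (measurableTypeR R) R db I mI (EFin \o zn) (EFin \o zp) ip_.
case.
- exact/measurable_EFinP.
- move=> E EI mE; have := key E mE; rewrite npE nnE.
  by rewrite (_ : E `&` I = E)//; apply/setIidPl.
move=> N [mN N0 NE]; rewrite /ip /Rintegral.
suff -> : (\int[db]_(t in I) (z t * z t)%:E = \int[db]_(t in I) (cst 0%E t))%E.
  by rewrite integral_cst// mul0e.
apply: ae_eq_integral => //.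
  by apply/measurable_EFinP; exact: measurable_funM.
exists N; split => // u /= h; apply: NE => /= h2; apply: h => Iu.
by have := h2 Iu; move=> [e]; rewrite /= zE e subrr mul0r.
Qed.

End density_uniqueness.

Section Cp_space.
Context (R : realType) (T : R) (a b : R -> R).
Hypotheses (T0 : 0 < T) (ma : mean_function T a) (vb : variance_function T b).
Local Notation db := (stieltjes T b).
Local Notation dab := (stieltjes T (b \+ tv_fun a)%R).
Local Notation I := (`[0%R, T]%classic : set (measurableTypeR R)).
Local Notation ipb := (ip db I).
Local Notation L2b := (L2 db I).
Local Notation Cp := (Cp T a b).
Local Notation nCp := (normCp T a b).
Implicit Types (u v w : Cp) (z : R -> R).

Let mI : measurable I. Proof. exact: measurable_itv. Qed.

Lemma Dt_density w : has_density T a b w (Dt T a b w).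
Proof.
have /andP[_ /asboolP [z zw]] := Cp_funP w.
exact: (@xgetPex _ (cst 0) [set z | has_density T a b w z] (ex_intro _ z zw)).
Qed.

Lemma Dt_mean : has_density T a b a (Dt T a b a).
Proof.
have [z [Lz az _]] := mean_density T0 ma vb.
by apply: (@xgetPex _ (cst 0) [set z | has_density T a b a z]); exists z.
Qed.

Lemma Dt_L2ab w : L2ab T a b (Dt T a b w).
Proof. by case: (Dt_density w). Qed.

Lemma Dt_L2 w : L2b (Dt T a b w).
Proof. exact/L2ab_L2b/Dt_L2ab. Qed.

Lemma Dt_mean_L2 : L2b (Dt T a b a).
Proof. exact: (has_density_L2 Dt_mean). Qed.

Lemma has_density_lin (k : R) u v y z : has_density T a b u y -> has_density T a b v z ->
  has_density T a b (k *: u + v : Cp) (fun t => k * y t + z t).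
Proof.
move=> [Ly yE] [Lz zE]; split; first exact: L2ab_lin.
move=> t /[dup] tI; rewrite /= in_itv/= => /andP[_ tT].
have iy := L2ab_integrable tT Ly; have iz := L2ab_integrable tT Lz.
rewrite [LHS](_ : _ = k * u t + v t)// (yE _ tI) (zE _ tI).
have mt : measurable (`[0, t]%classic : set (measurableTypeR R)) by exact: measurable_itv.
have iky := @integrableZl _ (measurableTypeR R) R db _ mt k _ iy.
rewrite (@RintegralD _ (measurableTypeR R) R db _ (fun t => k * y t) z mt iky iz).
by rewrite (@RintegralZl _ (measurableTypeR R) R db _ y k mt iy).
Qed.

(** [Dt] chooses a density; this makes integrals against it independent of the choice. *)
Lemma density_unique (w : R -> R) y z : has_density T a b w y -> has_density T a b w z ->
  ipb (fun t => y t - z t) (fun t => y t - z t) = 0.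
Proof.
move=> [Ly yE] [Lz zE]; apply: (density0 T0 (a := a)); split.
  by have := L2ab_lin (-1) Lz Ly; under eq_fun do rewrite mulN1r addrC.
move=> t /[dup] tI; rewrite /= in_itv/= => /andP[_ tT].
have iy := L2ab_integrable tT Ly; have iz := L2ab_integrable tT Lz.
have mt : measurable (`[0, t]%classic : set (measurableTypeR R)) by exact: measurable_itv.
by rewrite (@RintegralB _ (measurableTypeR R) R db _ y z mt iy iz) -(yE t tI) -(zE t tI) subrr.
Qed.

Lemma density_ip (w : R -> R) y z g : has_density T a b w y -> has_density T a b w z ->
  L2b g -> ipb y g = ipb z g.
Proof.
move=> dy dz Lg; have Ly := has_density_L2 dy; have Lz := has_density_L2 dz.
apply/eqP; rewrite -subr_eq0 -(ipB mI Ly Lz Lg).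
have := Cauchy_Schwarz mI (L2B mI Ly Lz) Lg; rewrite (density_unique dy dz) mul0r.
by rewrite le_eqVlt ltNge sqr_ge0 orbF sqrf_eq0.
Qed.

Lemma density_ip2 (w : R -> R) y z : has_density T a b w y -> has_density T a b w z ->
  ipb y y = ipb z z.
Proof.
move=> dy dz; have Ly := has_density_L2 dy; have Lz := has_density_L2 dz.
by rewrite (density_ip dy dz Ly) ipC (density_ip dy dz Lz).
Qed.

Lemma normCp_ge0 w : 0 <= nCp w. Proof. exact: sqrtr_ge0. Qed.

Lemma normCp_sqr w : nCp w ^+ 2 = ipCp T a b w w.
Proof. by rewrite sqr_sqrtr// ip_ge0. Qed.

Lemma normCpE w z : has_density T a b w z -> nCp w = Num.sqrt (ipb z z).
Proof. by move=> dz; congr Num.sqrt; exact: (density_ip2 (Dt_density w) dz). Qed.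

Lemma normCpB v w : nCp (v - w : Cp) =
  Num.sqrt (ipb (fun t => Dt T a b v t - Dt T a b w t) (fun t => Dt T a b v t - Dt T a b w t)).
Proof.
apply: normCpE; have := has_density_lin (-1) (Dt_density w) (Dt_density v).
by rewrite scaleN1r addrC; under eq_fun do rewrite mulN1r addrC.
Qed.

Lemma normCpZ (k : R) w : nCp (k *: w : Cp) = `|k| * nCp w.
Proof.
rewrite (normCpE (z := fun t => k * Dt T a b w t + cst 0 t)); last first.
  have d0 : has_density T a b (0 : Cp) (cst 0).
    split; first exact: L2ab0.
    by move=> t _; rewrite Rintegral_cst ?mul0r//; exact: measurable_itv.
  by have := has_density_lin k (Dt_density w) d0; rewrite addr0.
rewrite (ip_lin2 mI k (Dt_L2 w) (L2_0 _ _)).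
have i0 g : ipb g (cst 0) = 0.
  by rewrite /ip; under eq_Rintegral do rewrite mulr0; rewrite Rintegral_cst ?mul0r.
by rewrite !i0 mulr0 !addr0 sqrtrM ?sqr_ge0// sqrtr_sqr.
Qed.

Lemma normCp_triangle u v : nCp u <= nCp v + nCp (u - v : Cp).
Proof.
rewrite normCpB; exact: (ip_triangle mI (Dt_L2 u) (Dt_L2 v)).
Qed.

Lemma normCp_dist u v : `|nCp u - nCp v| <= nCp (u - v : Cp).
Proof.
rewrite ler_norml lerBlDl normCp_triangle andbT lerNl opprB lerBlDl.
have -> : nCp (u - v : Cp) = nCp (v - u : Cp).
  by rewrite -opprB -scaleN1r normCpZ normrN1 mul1r.
exact: normCp_triangle.
Qed.

Lemma ipCp_le w : `|ipCp T a b w a| <= nCp w * nCp a.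
Proof. exact: (Cauchy_Schwarz_sqrt mI (Dt_L2 w) Dt_mean_L2). Qed.

(** Preimages of open rays are open for the norm that defines the Borel sets. *)
Lemma Lipschitz_measurable (f : Cp -> R) (C : R) :
  (forall v w, `|f v - f w| <= C * nCp (v - w : Cp)) -> measurable_fun setT f.
Proof.
move=> H; apply: measurable_rays => c; apply: sub_sigma_algebra => w /= cw.
have C0 : 0 < `|C| + 1 by rewrite ltr_wpDl.
have e0 : 0 < f w - c by rewrite subr_gt0.
exists ((f w - c) / (`|C| + 1)); first by rewrite divr_gt0.
move=> v; rewrite ltr_pdivlMr// => h.
have : `|f v - f w| < f w - c.
  apply: le_lt_trans (H v w) _; apply: le_lt_trans h.
  rewrite mulrC ler_wpM2l ?normCp_ge0// (le_trans (ler_norm C))// lerDl//.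
by rewrite ltr_norml => /andP[+ _]; lra.
Qed.

Section operators.
Variable S : {linear Cp -> Cp}.
Hypothesis bS : bounded_op S.

(** Where the norm of [w] vanishes, so does that of [S w] by boundedness. *)
Lemma opnorm_le w : nCp (S w) <= opnorm S * nCp w.
Proof.
have [M HM] := bS.
have ub : has_ubound [set nCp (S w) | w in [set w : Cp | nCp w <= 1]].
  exists `|M| => _ [u u1 <-]; apply: le_trans (HM u) _.
  by rewrite (le_trans (ler_wpM2r (normCp_ge0 u) (ler_norm M)))// ler_piMr.
have [w0|w0] := eqVneq (nCp w) 0.
  by have := HM w; rewrite w0 !mulr0.
have wp : 0 < nCp w by rewrite lt0r w0 normCp_ge0.
have : nCp (S ((nCp w)^-1 *: w)) <= opnorm S.
  apply: ub_le_sup => //; exists ((nCp w)^-1 *: w) => //=.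
  by rewrite normCpZ ger0_norm ?invr_ge0 ?normCp_ge0// mulVf.
rewrite linearZ normCpZ ger0_norm ?invr_ge0 ?normCp_ge0//.
by rewrite mulrC ler_pdivrMr.
Qed.

Lemma measurable_normCp_op : measurable_fun setT (fun w : Cp => nCp (S w)).
Proof.
apply: (@Lipschitz_measurable _ (opnorm S)) => v w.
by apply: le_trans (normCp_dist _ _) _; rewrite -linearB; exact: opnorm_le.
Qed.

(** Such a functional of [S w] is Lipschitz in [w]. *)
Lemma measurable_functional_op (L : (R -> R) -> R) (C : R) : 0 <= C ->
  (forall u v, L (Dt T a b u) - L (Dt T a b v) = L (fun t => Dt T a b u t - Dt T a b v t)) ->
  (forall f, L2ab T a b f -> `|L f| <= C * Num.sqrt (ipb f f)) ->
  measurable_fun setT (fun w : Cp => L (Dt T a b (S w))).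
Proof.
move=> C0 LB LC; apply: (@Lipschitz_measurable _ (C * opnorm S)) => v w.
rewrite LB; apply: le_trans (LC _ _) _.
  have := L2ab_lin (-1) (Dt_L2ab (S w)) (Dt_L2ab (S v)).
  by under eq_fun do rewrite mulN1r addrC.
by rewrite -normCpB -mulrA ler_wpM2l// -linearB; exact: opnorm_le.
Qed.

Lemma measurable_ipCp_mean_op : measurable_fun setT (fun w : Cp => ipCp T a b (S w) a).
Proof.
apply: (@measurable_functional_op (fun f => ipb f (Dt T a b a)) (nCp a)).
- exact: sqrtr_ge0.
- by move=> u v; rewrite (ipB mI (Dt_L2 u) (Dt_L2 v) Dt_mean_L2).
- move=> f Lf; rewrite mulrC; exact: (Cauchy_Schwarz_sqrt mI (L2ab_L2b Lf) Dt_mean_L2).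
Qed.

(** The functional involves d|a|, but the domination of d|a| by |z| db with [z] square
    integrable and the boundedness of [g] reduce it to L^2(db). *)
Lemma ipab_bounded (g : R -> R) (M : R) : measurable_fun I g ->
  (forall t, 0 <= t <= T -> `|g t| <= M) ->
  exists2 C : R, 0 <= C & forall f, L2ab T a b f -> `|ipab T a b f g| <= C * Num.sqrt (ipb f f).
Proof.
move=> mg gM; have [z [Lz _ zva]] := mean_density T0 ma vb.
have M0 : 0 <= M by apply: le_trans (normr_ge0 _) (gM 0 _); rewrite lexx ltW.
pose c1 := Num.sqrt (ipb (cst 1) (cst 1)); pose cz := Num.sqrt (ipb (fun t => `|z t|) (fun t => `|z t|)).
exists (M * (c1 + cz)); first by rewrite mulr_ge0// addr_ge0 ?sqrtr_ge0.
move=> f Lf; have Lfb := L2ab_L2b Lf; have [mf _] := Lfb.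
have Labs h : L2b h -> L2b (fun t => `|h t|).
  move=> [mh h2]; split; first exact: measurableT_comp.
  by under eq_integral do rewrite real_normK ?num_real//.
have Lz' := Labs _ (L2ab_L2b Lz); have Lf' := Labs _ Lfb.
have L1 : L2b (cst 1).
  apply: (@bounded_L2 R T b (cst 1) 1); first exact: measurable_cst.
  by move=> t _; rewrite normr1.
have fE : ipb (fun t => `|f t|) (fun t => `|f t|) = ipb f f.
  by apply: eq_Rintegral => t _; rewrite -!expr2 real_normK ?num_real.
have mfg : measurable_fun I (fun t => f t * g t) by exact: measurable_funM.
have mabs : measurable_fun I (fun t => `|f t|%:E).
  by apply/measurable_EFinP; exact: measurableT_comp.
have i1 : (\int[db]_(t in I) `|f t|%:E = (ipb (fun t => `|f t|) (cst 1))%:E)%E.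
  rewrite /ip /Rintegral fineK; last exact: (integrable_fin_num mI (L2_mul mI Lf' L1)).
  by apply: eq_integral => t _; rewrite mulr1.
have i2 : (\int[db]_(t in I) (`|f t| * `|z t|)%:E = (ipb (fun t => `|f t|) (fun t => `|z t|))%:E)%E.
  by rewrite /ip /Rintegral fineK//; exact: (integrable_fin_num mI (L2_mul mI Lf' Lz')).
have bd : (\int[dab]_(t in I) (`|f t * g t|%R)%:E <=
    ((M * (ipb (fun t => `|f t|) (cst 1) + ipb (fun t => `|f t|) (fun t => `|z t|)))%R)%:E)%E.
  apply: (@le_trans _ _ (\int[dab]_(t in I) (M%:E * `|f t|%:E))%E).
    apply: ge0_le_integral.
    - exact: mI.
    - by move=> t _; rewrite lee_fin.
    - by apply/measurable_EFinP; exact: measurableT_comp.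
    - exact: measurable_funeM.
    - move=> t It; rewrite -EFinM lee_fin normrM mulrC ler_wpM2r//.
      by apply: gM; move: It; rewrite /= in_itv.
  rewrite ge0_integralZl//.
  rewrite EFinM lee_wpmul2l ?lee_fin//.
  rewrite (integral_stieltjesD T0 ma vb mabs); last by move=> t _; rewrite lee_fin.
  rewrite EFinD i1 leeD2l// -i2.
  apply: le_trans (zva _ mabs _) _; first by move=> t _; rewrite lee_fin.
  rewrite le_eqVlt; apply/orP; left; apply/eqP.
  by apply: eq_integral => t _; rewrite EFinM.
have h1 := Cauchy_Schwarz_sqrt mI Lf' L1; have h2 := Cauchy_Schwarz_sqrt mI Lf' Lz'.
rewrite fE in h1 h2.
apply: (@le_trans _ _ (M * (ipb (fun t => `|f t|) (cst 1) + ipb (fun t => `|f t|) (fun t => `|z t|)))).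
  rewrite -lee_fin; apply: le_trans bd.
  have mfgE : measurable_fun I (fun t => (f t * g t)%:E) by exact/measurable_EFinP.
  have := le_abse_integral (dab) mI mfgE.
  case e : (\int[dab]_(t in I) (f t * g t)%:E)%E => [r| |] h.
  - by rewrite /ipab /Rintegral e; exact: h.
  - by apply: le_trans _ h; rewrite leey.
  - by apply: le_trans _ h; rewrite leey.
rewrite -mulrA ler_wpM2l// mulrDl; apply: lerD.
  by rewrite mulrC; exact: le_trans (ler_norm _) h1.
by rewrite mulrC; exact: le_trans (ler_norm _) h2.
Qed.

Lemma measurable_ipab_op (g : R -> R) : mono_diff T g ->
  measurable_fun setT (fun w : Cp => ipab T a b (Dt T a b (S w)) g).
Proof.
move=> gm; have mg : measurable_fun I g := mono_diff_measurable T0 gm.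
have [M M0 gM] := mono_diff_bounded gm.
have [C C0 HC] := ipab_bounded mg gM.
apply: (measurable_functional_op C0 (L := fun f => ipab T a b f g)) => //.
move=> u v; symmetry; apply: (ipB mI).
- by apply/(L2abE T0 ma vb); exact: Dt_L2ab.
- by apply/(L2abE T0 ma vb); exact: Dt_L2ab.
- exact: (@mono_diff_L2 R T T0 _ g gm).
Qed.

End operators.

End Cp_space.

(** * The complex exponential and the principal square root *)

Section complex_exponential.
Context (R : realType).
Implicit Types z w : R[i].
Local Notation Re := (@complex.Re R).
Local Notation Im := (@complex.Im R).

Lemma cReD z w : Re (z + w) = Re z + Re w. Proof. by case: z; case: w. Qed.
Lemma cImD z w : Im (z + w) = Im z + Im w. Proof. by case: z; case: w. Qed.
Lemma cReN z : Re (- z) = - Re z. Proof. by case: z. Qed.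
Lemma cImN z : Im (- z) = - Im z. Proof. by case: z. Qed.
Lemma cReM z w : Re (z * w) = Re z * Re w - Im z * Im w. Proof. by case: z; case: w. Qed.
Lemma cImM z w : Im (z * w) = Re z * Im w + Im z * Re w. Proof. by case: z; case: w. Qed.
Lemma cReZ (x : R) z : Re (x%:C * z) = x * Re z. Proof. by rewrite cReM mul0r subr0. Qed.
Lemma cImZ (x : R) z : Im (x%:C * z) = x * Im z. Proof. by rewrite cImM mul0r addr0. Qed.
Lemma cReMr z (x : R) : Re (z * x%:C) = Re z * x. Proof. by rewrite cReM/= mulr0 subr0. Qed.
Lemma cImMr z (x : R) : Im (z * x%:C) = Im z * x. Proof. by rewrite cImM/= mulr0 add0r. Qed.
Lemma complex_ext z w : Re z = Re w -> Im z = Im w -> z = w.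
Proof. by case: z; case: w => a b c d /= -> ->. Qed.

Lemma cmodE z : cmod z = Num.sqrt (Re z ^+ 2 + Im z ^+ 2). Proof. by case: z. Qed.
Lemma cmod_ge0 z : 0 <= cmod z. Proof. by rewrite cmodE sqrtr_ge0. Qed.
Lemma cmod_sqr z : cmod z ^+ 2 = Re z ^+ 2 + Im z ^+ 2.
Proof. by rewrite cmodE sqr_sqrtr// addr_ge0// sqr_ge0. Qed.
Lemma cmodM z w : cmod (z * w) = cmod z * cmod w.
Proof. by rewrite /cmod normrM cReM /= mul0r subr0. Qed.
Lemma cmodD z w : cmod (z + w) <= cmod z + cmod w.
Proof. by rewrite /cmod -cReD; have := ler_normD z w; rewrite lecE => /andP[]. Qed.
Lemma cmodN z : cmod (- z) = cmod z. Proof. by rewrite /cmod normrN. Qed.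
Lemma cmodB z w : cmod (z - w) <= cmod z + cmod w.
Proof. by apply: le_trans (cmodD _ _) _; rewrite cmodN. Qed.
Lemma cmod_real (x : R) : cmod x%:C = `|x|.
Proof. by rewrite cmodE /= expr0n addr0 sqrtr_sqr. Qed.
Lemma cmod0 : cmod (0 : R[i]) = 0. Proof. by rewrite /cmod normr0. Qed.
Lemma cmod_eq0 z : cmod z = 0 -> z = 0.
Proof.
move=> h; have := cmod_sqr z; rewrite h expr0n/= => /esym/eqP.
rewrite paddr_eq0 ?sqr_ge0// !sqrf_eq0 => /andP[/eqP h1 /eqP h2].
exact: complex_ext.
Qed.
Lemma cmodV z : cmod z^-1 = (cmod z)^-1.
Proof.
rewrite /cmod normfV; have := normr_ge0 z; case: `|z| => x y; rewrite lecE /= => /andP[/eqP -> _].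
rewrite expr0n/= addr0; have [->|x0] := eqVneq x 0; first by rewrite mul0r invr0.
by rewrite expr2 invfM mulrA divff// mul1r.
Qed.
Lemma Re_le_cmod z : `|Re z| <= cmod z.
Proof. by rewrite cmodE -sqrtr_sqr ler_wsqrtr// lerDl sqr_ge0. Qed.
Lemma Im_le_cmod z : `|Im z| <= cmod z.
Proof. by rewrite cmodE -sqrtr_sqr ler_wsqrtr// lerDr sqr_ge0. Qed.
Lemma cmod_le z : cmod z <= `|Re z| + `|Im z|.
Proof.
rewrite -(@ler_pXn2r _ 2%N) ?nnegrE ?cmod_ge0 ?addr_ge0// cmod_sqr sqrrD.
by rewrite !real_normK ?num_real// addrAC lerDl mulrn_wge0// mulr_ge0.
Qed.

Lemma cexpD z w : cexp (z + w) = cexp z * cexp w.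
Proof.
rewrite /cexp cReD cImD expRD cosD sinD; apply: complex_ext;
  rewrite !(cReM, cImM)/=; ring.
Qed.

Lemma cmod_cexp z : cmod (cexp z) = expR (Re z).
Proof.
rewrite /cexp cmodM cmod_real ger0_norm ?expR_ge0//.
by rewrite cmodE/= cos2Dsin2 sqrtr1 mulr1.
Qed.

Lemma Re_cexp z : Re (cexp z) = expR (Re z) * cos (Im z).
Proof. by rewrite /cexp cReZ. Qed.
Lemma Im_cexp z : Im (cexp z) = expR (Re z) * sin (Im z).
Proof. by rewrite /cexp cImZ. Qed.

Let taylor2 (f f1 f2 : R -> R) (M : R) : (forall t : R, is_derive t (1 : R) f (f1 t)) ->
  (forall t : R, is_derive t (1 : R) f1 (f2 t)) ->
  (forall t, 0 <= t <= 1 -> `|f2 t| <= M) -> `|f 1 - f 0 - f1 0| <= M.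
Proof.
move=> d1 d2 fM.
have cd (k k' : R -> R) : (forall x : R, is_derive x (1 : R) k (k' x)) -> continuous k.
  move=> dk x; apply: differentiable_continuous; apply/derivable1_diffP.
  by have [] := dk x.
have [c c01 ->] := @MVT R f f1 0 1 ltr01 (fun x _ => d1 x) (continuous_subspaceT (cd _ _ d1)).
move: c01; rewrite in_itv/= => /andP[c0 c1].
have [e e0c e2] := @MVT R f1 f2 0 c c0 (fun x _ => d2 x) (continuous_subspaceT (cd _ _ d2)).
move: e0c; rewrite in_itv/= => /andP[e0 ec].
rewrite !subr0 mulr1 e2 subr0 normrM.
have h := fM e; rewrite (ltW e0) (ltW (lt_trans ec c1)) in h.
apply: le_trans (h isT); rewrite ler_piMr// ger0_norm ?ltW//.
Qed.

(** Taylor's formula for the real functions [t |-> Re (cexp (t z))] and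
    [t |-> Im (cexp (t z))] on [0, 1]. *)
Lemma cexp_taylor z : cmod (cexp z - 1 - z) <= 2 * (cmod z ^+ 2 * expR (cmod z)).
Proof.
case: z => x y; set M := cmod _ ^+ 2 * _.
have xy t : 0 <= t <= 1 -> forall u v : R, u ^+ 2 + v ^+ 2 = 1 ->
    `|expR (t * x) * ((x ^+ 2 - y ^+ 2) * u + 2 * x * y * v)| <= M.
  move=> /andP[t0 t1] u v uv; rewrite normrM ger0_norm ?expR_ge0// mulrC.
  apply: ler_pM => //.
    rewrite cmod_sqr/=; rewrite -(@ler_pXn2r _ 2%N) ?nnegrE ?addr_ge0 ?sqr_ge0//.
    rewrite real_normK ?num_real//.
    have -> : (x ^+ 2 + y ^+ 2) ^+ 2 = ((x ^+ 2 - y ^+ 2) ^+ 2 + (2 * x * y) ^+ 2) * (u ^+ 2 + v ^+ 2).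
      by rewrite uv; ring.
    rewrite -subr_ge0 (_ : _ - _ = ((x ^+ 2 - y ^+ 2) * v - 2 * x * y * u) ^+ 2) ?sqr_ge0//.
    ring.
  rewrite ler_expR; apply: le_trans (Re_le_cmod (x +i* y)).
  apply: le_trans (ler_norm _) _; rewrite normrM ger0_norm// ler_piMl//.
have h1 : `|expR (1 * x) * cos (1 * y) - expR (0 * x) * cos (0 * y) -
    expR (0 * x) * (x * cos (0 * y) - y * sin (0 * y))| <= M.
  apply: (@taylor2 (fun t => expR (t * x) * cos (t * y))
    (fun t => expR (t * x) * (x * cos (t * y) - y * sin (t * y)))
    (fun t => expR (t * x) * ((x ^+ 2 - y ^+ 2) * cos (t * y) + 2 * x * y * - sin (t * y)))).
  - by move=> t; apply: is_derive_eq; rewrite /GRing.scale/=; ring.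
  - by move=> t; apply: is_derive_eq; rewrite /GRing.scale/=; ring.
  - by move=> t t01; apply: xy => //; rewrite sqrrN cos2Dsin2.
have h2 : `|expR (1 * x) * sin (1 * y) - expR (0 * x) * sin (0 * y) -
    expR (0 * x) * (x * sin (0 * y) + y * cos (0 * y))| <= M.
  apply: (@taylor2 (fun t => expR (t * x) * sin (t * y))
    (fun t => expR (t * x) * (x * sin (t * y) + y * cos (t * y)))
    (fun t => expR (t * x) * ((x ^+ 2 - y ^+ 2) * sin (t * y) + 2 * x * y * cos (t * y)))).
  - by move=> t; apply: is_derive_eq; rewrite /GRing.scale/=; ring.
  - by move=> t; apply: is_derive_eq; rewrite /GRing.scale/=; ring.
  - by move=> t t01; apply: xy => //; rewrite addrC cos2Dsin2.
apply: le_trans (cmod_le _) _; rewrite mulr2n mulrDl mul1r.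
rewrite !(cReD, cImD, cReN, cImN) Re_cexp Im_cexp/=.
move: h1 h2.
rewrite !(mul0r, mul1r, expR0, cos0, sin0, mulr0, mulr1, addr0, subr0, add0r).
exact: lerD.
Qed.

Lemma cexp_cvg (z_ : nat -> R[i]) z : Re (z_ n) @[n --> \oo] --> Re z ->
  Im (z_ n) @[n --> \oo] --> Im z -> cmod (cexp (z_ n) - cexp z) @[n --> \oo] --> (0 : R).
Proof.
move=> cr ci.
have h1 : Re (cexp (z_ n)) - Re (cexp z) @[n --> \oo] --> (0 : R).
  rewrite -(subrr (Re (cexp z))); apply: cvgB; last exact: cvg_cst.
  under eq_fun do rewrite Re_cexp; rewrite Re_cexp; apply: cvgM.
    by apply: continuous_cvg => //; exact: continuous_expR.
  by apply: continuous_cvg => //; exact: continuous_cos.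
have h2 : Im (cexp (z_ n)) - Im (cexp z) @[n --> \oo] --> (0 : R).
  rewrite -(subrr (Im (cexp z))); apply: cvgB; last exact: cvg_cst.
  under eq_fun do rewrite Im_cexp; rewrite Im_cexp; apply: cvgM.
    by apply: continuous_cvg => //; exact: continuous_expR.
  by apply: continuous_cvg => //; exact: continuous_sin.
apply: (@squeeze_cvgr _ _ _ _ (cst 0) (fun n => `|Re (cexp (z_ n)) - Re (cexp z)| +
  `|Im (cexp (z_ n)) - Im (cexp z)|)).
- apply: nearW => n; rewrite cmod_ge0/=; apply: le_trans (cmod_le _) _.
  by rewrite !(cReD, cImD, cReN, cImN).
- exact: cvg_cst.
- rewrite -[X in _ --> X](addr0 (0 : R)) -[X in _ --> X + X](normr0 R).
  by apply: cvgD; exact: cvg_norm.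
Qed.

(** ** Principal square root *)

Lemma Re_sqrtc_ge0 z : 0 <= Re (sqrtc z).
Proof. by case: z => x y; rewrite /sqrtc/= sqrtr_ge0. Qed.

Lemma sqrtc_real (x : R) : 0 <= x -> sqrtc x%:C = (Num.sqrt x)%:C.
Proof. by move=> x0; rewrite sqrtc_sqrtr ?lecR//. Qed.

Lemma cmod_sqrtc z : cmod (sqrtc z) ^+ 2 = cmod z.
Proof. by rewrite expr2 -cmodM -expr2 sqr_sqrtc. Qed.

Lemma Re_sqrtc_sqr z : Re (sqrtc z) ^+ 2 - Im (sqrtc z) ^+ 2 = Re z.
Proof. by rewrite -{3}(sqr_sqrtc z) expr2 cReM -!expr2. Qed.

Lemma Re_sqrtc_gt0 z : z != 0 -> 0 <= Re z -> 0 < Re (sqrtc z).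
Proof.
move=> z0 rz; rewrite lt0r Re_sqrtc_ge0 andbT; apply: contra z0 => /eqP h.
have := Re_sqrtc_sqr z; rewrite h expr0n/= sub0r => h2.
have i0 : Im (sqrtc z) ^+ 2 = 0.
  by apply/eqP; rewrite eq_le sqr_ge0 andbT -oppr_ge0 h2.
rewrite -sqrtc_eq0; apply/eqP/complex_ext => //=.
by apply/eqP; rewrite -sqrf_eq0 i0.
Qed.

(** Factor [w - z] as a difference of squares; the sum of the two roots has real part at
    least that of [sqrtc z]. *)
Lemma sqrtc_dist z w : z != 0 -> 0 <= Re z -> 0 <= Re w ->
  cmod (sqrtc w - sqrtc z) <= cmod (w - z) / Re (sqrtc z).
Proof.
move=> z0 rz rw; have p := Re_sqrtc_gt0 z0 rz.
rewrite ler_pdivlMr//.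
have -> : w - z = (sqrtc w - sqrtc z) * (sqrtc w + sqrtc z).
  by rewrite -subr_sqr !sqr_sqrtc.
rewrite cmodM ler_wpM2l ?cmod_ge0//; apply: le_trans (Re_le_cmod _).
apply: le_trans (ler_norm _); rewrite cReD lerDr; exact: Re_sqrtc_ge0.
Qed.

(** In the closed right half-plane the argument of the square root is at most
    pi/4 in absolute value. *)
Lemma Im_inv_sqrtc z : 0 <= Re z -> 2 * Im ((sqrtc z)^-1) ^+ 2 <= (cmod z)^-1.
Proof.
move=> rz; rewrite -cmod_sqrtc -exprVn -cmodV cmod_sqr.
rewrite mulr2n mulrDl mul1r lerD2r -subr_ge0.
have -> : Re (sqrtc z)^-1 ^+ 2 - Im (sqrtc z)^-1 ^+ 2 = Re (z^-1).
  by rewrite -{3}(sqr_sqrtc z) -exprVn expr2 cReM -!expr2.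
by case: z rz => x y /= rz; rewrite divr_ge0// addr_ge0// sqr_ge0.
Qed.

End complex_exponential.

(** * Complex integrals and differentiability in two complex variables *)

Section complex_integrals.
Context d (X : measurableType d) (R : realType) (m : {measure set X -> \bar R}).
Implicit Types F G : X -> R[i].
Local Notation Re := (@complex.Re R).
Local Notation Im := (@complex.Im R).

Definition measurable_cfun F :=
  measurable_fun setT (fun x => Re (F x)) /\ measurable_fun setT (fun x => Im (F x)).

Lemma measurable_cfunD F G : measurable_cfun F -> measurable_cfun G ->
  measurable_cfun (fun x => F x + G x).
Proof.
move=> [a b] [c e]; split.
  by under eq_fun do rewrite cReD; exact: measurable_funD.
by under eq_fun do rewrite cImD; exact: measurable_funD.
Qed.

Lemma measurable_cfunM F G : measurable_cfun F -> measurable_cfun G ->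
  measurable_cfun (fun x => F x * G x).
Proof.
move=> [a b] [c e]; split.
  by under eq_fun do rewrite cReM; apply: measurable_funB; exact: measurable_funM.
by under eq_fun do rewrite cImM; apply: measurable_funD; exact: measurable_funM.
Qed.

Lemma measurable_cfun_cst (z : R[i]) : measurable_cfun (fun=> z).
Proof. by split; exact: measurable_cst. Qed.

Lemma measurable_cfun_real (g : X -> R) : measurable_fun setT g ->
  measurable_cfun (fun x => (g x)%:C).
Proof. by move=> mg; split => //; exact: measurable_cst. Qed.

Lemma measurable_cfun_exp F : measurable_cfun F -> measurable_cfun (fun x => cexp (F x)).
Proof.
move=> [a b]; have me : measurable_fun setT (fun x => expR (Re (F x))).
  exact: measurableT_comp.
split.
  under eq_fun do rewrite Re_cexp; apply: measurable_funM => //.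
  exact: (measurableT_comp (continuous_measurable_fun (@continuous_cos R)) b).
under eq_fun do rewrite Im_cexp; apply: measurable_funM => //.
exact: (measurableT_comp (continuous_measurable_fun (@continuous_sin R)) b).
Qed.

Lemma measurable_cmod F : measurable_cfun F -> measurable_fun setT (fun x => cmod (F x)).
Proof.
move=> [a b]; under eq_fun do rewrite cmodE.
apply: (measurableT_comp (continuous_measurable_fun (@sqrt_continuous R))).
by apply: measurable_funD; exact: measurable_funX.
Qed.

Definition cintble F := m.-integrable setT (EFin \o (Re \o F)) /\
  m.-integrable setT (EFin \o (Im \o F)).

Lemma cintble_le F (g : X -> R) : measurable_cfun F -> (forall x, cmod (F x) <= g x) ->
  m.-integrable setT (EFin \o g) -> cintble F.
Proof.
move=> [mr mi] Fg ig; split.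
  apply: le_integrable ig => //; first exact/measurable_EFinP.
  move=> x _; rewrite lee_fin; apply: le_trans (Re_le_cmod _) _.
  exact: le_trans (Fg x) (ler_norm _).
apply: le_integrable ig => //; first exact/measurable_EFinP.
move=> x _; rewrite lee_fin; apply: le_trans (Im_le_cmod _) _.
exact: le_trans (Fg x) (ler_norm _).
Qed.

Lemma Re_cintegral F : Re (cintegral m F) = \int[m]_x Re (F x). Proof. by []. Qed.
Lemma Im_cintegral F : Im (cintegral m F) = \int[m]_x Im (F x). Proof. by []. Qed.

Lemma cintbleD F G : cintble F -> cintble G -> cintble (fun x => F x + G x).
Proof.
move=> [a b] [c e]; split.
  by apply: eq_integrable (integrableD measurableT a c) => // x _; rewrite /= cReD.
by apply: eq_integrable (integrableD measurableT b e) => // x _; rewrite /= cImD.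
Qed.

Lemma cintegralD F G : cintble F -> cintble G ->
  cintegral m (fun x => F x + G x) = cintegral m F + cintegral m G.
Proof.
move=> [a b] [c e]; apply: complex_ext.
  rewrite cReD !Re_cintegral; under eq_Rintegral do rewrite cReD.
  exact: RintegralD.
rewrite cImD !Im_cintegral; under eq_Rintegral do rewrite cImD.
exact: RintegralD.
Qed.

Lemma cintbleZ (z : R[i]) F : cintble F -> cintble (fun x => z * F x).
Proof.
move=> [a b]; split.
  have h := integrableB measurableT (integrableZl measurableT (Re z) a)
    (integrableZl measurableT (Im z) b).
  by apply: eq_integrable h => // x _; rewrite /= cReM.
have h := integrableD measurableT (integrableZl measurableT (Re z) b)
    (integrableZl measurableT (Im z) a).
by apply: eq_integrable h => // x _; rewrite /= cImM.
Qed.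

Lemma cintegralZ (z : R[i]) F : cintble F ->
  cintegral m (fun x => z * F x) = z * cintegral m F.
Proof.
move=> [a b].
have ia := integrableZl measurableT (Re z) a; have ib := integrableZl measurableT (Im z) b.
have ia' := integrableZl measurableT (Im z) a; have ib' := integrableZl measurableT (Re z) b.
apply: complex_ext.
  rewrite cReM Re_cintegral Im_cintegral; under eq_Rintegral do rewrite cReM.
  by rewrite (RintegralB measurableT ia ib) !RintegralZl.
rewrite cImM Re_cintegral Im_cintegral; under eq_Rintegral do rewrite cImM.
by rewrite (RintegralD measurableT ib' ia') !RintegralZl.
Qed.

Lemma cintbleB F G : cintble F -> cintble G -> cintble (fun x => F x - G x).
Proof.
move=> a b; have := cintbleD a (cintbleZ (-1) b).
by under eq_fun do rewrite mulN1r.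
Qed.

Lemma cintegralB F G : cintble F -> cintble G ->
  cintegral m (fun x => F x - G x) = cintegral m F - cintegral m G.
Proof.
move=> a b; have := cintegralD a (cintbleZ (-1) b).
rewrite cintegralZ// mulN1r => <-; congr cintegral.
by apply/funext => x; rewrite mulN1r.
Qed.

(** The factor 2 comes from bounding real and imaginary parts separately. *)
Lemma cmod_cintegral F (g : X -> R) : cintble F -> m.-integrable setT (EFin \o g) ->
  (forall x, cmod (F x) <= g x) -> cmod (cintegral m F) <= 2 * \int[m]_x g x.
Proof.
move=> [a b] ig Fg; apply: le_trans (cmod_le _) _; rewrite mulr2n mulrDl mul1r.
apply: lerD.
  apply: le_trans (le_normr_Rintegral measurableT a) _.
  apply: le_Rintegral => //; first exact: integrable_norm a.
  by move=> x _; exact: le_trans (Re_le_cmod _) (Fg x).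
apply: le_trans (le_normr_Rintegral measurableT b) _.
apply: le_Rintegral => //; first exact: integrable_norm b.
by move=> x _; exact: le_trans (Im_le_cmod _) (Fg x).
Qed.

End complex_integrals.

Section complex_differentiability.
Context (R : realType).
Local Notation V := (R[i]^o * R[i]^o)%type.
Implicit Types (J U : V -> R[i]^o) (l h : V).

Definition vmod h : R := complex.Re `|h|.

Lemma vmodE h : `|h| = (vmod h)%:C.
Proof. by rewrite /vmod RRe_real// ger0_real. Qed.

Lemma vmod_ge0 h : 0 <= vmod h.
Proof. by rewrite -(@ler0c R) -vmodE. Qed.

Lemma normcR (z : R[i]^o) : `|z| = (cmod z)%:C. Proof. by []. Qed.

Lemma near0_vmod (r : R) : 0 < r -> \forall h \near (0 : V), vmod h <= r.
Proof.
move=> r0; apply/nbhs_norm0P; exists r%:C => /=; first by rewrite ltcR.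
by move=> h /=; rewrite vmodE ltcR; exact: ltW.
Qed.

(** A remainder of order o(|h|) has zero differential. *)
Lemma differentiable_flat J l :
  (forall e : R, 0 < e -> \forall h \near (0 : V), cmod (J (h + l) - J l) <= e * vmod h) ->
  differentiable J l.
Proof.
move=> H; pose df : {linear V -> R[i]^o} := \0.
have e0 : J \o shift l = cst (J l) + df +o_ (0 : V) id.
  apply/eqaddoP => eps; case: eps => x y; rewrite ltcE/= => /andP[/eqP y0 x0].
  apply: filterS (H x x0) => h; rewrite -(@lecR R) rmorphM/= -vmodE => h1.
  move: h1; rewrite -normcR y0; congr (is_true (`|_| <= _)).
  by rewrite /= !fctE/= addr0.
have cdf : continuous df by move=> x; exact: cvg_cst.
apply/diff_locallyP; rewrite (diff_unique cdf e0); split => //.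
Qed.

Lemma differentiable_increment U l : differentiable U l ->
  exists2 M : R, 0 < M & \forall h \near (0 : V), cmod (U (h + l) - U l) <= M * vmod h.
Proof.
move=> /diff_locallyP[cd e].
have [k k0 kd] := linear_lipschitz cd.
move: k0; rewrite ltcE/= => /andP[/eqP kI kR].
exists (complex.Re k + 1); first by rewrite addr_gt0.
have : \forall h \near (0 : V), `|(U \o shift l - (cst (U l) + 'd U l)) h| <= 1 * `|h|.
  have /eqaddoP := e; exact.
apply: filterS => h h1; rewrite -(@lecR R) -normcR rmorphM/= -vmodE.
have -> : U (h + l) - U l = (U \o shift l - (cst (U l) + 'd U l)) h + 'd U l h.
  by rewrite !fctE/=; ring.
apply: le_trans (ler_normD _ _) _; rewrite rmorphD/= mulrDl addrC lerD//.
have <- : k = (complex.Re k)%:C by case: k kI {kR kd} => x y /= ->.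
exact: kd.
Qed.

End complex_differentiability.

(** * Analyticity of integrals of exponentials *)

Section finite_sums.
Context d (X : measurableType d) (R : realType) (m : {measure set X -> \bar R}).
Variables (I : finType) (F : I -> X -> R[i]).

Lemma measurable_cfun_sum : (forall k, measurable_cfun (F k)) ->
  measurable_cfun (fun x => \sum_k F k x).
Proof.
move=> mF; elim: (index_enum _) => [|k s IH].
  by under eq_fun do rewrite big_nil; exact: measurable_cfun_cst.
by under eq_fun do rewrite big_cons; exact: measurable_cfunD.
Qed.

Lemma cintegral_sum : (forall k, cintble m (F k)) ->
  cintble m (fun x => \sum_k F k x) /\
  cintegral m (fun x => \sum_k F k x) = \sum_k cintegral m (F k).
Proof.
move=> iF; elim: (index_enum _) => [|k s [IH1 IH2]].
  under eq_fun do rewrite big_nil; rewrite big_nil; split.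
    by split; apply: eq_integrable (integrable0 _ _) => // x _.
  by apply: complex_ext; rewrite /= Rintegral_cst// mul0r.
under eq_fun do rewrite big_cons; rewrite big_cons; split; first exact: cintbleD.
by rewrite cintegralD// IH2.
Qed.

End finite_sums.

Section parametric_exponential.
Context d (X : measurableType d) (R : realType) (m : {finite_measure set X -> \bar R}).
Local Notation V := (R[i]^o * R[i]^o)%type.
Variables (n : nat) (U : 'I_n -> V -> R[i]^o) (c : 'I_n -> X -> R) (G : X -> R[i]).
Variables (tau : X -> R) (C C0 al : R) (l : V).
Hypotheses (mc : forall k, measurable_fun setT (c k)) (mG : measurable_cfun G).
Hypothesis G1 : forall x, cmod (G x) <= 1.
Hypotheses (tau0 : forall x, 0 <= tau x) (al0 : 0 < al) (Cge0 : 0 <= C).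
Hypothesis cC : forall k x, `|c k x| <= C * (1 + tau x).
Hypothesis dU : forall k, differentiable (U k) l.

Definition exponent (l' : V) x : R[i] := \sum_k U k l' * (c k x)%:C.

Hypothesis decay : forall x, complex.Re (exponent l x) <= C0 - al * tau x.

Let qq := Num.min 1 (al / 4).
Let qq0 : 0 < qq. Proof. by rewrite lt_min ltr01 divr_gt0. Qed.

(** The square of [qq * (1 + t) <= 1 + al / 4 * t <= expR (al / 4 * t)]. *)
Lemma poly_exp_decay (t : R) : 0 <= t ->
  (1 + t) ^+ 2 * expR (- (al / 2 * t)) <= qq ^- 2.
Proof.
move=> t0; rewrite expRN ler_pdivrMr ?expR_gt0//.
rewrite (_ : al / 2 * t = al / 4 * t + al / 4 * t); last by field.
rewrite expRD -expr2 mulrC -ler_pdivrMr ?invr_gt0 ?exprn_gt0// invrK -exprMn.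
rewrite ler_sqr ?nnegrE ?expR_ge0 ?mulr_ge0 ?addr_ge0 ?(ltW qq0)//.
apply: le_trans (expR_ge1Dx _); rewrite mulrDl mul1r.
by apply: lerD; [|rewrite mulrC ler_wpM2r//]; rewrite ge_min lexx ?orbT.
Qed.

Lemma measurable_exponent l' : measurable_cfun (exponent l').
Proof.
apply: measurable_cfun_sum => k; apply: measurable_cfunM.
  exact: measurable_cfun_cst.
exact: measurable_cfun_real.
Qed.

Let kernel l' x := G x * cexp (exponent l' x).

Let mk l' : measurable_cfun (kernel l').
Proof.
by apply: measurable_cfunM => //; apply: measurable_cfun_exp; exact: measurable_exponent.
Qed.

Let kernel_le x : cmod (kernel l x) <= expR (C0 - al * tau x).
Proof.
rewrite cmodM cmod_cexp -[leRHS]mul1r ler_pM ?cmod_ge0 ?expR_ge0//.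
by rewrite ler_expR.
Qed.

Let icst (k : R) : m.-integrable setT (EFin \o (fun=> k)).
Proof. exact: finite_measure_integrable_cst. Qed.

Let ker0 : cintble m (kernel l).
Proof.
apply: (cintble_le (mk l)) (icst (expR C0)) => x.
apply: le_trans (kernel_le x) _.
by rewrite ler_expR gerBl mulr_ge0// ltW.
Qed.

Let ker_c k : cintble m (fun x => kernel l x * (c k x)%:C).
Proof.
apply: (cintble_le (g := fun=> expR C0 * C * qq ^- 2)) => //.
  by apply: measurable_cfunM => //; exact: measurable_cfun_real.
move=> x; rewrite cmodM cmod_real.
apply: le_trans (ler_pM (cmod_ge0 _) (normr_ge0 _) (kernel_le x) (cC k x)) _.
rewrite expRD -!mulrA ler_wpM2l ?expR_ge0// mulrCA ler_wpM2l//.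
apply: le_trans (poly_exp_decay (tau0 x)); rewrite mulrC.
have t1 : 1 <= 1 + tau x by rewrite lerDl.
apply: ler_pM; rewrite ?expR_ge0 ?(le_trans _ t1)//.
  by rewrite expr2 ler_peMr// (le_trans _ t1).
rewrite ler_expR lerN2 ler_wpM2r//; move: al0; lra.
Qed.

(** Subtract from the integral the combination [L] of the differentiable functions [U k]
    that has the expected differential. The difference has increment equal to the integral of
    the second order Taylor remainder of the exponential, which is O(|h|^2): the
    exponent moves by at most [B |h| (1 + tau)], and the decay [exp (- al tau)] absorbs both the
    factor [(1 + tau) ^ 2] and the growth of the exponential of the displacement. *)
Lemma differentiable_exp_integral :
  differentiable ((fun l' => cintegral m (kernel l')) : V -> R[i]^o) l.
Proof.
pose I_ k : R[i] := cintegral m (fun x => kernel l x * (c k x)%:C).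
pose L : V -> R[i]^o := \sum_k ((I_ k : R[i]) *: (U k : V -> R[i]^o)).
have dL : differentiable L l.
  by apply: differentiable_sum => k; exact: differentiableZ.
pose J : V -> R[i]^o := fun l' => cintegral m (kernel l').
suff dJL : differentiable (J - L) l.
  rewrite (_ : (fun l' => _) = (J - L) + L); last by rewrite subrK.
  exact: differentiableD.
have [M M0 HM] : exists2 M : R, 0 < M & \forall h \near (0 : V), forall k,
    cmod (U k (h + l) - U k l) <= M * vmod h.
  have /choice [M_ HM_] : forall k, exists M : R, 0 < M /\ \forall h \near (0 : V),
      cmod (U k (h + l) - U k l) <= M * vmod h.
    by move=> k; have [M M0 HM] := differentiable_increment (dU k); exists M.
  exists (1 + \sum_k M_ k).
    by rewrite ltr_pwDl// sumr_ge0// => k _; rewrite ltW//; case: (HM_ k).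
  have : \forall h \near (0 : V), forall k, cmod (U k (h + l) - U k l) <= M_ k * vmod h.
    apply: (@filter_forall V 'I_n (fun k h => cmod (U k (h + l) - U k l) <= M_ k * vmod h)
      (nbhs (0 : V))) => k.
    by case: (HM_ k).
  apply: filterS => h H k; apply: le_trans (H k) _; rewrite ler_wpM2r ?vmod_ge0//.
  rewrite (bigD1 k)//= addrCA lerDl addr_ge0// sumr_ge0// => j _.
  by rewrite ltW//; case: (HM_ j).
pose B := n%:R * M * C + 1.
have B0 : 0 < B by rewrite ltr_wpDl// !mulr_ge0// ltW.
pose mT := fine (m setT).
have mT0 : 0 <= mT by exact: fine_ge0.
pose K := 2 * (2 * B ^+ 2 * expR (C0 + al / 2) * qq ^- 2) * mT.
have K0 : 0 <= K.
  have q2 : 0 <= qq ^- 2 by rewrite invr_ge0 sqr_ge0.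
  have p2 : 0 <= 2 :> R by [].
  exact: (mulr_ge0 (mulr_ge0 p2 (mulr_ge0 (mulr_ge0 (mulr_ge0 p2 (sqr_ge0 B))
    (expR_ge0 _)) q2)) mT0).
apply: differentiable_flat => e e0.
have r0 : 0 < Num.min (al / 2 / B) (e / (K + 1)).
  by rewrite lt_min !divr_gt0// ltr_wpDl.
apply: filterS2 HM (near0_vmod r0) => h HMh.
rewrite le_min => /andP[hB hK].
have v0 := vmod_ge0 h.
pose z x := exponent (h + l) x - exponent l x.
have zE x : z x = \sum_k (U k (h + l) - U k l) * (c k x)%:C.
  by rewrite /z /exponent -sumrB; apply: eq_bigr => k _; rewrite mulrBl.
have zB x : cmod (z x) <= B * vmod h * (1 + tau x).
  rewrite zE; apply: (@le_trans _ _ (\sum_(k < n) M * vmod h * (C * (1 + tau x)))).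
    elim/big_ind2: _ => [|p u q v pu qv|k _]; first by rewrite cmod0.
      by apply: le_trans (cmodD _ _) _; exact: lerD.
    by rewrite cmodM cmod_real; apply: ler_pM (HMh k) (cC k x); rewrite ?cmod_ge0.
  rewrite sumr_const card_ord -mulr_natl.
  rewrite (_ : n%:R * _ = n%:R * M * C * vmod h * (1 + tau x)); last by ring.
  by rewrite ler_wpM2r ?addr_ge0// ler_wpM2r// /B lerDl.
have zal x : cmod (z x) <= al / 2 * (1 + tau x).
  apply: le_trans (zB x) _; rewrite ler_wpM2r ?addr_ge0//.
  by rewrite mulrC -ler_pdivlMr.
have kerz x : kernel (h + l) x = kernel l x * cexp (z x).
  by rewrite /kernel /z -mulrA -cexpD [exponent l x + _]addrC subrK.
have i1 : cintble m (kernel (h + l)).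
  apply: (cintble_le (mk _)) (icst (expR (C0 + al / 2))) => x.
  rewrite kerz cmodM cmod_cexp.
  apply: le_trans (ler_pM (cmod_ge0 _) (expR_ge0 _) (kernel_le x) (lexx _)) _.
  rewrite -expRD ler_expR.
  have := le_trans (ler_norm _) (le_trans (Re_le_cmod _) (zal x)).
  have : 0 <= al / 2 * tau x by rewrite mulr_ge0// divr_ge0// ltW.
  rewrite mulrDr mulr1; lra.
have [iz zI] : cintble m (fun x => kernel l x * z x) /\
    cintegral m (fun x => kernel l x * z x) = \sum_k (U k (h + l) - U k l) * I_ k.
  have ik k : cintble m (fun x => (U k (h + l) - U k l) * (kernel l x * (c k x)%:C)).
    exact: cintbleZ (ker_c k).
  have kzE x : kernel l x * z x = \sum_k (U k (h + l) - U k l) * (kernel l x * (c k x)%:C).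
    by rewrite zE mulr_sumr; apply: eq_bigr => k _; rewrite mulrCA.
  rewrite (funext kzE); have [i1' ->] := cintegral_sum ik; split => //.
  by apply: eq_bigr => k _; rewrite cintegralZ.
have e1 : (J - L) (h + l) - (J - L) l =
    cintegral m (fun x => kernel l x * (cexp (z x) - 1 - z x)).
  have -> : (fun x => kernel l x * (cexp (z x) - 1 - z x)) =
      (fun x => kernel (h + l) x - kernel l x - kernel l x * z x).
    by apply/funext => x; rewrite kerz; ring.
  rewrite (cintegralB (cintbleB i1 ker0) iz) (cintegralB i1 ker0) zI.
  have LE l' : L l' = \sum_k I_ k * U k l' by rewrite /L fct_sumE.
  rewrite -[(J - L) (h + l)]/(J (h + l) - L (h + l)) -[(J - L) l]/(J l - L l) !LE.
  have -> : \sum_k (U k (h + l) - U k l) * I_ k =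
      \sum_k I_ k * U k (h + l) - \sum_k I_ k * U k l.
    by rewrite -sumrB; apply: eq_bigr => k _; ring.
  rewrite /J; ring.
rewrite e1.
have bd x : cmod (kernel l x * (cexp (z x) - 1 - z x)) <=
    2 * B ^+ 2 * expR (C0 + al / 2) * qq ^- 2 * vmod h ^+ 2.
  rewrite cmodM.
  apply: le_trans (ler_pM (cmod_ge0 _) (cmod_ge0 _) (kernel_le x) (cexp_taylor _)) _.
  have h1 : cmod (z x) ^+ 2 <= (B * vmod h * (1 + tau x)) ^+ 2.
    by rewrite ler_sqr ?nnegrE ?cmod_ge0// (le_trans (cmod_ge0 _) (zB x)).
  have h2 : expR (cmod (z x)) <= expR (al / 2 * (1 + tau x)) by rewrite ler_expR.
  have h3 := ler_pM (sqr_ge0 _) (expR_ge0 _) h1 h2.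
  apply: (@le_trans _ _ (expR (C0 - al * tau x) *
      (2 * ((B * vmod h * (1 + tau x)) ^+ 2 * expR (al / 2 * (1 + tau x)))))).
    by rewrite ler_wpM2l ?expR_ge0// ler_wpM2l.
  have -> : expR (C0 - al * tau x) * (2 * ((B * vmod h * (1 + tau x)) ^+ 2 * expR (al / 2 * (1 + tau x)))) =
     2 * B ^+ 2 * vmod h ^+ 2 * (expR (C0 + al / 2) * ((1 + tau x) ^+ 2 * expR (- (al / 2 * tau x)))).
    have -> : expR (C0 + al / 2) * ((1 + tau x) ^+ 2 * expR (- (al / 2 * tau x))) =
        (1 + tau x) ^+ 2 * (expR (C0 - al * tau x) * expR (al / 2 * (1 + tau x))).
      by rewrite mulrCA -!expRD; congr (_ * expR _); field.
    ring.
  rewrite (_ : 2 * B ^+ 2 * expR (C0 + al / 2) * qq ^- 2 * vmod h ^+ 2 =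
    2 * B ^+ 2 * vmod h ^+ 2 * (expR (C0 + al / 2) * qq ^- 2)); last by ring.
  apply: ler_wpM2l.
    exact: (mulr_ge0 (mulr_ge0 (ler0n _ 2) (sqr_ge0 B)) (sqr_ge0 (vmod h))).
  by apply: ler_wpM2l; [exact: expR_ge0|exact: poly_exp_decay].
have ii : cintble m (fun x => kernel l x * (cexp (z x) - 1 - z x)).
  have := cintbleB (cintbleB i1 ker0) iz.
  congr cintble; apply/funext => x; rewrite kerz; ring.
apply: le_trans (cmod_cintegral ii (icst _) bd) _.
rewrite Rintegral_cst// -/mT.
rewrite [leLHS](_ : _ = K * vmod h * vmod h); last by rewrite /K; ring.
rewrite ler_wpM2r//; apply: (@le_trans _ _ ((K + 1) * vmod h)).
  by rewrite ler_wpM2r// lerDl.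
by rewrite mulrC -ler_pdivlMr// ltr_wpDl.
Qed.

End parametric_exponential.

(** * The coefficients of the exponent *)

Section exponent_coefficients.
Context (R : realType).
Local Notation V := (R[i]^o * R[i]^o)%type.

(** Indexed by a boolean so that both variables are treated at once. *)
Definition coordinate (j : bool) (l : V) : R[i] := if j then l.2 else l.1.

Lemma coordinateD j (h l : V) : coordinate j (h + l) = coordinate j h + coordinate j l.
Proof. by case: j. Qed.

Lemma cmod_coordinate j h : cmod (coordinate j h) <= vmod h.
Proof.
rewrite -(@lecR R) -vmodE -normcR prod_normE /coordinate.
by case: j; rewrite comparable_le_max ?lexx ?orbT//; apply: real_comparable; apply: normr_real.
Qed.

Lemma differentiable_coordinate j (l : V) :
  differentiable (coordinate j : V -> R[i]^o) l.
Proof.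
case: j; rewrite /coordinate.
  apply: (@linear_differentiable _ _ _ (snd : {linear V -> R[i]^o})) => x.
  exact: cvg_snd.
apply: (@linear_differentiable _ _ _ (fst : {linear V -> R[i]^o})) => x.
exact: cvg_fst.
Qed.

(** A quadratic remainder makes [f] complex differentiable; the composition with a
    coordinate is then corrected by a linear map and is flat. *)
Lemma differentiable_of_taylor (f : R[i] -> R[i]) (f' : R[i]) j (l : V) (K r : R) :
  0 <= K -> 0 < r ->
  (forall h : R[i], cmod h <= r ->
     cmod (f (coordinate j l + h) - f (coordinate j l) - f' * h) <= K * cmod h ^+ 2) ->
  differentiable ((fun l => f (coordinate j l)) : V -> R[i]^o) l.
Proof.
move=> K0 r0 H.
pose L : V -> R[i]^o := f' *: (coordinate j : V -> R[i]^o).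
have dL : differentiable L l by apply: differentiableZ; exact: differentiable_coordinate.
pose J : V -> R[i]^o := fun l => f (coordinate j l).
suff dJL : differentiable (J - L) l.
  rewrite (_ : (fun l' => _) = (J - L) + L); last by rewrite subrK.
  exact: differentiableD.
apply: differentiable_flat => e e0.
have r1 : 0 < Num.min r (e / (K + 1)) by rewrite lt_min r0 divr_gt0// ltr_wpDl.
apply: filterS (near0_vmod r1) => h; rewrite le_min => /andP[hr he].
have v0 := vmod_ge0 h; have ch := cmod_coordinate j h.
rewrite -[(J - L) (h + l)]/(J (h + l) - f' * coordinate j (h + l)).
rewrite -[(J - L) l]/(J l - f' * coordinate j l) /J coordinateD.
have -> : f (coordinate j h + coordinate j l) - f' * (coordinate j h + coordinate j l) -
    (f (coordinate j l) - f' * coordinate j l) =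
    f (coordinate j l + coordinate j h) - f (coordinate j l) - f' * coordinate j h.
  rewrite (addrC (coordinate j h)); ring.
apply: le_trans (H _ (le_trans ch hr)) _.
apply: (@le_trans _ _ (K * vmod h * vmod h)).
  rewrite -mulrA ler_wpM2l// -expr2 ler_sqr// nnegrE; exact: cmod_ge0.
rewrite ler_wpM2r//; apply: (@le_trans _ _ ((K + 1) * vmod h)).
  by rewrite ler_wpM2r// lerDl.
by rewrite mulrC -ler_pdivlMr// ltr_wpDl.
Qed.

(** The exponent of psi is [quad_coef l * (A w, w) + lin_coef l * (S w, a)] in each
    coordinate. *)
Definition quad_coef (z : R[i]) : R[i] := - (2 * z)^-1.
Definition lin_coef (z : R[i]) : R[i] := 'i * (sqrtc z)^-1.

Let cmod_neq0 (z : R[i]) : 0 < complex.Re z -> z != 0.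
Proof. by move=> h; apply/eqP => z0; rewrite z0 ltxx in h. Qed.

Let cmod_gt0 (z : R[i]) : z != 0 -> 0 < cmod z.
Proof.
by move=> z0; rewrite lt0r cmod_ge0 andbT; apply: contra z0 => /eqP/cmod_eq0 ->.
Qed.

Let cmod_add_ge (z h : R[i]) : cmod h <= cmod z / 2 -> cmod z / 2 <= cmod (z + h).
Proof.
by move=> hz; have := cmodB (z + h) h; rewrite addrK; lra.
Qed.

Lemma differentiable_quad_coef j (l : V) : 0 < complex.Re (coordinate j l) ->
  differentiable ((fun l => quad_coef (coordinate j l)) : V -> R[i]^o) l.
Proof.
move=> rz; set z := coordinate j l; have z0 : z != 0 := cmod_neq0 rz.
have cz := cmod_gt0 z0.
apply: (@differentiable_of_taylor _ ((2 * z ^+ 2)^-1) j l ((cmod z ^+ 3)^-1) (cmod z / 2)).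
- by rewrite invr_ge0 exprn_ge0// cmod_ge0.
- by rewrite divr_gt0.
move=> h hz; rewrite -/z; have hz2 := cmod_add_ge hz.
have zh0 : z + h != 0.
  by apply: contraTN hz2 => /eqP ->; rewrite cmod0 -ltNge divr_gt0.
have -> : quad_coef (z + h) - quad_coef z - (2 * z ^+ 2)^-1 * h =
    - (h ^+ 2) / (2 * z ^+ 2 * (z + h)).
  by rewrite /quad_coef; field; rewrite ?z0 ?zh0//.
have c2 : cmod (2 : R[i]) = 2 by rewrite -(rmorph_nat (real_complex R) 2) cmod_real ger0_norm.
have cX (u : R[i]) k : cmod (u ^+ k) = cmod u ^+ k.
  elim: k => [|k IH]; last by rewrite !exprS cmodM IH.
  by rewrite !expr0 -(rmorph1 (real_complex R)) cmod_real normr1.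
rewrite !(cX, cmodV, cmodN, c2, cmodM) mulrC ler_wpM2r ?sqr_ge0//.
rewrite lef_pV2 ?posrE ?exprn_gt0 ?mulr_gt0 ?exprn_gt0//; last by apply: lt_le_trans hz2; rewrite divr_gt0.
rewrite (_ : cmod z ^+ 3 = 2 * cmod z ^+ 2 * (cmod z / 2)); last by field.
by rewrite ler_wpM2l// mulr_ge0// sqr_ge0.
Qed.

Lemma differentiable_lin_coef j (l : V) : 0 < complex.Re (coordinate j l) ->
  differentiable ((fun l => lin_coef (coordinate j l)) : V -> R[i]^o) l.
Proof.
move=> rz; set z := coordinate j l; have z0 : z != 0 := cmod_neq0 rz.
have cz := cmod_gt0 z0; set s := sqrtc z.
have s0 : s != 0 by rewrite sqrtc_eq0.
have cs := cmod_gt0 s0; have rs : 0 < complex.Re s := Re_sqrtc_gt0 z0 (ltW rz).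
have s2 : s ^+ 2 = z by rewrite sqr_sqrtc.
have cX (u : R[i]) k : cmod (u ^+ k) = cmod u ^+ k.
  elim: k => [|k IH]; last by rewrite !exprS cmodM IH.
  by rewrite !expr0 -(rmorph1 (real_complex R)) cmod_real normr1.
have c2 : cmod (2 : R[i]) = 2 by rewrite -(rmorph_nat (real_complex R) 2) cmod_real ger0_norm.
have ci : cmod ('i : R[i]) = 1 by rewrite cmodE/= expr0n/= add0r expr1n sqrtr1.
apply: (@differentiable_of_taylor _ (- 'i / (2 * s ^+ 3)) j l
  ((complex.Re s) ^- 2 * (3 / cmod s ^+ 3)) (Num.min (complex.Re z) (cmod z / 2))).
- by rewrite mulr_ge0// ?divr_ge0 ?exprn_ge0 ?cmod_ge0// invr_ge0 sqr_ge0.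
- by rewrite lt_min rz divr_gt0.
move=> h; rewrite -/z le_min => /andP[hr hz]; have hz2 := cmod_add_ge hz.
have zh0 : z + h != 0.
  by apply: contraTN hz2 => /eqP ->; rewrite cmod0 -ltNge divr_gt0.
have rzh : 0 <= complex.Re (z + h).
  have := le_trans (Re_le_cmod h) hr; rewrite cReD ler_norml => /andP[+ _]; lra.
set s' := sqrtc (z + h).
have s'0 : s' != 0 by rewrite sqrtc_eq0.
have s'2 : s' ^+ 2 = z + h by rewrite sqr_sqrtc.
have cs' : cmod s / 2 <= cmod s'.
  rewrite -(@ler_pXn2r _ 2%N) ?nnegrE ?cmod_ge0 ?divr_ge0 ?cmod_ge0//.
  rewrite -[leRHS]cX s'2; apply: le_trans hz2; rewrite exprMn -cX s2.
  rewrite ler_wpM2l ?cmod_ge0// exprVn lef_pV2 ?posrE ?exprn_gt0//.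
  by rewrite expr2 ler_peMr// (ler_nat R 1 2).
have hE : h = s' ^+ 2 - s ^+ 2 by rewrite s'2 s2; ring.
(* With s and s' the roots of z and z + h, the remainder has the factor (s' - s)^2.
   *)
have -> : lin_coef (z + h) - lin_coef z - - 'i / (2 * s ^+ 3) * h =
    'i * (s' - s) ^+ 2 * ((s ^+ 2 * s')^-1 + (2 * s ^+ 3)^-1).
  by rewrite /lin_coef -/s -/s' hE; field; rewrite ?s0 ?s'0.
have ds : cmod (s' - s) <= cmod h / complex.Re s.
  have := sqrtc_dist z0 (ltW rz) rzh; rewrite -/s -/s'.
  by rewrite (_ : z + h - z = h)//; ring.
rewrite cmodM !(cX, ci, mul1r, cmodM 'i).
have d2 : cmod (s' - s) ^+ 2 <= complex.Re s ^- 2 * cmod h ^+ 2.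
  rewrite mulrC -exprVn -exprMn ler_sqr ?nnegrE ?cmod_ge0//.
  by rewrite divr_ge0 ?cmod_ge0// ltW.
have d3 : cmod ((s ^+ 2 * s')^-1 + (2 * s ^+ 3)^-1) <= 3 / cmod s ^+ 3.
  apply: le_trans (cmodD _ _) _; rewrite !(cX, cmodV, c2, cmodM).
  have h1 : (cmod s ^+ 2 * cmod s')^-1 <= 2 / cmod s ^+ 3.
    rewrite (_ : 2 / cmod s ^+ 3 = (cmod s ^+ 2 * (cmod s / 2))^-1); last first.
      by field; rewrite ?gt_eqF.
    rewrite lef_pV2 ?posrE ?mulr_gt0 ?exprn_gt0 ?divr_gt0// ?ler_wpM2l ?sqr_ge0//.
    by apply: lt_le_trans cs'; rewrite divr_gt0.
  have h2 : (2 * cmod s ^+ 3)^-1 <= 1 / cmod s ^+ 3.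
    rewrite div1r lef_pV2 ?posrE ?mulr_gt0 ?exprn_gt0// ler_peMl ?exprn_ge0 ?cmod_ge0//.
    by rewrite (ler_nat R 1 2).
  rewrite (_ : 3 = 2 + 1 :> R); last by ring.
  by rewrite [leRHS]mulrDl; exact: lerD.
apply: le_trans (ler_pM (sqr_ge0 _) (cmod_ge0 _) d2 d3) _.
by rewrite mulrAC.
Qed.

End exponent_coefficients.

(** * Averages of Gaussian phases *)

Section bounded_fubini.
Context d1 d2 (X1 : measurableType d1) (X2 : measurableType d2) (R : realType).
Variables (m1 : {sigma_finite_measure set X1 -> \bar R})
  (m2 : {sigma_finite_measure set X2 -> \bar R}).
Hypotheses (fin1 : (m1 setT < +oo)%E) (fin2 : (m2 setT < +oo)%E).
Variables (f : X1 * X2 -> R) (K : R).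
Hypotheses (mf : measurable_fun setT f) (fK : forall z, `|f z| <= K).

Lemma product_finite : ((m1 \x m2)%E setT < +oo)%E.
Proof.
rewrite -setXTT product_measure1E//; apply: lte_mul_pinfty => //.
by rewrite ge0_fin_numE.
Qed.

Lemma bounded_integrable_fin d (X : measurableType d) (m : {measure set X -> \bar R})
    (g : X -> R) : (m setT < +oo)%E -> measurable_fun setT g -> (forall x, `|g x| <= K) ->
  m.-integrable setT (EFin \o g).
Proof.
move=> mfin mg gK; apply/integrableP; split; first exact/measurable_EFinP.
apply: (@le_lt_trans _ _ (\int[m]_x (cst K%:E x))%E).
  apply: ge0_le_integral => //.
  - by apply: measurableT_comp => //; exact/measurable_EFinP.
  - by move=> x _; rewrite lee_fin (le_trans _ (gK x)).
rewrite integral_cst//; have [K0|K0] := leP 0 K; first exact: lte_mul_pinfty.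
by rewrite (@le_lt_trans _ _ 0%E)// mule_le0_ge0// lee_fin ltW.
Qed.

Lemma product_bounded_integrable : (m1 \x m2)%E.-integrable setT (EFin \o f).
Proof. by apply: bounded_integrable_fin => //; exact: product_finite. Qed.

Let sec1 x : m2.-integrable setT (EFin \o (fun y => f (x, y))).
Proof. by apply: bounded_integrable_fin => //; apply: measurableT_comp. Qed.

Let sec2 y : m1.-integrable setT (EFin \o (fun x => f (x, y))).
Proof. by apply: bounded_integrable_fin => //; apply: measurableT_comp. Qed.

Lemma Rintegral_product : \int[(m1 \x m2)%E]_z f z = \int[m1]_x \int[m2]_y f (x, y).
Proof.
rewrite /Rintegral -(integral12_prod_meas1 product_bounded_integrable); congr fine.
apply: eq_integral => x _; rewrite /fubini_F fineK//.
exact: (integrable_fin_num measurableT (sec1 x)).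
Qed.

Lemma Rintegral_swap : \int[m1]_x \int[m2]_y f (x, y) = \int[m2]_y \int[m1]_x f (x, y).
Proof.
rewrite -Rintegral_product /Rintegral -(integral21_prod_meas1 product_bounded_integrable).
congr fine; apply: eq_integral => y _; rewrite /fubini_G fineK//.
exact: (integrable_fin_num measurableT (sec2 y)).
Qed.

End bounded_fubini.

Section gaussian_fubini.
Context d1 d2 (W : measurableType d1) (X : measurableType d2) (R : realType).
Variables (m : {finite_measure set W -> \bar R}) (P : probability X R).

Lemma chf_shift (Y : X -> R) (mean V th c : R) : normal_chf P Y mean V ->
  \int[P]_x cos (th + c * Y x) = cos (th + c * mean) * expR (- (c ^+ 2 * V / 2)).
Proof.
move=> [mY V0 cY sY].
transitivity (\int[P]_x (cos (th + c * mean) * cos (c * (Y x - mean)) -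
    sin (th + c * mean) * sin (c * (Y x - mean)))).
  by apply: eq_Rintegral => x _; rewrite -cosD; congr cos; ring.
have ic := integrable_cos P c mean mY; have is_ := integrable_sin P c mean mY.
rewrite (RintegralB measurableT (integrableZl measurableT _ ic) (integrableZl measurableT _ is_)).
by rewrite !RintegralZl// cY sY mulr0 subr0.
Qed.

Variables (th : W -> R) (q1 q2 : W -> X -> R) (e1 e2 V1 V2 : W -> R) (c1 c2 : R).
Hypothesis mth : measurable_fun setT th.
Hypothesis mq1 : measurable_fun setT (fun z : W * X => q1 z.1 z.2).
Hypothesis mq2 : measurable_fun setT (fun z : W * X => q2 z.1 z.2).
Hypothesis chf1 : forall w, normal_chf P (q1 w) (e1 w) (V1 w).
Hypothesis chf2 : forall w, normal_chf P (q2 w) (e2 w) (V2 w).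

Let arg (z : W * (X * X)) := th z.1 + (c1 * q1 z.1 z.2.1 + c2 * q2 z.1 z.2.2).

Let marg : measurable_fun setT arg.
Proof.
apply: measurable_funD; first exact: measurableT_comp.
apply: measurable_funD; apply: measurable_funM => //.
  apply: (measurableT_comp mq1 (g := fun z : W * (X * X) => (z.1, z.2.1))).
  apply: measurable_fun_pair => //; exact: measurableT_comp.
apply: (measurableT_comp mq2 (g := fun z : W * (X * X) => (z.1, z.2.2))).
apply: measurable_fun_pair => //; exact: measurableT_comp.
Qed.

Let Pfin : (P setT < +oo)%E. Proof. by rewrite probability_setT ltry. Qed.
Let mfin : (m setT < +oo)%E. Proof. by rewrite -ge0_fin_numE// fin_num_measure. Qed.

(** After exchanging the integrals, the two coordinates of [x] are independent normal
    variables for each fixed [w]. *)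
Lemma gaussian_fubini :
  \int[(P \x P)%E]_x \int[m]_w cos (th w + (c1 * q1 w x.1 + c2 * q2 w x.2)) =
  \int[m]_w (cos (th w + (c1 * e1 w + c2 * e2 w)) *
             expR (- (c1 ^+ 2 * V1 w / 2) - (c2 ^+ 2 * V2 w / 2))).
Proof.
have mc : measurable_fun setT (fun z => cos (arg z)).
  exact: (measurableT_comp (continuous_measurable_fun (@continuous_cos R)) marg).
pose PP : probability (X * X)%type R := (P \x P)%E.
have PPfin : (PP setT < +oo)%E by rewrite probability_setT ltry.
have cb z : `|cos (arg z)| <= 1 by exact: cos_max.
have := @Rintegral_swap _ _ _ _ _ m PP mfin PPfin (fun z => cos (arg z)) 1 mc cb.
move=> /esym e; rewrite [LHS]e {e}.
apply: eq_Rintegral => w _.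
have mcw : measurable_fun setT (fun z : X * X => cos (arg (w, z))).
  by apply: (measurableT_comp mc).
have := @Rintegral_product _ _ _ _ _ P P Pfin Pfin (fun z => cos (arg (w, z))) 1 mcw
  (fun z => cb (w, z)).
move=> e; rewrite [LHS]e {e} /arg/=.
under eq_Rintegral => x _.
  under eq_Rintegral do rewrite addrA.
  rewrite (chf_shift (th w + c1 * q1 w x) c2 (chf2 w)) mulrC.
  rewrite (_ : th w + c1 * q1 w x + c2 * e2 w = (th w + c2 * e2 w) + c1 * q1 w x); last by ring.
  over.
rewrite RintegralZl//; last first.
  apply: (@bounded_integrable _ _ _ P _ 1) => [|x]; last exact: cos_max.
  have [mq _ _ _] := chf1 w.
  apply: (measurableT_comp (continuous_measurable_fun (@continuous_cos R))).
  by apply: measurable_funD => //; exact: measurable_funM.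
rewrite (chf_shift (th w + c2 * e2 w) c1 (chf1 w)) expRD.
rewrite (_ : th w + c2 * e2 w + c1 * e1 w = th w + (c1 * e1 w + c2 * e2 w)); last by ring.
ring.
Qed.

End gaussian_fubini.

(** * Exceptional paths *)

Section convergence_sets.
Context (R : realType) (T : R) (a b : R -> R) (mu : probability (Cab T) R).
Context (phi : nat -> R -> R).
Hypotheses (T0 : 0 < T) (ma : mean_function T a) (vb : variance_function T b).
Hypothesis gmu : gaussian_measure a b mu.
Hypothesis cphi : complete_orthonormal T a b phi.
Local Notation Cp := (Cp T a b).
Local Notation Y := (Cab T * Cab T)%type.
Implicit Types (w : Cp) (x : Cab T) (y : Y).

Section one_operator.
Variable S : {linear Cp -> Cp}.
Hypothesis bS : bounded_op S.

Definition pwz_partial w x n := RS_integral T (phi_sum T a b phi (Dt T a b (S w)) n) x.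

Definition pwz_converges w x := cvgn (pwz_partial w x).

Lemma measurable_pwz_partial n :
  measurable_fun setT (fun z : Cp * Cab T => pwz_partial z.1 z.2 n).
Proof.
under eq_fun => z.
  rewrite /pwz_partial /phi_sum.
  rewrite (RS_sum T0 n (fun j => ipab T a b (Dt T a b (S z.1)) (phi j)) (phi_mono_diff cphi)
    (@Cab_cts R T z.2)).
  over.
apply: measurable_sum => j; apply: measurable_funM.
  apply: (measurableT_comp (f := fun w : Cp => ipab T a b (Dt T a b (S w)) (phi j))) => //.
  exact: (measurable_ipab_op T0 ma vb bS (phi_mono_diff cphi j)).
apply: (measurableT_comp (f := fun x : Cab T => RS_integral T (phi j) x)) => //.
exact: (measurable_RS T0 (phi_mono_diff cphi j)).
Qed.

Lemma measurable_pwz_converges :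
  measurable [set z : Cp * Cab T | pwz_converges z.1 z.2].
Proof. exact: (measurable_cvgn measurable_pwz_partial). Qed.

Lemma measurable_pwzC : measurable_fun setT (fun z : Cp * Cab T => pwzC phi (S z.1) z.2).
Proof. exact: (measurable_limn measurable_pwz_partial). Qed.

Lemma pwz_converges_ae w : {ae mu, forall x, pwz_converges w x}.
Proof. exact: (pwz_cvg T0 ma vb gmu cphi (Dt_mean T0 ma vb) (Dt_L2ab (S w))). Qed.

Lemma pwzC_chf w : normal_chf mu (fun x => pwzC phi (S w) x)
  (ipCp T a b (S w) a) (ipCp T a b (S w) (S w)).
Proof. exact: (pwz_chf T0 ma vb gmu cphi (Dt_mean T0 ma vb) (Dt_L2ab (S w))). Qed.

Lemma pwzC_linear w (k : R) x x' : pwz_converges w x -> pwz_converges w x' ->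
  pwz_converges w (k *: x + x') /\
  pwzC phi (S w) (k *: x + x') = k * pwzC phi (S w) x + pwzC phi (S w) x'.
Proof. exact: (pwz_linear T0 cphi). Qed.

Lemma pwz_converges_scale w (k : R) x : k != 0 ->
  pwz_converges w (k *: x) <-> pwz_converges w x.
Proof.
have H (l : R) u : pwz_converges w u -> pwz_converges w (l *: u).
  move=> cu; have [] := pwzC_linear (l - 1) cu cu.
  by rewrite -[X in _ + X]scale1r -scalerDl subrK.
move=> k0; split; last exact: H.
by move=> /(H k^-1); rewrite scalerA (mulVf k0) scale1r.
Qed.

End one_operator.

Variables S1 S2 : {linear Cp -> Cp}.
Hypotheses (bS1 : bounded_op S1) (bS2 : bounded_op S2).

Definition pair_converges w y := pwz_converges S1 w y.1 /\ pwz_converges S2 w y.2.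

Let NC : set (Cp * Y) := [set z | ~ pair_converges z.1 z.2].

Lemma measurable_not_converges : measurable NC.
Proof.
have -> : NC = ~` ((fun z : Cp * Y => (z.1, z.2.1)) @^-1` [set z : Cp * Cab T | pwz_converges S1 z.1 z.2]
   `&` (fun z : Cp * Y => (z.1, z.2.2)) @^-1` [set z : Cp * Cab T | pwz_converges S2 z.1 z.2]).
  by [].
apply: measurableC; apply: measurableI; rewrite -[X in measurable X]setTI.
  apply: (measurable_fun_pair (f := fst) (g := fun z : Cp * Y => z.2.1)) => //.
    exact: measurableT_comp.
  exact: (measurable_pwz_converges bS1).
apply: (measurable_fun_pair (f := fst) (g := fun z : Cp * Y => z.2.2)) => //.
  exact: measurableT_comp.
exact: (measurable_pwz_converges bS2).
Qed.

Let PP : probability Y R := (mu \x mu)%E.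

(** Each coordinate converges almost surely for each fixed direction. *)
Lemma not_converges_null w : PP (xsection NC w) = 0%E.
Proof.
have [N1 [m1 n1 H1]] := pwz_converges_ae S1 w; have [N2 [m2 n2 H2]] := pwz_converges_ae S2 w.
have mN : measurable ((N1 `*` setT) `|` (setT `*` N2)).
  by apply: measurableU; apply: measurableX.
apply/eqP; rewrite -measure_le0.
apply: (@le_trans _ _ (PP ((N1 `*` setT) `|` (setT `*` N2)))).
  apply: le_measure; rewrite ?inE//.
    exact: (measurable_xsection w measurable_not_converges).
  move=> y; rewrite /xsection /= => /set_mem /= nc.
  have [c1|c1] := pselect (pwz_converges S1 w y.1); last by left; split => //; exact: H1.
  by right; split => //; apply: H2 => /= c2; apply: nc.
apply: le_trans (measureU2 _ _ _) _; [exact: measurableX|exact: measurableX|].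
have h1 : PP (N1 `*` setT) = 0%E.
  by rewrite [LHS](product_measure1E mu mu m1 measurableT) [X in (X * _)%E]n1 mul0e.
have h2 : PP (setT `*` N2) = 0%E.
  by rewrite [LHS](product_measure1E mu mu measurableT m2) [X in (_ * X)%E]n2 mule0.
by rewrite [X in (X + _)%E]h1 [X in (_ + X)%E]h2 adde0.
Qed.

Variable m : {finite_measure set Cp -> \bar R}.

(** Convergence is required in almost every direction only: this suffices for integrals
    over directions, and Tonelli's theorem provides it for almost every path pair. *)
Definition exceptional : set Y := [set y | m [set w | ~ pair_converges w y] != 0%E].

Let ysecE y : ysection NC y = [set w | ~ pair_converges w y].
Proof.
apply/seteqP; split => w; rewrite /ysection/= => h; first exact: set_mem h.
exact: mem_set h.
Qed.

Lemma measurable_exceptional : measurable exceptional.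
Proof.
have mf := measurable_fun_ysection m measurable_not_converges.
have := mf measurableT [set~ 0%E] (measurableC (emeasurable_set1 _)).
rewrite setTI; congr measurable; apply/seteqP; split => y /=; rewrite ysecE.
  by move=> /eqP.
by move=> /eqP.
Qed.

(** Tonelli's theorem on the set of pairs (direction, path pair) without convergence. *)
Lemma exceptional_null : PP exceptional = 0%E.
Proof.
have mf := measurable_fun_ysection m measurable_not_converges.
have h : (\int[PP]_y m (ysection NC y) = 0)%E.
  have := @indic_fubini_tonelli _ _ _ _ R m PP NC measurable_not_converges.
  rewrite (indic_fubini_tonelli_FE _ measurable_not_converges).
  rewrite (indic_fubini_tonelli_GE _ measurable_not_converges) => e.
  rewrite -[LHS]e integral0_eq// => w _; exact: not_converges_null.
have [N [mN N0 HN]] : ae_eq PP setT (m \o ysection NC) (cst 0%E).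
  apply/ae_eq_integral_abs => //.
  by rewrite -h; apply: eq_integral => y _; rewrite gee0_abs.
apply/eqP; rewrite -measure_le0 -N0; apply: le_measure; rewrite ?inE//.
  exact: measurable_exceptional.
move=> y /= ey; apply: HN => /= H; move/eqP: ey; apply.
by rewrite -ysecE; exact: H.
Qed.

(** Convergence at a path is equivalent to convergence at its nonzero multiples. *)
Lemma exceptional_scale (r1 r2 : R) y : r1 != 0 -> r2 != 0 ->
  exceptional (scale2 r1 r2 y) <-> exceptional y.
Proof.
move=> r10 r20.
have e w : pair_converges w (scale2 r1 r2 y) = pair_converges w y.
  apply/propext; have h1 := pwz_converges_scale S1 w y.1 r10.
  have h2 := pwz_converges_scale S2 w y.2 r20.
  by split=> -[c1 c2]; split; [exact: h1.1|exact: h2.1|exact: h1.2|exact: h2.2].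
rewrite /exceptional /= (_ : [set w | ~ pair_converges w (scale2 r1 r2 y)] =
  [set w | ~ pair_converges w y]); first by [].
by apply/funext => w; rewrite /= e.
Qed.

End convergence_sets.

(** * Integrals of characters *)

Section parametric_measurability.
Context d1 d2 (X1 : measurableType d1) (X2 : measurableType d2) (R : realType).
Variables (m1 : {sigma_finite_measure set X1 -> \bar R}) (f : X1 * X2 -> R).

Lemma measurable_Rintegral_param : measurable_fun setT f ->
  measurable_fun setT (fun y => \int[m1]_x f (x, y)).
Proof.
move=> mf; apply: (measurableT_comp (@fine_measurable R setT measurableT)).
have mfE : measurable_fun setT (EFin \o f) by exact/measurable_EFinP.
rewrite (_ : (fun y => _) = (fun y => \int[m1]_x (EFin \o f)^\+ (x, y) -
    \int[m1]_x (EFin \o f)^\- (x, y))%E); last first.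
  apply/funext => y; rewrite integralE; congr (_ - _)%E.
    by apply: eq_integral => x _; rewrite !funeposE.
  by apply: eq_integral => x _; rewrite !funenegE.
apply: emeasurable_funB.
  by apply: measurable_fun_fubini_tonelli_G => //; exact: measurable_funepos.
by apply: measurable_fun_fubini_tonelli_G => //; exact: measurable_funeneg.
Qed.

End parametric_measurability.

Section path_translations.
Context (R : realType) (T : R).
Hypothesis T0 : 0 < T.
Implicit Types x u : Cab T.

Lemma supnormZ_le (k : R) x : supnorm (k *: x) <= `|k| * supnorm x.
Proof.
apply: ge_sup; first by exists `|(k *: x : Cab T) 0|, 0 => //=; rewrite in_itv/= lexx ltW.
move=> _ [t _ <-]; rewrite [X in `|X|](_ : _ = k * x t)// normrM.
by rewrite ler_wpM2l//; exact: supnorm_ge.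
Qed.

Lemma measurable_affine_path (k : R) u : measurable_fun setT (fun x : Cab T => k *: x + u).
Proof.
apply: (@measurability _ _ _ _ _ _ (@Cab_open R T)) => //.
move=> _ [U Uo <-]; rewrite setTI; apply: sub_sigma_algebra => x /= Ux.
have [e e0 He] := Uo _ Ux; have k1 : 0 < `|k| + 1 by rewrite ltr_wpDl.
exists (e / (`|k| + 1)); first by rewrite divr_gt0.
move=> y h; apply: He.
have -> : k *: y + u - (k *: x + u) = k *: (y - x) by rewrite opprD addrACA subrr addr0 scalerBr.
apply: le_lt_trans (supnormZ_le _ _) _; move: h; rewrite ltr_pdivlMr//; apply: le_lt_trans.
rewrite mulrC ler_wpM2l// ?lerDl//.
by apply: le_trans (normr_ge0 ((y - x) 0)) _; exact: supnorm_ge.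
Qed.

Lemma measurable_affine_pair (r1 r2 : R) (y : Cab T * Cab T) :
  measurable_fun setT (fun x : Cab T * Cab T => y + scale2 r1 r2 x).
Proof.
rewrite (_ : (fun x : Cab T * Cab T => y + scale2 r1 r2 x) =
  (fun x : Cab T * Cab T => (r1 *: x.1 + y.1, r2 *: x.2 + y.2))).
  apply: measurable_fun_pair.
    exact: (measurableT_comp (measurable_affine_path r1 y.1)).
  exact: (measurableT_comp (measurable_affine_path r2 y.2)).
by apply/funext => x; rewrite [r1 *: _ + _]addrC [r2 *: _ + _]addrC.
Qed.

Lemma measurable_scale2 (r1 r2 : R) : measurable_fun setT (@scale2 R T r1 r2).
Proof.
have := measurable_affine_pair r1 r2 0; congr measurable_fun.
by apply/funext => x; rewrite add0r.
Qed.

End path_translations.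

Section completed_measurability.
Context d (X : measurableType d) (R : realType) (m : {measure set X -> \bar R}).

Lemma completed_of_measurable (A : set X) : measurable A -> completed_algebra_gen m A.
Proof.
move=> mA; exists A => //; exists set0; rewrite ?setU0//.
exact: negligible_set0.
Qed.

Lemma completed_cfun (F : X -> R[i]) : measurable_cfun F -> completed_measurable_fun m F.
Proof.
move=> [mr mi] B mB; split; apply: completed_of_measurable.
  by have := mr measurableT B mB; rewrite setTI.
by have := mi measurableT B mB; rewrite setTI.
Qed.

End completed_measurability.

Section functionals.
Context (R : realType) (T : R) (a b : R -> R) (mu : probability (Cab T) R).
Context (phi : nat -> R -> R).
Hypotheses (T0 : 0 < T) (ma : mean_function T a) (vb : variance_function T b).
Hypothesis gmu : gaussian_measure a b mu.
Hypothesis cphi : complete_orthonormal T a b phi.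
Local Notation Cp := (Cp T a b).
Local Notation Y := (Cab T * Cab T)%type.
Local Notation nCp := (normCp T a b).
Variables A1 A2 S1 S2 : {linear Cp -> Cp}.
Hypotheses (sq1 : is_sqrt_op A1 S1) (sq2 : is_sqrt_op A2 S2).
Implicit Types (w : Cp) (x y : Y).

Let bS1 : bounded_op S1. Proof. by case: sq1 => -[]. Qed.
Let bS2 : bounded_op S2. Proof. by case: sq2 => -[]. Qed.

Definition phase w y : R := pwzC phi (S1 w) y.1 + pwzC phi (S2 w) y.2.

Lemma char_kernelE w y : char_kernel phi S1 S2 w y = cexp ('i * (phase w y)%:C).
Proof. by rewrite /char_kernel -mulrDr -rmorphD. Qed.

Lemma Re_char_kernel w y : complex.Re (char_kernel phi S1 S2 w y) = cos (phase w y).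
Proof. by rewrite char_kernelE Re_cexp cReM cImM /=
  !(mul0r, mul1r, subr0, mulr0, addr0, add0r, oppr0, expR0). Qed.

Lemma Im_char_kernel w y : complex.Im (char_kernel phi S1 S2 w y) = sin (phase w y).
Proof. by rewrite char_kernelE Im_cexp cReM cImM /=
  !(mul0r, mul1r, subr0, mulr0, addr0, add0r, oppr0, expR0). Qed.

Lemma cmod_char_kernel w y : cmod (char_kernel phi S1 S2 w y) = 1.
Proof. by rewrite char_kernelE cmod_cexp cReM /= !mul0r !mulr0 subrr expR0. Qed.

Lemma measurable_phase : measurable_fun setT (fun z : Cp * Y => phase z.1 z.2).
Proof.
apply: measurable_funD.
  apply: (measurableT_comp (f := fun z : Cp * Cab T => pwzC phi (S1 z.1) z.2)
    (g := fun z : Cp * Y => (z.1, z.2.1))).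
    exact: (measurable_pwzC T0 ma vb cphi bS1).
  by apply: measurable_fun_pair => //; exact: measurableT_comp.
apply: (measurableT_comp (f := fun z : Cp * Cab T => pwzC phi (S2 z.1) z.2)
    (g := fun z : Cp * Y => (z.1, z.2.2))).
  exact: (measurable_pwzC T0 ma vb cphi bS2).
by apply: measurable_fun_pair => //; exact: measurableT_comp.
Qed.

Lemma measurable_char_kernel :
  measurable_cfun (fun z : Cp * Y => char_kernel phi S1 S2 z.1 z.2).
Proof.
split.
  under eq_fun do rewrite Re_char_kernel.
  exact: (measurableT_comp (continuous_measurable_fun (@continuous_cos R)) measurable_phase).
under eq_fun do rewrite Im_char_kernel.
exact: (measurableT_comp (continuous_measurable_fun (@continuous_sin R)) measurable_phase).
Qed.

Lemma measurable_char_kernel1 y : measurable_cfun (fun w => char_kernel phi S1 S2 w y).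
Proof.
have [mr mi] := measurable_char_kernel.
by split; [exact: (measurableT_comp mr (measurable_pair2 y))|
  exact: (measurableT_comp mi (measurable_pair2 y))].
Qed.

Lemma measurable_phase1 y : measurable_fun setT (fun w => phase w y).
Proof. exact: (measurableT_comp measurable_phase (measurable_pair2 y)). Qed.

Definition var1 w := ipCp T a b (S1 w) (S1 w).
Definition var2 w := ipCp T a b (S2 w) (S2 w).
Definition mean1 w := ipCp T a b (S1 w) a.
Definition mean2 w := ipCp T a b (S2 w) a.

Lemma sqrt_op_form (A S : {linear Cp -> Cp}) w : is_sqrt_op A S ->
  ipCp T a b (A w) w = ipCp T a b (S w) (S w).
Proof. by move=> [[_ sa _] SA]; rewrite -SA sa. Qed.

Lemma psi_exponentE (A S : {linear Cp -> Cp}) l w : is_sqrt_op A S ->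
  psi_exponent A S l w = quad_coef l * (ipCp T a b (S w) (S w))%:C +
    lin_coef l * (ipCp T a b (S w) a)%:C.
Proof.
move=> sq; rewrite /psi_exponent (sqrt_op_form w sq) /quad_coef /lin_coef.
by congr (_ + _); rewrite mulNr mulrC.
Qed.

Section one_measure.
Variable m : {finite_measure set Cp -> \bar R}.

Definition char_integral (g : Cp -> R[i]) y : R[i] :=
  cintegral m (fun w => char_kernel phi S1 S2 w y * g w).

Lemma measurable_char_integral g : measurable_cfun g -> measurable_cfun (char_integral g).
Proof.
move=> mg; have [mr mi] : measurable_cfun (fun z : Cp * Y => char_kernel phi S1 S2 z.1 z.2 * g z.1).
  apply: measurable_cfunM; first exact: measurable_char_kernel.
  by case: mg => a1 a2; split;
    [exact: (measurableT_comp a1 measurable_fst)|exact: (measurableT_comp a2 measurable_fst)].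
split.
  exact: (measurable_Rintegral_param m mr).
exact: (measurable_Rintegral_param m mi).
Qed.

Local Notation psi_ l w := (psi A1 A2 S1 S2 l.1 l.2 w).

Definition coef (k : 'I_4) (l : R[i]^o * R[i]^o) : R[i]^o :=
  if (val k < 2)%N then (if val k == 0%N then quad_coef l.1 else lin_coef l.1)
  else (if val k == 2%N then quad_coef l.2 else lin_coef l.2).

Definition moment (k : 'I_4) w : R :=
  if (val k < 2)%N then (if val k == 0%N then var1 w else mean1 w)
  else (if val k == 2%N then var2 w else mean2 w).

Lemma coef_momentE l w : exponent coef moment l w =
  (quad_coef l.1 * (var1 w)%:C + lin_coef l.1 * (mean1 w)%:C) +
  (quad_coef l.2 * (var2 w)%:C + lin_coef l.2 * (mean2 w)%:C).
Proof.
have sum4 (G : 'I_4 -> R[i]) : \sum_i G i = (G 0 + G 1) + (G 2 + G 3).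
  rewrite !big_ord_recl big_ord0 addr0 addrA.
  by congr (_ + _ + (_ + _)); congr G; apply/val_inj.
by rewrite /exponent sum4 /coef /moment.
Qed.

Lemma psiE l w : psi_ l w = cexp (exponent coef moment l w).
Proof.
by rewrite coef_momentE /psi (psi_exponentE _ _ sq1) (psi_exponentE _ _ sq2).
Qed.

Lemma var_ge0 (S : Cp -> Cp) w : 0 <= ipCp T a b (S w) (S w).
Proof. exact: ip_ge0. Qed.

Lemma mean_var_le (S : Cp -> Cp) w :
  `|ipCp T a b (S w) a| <= Num.sqrt (ipCp T a b (S w) (S w)) * nCp a.
Proof. exact: (ipCp_le T0 ma vb). Qed.

Lemma measurable_moment k : measurable_fun setT (moment k).
Proof.
have mv (S : {linear Cp -> Cp}) : bounded_op S ->
    measurable_fun setT (fun w : Cp => ipCp T a b (S w) (S w)).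
  move=> bS; under eq_fun do rewrite -normCp_sqr.
  by apply: measurable_funX; exact: (measurable_normCp_op T0).
have mm (S : {linear Cp -> Cp}) : bounded_op S ->
    measurable_fun setT (fun w : Cp => ipCp T a b (S w) a).
  by move=> bS; exact: (measurable_ipCp_mean_op T0 ma vb).
rewrite /moment; case: (val k < 2)%N; [case: (val k == 0%N)|case: (val k == 2%N)].
- exact: (mv S1 bS1).
- exact: (mm S1 bS1).
- exact: (mv S2 bS2).
- exact: (mm S2 bS2).
Qed.

Lemma measurable_psi l : measurable_cfun (fun w => psi_ l w).
Proof.
under eq_fun do rewrite psiE; apply: measurable_cfun_exp.
exact: measurable_exponent measurable_moment l.
Qed.

Let tau w := var1 w + var2 w.

(** The linear terms are at most of the order of a square root of the quadratic ones. *)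
Lemma moment_le k w : `|moment k w| <= (1 + nCp a) * (1 + tau w).
Proof.
have n0 : 0 <= nCp a := sqrtr_ge0 _.
have sq (v : R) : 0 <= v -> Num.sqrt v <= 1 + v.
  move=> v0; have : 0 <= (Num.sqrt v - 1 / 2) ^+ 2 by exact: sqr_ge0.
  rewrite sqrrB sqr_sqrtr// mulr2n; lra.
have var_le (u v n : R) : 0 <= n -> 0 <= u -> 0 <= v -> `|u| <= (1 + n) * (1 + (u + v)).
  move=> n0' u0 v0; have p1 := mulr_ge0 n0' u0; have p2 := mulr_ge0 n0' v0.
  by rewrite (ger0_norm u0); lra.
have mean_le (u v n e : R) : 0 <= n -> 0 <= u -> 0 <= v -> `|e| <= Num.sqrt u * n ->
    `|e| <= (1 + n) * (1 + (u + v)).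
  move=> n0' u0 v0; have p2 := mulr_ge0 n0' v0; have q := ler_wpM2r n0' (sq _ u0).
  by move: (`|e|) => e'; lra.
have v1 : 0 <= var1 w := var_ge0 S1 w; have v2 : 0 <= var2 w := var_ge0 S2 w.
rewrite /moment; case: (val k < 2)%N; [case: (val k == 0%N)|case: (val k == 2%N)].
- exact: (var_le _ _ _ n0 v1 v2).
- exact: (mean_le _ _ _ _ n0 v1 v2 (mean_var_le S1 w)).
- rewrite /tau [var1 w + _]addrC; exact: (var_le _ _ _ n0 v2 v1).
- rewrite /tau [var1 w + _]addrC; exact: (mean_le _ _ _ _ n0 v2 v1 (mean_var_le S2 w)).
Qed.

(** Only the real part of [quad_coef z] and the imaginary part of the inverse square root
    enter, the latter through the linear term. *)
Lemma Re_coef_le (z : R[i]) (v e : R) : 0 <= v -> `|e| <= Num.sqrt v * nCp a ->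
  complex.Re (quad_coef z * v%:C + lin_coef z * e%:C) <=
  - (complex.Re ((2 * z)^-1) * v) + `|complex.Im ((sqrtc z)^-1)| * (Num.sqrt v * nCp a).
Proof.
move=> v0 ev; rewrite cReD; apply: lerD.
  by rewrite /quad_coef cReM cReN /= mulr0 subr0 mulNr.
rewrite /lin_coef !(cReM, cImM)/= !(mul0r, mulr0, subr0, addr0, mul1r) sub0r mulNr.
apply: le_trans (ler_norm _) _; rewrite normrN normrM.
by rewrite ler_wpM2l.
Qed.

(** Young's inequality absorbs half of the quadratic decay to compensate for the linear
    term, leaving the exponent below [C0 - al * tau]. *)
Lemma differentiable_char_integral y l : Cplus2 l ->
  differentiable ((fun l' => char_integral (fun w => psi_ l' w) y) :
    R[i]^o * R[i]^o -> R[i]^o) l.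
Proof.
move=> [l1 l2].
pose al1 := complex.Re ((2 * l.1)^-1); pose al2 := complex.Re ((2 * l.2)^-1).
have Rinv (z : R[i]) : 0 < complex.Re z -> 0 < complex.Re ((2 * z)^-1).
  move=> z0; have zn : z != 0 by apply/eqP => h; rewrite h ltxx in z0.
  have -> : (2 * z)^-1 = (2^-1)%:C * z^-1.
    rewrite invfM; congr (_ * _).
    by rewrite -(rmorph_nat (real_complex R) 2) fmorphV.
  rewrite cReZ; apply: mulr_gt0; first by rewrite invr_gt0.
  case: z z0 {zn} => p q /= p0; rewrite divr_gt0//.
  by rewrite ltr_pwDl ?sqr_ge0// exprn_gt0.
have al10 : 0 < al1 by exact: Rinv.
have al20 : 0 < al2 by exact: Rinv.
pose be1 := `|complex.Im ((sqrtc l.1)^-1)| * nCp a.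
pose be2 := `|complex.Im ((sqrtc l.2)^-1)| * nCp a.
pose al := Num.min al1 al2 / 2.
have al0 : 0 < al by rewrite divr_gt0// lt_min al10.
pose C0 := be1 ^+ 2 / (2 * al1) + be2 ^+ 2 / (2 * al2).
under eq_fun => l' do rewrite /char_integral; rewrite /=.
have -> : ((fun l' => cintegral m (fun w => char_kernel phi S1 S2 w y * psi_ l' w)) :
    R[i]^o * R[i]^o -> R[i]^o) =
  (fun l' => cintegral m (fun w => char_kernel phi S1 S2 w y * cexp (exponent coef moment l' w))).
  by apply/funext => l'; congr cintegral; apply/funext => w; rewrite psiE.
apply: (@differentiable_exp_integral _ _ _ m 4 coef moment _ tau (1 + nCp a) C0 al).
- exact: measurable_moment.
- exact: measurable_char_kernel1.
- by move=> w; rewrite cmod_char_kernel.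
- by move=> w; rewrite addr_ge0// var_ge0.
- exact: al0.
- by rewrite addr_ge0// sqrtr_ge0.
- exact: moment_le.
- move=> k; rewrite /coef; case: (val k < 2)%N; [case: (val k == 0%N)|case: (val k == 2%N)].
  + exact: (@differentiable_quad_coef R false l l1).
  + exact: (@differentiable_lin_coef R false l l1).
  + exact: (@differentiable_quad_coef R true l l2).
  + exact: (@differentiable_lin_coef R true l l2).
- move=> w.
  rewrite coef_momentE cReD.
  have v1 : 0 <= var1 w := var_ge0 S1 w; have v2 : 0 <= var2 w := var_ge0 S2 w.
  have b1 := Re_coef_le l.1 v1 (mean_var_le S1 w).
  have b2 := Re_coef_le l.2 v2 (mean_var_le S2 w).
  have young (al' be v : R) : 0 < al' -> 0 <= v ->
      be * Num.sqrt v <= al' * v / 2 + be ^+ 2 / (2 * al').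
    move=> a0 v0; rewrite -subr_ge0.
    rewrite (_ : _ - _ = (al' * Num.sqrt v - be) ^+ 2 / (2 * al')).
      by rewrite divr_ge0 ?sqr_ge0// mulr_ge0// ltW.
    rewrite -{1}(sqr_sqrtr v0); field; exact: lt0r_neq0.
  have y1 := young al1 be1 _ al10 v1; have y2 := young al2 be2 _ al20 v2.
  have m1 : Num.min al1 al2 <= al1 by rewrite ge_min lexx.
  have m2 : Num.min al1 al2 <= al2 by rewrite ge_min lexx orbT.
  have n1 := ler_wpM2r v1 m1; have n2 := ler_wpM2r v2 m2.
  have e1 : `|complex.Im (sqrtc l.1)^-1| * (Num.sqrt (var1 w) * nCp a) = be1 * Num.sqrt (var1 w).
    by rewrite /be1; ring.
  have e2 : `|complex.Im (sqrtc l.2)^-1| * (Num.sqrt (var2 w) * nCp a) = be2 * Num.sqrt (var2 w).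
    by rewrite /be2; ring.
  rewrite e1 in b1; rewrite e2 in b2.
  rewrite -/al1 in b1; rewrite -/al2 in b2.
  rewrite /al /tau /C0 mulrDr; clear -b1 b2 y1 y2 n1 n2.
  rewrite (mulrAC _ _ (var1 w)) (mulrAC _ _ (var2 w)).
  move: b1 b2 y1 y2 n1 n2.
  move: (complex.Re (quad_coef l.1 * _ + _)) (complex.Re (quad_coef l.2 * _ + _)) => X1 X2.
  move: (be1 * _) (be2 * _) (be1 ^+ 2 / _) (be2 ^+ 2 / _) => z1 z2 c1 c2.
  move: (al1 * var1 w) (al2 * var2 w) (Num.min al1 al2 * var1 w) (Num.min al1 al2 * var2 w).
  move=> p1 p2 q1 q2; lra.
Qed.

End one_measure.

End functionals.

(** * Gaussian averages of integrals of characters *)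

Section gaussian_averages.
Context (R : realType) (T : R) (a b : R -> R) (mu : probability (Cab T) R).
Context (phi : nat -> R -> R).
Hypotheses (T0 : 0 < T) (ma : mean_function T a) (vb : variance_function T b).
Hypothesis gmu : gaussian_measure a b mu.
Hypothesis cphi : complete_orthonormal T a b phi.
Local Notation Cp := (Cp T a b).
Local Notation Y := (Cab T * Cab T)%type.
Local Notation nCp := (normCp T a b).
Variables A1 A2 S1 S2 : {linear Cp -> Cp}.
Hypotheses (sq1 : is_sqrt_op A1 S1) (sq2 : is_sqrt_op A2 S2).
Implicit Types (w : Cp) (x y : Y).
Variable m : {finite_measure set Cp -> \bar R}.

Let bS1 : bounded_op S1. Proof. by case: sq1 => -[]. Qed.
Let bS2 : bounded_op S2. Proof. by case: sq2 => -[]. Qed.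
Let PP : probability Y R := (mu \x mu)%E.
Local Notation ph := (phase phi S1 S2).
Local Notation exc := (exceptional phi S1 S2 m).

(** This additivity needs convergence at both points, which is why exceptional path
    pairs are excluded. *)
Lemma phase_affine (c1 c2 : R) w x y : pair_converges phi S1 S2 w x ->
  pair_converges phi S1 S2 w y ->
  ph w (y + scale2 c1 c2 x) =
  ph w y + (c1 * pwzC phi (S1 w) x.1 + c2 * pwzC phi (S2 w) x.2).
Proof.
move=> [x1 x2] [y1 y2]; rewrite /phase.
have [_ e1] := pwzC_linear T0 cphi (S := S1) c1 x1 y1.
have [_ e2] := pwzC_linear T0 cphi (S := S2) c2 x2 y2.
rewrite -[(y + _).1]/(y.1 + c1 *: x.1) -[(y + _).2]/(y.2 + c2 *: x.2).
rewrite (addrC y.1) (addrC y.2) e1 e2; ring.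
Qed.

(** The shift [dl] makes the formula cover the sine, at [dl = pi / 2]. *)
Lemma cos_phase_average (dl c1 c2 : R) y : ~ exc y ->
  \int[(mu \x mu)%E]_x \int[m]_w cos (ph w (y + scale2 c1 c2 x) - dl) =
  \int[m]_w (cos (ph w y - dl + (c1 * ipCp T a b (S1 w) a + c2 * ipCp T a b (S2 w) a)) *
    expR (- (c1 ^+ 2 * ipCp T a b (S1 w) (S1 w) / 2) - (c2 ^+ 2 * ipCp T a b (S2 w) (S2 w) / 2))).
Proof.
move=> ny.
have mcos := continuous_measurable_fun (@continuous_cos R).
have mph := measurable_phase T0 ma vb cphi sq1 sq2.
have mp1 := measurable_pwzC T0 ma vb cphi bS1.
have mp2 := measurable_pwzC T0 ma vb cphi bS2.
have mth : measurable_fun setT (fun w => ph w y - dl).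
  by apply: measurable_funB => //; exact: (measurable_phase1 T0 ma vb cphi sq1 sq2).
rewrite -[RHS](gaussian_fubini m c1 c2 mth mp1 mp2 (pwzC_chf T0 ma vb gmu cphi S1)
  (pwzC_chf T0 ma vb gmu cphi S2)).
have mfin : (m setT < +oo)%E by rewrite -ge0_fin_numE// fin_num_measure.
have PPfin : (PP setT < +oo)%E by rewrite probability_setT ltry.
have maff := measurable_affine_pair T0 c1 c2 y.
pose f (z : Cp * Y) := cos (ph z.1 (y + scale2 c1 c2 z.2) - dl).
have mf : measurable_fun setT f.
  apply: (measurableT_comp mcos); apply: measurable_funB => //.
  apply: (measurableT_comp mph (g := fun z : Cp * Y => (z.1, y + scale2 c1 c2 z.2))).
  by apply: measurable_fun_pair => //; exact: (measurableT_comp maff).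
pose g (z : Cp * Y) := cos (ph z.1 y - dl + (c1 * pwzC phi (S1 z.1) z.2.1 + c2 * pwzC phi (S2 z.1) z.2.2)).
have mg : measurable_fun setT g.
  apply: (measurableT_comp mcos); apply: measurable_funD.
    exact: (measurableT_comp mth).
  apply: measurable_funD; apply: measurable_funM => //.
    apply: (measurableT_comp mp1 (g := fun z : Cp * Y => (z.1, z.2.1))).
    by apply: measurable_fun_pair => //; exact: measurableT_comp.
  apply: (measurableT_comp mp2 (g := fun z : Cp * Y => (z.1, z.2.2))).
  by apply: measurable_fun_pair => //; exact: measurableT_comp.
have mF : measurable_fun setT (fun x => \int[m]_w f (w, x)) by exact: measurable_Rintegral_param.
have mG : measurable_fun setT (fun x => \int[m]_w g (w, x)) by exact: measurable_Rintegral_param.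
rewrite /Rintegral; congr fine; apply: ae_eq_integral;
  [exact: measurableT|exact/measurable_EFinP|exact/measurable_EFinP|].
exists exc; split.
- exact: (measurable_exceptional T0 ma vb cphi bS1 bS2).
- exact: (exceptional_null T0 ma vb gmu cphi bS1 bS2).
move=> x /= ne; apply: contrapT => nx; apply: ne => _.
congr (_%:E); congr fine; apply: ae_eq_integral => //.
- apply/measurable_EFinP; exact: (measurableT_comp mf (measurable_pair2 x)).
- apply/measurable_EFinP; exact: (measurableT_comp mg (measurable_pair2 x)).
have msec u : ~ exc u -> m.-negligible [set w | ~ pair_converges phi S1 S2 w u].
  move=> /negP; rewrite negbK => /eqP h; exists [set w | ~ pair_converges phi S1 S2 w u]; split => //.
  have := measurable_ysection u (measurable_not_converges T0 ma vb cphi bS1 bS2).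
  congr measurable; apply/seteqP; split => w; rewrite /ysection/= => h'; first exact: set_mem h'.
  exact: mem_set h'.
apply: negligibleS (negligibleU (msec x nx) (msec y ny)) => w /= h.
apply: contrapT => /not_orP[/contrapT cx /contrapT cy]; apply: h => _.
by rewrite phase_affine//; congr ((cos _)%:E); ring.
Qed.

(** For real parameters the exponent separates into a damping factor and a phase. *)
Lemma psi_real (l1 l2 : R) w : 0 < l1 -> 0 < l2 ->
  psi A1 A2 S1 S2 l1%:C l2%:C w =
  cexp ((- ((Num.sqrt l1)^-1 ^+ 2 * ipCp T a b (S1 w) (S1 w) / 2)
         - ((Num.sqrt l2)^-1 ^+ 2 * ipCp T a b (S2 w) (S2 w) / 2))%:C +
    'i * ((Num.sqrt l1)^-1 * ipCp T a b (S1 w) a + (Num.sqrt l2)^-1 * ipCp T a b (S2 w) a)%:C).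
Proof.
move=> l10 l20; rewrite /psi (psi_exponentE _ _ sq1) (psi_exponentE _ _ sq2).
have q (l v : R) : 0 < l -> quad_coef l%:C * v%:C = (- ((Num.sqrt l)^-1 ^+ 2 * v / 2))%:C.
  move=> l0; rewrite /quad_coef -(rmorph_nat (real_complex R) 2) -rmorphM -fmorphV -rmorphN -rmorphM.
  by congr (_%:C); rewrite exprVn sqr_sqrtr ?ltW//; field; exact: lt0r_neq0.
have li (l v : R) : 0 < l -> lin_coef l%:C * v%:C = 'i * ((Num.sqrt l)^-1 * v)%:C.
  by move=> l0; rewrite /lin_coef sqrtc_real ?ltW// -fmorphV -mulrA -rmorphM.
rewrite !q// !li// addrACA -mulrDr -!rmorphD//.
Qed.

Lemma char_integral_average (l1 l2 : R) y : 0 < l1 -> 0 < l2 -> ~ exc y ->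
  cintegral (mu \x mu)%E (fun x => char_integral phi S1 S2 m (fun=> 1)
     (y + scale2 (Num.sqrt l1)^-1 (Num.sqrt l2)^-1 x)) =
  char_integral phi S1 S2 m (fun w => psi A1 A2 S1 S2 l1%:C l2%:C w) y.
Proof.
move=> l10 l20 ny; set c1 := (Num.sqrt l1)^-1; set c2 := (Num.sqrt l2)^-1.
apply: complex_ext.
  rewrite Re_cintegral /char_integral Re_cintegral.
  transitivity (\int[(mu \x mu)%E]_x \int[m]_w cos (ph w (y + scale2 c1 c2 x) - 0)).
    apply: eq_Rintegral => x _; apply: eq_Rintegral => w _.
    by rewrite mulr1 Re_char_kernel subr0.
  rewrite cos_phase_average//; apply: eq_Rintegral => w _.
  rewrite psi_real// char_kernelE -cexpD Re_cexp cReD cImD cReD cImD.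
  rewrite !(cReM, cImM)/= !(mul0r, mul1r, subr0, mulr0, addr0, add0r, oppr0) mulrC.
  by congr (_ * _).
rewrite Im_cintegral /char_integral Im_cintegral.
transitivity (\int[(mu \x mu)%E]_x \int[m]_w cos (ph w (y + scale2 c1 c2 x) - pi / 2)).
  apply: eq_Rintegral => x _; apply: eq_Rintegral => w _.
  by rewrite mulr1 Im_char_kernel cosBpihalf.
rewrite cos_phase_average//; apply: eq_Rintegral => w _.
rewrite psi_real// char_kernelE -cexpD Im_cexp cReD cImD cReD cImD.
rewrite !(cReM, cImM)/= !(mul0r, mul1r, subr0, mulr0, addr0, add0r, oppr0) mulrC.
congr (_ * _); rewrite addrAC cosBpihalf; congr sin.
Qed.

End gaussian_averages.

(** * Boundary values *)

Section coefficient_limits.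
Context (R : realType).
Implicit Types z u : R[i].

Let cmod_gt0 z : z != 0 -> 0 < cmod z.
Proof.
by move=> z0; rewrite lt0r cmod_ge0 andbT; apply: contra z0 => /eqP/cmod_eq0 ->.
Qed.

Let cmod_near_ge z u : cmod (u - z) <= cmod z / 2 -> cmod z / 2 <= cmod u.
Proof. by move=> h; have := cmodB u (u - z); rewrite opprB addrC subrK; lra. Qed.

Lemma quad_coef_dist z u : z != 0 -> cmod (u - z) <= cmod z / 2 ->
  cmod (quad_coef u - quad_coef z) <= cmod (u - z) / cmod z ^+ 2.
Proof.
move=> z0 uz; have cz := cmod_gt0 z0; have cu := cmod_near_ge uz.
have u0 : u != 0 by apply: contraTN cu => /eqP ->; rewrite cmod0 -ltNge divr_gt0.
have -> : quad_coef u - quad_coef z = (u - z) / (2 * (u * z)).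
  by rewrite /quad_coef; field; rewrite u0 z0.
have c2 : cmod (2 : R[i]) = 2 by rewrite -(rmorph_nat (real_complex R) 2) cmod_real ger0_norm.
rewrite cmodM cmodV !cmodM c2 ler_wpM2l ?cmod_ge0//.
rewrite lef_pV2 ?posrE ?exprn_gt0 ?mulr_gt0 ?cmod_gt0//.
rewrite (_ : cmod z ^+ 2 = 2 * (cmod z / 2 * cmod z)); last by field.
by rewrite ler_wpM2l// ler_wpM2r// ltW.
Qed.

Lemma lin_coef_dist z u : z != 0 -> 0 <= complex.Re z -> 0 <= complex.Re u ->
  cmod (u - z) <= cmod z / 2 ->
  cmod (lin_coef u - lin_coef z) <= cmod (u - z) * (2 / (complex.Re (sqrtc z) * cmod z)).
Proof.
move=> z0 rz ru uz; have cz := cmod_gt0 z0; have cu := cmod_near_ge uz.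
have u0 : u != 0 by apply: contraTN cu => /eqP ->; rewrite cmod0 -ltNge divr_gt0.
have d := sqrtc_dist z0 rz ru; have rs := Re_sqrtc_gt0 z0 rz.
have sz0 : sqrtc z != 0 by rewrite sqrtc_eq0.
have su0 : sqrtc u != 0 by rewrite sqrtc_eq0.
have csz := cmod_gt0 sz0; have csu := cmod_gt0 su0.
have ci : cmod ('i : R[i]) = 1 by rewrite cmodE/= expr0n/= add0r expr1n sqrtr1.
have su : cmod (sqrtc z) / 2 <= cmod (sqrtc u).
  rewrite -(@ler_pXn2r _ 2%N) ?nnegrE ?cmod_ge0 ?divr_ge0 ?cmod_ge0//.
  rewrite cmod_sqrtc; apply: le_trans cu; rewrite exprMn cmod_sqrtc.
  rewrite ler_wpM2l ?cmod_ge0// exprVn lef_pV2 ?posrE ?exprn_gt0//.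
  by rewrite expr2 ler_peMr// (ler_nat R 1 2).
have -> : lin_coef u - lin_coef z = 'i * (- (sqrtc u - sqrtc z)) / (sqrtc u * sqrtc z).
  by rewrite /lin_coef; field; rewrite su0 sz0.
rewrite !cmodM ci mul1r cmodN cmodV cmodM.
apply: (@le_trans _ _ (cmod (u - z) / complex.Re (sqrtc z) * (2 / cmod z))).
  apply: ler_pM d _; rewrite ?cmod_ge0 ?invr_ge0 ?mulr_ge0 ?cmod_ge0//.
  rewrite (_ : 2 / cmod z = (cmod (sqrtc z) / 2 * cmod (sqrtc z))^-1); last first.
    by rewrite -(cmod_sqrtc z); field; exact: lt0r_neq0.
  rewrite lef_pV2 ?posrE ?mulr_gt0 ?divr_gt0//.
  by rewrite ler_wpM2r ?cmod_ge0.
by rewrite le_eqVlt; apply/orP; left; apply/eqP; field; rewrite !gt_eqF.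
Qed.

Lemma cmod_cvg_parts (z_ : nat -> R[i]) z : cmod (z_ n - z) @[n --> \oo] --> (0 : R) ->
  complex.Re (z_ n) @[n --> \oo] --> complex.Re z /\
  complex.Im (z_ n) @[n --> \oo] --> complex.Im z.
Proof.
move=> /cvgrPdist_le h; split; apply/cvgrPdist_le => e e0; apply: filterS (h e e0) => n.
  rewrite sub0r normrN ger0_norm ?cmod_ge0//; apply: le_trans.
  by rewrite distrC; apply: le_trans (Re_le_cmod _); rewrite cReD cReN.
rewrite sub0r normrN ger0_norm ?cmod_ge0//; apply: le_trans.
by rewrite distrC; apply: le_trans (Im_le_cmod _); rewrite cImD cImN.
Qed.

Lemma coef_cvg (u_ : nat -> R[i]) z : z != 0 -> 0 <= complex.Re z ->
  (forall n, 0 <= complex.Re (u_ n)) -> cmod (u_ n - z) @[n --> \oo] --> (0 : R) ->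
  cmod (quad_coef (u_ n) - quad_coef z) @[n --> \oo] --> (0 : R) /\
  cmod (lin_coef (u_ n) - lin_coef z) @[n --> \oo] --> (0 : R).
Proof.
move=> z0 rz ru uz; have cz : 0 < cmod z / 2 by rewrite divr_gt0// cmod_gt0.
have uz' : \forall n \near \oo, cmod (u_ n - z) <= cmod z / 2.
  move/cvgrPdist_le : (uz) => /(_ _ cz); apply: filterS => n.
  by rewrite sub0r normrN ger0_norm ?cmod_ge0.
have sq (f : nat -> R) (k : R) : (forall n, 0 <= f n) ->
    (\forall n \near \oo, f n <= cmod (u_ n - z) * k) -> f n @[n --> \oo] --> (0 : R).
  move=> f0 fk; apply: (@squeeze_cvgr _ _ _ _ (cst 0) (fun n => cmod (u_ n - z) * k)).
  - by apply: filterS fk => n ->; rewrite f0.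
  - exact: cvg_cst.
  - by rewrite -(mul0r k); apply: cvgM => //; exact: cvg_cst.
split.
  apply: (sq _ ((cmod z ^+ 2)^-1)) => [n|]; first exact: cmod_ge0.
  by apply: filterS uz' => n; exact: quad_coef_dist.
apply: (sq _ (2 / (complex.Re (sqrtc z) * cmod z))) => [n|]; first exact: cmod_ge0.
by apply: filterS uz' => n; exact: lin_coef_dist.
Qed.

End coefficient_limits.

Section weights.
Context (R : realType) (T : R) (a b : R -> R).
Hypotheses (T0 : 0 < T) (ma : mean_function T a) (vb : variance_function T b).
Local Notation Cp := (Cp T a b).
Local Notation V := (R[i]^o * R[i]^o)%type.
Local Notation nCp := (normCp T a b).
Variables A1 A2 S1 S2 : {linear Cp -> Cp}.
Hypotheses (sq1 : is_sqrt_op A1 S1) (sq2 : is_sqrt_op A2 S2).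
Implicit Types (w : Cp) (l : V).
Local Notation psi_ l w := (psi A1 A2 S1 S2 l.1 l.2 w).
Variable q0 : R.
Hypothesis q00 : 0 < q0.
Local Notation k := (k_weight q0 S1 S2).

Let bS1 : bounded_op S1. Proof. by case: sq1 => -[]. Qed.
Let bS2 : bounded_op S2. Proof. by case: sq2 => -[]. Qed.

Let cmod_neq0 (z : R[i]) : q0 <= cmod z -> z != 0.
Proof. by apply: contraTN => /eqP ->; rewrite cmod0 -ltNge. Qed.

(** The quadratic term has nonpositive real part in the closed right half-plane, and the
    imaginary part of the inverse square root is at most [(2 * q0) ^ (-1/2)]. *)
Lemma Re_coef_weight (S : {linear Cp -> Cp}) (z : R[i]) w : bounded_op S ->
  0 <= complex.Re z -> q0 <= cmod z ->
  complex.Re (quad_coef z * (ipCp T a b (S w) (S w))%:C + lin_coef z * (ipCp T a b (S w) a)%:C) <=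
  (Num.sqrt (2 * q0))^-1 * opnorm S * nCp w * nCp a.
Proof.
move=> bS rz zq; apply: le_trans (Re_coef_le z (var_ge0 S w) (mean_var_le T0 ma vb S w)) _.
have cz : 0 < cmod z by exact: lt_le_trans zq.
have r0 : 0 <= complex.Re ((2 * z)^-1).
  have -> : (2 * z)^-1 = (2^-1)%:C * z^-1.
    by rewrite invfM; congr (_ * _); rewrite -(rmorph_nat (real_complex R) 2) fmorphV.
  rewrite cReZ; apply: mulr_ge0; first by rewrite invr_ge0.
  by case: z rz {zq cz} => p q /= p0; rewrite divr_ge0// addr_ge0// sqr_ge0.
have im : `|complex.Im (sqrtc z)^-1| <= (Num.sqrt (2 * q0))^-1.
  rewrite -(@ler_pXn2r _ 2%N) ?nnegrE ?invr_ge0 ?sqrtr_ge0//.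
  rewrite real_normK ?num_real// exprVn sqr_sqrtr; last by rewrite mulr_ge0// ltW.
  have h1 := Im_inv_sqrtc rz; have h2 : (cmod z)^-1 <= q0^-1 by rewrite lef_pV2.
  have := le_trans h1 h2; rewrite invfM.
  by move: (complex.Im _ ^+ 2) (q0^-1) => u1 u2; lra.
have v0 := var_ge0 S w; have p0 := mulr_ge0 r0 v0.
apply: (@le_trans _ _ (`|complex.Im (sqrtc z)^-1| *
  (Num.sqrt (ipCp T a b (S w) (S w)) * nCp a))); first by lra.
rewrite -!mulrA; apply: ler_pM => //; first by rewrite mulr_ge0 ?sqrtr_ge0.
by rewrite mulrA ler_wpM2r ?sqrtr_ge0//; exact: (opnorm_le T0 bS w).
Qed.

Lemma psi_le_weight l w : 0 <= complex.Re l.1 -> 0 <= complex.Re l.2 ->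
  q0 <= cmod l.1 -> q0 <= cmod l.2 -> cmod (psi_ l w) <= k w.
Proof.
move=> r1 r2 c1 c2; rewrite /psi (psi_exponentE _ _ sq1) (psi_exponentE _ _ sq2).
rewrite cmod_cexp cReD ler_expR; apply: lerD.
  exact: (Re_coef_weight w bS1 r1 c1).
exact: (Re_coef_weight w bS2 r2 c2).
Qed.

Lemma measurable_weight : measurable_fun setT (fun w : Cp => k w).
Proof.
rewrite /k_weight; apply: (measurableT_comp (f := @expR R)) => //.
have mn : measurable_fun setT (fun w : Cp => nCp w).
  apply: (Lipschitz_measurable (C := 1)) => v w; rewrite mul1r; exact: normCp_dist.
have term (c : R) : measurable_fun setT (fun w : Cp => c * nCp w * nCp a).
  by apply: measurable_funM; [apply: measurable_funM|]; exact: measurable_cst || exact: mn.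
by apply: measurable_funD; exact: term.
Qed.

Lemma weight_ge0 w : 0 <= k w. Proof. exact: expR_ge0. Qed.

Lemma psi_cvg (l_ : nat -> V) l w : l.1 != 0 -> l.2 != 0 ->
  0 <= complex.Re l.1 -> 0 <= complex.Re l.2 -> (forall n, Cplus2 (l_ n)) ->
  cmod ((l_ n).1 - l.1) @[n --> \oo] --> (0 : R) ->
  cmod ((l_ n).2 - l.2) @[n --> \oo] --> (0 : R) ->
  cmod (psi_ (l_ n) w - psi_ l w) @[n --> \oo] --> (0 : R).
Proof.
move=> n1 n2 r1 r2 rl c1 c2.
have rl1 n : 0 <= complex.Re (l_ n).1 by case: (rl n) => /ltW.
have rl2 n : 0 <= complex.Re (l_ n).2 by case: (rl n) => _ /ltW.
have [/cmod_cvg_parts[q1r q1i] /cmod_cvg_parts[l1r l1i]] := coef_cvg n1 r1 rl1 c1.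
have [/cmod_cvg_parts[q2r q2i] /cmod_cvg_parts[l2r l2i]] := coef_cvg n2 r2 rl2 c2.
have part (S : {linear Cp -> Cp}) (A : {linear Cp -> Cp}) (u_ : nat -> R[i]) u : is_sqrt_op A S ->
    complex.Re (quad_coef (u_ n)) @[n --> \oo] --> complex.Re (quad_coef u) ->
    complex.Im (quad_coef (u_ n)) @[n --> \oo] --> complex.Im (quad_coef u) ->
    complex.Re (lin_coef (u_ n)) @[n --> \oo] --> complex.Re (lin_coef u) ->
    complex.Im (lin_coef (u_ n)) @[n --> \oo] --> complex.Im (lin_coef u) ->
    complex.Re (psi_exponent A S (u_ n) w) @[n --> \oo] --> complex.Re (psi_exponent A S u w) /\
    complex.Im (psi_exponent A S (u_ n) w) @[n --> \oo] --> complex.Im (psi_exponent A S u w).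
  move=> sq qr qi lr li.
  have eR z : complex.Re (psi_exponent A S z w) = complex.Re (quad_coef z) * ipCp T a b (S w) (S w) +
      complex.Re (lin_coef z) * ipCp T a b (S w) a.
    by rewrite (psi_exponentE _ _ sq) cReD !cReMr.
  have eI z : complex.Im (psi_exponent A S z w) = complex.Im (quad_coef z) * ipCp T a b (S w) (S w) +
      complex.Im (lin_coef z) * ipCp T a b (S w) a.
    by rewrite (psi_exponentE _ _ sq) cImD !cImMr.
  split.
    under eq_fun do rewrite eR; rewrite eR.
    exact: (cvgD (cvgM qr (cvg_cst _)) (cvgM lr (cvg_cst _))).
  under eq_fun do rewrite eI; rewrite eI.
  exact: (cvgD (cvgM qi (cvg_cst _)) (cvgM li (cvg_cst _))).
have [e1r e1i] := part S1 A1 _ _ sq1 q1r q1i l1r l1i.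
have [e2r e2i] := part S2 A2 _ _ sq2 q2r q2i l2r l2i.
rewrite /psi; apply: cexp_cvg.
  by under eq_fun do rewrite cReD; rewrite cReD; exact: cvgD.
by under eq_fun do rewrite cImD; rewrite cImD; exact: cvgD.
Qed.

Variable m : {finite_measure set Cp -> \bar R}.
Hypothesis ik : m.-integrable setT (EFin \o (fun w : Cp => k w)).

Lemma psi_dist_integrable l l' : 0 <= complex.Re l.1 -> 0 <= complex.Re l.2 ->
  q0 <= cmod l.1 -> q0 <= cmod l.2 -> 0 <= complex.Re l'.1 -> 0 <= complex.Re l'.2 ->
  q0 <= cmod l'.1 -> q0 <= cmod l'.2 ->
  m.-integrable setT (EFin \o (fun w => cmod (psi_ l w - psi_ l' w))).
Proof.
move=> r1 r2 c1 c2 r1' r2' c1' c2'.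
apply: (@le_integrable _ _ _ m setT measurableT _ (EFin \o (fun w => k w + k w))).
- apply/measurable_EFinP/measurable_cmod.
  apply: measurable_cfunD; first exact: (measurable_psi T0 ma vb sq1 sq2).
  have [a1 a2] := measurable_psi T0 ma vb sq1 sq2 l'.
  split; [under eq_fun do rewrite cReN|under eq_fun do rewrite cImN]; exact: measurableT_comp.
- move=> w _; rewrite lee_fin !ger0_norm ?cmod_ge0 ?addr_ge0 ?weight_ge0//.
  by apply: le_trans (cmodB _ _) _; apply: lerD; exact: psi_le_weight.
- exact: (integrableD measurableT ik ik).
Qed.

(** Otherwise some sequence tending to [l] would contradict dominated convergence with
    dominating function twice the weight. *)
Lemma psi_dist_small l : 0 <= complex.Re l.1 -> 0 <= complex.Re l.2 ->
  q0 < cmod l.1 -> q0 < cmod l.2 -> forall e : R, 0 < e -> exists2 dl : R, 0 < dl &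
  forall l', Cplus2 l' -> cmod (l'.1 - l.1) <= dl -> cmod (l'.2 - l.2) <= dl ->
    [/\ q0 <= cmod l'.1, q0 <= cmod l'.2 &
     \int[m]_w cmod (psi_ l' w - psi_ l w) <= e].
Proof.
move=> r1 r2 c1 c2 e e0.
pose d0 := Num.min (cmod l.1 - q0) (cmod l.2 - q0).
have d00 : 0 < d0 by rewrite lt_min !subr_gt0 c1.
have away l' : cmod (l'.1 - l.1) <= d0 -> cmod (l'.2 - l.2) <= d0 ->
    q0 <= cmod l'.1 /\ q0 <= cmod l'.2.
  rewrite !le_min => /andP[h1 _] /andP[_ h2].
  have := cmodB l'.1 (l'.1 - l.1); have := cmodB l'.2 (l'.2 - l.2).
  rewrite !opprB !(addrC _ (_ - _)) !subrK => k1 k2; split; lra.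
apply: contrapT => /forall2NP H.
pose dn n := Num.min d0 n.+1%:R^-1.
have dn0 n : 0 < dn n by rewrite /dn lt_min d00 /= invr_gt0 ltr0n.
have /choice [l_ Hl] : forall n, exists l', [/\ Cplus2 l', cmod (l'.1 - l.1) <= dn n,
    cmod (l'.2 - l.2) <= dn n & e < \int[m]_w cmod (psi_ l' w - psi_ l w)].
  move=> n; have [//|/existsNP[l' /not_implyP[Cl' /not_implyP[h1 /not_implyP[h2 h3]]]]] := H (dn n).
  exists l'; split => //; rewrite ltNge; apply/negP => h4; apply: h3.
  have [k1 k2] : q0 <= cmod l'.1 /\ q0 <= cmod l'.2.
    by apply: away; [apply: le_trans h1 _|apply: le_trans h2 _]; rewrite ge_min lexx.
  by [].
have dnc (f : nat -> R) : (forall n, 0 <= f n <= dn n) -> f n @[n --> \oo] --> (0 : R).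
  move=> h; apply: (@squeeze_cvgr _ _ _ _ (cst 0) (@harmonic R)).
  - apply: nearW => n; have /andP[-> h2] := h n; rewrite /= (le_trans h2)//.
    by rewrite ge_min lexx orbT.
  - exact: cvg_cst.
  - exact: cvg_harmonic.
have cl1 : cmod ((l_ n).1 - l.1) @[n --> \oo] --> (0 : R).
  by apply: dnc => n; rewrite cmod_ge0; case: (Hl n).
have cl2 : cmod ((l_ n).2 - l.2) @[n --> \oo] --> (0 : R).
  by apply: dnc => n; rewrite cmod_ge0; case: (Hl n).
have aw n : q0 <= cmod (l_ n).1 /\ q0 <= cmod (l_ n).2.
  have [_ h1 h2 _] := Hl n.
  by apply: away; [apply: le_trans h1 _|apply: le_trans h2 _]; rewrite ge_min lexx.
have ii n : m.-integrable setT (EFin \o (fun w => cmod (psi_ (l_ n) w - psi_ l w))).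
  have [[/ltW p1 /ltW p2] _ _ _] := Hl n; have [k1 k2] := aw n.
  by apply: psi_dist_integrable => //; exact: ltW.
have cv : \int[m]_w cmod (psi_ (l_ n) w - psi_ l w) @[n --> \oo] --> (0 : R).
  have := @dominated_convergence _ _ R m setT measurableT
    (fun n w => (cmod (psi_ (l_ n) w - psi_ l w))%:E) (cst 0%E) (EFin \o (fun w => k w + k w)).
  case.
  - by move=> n; exact: (measurable_int m (ii n)).
  - exact: measurable_cst.
  - apply: aeW => w _; apply: cvg_EFin; first exact: nearW.
    apply: psi_cvg => //; [exact: cmod_neq0 (ltW c1)|exact: cmod_neq0 (ltW c2)|].
    by move=> n; case: (Hl n).
  - exact: (integrableD measurableT ik ik).
  - apply: aeW => w n _; rewrite lee_fin ger0_norm ?cmod_ge0//.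
    have [[/ltW p1 /ltW p2] _ _ _] := Hl n; have [k1 k2] := aw n.
    by apply: le_trans (cmodB _ _) _; apply: lerD; apply: psi_le_weight => //; exact: ltW.
  move=> _ _; rewrite integral_cst// mul0e => h.
  by apply: fine_cvg; exact: h.
have : e <= 0.
  rewrite -(cvg_lim _ cv)//; apply: limr_ge; first by apply/cvg_ex; exists 0.
  by apply: nearW => n; case: (Hl n) => _ _ _ /ltW.
by rewrite leNgt e0.
Qed.

End weights.

(** * Complex measures *)

Section complex_measures.
Context d (X : measurableType d) (R : realType).
Variables (f : complex_measure (R := R) X) (nu : {measure set X -> \bar R}).
Hypothesis tv : is_total_variation f nu.

(** The set itself followed by empty sets is an admissible partition. *)
Lemma cm_val_le A : measurable A -> ((cmod (cm_val f A))%:E <= nu A)%E.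
Proof.
move=> mA; rewrite (tv mA).
pose E (n : nat) := if n == 0%N then A else set0.
have E0 n : cm_val f set0 = 0 by rewrite /cm_val !charge0.
apply: (@le_trans _ _ (\sum_(0 <= n <oo) (cmod (cm_val f (E n)))%:E)%E).
  apply: le_trans (nneseries_lim_ge 1 _); last by move=> n _ _; rewrite lee_fin cmod_ge0.
  by rewrite big_nat1.
apply: ereal_sup_ubound; exists E => //; split.
- by move=> n; rewrite /E; case: ifP.
- move=> i j _ _; rewrite /E; case: eqP => [->|_]; case: eqP => [->|_] //;
  by rewrite ?setI0 ?set0I => -[].
- apply/seteqP; split => x; last by exists 0%N.
  by move=> [n _]; rewrite /E; case: ifP.
Qed.

Let re_le A : measurable A -> (`|cm_re f A| <= nu A)%E.
Proof.
move=> mA; apply: le_trans (cm_val_le mA).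
rewrite -[X in (`|X| <= _)%E]fineK ?fin_num_measure//.
by rewrite lee_fin; exact: (Re_le_cmod (cm_val f A)).
Qed.

Let im_le A : measurable A -> (`|cm_im f A| <= nu A)%E.
Proof.
move=> mA; apply: le_trans (cm_val_le mA).
rewrite -[X in (`|X| <= _)%E]fineK ?fin_num_measure//.
by rewrite lee_fin; exact: (Im_le_cmod (cm_val f A)).
Qed.

Let jordan_le (c : {charge set X -> \bar R}) P N (PN : hahn_decomposition c P N) :
  (forall A, measurable A -> (`|c A| <= nu A)%E) ->
  forall A, measurable A -> (jordan_pos PN A <= nu A)%E /\ (jordan_neg PN A <= nu A)%E.
Proof.
move=> cA A mA; have [[mP _] [mN _] _ _] := PN; split.
  rewrite jordan_posE cjordan_posE /crestr0/= mem_set// /crestr.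
  have mAP : measurable (A `&` P) by exact: measurableI.
  apply: le_trans (lee_abs _) _; apply: le_trans (cA _ mAP) _.
  by apply: le_measure; rewrite ?inE//; exact: subIsetl.
rewrite jordan_negE cjordan_negE /crestr0/= mem_set// /crestr.
have mAN : measurable (A `&` N) by exact: measurableI.
apply: le_trans (lee_abs _) _; rewrite abseN; apply: le_trans (cA _ mAN) _.
by apply: le_measure; rewrite ?inE//; exact: subIsetl.
Qed.

(** Jordan decompositions of the real and imaginary parts. A Hahn set cuts out of
    [A] a piece on which the positive part is the charge itself, whence the bound by the total
    variation. *)
Lemma cm_integral_decomposition :
  exists (mm : 'I_4 -> {finite_measure set X -> \bar R}) (ep : 'I_4 -> R[i]),
  [/\ forall F, cm_integral f F = \sum_i ep i * cintegral (mm i) F,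
      forall i, cmod (ep i) = 1 &
      forall i A, measurable A -> (mm i A <= nu A)%E].
Proof.
pose P1 := cid (Hahn_decomposition (cm_re f)); pose N1 := cid (projT2 P1).
pose P2 := cid (Hahn_decomposition (cm_im f)); pose N2 := cid (projT2 P2).
pose m1 : {finite_measure set X -> \bar R} := jordan_pos (projT2 N1).
pose m2 : {finite_measure set X -> \bar R} := jordan_neg (projT2 N1).
pose m3 : {finite_measure set X -> \bar R} := jordan_pos (projT2 N2).
pose m4 : {finite_measure set X -> \bar R} := jordan_neg (projT2 N2).
pose mm (i : 'I_4) : {finite_measure set X -> \bar R} :=
  if (val i < 2)%N then (if val i == 0%N then m1 else m2)
  else (if val i == 2%N then m3 else m4).
pose ep (i : 'I_4) : R[i] := if (val i < 2)%N then (if val i == 0%N then 1 else -1)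
  else (if val i == 2%N then 'i else - 'i).
exists mm, ep; split.
- move=> F; rewrite !big_ord_recl big_ord0 /mm /ep/= /cm_integral /charge_integral.
  by rewrite mul1r mulN1r addr0 mulNr mulrBr -!addrA.
- have ci : cmod ('i : R[i]) = 1 by rewrite cmodE/= expr0n/= add0r expr1n sqrtr1.
  have c1 : cmod (1 : R[i]) = 1 by rewrite -(rmorph1 (real_complex R)) cmod_real normr1.
  by move=> i; rewrite /ep; case: (val i < 2)%N; [case: (val i == 0%N)|case: (val i == 2%N)];
    rewrite ?cmodN.
- move=> i A mA; have [h1 h2] := jordan_le (projT2 N1) re_le mA.
  have [h3 h4] := jordan_le (projT2 N2) im_le mA.
  by rewrite /mm; case: (val i < 2)%N; [case: (val i == 0%N)|case: (val i == 2%N)].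
Qed.

Lemma integrable_le_measure (m : {measure set X -> \bar R}) (g : X -> R) :
  (forall A, measurable A -> (m A <= nu A)%E) -> measurable_fun setT g ->
  (forall x, 0 <= g x) -> (\int[nu]_x (g x)%:E < +oo)%E ->
  m.-integrable setT (EFin \o g).
Proof.
move=> mn mg g0 gi; apply/integrableP; split; first exact/measurable_EFinP.
apply: le_lt_trans gi.
rewrite (_ : (fun x => _) = EFin \o g); last first.
  by apply/funext => x; rewrite /= ger0_norm.
apply: ge0_le_measure_integral; [exact: mn|exact: measurableT| |exact/measurable_EFinP].
by move=> x; rewrite lee_fin.
Qed.

End complex_measures.

(** * Combinations of integrals of characters and the transform *)

Section squeeze.
Context (R : realType) (I : Type) (F : set_system I) (FF : Filter F).

Lemma ge0_cvge0 (h : I -> \bar R) : (forall l, (0 <= h l)%E) ->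
  (forall e : R, 0 < e -> \forall l \near F, (h l <= e%:E)%E) ->
  h l @[l --> F] --> 0%E.
Proof.
move=> h0 he; apply/fine_cvgP; split.
  near=> l; rewrite ge0_fin_numE//; apply: (@le_lt_trans _ _ 1%:E); last exact: ltry.
  by near: l; exact: he.
apply/cvgrPdist_le => e e0; near=> l.
have hl : (h l <= e%:E)%E by near: l; exact: he.
by rewrite sub0r normrN ger0_norm ?fine_ge0// -lee_fin fineK// ge0_fin_numE// (le_lt_trans hl)// ltry.
Unshelve. all: by end_near. Qed.

End squeeze.

Section scale_invariant_sets.
Context (R : realType) (T : R) (mu : probability (Cab T) R).
Hypothesis T0 : 0 < T.
Local Notation Y := (Cab T * Cab T)%type.

Lemma si_measurable_cfun (F : Y -> R[i]) : measurable_cfun F -> si_measurable_fun mu F.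
Proof.
move=> [mr mi] r1 r2 _ _; apply: completed_cfun.
have ms := measurable_scale2 T0 r1 r2.
by split; [apply: (measurableT_comp mr)|apply: (measurableT_comp mi)].
Qed.

(** Such a set is equal to all its rescalings. *)
Lemma si_null_invariant (N : set Y) : measurable N -> (mu \x mu)%E N = 0%E ->
  (forall r1 r2 y, r1 != 0 -> r2 != 0 -> N (scale2 r1 r2 y) <-> N y) -> si_null mu N.
Proof.
move=> mN N0 Ns.
have e r1 r2 : 0 < r1 -> 0 < r2 -> scale2 r1 r2 @` N = N.
  move=> r10 r20; have n1 := lt0r_neq0 r10; have n2 := lt0r_neq0 r20.
  apply/seteqP; split => [_ [y Ny <-]|y Ny]; first exact/Ns.
  exists (scale2 r1^-1 r2^-1 y); first by apply/Ns; rewrite ?invr_neq0.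
  by rewrite /scale2/= !scalerA !divff// !scale1r; case: (y).
split => r1 r2 r10 r20; rewrite e//; first exact: completed_of_measurable.
by exists N; split.
Qed.

End scale_invariant_sets.

Section decomposed_functionals.
Context (R : realType) (T : R) (a b : R -> R) (mu : probability (Cab T) R).
Context (phi : nat -> R -> R).
Hypotheses (T0 : 0 < T) (ma : mean_function T a) (vb : variance_function T b).
Hypothesis gmu : gaussian_measure a b mu.
Hypothesis cphi : complete_orthonormal T a b phi.
Local Notation Cp := (Cp T a b).
Local Notation Y := (Cab T * Cab T)%type.
Local Notation V := (R[i]^o * R[i]^o)%type.
Variables A1 A2 S1 S2 : {linear Cp -> Cp}.
Hypotheses (sq1 : is_sqrt_op A1 S1) (sq2 : is_sqrt_op A2 S2).
Variables (mm : 'I_4 -> {finite_measure set Cp -> \bar R}) (ep : 'I_4 -> R[i]).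
Hypothesis ep1 : forall i, cmod (ep i) = 1.

Let bS1 : bounded_op S1. Proof. by case: sq1 => -[]. Qed.
Let bS2 : bounded_op S2. Proof. by case: sq2 => -[]. Qed.
Let PP : probability Y R := (mu \x mu)%E.
Local Notation psi_ l := (fun w => psi A1 A2 S1 S2 l.1 l.2 w).

(** The integral of a character times [g] with respect to the complex measure that
    the family [mm] decomposes. *)
Definition mixed_integral (g : Cp -> R[i]) (y : Y) : R[i] :=
  \sum_i ep i * char_integral phi S1 S2 (mm i) g y.

Lemma measurable_mixed g : measurable_cfun g -> measurable_cfun (mixed_integral g).
Proof.
move=> mg; apply: (@measurable_cfun_sum _ _ _ _ (fun i y => ep i * char_integral phi S1 S2 (mm i) g y)) => i; apply: measurable_cfunM.
  exact: measurable_cfun_cst.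
exact: (measurable_char_integral T0 ma vb cphi sq1 sq2).
Qed.

Lemma cmod_mixed_le (c : 'I_4 -> R[i]) : cmod (\sum_i ep i * c i) <= \sum_i cmod (c i).
Proof.
elim/big_ind2 : _ => [|u1 x u2 y h1 h2|i _]; first by rewrite cmod0.
  by apply: le_trans (cmodD _ _) _; exact: lerD.
by rewrite cmodM ep1 mul1r.
Qed.

(** [inord] turns the union over the four measures into a countable one. *)
Let exc_all : set Y := \bigcup_n exceptional phi S1 S2 (mm (inord n)).

Lemma exceptional_all_null : si_null mu exc_all.
Proof.
have mE i := measurable_exceptional T0 ma vb cphi bS1 bS2 (mm i).
have E0 i := exceptional_null T0 ma vb gmu cphi bS1 bS2 (mm i).
apply: si_null_invariant.
- by apply: bigcup_measurable => n _; exact: mE.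
- apply: measure_negligible; first by apply: bigcup_measurable => n _; exact: mE.
  apply: (@negligible_bigcup _ _ _ (mu \x mu)%E (fun n => exceptional phi S1 S2 (mm (inord n)))) => n.
  by exists (exceptional phi S1 S2 (mm (inord n))); split; [exact: mE|exact: E0|].
- move=> r1 r2 y n1 n2.
  have h n := exceptional_scale T0 cphi S1 S2 (mm (inord n)) y n1 n2.
  by split=> -[i _ Ei]; (exists i; first exact: I); [apply: (h i).1|apply: (h i).2].
Qed.

Lemma char_integral_bound i y (g : Cp -> R[i]) (k : Cp -> R) : measurable_cfun g ->
  (forall w, cmod (g w) <= k w) -> (mm i).-integrable setT (EFin \o k) ->
  cintble (mm i) (fun w => char_kernel phi S1 S2 w y * g w) /\
  cmod (char_integral phi S1 S2 (mm i) g y) <= 2 * \int[mm i]_w k w.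
Proof.
move=> mg gk ik.
have le w : cmod (char_kernel phi S1 S2 w y * g w) <= k w.
  by rewrite cmodM cmod_char_kernel mul1r.
have ci : cintble (mm i) (fun w => char_kernel phi S1 S2 w y * g w).
  apply: cintble_le le ik; apply: measurable_cfunM mg.
  exact: (measurable_char_kernel1 T0 ma vb cphi sq1 sq2).
by split=> //; exact: cmod_cintegral ci ik le.
Qed.

Let one_integrable i : (mm i).-integrable setT (EFin \o (fun _ : Cp => 1 : R)).
Proof. exact: finite_measure_integrable_cst. Qed.

Let one_le (w : Cp) : cmod (1 : R[i]) <= 1.
Proof. by rewrite -(rmorph1 (real_complex R)) cmod_real normr1. Qed.

Let char_one_le i y : cmod (char_integral phi S1 S2 (mm i) (fun=> 1) y) <= 2 * \int[mm i]_w (1 : R).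
Proof.
have mg : measurable_cfun (fun _ : Cp => 1 : R[i]) by exact: measurable_cfun_cst.
have [_ h] := char_integral_bound y mg one_le (one_integrable i).
exact: h.
Qed.

Lemma char_integral_affine_cintble i (r1 r2 : R) y :
  cintble (mu \x mu)%E (fun x => char_integral phi S1 S2 (mm i) (fun=> 1) (y + scale2 r1 r2 x)).
Proof.
have mg : measurable_cfun (fun _ : Cp => 1 : R[i]) by exact: measurable_cfun_cst.
have [mr mi] := measurable_char_integral T0 ma vb cphi sq1 sq2 (mm i) mg.
have ms := measurable_affine_pair T0 r1 r2 y.
apply: (@cintble_le _ _ _ _ _ (fun=> 2 * \int[mm i]_w 1)).
- by split; [apply: (measurableT_comp mr)|apply: (measurableT_comp mi)].
- by move=> x; apply: char_one_le.
- exact: (@finite_measure_integrable_cst _ _ _ PP).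
Qed.

(** Boundedness of the characters makes the functional integrable, and the other two
    requirements are linear in the measure. *)
Lemma analytic_mixed y : ~ exc_all y ->
  is_analytic_integral mu (fun x => mixed_integral (fun=> 1) (y + x))
    (fun l => mixed_integral (psi_ l) y : R[i]^o).
Proof.
move=> ny; have nyi i : ~ exceptional phi S1 S2 (mm i) y by move=> h; apply: ny; exists (val i); rewrite ?inord_val.
have ci i r1 r2 : cintble (mu \x mu)%E (fun x => ep i * char_integral phi S1 S2 (mm i) (fun=> 1) (y + scale2 r1 r2 x)).
  exact/cintbleZ/char_integral_affine_cintble.
split.
- move=> l1 l2 _ _; split.
    apply: completed_cfun.
    have mg : measurable_cfun (fun _ : Cp => 1 : R[i]) by exact: measurable_cfun_cst.
    have [mr mi] := measurable_mixed mg.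
    have ms := measurable_affine_pair T0 (Num.sqrt l1)^-1 (Num.sqrt l2)^-1 y.
    by split; [apply: (measurableT_comp mr)|apply: (measurableT_comp mi)].
  apply: (@le_lt_trans _ _ (\int[PP]_(x in setT) (\sum_i 2 * \int[mm i]_w 1)%:E)%E).
    apply: ge0_le_integral_nonmeasurable => // x _.
    + by rewrite lee_fin cmod_ge0.
    + by rewrite lee_fin sumr_ge0// => i _; rewrite mulr_ge0// Rintegral_ge0.
    + rewrite lee_fin; apply: le_trans (cmod_mixed_le _) _; apply: ler_sum => i _.
      exact: char_one_le.
  have PPfin : (PP setT < +oo)%E by rewrite probability_setT ltry.
  rewrite (@integral_cst _ _ _ PP); last exact: measurableT.
  by rewrite lte_mul_pinfty// lee_fin sumr_ge0// => i _; rewrite mulr_ge0// Rintegral_ge0.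
- move=> l cl.
  have d i := differentiable_char_integral T0 ma vb cphi sq1 sq2 (mm i) y cl.
  rewrite (_ : (fun l' : V => _) = \sum_(i < 4) (fun l' : V =>
      ep i *: (char_integral phi S1 S2 (mm i) (psi_ l') y : R[i]^o))); last first.
    by apply/funext => l'; rewrite fct_sumE.
  apply: differentiable_sum => i.
  exact: differentiableZ.
- move=> l1 l2 l10 l20.
  rewrite (cintegral_sum (fun i => ci i _ _)).2; apply: eq_bigr => i _.
  rewrite cintegralZ; last exact: char_integral_affine_cintble.
  by rewrite (char_integral_average T0 ma vb gmu cphi sq1 sq2 l10 l20 (nyi i)).
Qed.

Variable q0 : R.
Hypothesis q00 : 0 < q0.
Hypothesis ik : forall i, (mm i).-integrable setT (EFin \o (fun w : Cp => k_weight q0 S1 S2 w)).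

(** The estimate is uniform in [y] because characters have modulus one. *)
Lemma mixed_dist_small (l0 : V) (e : R) : 0 <= complex.Re l0.1 -> 0 <= complex.Re l0.2 ->
  q0 < cmod l0.1 -> q0 < cmod l0.2 -> 0 < e ->
  \forall l \near within (@Cplus2 R) (nbhs l0), forall y,
    cmod (mixed_integral (psi_ l) y - mixed_integral (psi_ l0) y) <= e.
Proof.
move=> r1 r2 c1 c2 e0.
have e8 : 0 < e / 8 by rewrite divr_gt0.
have near1 i : \forall l \near within (@Cplus2 R) (nbhs l0), forall y,
    cmod (char_integral phi S1 S2 (mm i) (psi_ l) y - char_integral phi S1 S2 (mm i) (psi_ l0) y) <= e / 4.
  have [dl dl0 dlP] := psi_dist_small T0 ma vb sq1 sq2 q00 (ik i) r1 r2 c1 c2 e8.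
  have nd : \forall l \near nbhs l0, vmod (l - l0) <= dl.
    apply/(@nbhs_normP _ (R[i]^o * R[i]^o)%type); exists dl%:C => /=; first by rewrite ltcR.
    by move=> l /=; rewrite distrC vmodE ltcR; exact: ltW.
  near=> l => y.
  have cl : Cplus2 l by near: l; exact: withinT.
  have vl : vmod (l - l0) <= dl by near: l; exact: cvg_within.
  have [s1 s2 s3] := dlP l cl (le_trans (cmod_coordinate false (l - l0)) vl) (le_trans (cmod_coordinate true (l - l0)) vl).
  have [p1 p2] := cl.
  have ml u := measurable_psi T0 ma vb sq1 sq2 u.
  have [i1 _] := char_integral_bound y (ml l) (fun w => psi_le_weight T0 ma vb sq1 sq2 q00 w (ltW p1) (ltW p2) s1 s2) (ik i).
  have [i2 _] := char_integral_bound y (ml l0) (fun w => psi_le_weight T0 ma vb sq1 sq2 q00 w r1 r2 (ltW c1) (ltW c2)) (ik i).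
  rewrite -cintegralB//.
  have id := psi_dist_integrable T0 ma vb sq1 sq2 q00 (ik i) (ltW p1) (ltW p2) s1 s2 r1 r2 (ltW c1) (ltW c2).
  apply: le_trans (cmod_cintegral (cintbleB i1 i2) id _) _.
    by move=> w; rewrite -mulrBr cmodM cmod_char_kernel mul1r.
  by rewrite (_ : e / 4 = 2 * (e / 8)); [rewrite ler_pM2l|field].
have nearA : \forall l \near within (@Cplus2 R) (nbhs l0), forall i y,
    cmod (char_integral phi S1 S2 (mm i) (psi_ l) y - char_integral phi S1 S2 (mm i) (psi_ l0) y) <= e / 4.
  exact: (@filter_forall _ _ _ _ (within_filter _ (nbhs_filter l0)) near1).
apply: (@filterS _ _ (within_filter (@Cplus2 R) (nbhs_filter l0)) _ _ _ nearA) => l le y.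
rewrite /mixed_integral -sumrB.
under eq_bigr do rewrite -mulrBr.
apply: le_trans (cmod_mixed_le _) _.
apply: (@le_trans _ _ (\sum_(i < 4) e / 4)); last first.
  by rewrite sumr_const card_ord -[_ *+ 4]mulr_natr divfK.
by apply: ler_sum => i _; exact: le.
Unshelve. all: by end_near. Qed.

End decomposed_functionals.

Theorem theorem3p9 (R : realType) (T : R) (a b : R -> R)
    (mu : probability (Cab T) R) (phi : nat -> R -> R)
    (A1 A2 S1 S2 : {linear Cp T a b -> Cp T a b})
    (f : complex_measure (R := R) (Cp T a b))
    (F : Cab T * Cab T -> R[i]) (q0 : R) :
  0 < T ->
  mean_function T a ->
  variance_function T b ->
  gaussian_measure a b mu ->
  complete_orthonormal T a b phi ->
  nonneg_selfadjoint A1 -> nonneg_selfadjoint A2 ->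
  is_sqrt_op A1 S1 -> is_sqrt_op A2 S2 ->
  0 < q0 ->
  in_Fq0 phi mu q0 S1 S2 f F ->
  forall p q1 q2 : R, 1 < p -> p <= 2 ->
    q1 != 0 -> q2 != 0 -> q0 < `|q1| -> q0 < `|q2| ->
  exists2 TF : Cab T * Cab T -> R[i],
    is_GFFT mu p q1 q2 F TF &
    sae mu (fun y => TF y =
      cm_integral f (fun w => char_kernel phi S1 S2 w y *
                              psi A1 A2 S1 S2 (0 -i* q1) (0 -i* q2) w)).
Proof.
move=> T0 ma vb gmu cphi _ _ sq1 sq2 q00 [inF [nu tv ki]] p q1 q2 p1 _ _ _ q1q q2q.
have [mm [ep [fE ep1 mle]]] := cm_integral_decomposition tv.
have ik i : (mm i).-integrable setT (EFin \o (fun w : Cp T a b => k_weight q0 S1 S2 w)).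
  apply: integrable_le_measure ki; [exact: mle|exact: measurable_weight|].
  by move=> w; exact: expR_ge0.
pose mix := mixed_integral phi S1 S2 mm ep.
have mixE g y : cm_integral f (fun w => char_kernel phi S1 S2 w y * g w) = mix g y by rewrite fE.
pose l0 : R[i]^o * R[i]^o := (0 -i* q1, 0 -i* q2).
pose ps (l : R[i]^o * R[i]^o) := fun w => psi A1 A2 S1 S2 l.1 l.2 w.
have mps l : measurable_cfun (ps l) := measurable_psi T0 ma vb sq1 sq2 l.
have m1 : measurable_cfun (fun _ : Cp T a b => 1 : R[i]) := measurable_cfun_cst _ 1.
have mmix g : measurable_cfun g -> measurable_cfun (mix g) := measurable_mixed T0 ma vb cphi sq1 sq2 mm ep (g := g).
have si0 : si_null mu set0.
  by apply: si_null_invariant => //; rewrite measure0.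
exists (mix (ps l0)); last first.
  by exists set0 => // y _; rewrite -mixE.
(* The representative of the class is the integral formula, used at every path pair.
   *)
exists (mix (fun=> 1)).
  have [N nN FE] := inF; exists N => // x Nx; rewrite FE// -mixE.
  by congr cm_integral; apply/funext => w; rewrite mulr1.
split; [exact/(si_measurable_cfun _ T0)/mmix|exact/(si_measurable_cfun _ T0)/mmix/mps|].
exists (fun l => mix (ps l)); split.
- exists (\bigcup_n exceptional phi S1 S2 (mm (inord n))).
    exact: (exceptional_all_null T0 ma vb gmu cphi sq1 sq2).
  move=> y; exact: (analytic_mixed T0 ma vb gmu cphi sq1 sq2).
- by move=> l _; exact/(si_measurable_cfun _ T0)/mmix/mps.
move=> r1 r2 _ _.
have p'1 : 1 <= (1 - p^-1)^-1.
  have p0 : 0 < p by exact: lt_trans p1.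
  have pi0 : 0 < p^-1 by rewrite invr_gt0.
  have pi1 : p^-1 < 1 by rewrite invf_lt1.
  by rewrite invf_ge1 ?subr_gt0// gerBl ltW.
have modq q : cmod (0 -i* q : R[i]) = `|q|.
  by rewrite cmodE/= expr0n/= add0r sqrrN sqrtr_sqr.
apply: ge0_cvge0 => [l|e e0].
  by apply: integral_ge0 => y _; rewrite lee_fin powR_ge0.
(* For values in [0, 1] raising to a power at least 1 only decreases, so that a
   uniform bound by e' <= 1 suffices. *)
pose e' := Num.min e 1.
have e'0 : 0 < e' by rewrite lt_min e0 ltr01.
have e'1 : e' <= 1 by rewrite ge_min lexx orbT.
have c1 : q0 < cmod l0.1 by rewrite modq.
have c2 : q0 < cmod l0.2 by rewrite modq.
have near_small := mixed_dist_small T0 ma vb cphi sq1 sq2 ep1 q00 ik (lexx 0 : 0 <= complex.Re l0.1) (lexx 0 : 0 <= complex.Re l0.2) c1 c2 e'0.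
apply: (@filterS _ _ (within_filter (@Cplus2 R) (nbhs_filter l0)) _ _ _ near_small) => l small.
pose PP : probability (Cab T * Cab T)%type R := (mu \x mu)%E.
apply: (@le_trans _ _ (\int[PP]_(y in setT) e%:E)%E); last first.
  rewrite (@integral_cst _ _ _ PP); last exact: measurableT.
  rewrite -[leRHS]mule1; apply: lee_wpmul2l; first by rewrite lee_fin ltW.
  exact: probability_le1.
apply: ge0_le_integral_nonmeasurable => // y _; rewrite lee_fin ?powR_ge0//; first exact: ltW.
apply: (@le_trans _ _ (e' `^ (1 - p^-1)^-1)).
  apply: ge0_ler_powR; rewrite ?nnegrE ?cmod_ge0 ?(ltW e'0)//.
    exact: le_trans p'1.
  exact: small.
apply: (@le_trans _ _ e'); last by rewrite ge_min lexx.
by apply: ge1r_powR; rewrite ?e'0.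
Qed.
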